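(* Let $\sigma:\overline{\mathbb F}\to\overline{\mathbb F}$ be an activation function satisfying Condition 1 (defined in the context). Then for every $d\in\mathbb N$ and every target function $f:\mathbb R^d\to\mathbb R$ there exists a $\sigma$-network $\nu:\overline{\mathbb F}^d\to\overline{\mathbb F}$ such that $$\gamma\big(\nu^\sharp(\mathcal B)\big)=\Big[\min \widehat f\big(\gamma(\mathcal B)\big),\ \max \widehat f\big(\gamma(\mathcal B)\big)\Big]\cap\overline{\mathbb F}$$ for every abstract box $\mathcal B\in\mathbb I^d$ with $\gamma(\mathcal B)\subseteq[-1,1]^d$, where $\widehat f:\mathbb F^d\to\overline{\mathbb F}$ is the rounded target $\widehat f(\mathbf x)=\mathrm{rnd}(f(\mathbf x))$.
   Context: Floating point. Fix integers $E\ge 5$ and $M$ with $2^{E-1}\ge M\ge 3$; let $\mathfrak e_{\min}=-2^{E-1}+2$ and $\mathfrak e_{\max}=2^{E-1}-1$. The set of finite floats is $\mathbb F=\{(-1)^b(s_0.s_1\dots s_M)_2\cdot 2^e: b,s_i\in\{0,1\},\ e\in\{\mathfrak e_{\min},\dots,\mathfrak e_{\max}\}\}$ and $\overline{\mathbb F}=\mathbb F\cup\{-\infty,+\infty,\mathrm{NaN}\}$. Let $\omega=2^{\mathfrak e_{\min}-M}$, $\Omega=2^{\mathfrak e_{\max}}(2-2^{-M})$, $\varepsilon=2^{-M-1}$. For $x\in\mathbb F$, $x^+=\min\{y\in\overline{\mathbb F}\setminus\{\mathrm{NaN}\}:y>x\}$ and $x^-=\max\{y\in\overline{\mathbb F}\setminus\{\mathrm{NaN}\}:y<x\}$.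 The rounding $\mathrm{rnd}:\mathbb R\cup\{\pm\infty\}\to\overline{\mathbb F}$ is $\mathrm{rnd}(x)=-\infty$ if $x\le-\Omega-c$, $+\infty$ if $x\ge\Omega+c$ (with $c=2^{\mathfrak e_{\max}}\varepsilon$), and otherwise the element of $\mathbb F$ nearest to $x$, ties broken toward the float whose last significand bit is $0$. For $x,y\in\mathbb F$: $x\oplus y=\mathrm{rnd}(x+y)$, $x\ominus y=\mathrm{rnd}(x-y)$, $x\otimes y=\mathrm{rnd}(x y)$; on non-finite operands these follow IEEE-754. Iterated sums $\bigoplus_{i=1}^n y_i$ are evaluated left to right. Networks. For $W=(w_{ij})\in\mathbb F^{m\times n}$ and $\mathbf b\in\mathbb F^m$, $\mathrm{aff}_{W,\mathbf b}:\overline{\mathbb F}^n\to\overline{\mathbb F}^m$ is $\mathrm{aff}_{W,\mathbf b}(\mathbf x)_i=\big(\bigoplus_{j=1}^n x_j\otimes w_{ij}\big)\oplus b_i$. For $\sigma:\overline{\mathbb F}\to\overline{\mathbb F}$, a depth-$L$ $\sigma$-network is a map $\nu=\mathrm{aff}_{W_L,\mathbf b_L}\circ\tilde\sigma_{d_{L-1}}\circ\mathrm{aff}_{W_{L-1},\mathbf b_{L-1}}\circ\cdots\circ\tilde\sigma_{d_1}\circ\mathrm{aff}_{W_1,\mathbf b_1}:\overline{\mathbb F}^{d_0}\to\overline{\mathbb F}^{d_L}$ with $W_\ell\in\mathbb F^{d_\ell\times d_{\ell-1}}$, $\mathbf b_\ell\in\mathbb F^{d_\ell}$, and $\tilde\sigma_n$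 the coordinatewise application of $\sigma$. Intervals. $\mathbb I=\{\langle a,b\rangle: a,b\in\overline{\mathbb F}\setminus\{\mathrm{NaN}\},a\le b\}\cup\{\top\}$, with $\gamma(\langle a,b\rangle)=[a,b]\cap\overline{\mathbb F}$, $\gamma(\top)=\overline{\mathbb F}$, and for a box $\mathcal B=(\mathcal I_1,\dots,\mathcal I_d)\in\mathbb I^d$, $\gamma(\mathcal B)=\prod_i\gamma(\mathcal I_i)$. For $\phi:\overline{\mathbb F}^d\to\overline{\mathbb F}$, $\phi^\sharp(\mathcal B)=\langle\min S,\max S\rangle$ if $\mathrm{NaN}\notin S$ and $\top$ otherwise, where $S=\phi(\gamma(\mathcal B))$. For $\odot\in\{\oplus,\otimes\}$: $\langle a,b\rangle\odot^\sharp\langle c,d\rangle=\langle\min S,\max S\rangle$ with $S=\{a\odot c,a\odot d,b\odot c,b\odot d\}$ if $\mathrm{NaN}\notin S$, $\top$ if $\mathrm{NaN}\in S$ or an operand is $\top$. $\mathrm{aff}^\sharp_{W,\mathbf b}(\mathcal I_1,\dots,\mathcal I_n)_i=\big(\bigoplus^\sharp_{j}\mathcal I_j\otimes^\sharp\langle w_{ij},w_{ij}\rangle\big)\oplus^\sharp\langle b_i,b_i\rangle$ (left to right). The interval semantics of the network $\nu$ above is $\nu^\sharp=\mathrm{aff}^\sharp_{W_L,\mathbf b_L}\circ\tilde\sigma^\sharp\circ\cdots\circ\tilde\sigma^\sharp\circ\mathrm{aff}^\sharp_{W_1,\mathbf b_1}$, where $\tilde\sigma^\sharp$ applies $\sigma^\sharp$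 coordinatewise. Condition 1. $\sigma:\overline{\mathbb F}\to\overline{\mathbb F}$ satisfies: (C1) there exist $c_1,c_2\in\mathbb F$ with $\sigma(c_1)=0$, $|\sigma(c_2)|\in[\frac\varepsilon2+2\varepsilon^2,\frac54-2\varepsilon]$, $\max\{|c_1|,|c_2|\}\ge 2^{\mathfrak e_{\min}+1}$, and $\sigma(x)$ lies between $\sigma(c_1)$ and $\sigma(c_2)$ for all $x$ between $c_1$ and $c_2$; (C2) there exists $\eta\in\mathbb F$ with $|\eta|\in[2^{\mathfrak e_{\min}+5},4-8\varepsilon]$ and $|\sigma(\eta)|,|\sigma(\eta^+)|\in[2^{\mathfrak e_{\min}+5},2^{\mathfrak e_{\max}-6}|\eta|]$ such that for all $x,y\in\mathbb F$ with $x\le\eta<\eta^+\le y$, either $\sigma(x)\le\sigma(\eta)<\sigma(\eta^+)\le\sigma(y)$ or $\sigma(x)\ge\sigma(\eta)>\sigma(\eta^+)\ge\sigma(y)$; (C3) there exists $\lambda\in[0,2^{\mathfrak e_{\max}-7}\min\{|\sigma(\eta)|,2^{M+3}\}]$ such that for all $x,y\in\mathbb F$ with $x\le\eta<\eta^+\le y$: $|\sigma(x)-\sigma(\eta)|\le\lambda|x-\eta|$ and $|\sigma(y)-\sigma(\eta^+)|\le\lambda|y-\eta^+|$. *)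

(* Defs.v *)
From Stdlib Require Import Bool Reals Lra Lia ZArith List Classical ClassicalEpsilon.
Import ListNotations.
Open Scope R_scope.

Set Implicit Arguments.
Unset Strict Implicit.

Definition emin (E : nat) : Z := (- 2 ^ (Z.of_nat E - 1) + 2)%Z.
Definition emax (E : nat) : Z := (2 ^ (Z.of_nat E - 1) - 1)%Z.

(* x = (-1)^b (s_0.s_1...s_M)_2 * 2^e, i.e. x = m * 2^(e-M) with |m| < 2^(M+1) *)
Definition isF (E M : nat) (x : R) : Prop :=
  exists (m e : Z), (Z.abs m < 2 ^ (Z.of_nat M + 1))%Z /\
    (emin E <= e <= emax E)%Z /\ x = IZR m * powerRZ 2 (e - Z.of_nat M).

Definition float (E M : nat) := { x : R | isF E M x }.
Definition fval {E M : nat} (x : float E M) : R := proj1_sig x.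

Inductive fbar (E M : nat) : Type :=
| Fin : float E M -> fbar E M
| PInf : fbar E M
| NInf : fbar E M
| NaN : fbar E M.
Arguments Fin {E M} _.
Arguments PInf {E M}.
Arguments NInf {E M}.
Arguments NaN {E M}.

Definition omega (E M : nat) : R := powerRZ 2 (emin E - Z.of_nat M).
Definition Omega (E M : nat) : R :=
  powerRZ 2 (emax E) * (2 - powerRZ 2 (- Z.of_nat M)).
Definition eps (M : nat) : R := powerRZ 2 (- Z.of_nat M - 1).
Definition rnd_c (E M : nat) : R := powerRZ 2 (emax E) * eps M.

Section Float.
Variables (E M : nat).
Local Notation float := (float E M).
Local Notation fbar := (fbar E M).

Definition fleb (v w : fbar) : bool :=
  match v, w with
  | NaN, _ | _, NaN => false
  | NInf, _ => true
  | _, PInf => true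
  | Fin x, Fin y => if Rle_dec (fval x) (fval y) then true else false
  | _, _ => false
  end.
Definition fle (v w : fbar) : Prop := fleb v w = true.
Definition flt (v w : fbar) : Prop := fle v w /\ v <> w.

Definition isNaN (v : fbar) : bool := match v with NaN => true | _ => false end.

Definition fmin (v w : fbar) : fbar := if fleb v w then v else w.
Definition fmax (v w : fbar) : fbar := if fleb v w then w else v.

(* "last significand bit 0": the canonical (minimal-exponent) representation
   m * 2^(e-M) of y has m even. *)
Definition even_float (y : float) : Prop :=
  exists (m e : Z), (Z.abs m < 2 ^ (Z.of_nat M + 1))%Z /\
    (emin E <= e <= emax E)%Z /\ fval y = IZR m * powerRZ 2 (e - Z.of_nat M) /\
    (e = emin E \/ (2 ^ (Z.of_nat M) <= Z.abs m)%Z) /\ Z.even m = true.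

Definition nearest_even (x : R) (y : float) : Prop :=
  (forall z : float, Rabs (x - fval y) <= Rabs (x - fval z)) /\
  (forall z : float, Rabs (x - fval z) = Rabs (x - fval y) -> z <> y -> even_float y).

Definition rnd (x : R) : fbar :=
  if Rle_dec x (- Omega E M - rnd_c E M) then NInf
  else if Rle_dec (Omega E M + rnd_c E M) x then PInf
  else epsilon (inhabits NaN) (fun v => exists y, v = Fin y /\ nearest_even x y).

(* IEEE-754 style addition and multiplication on Fbar (no signed zeros in Fbar). *)
Definition fadd (v w : fbar) : fbar :=
  match v, w with
  | Fin x, Fin y => rnd (fval x + fval y)
  | NaN, _ | _, NaN => NaN
  | PInf, NInf | NInf, PInf => NaN
  | PInf, _ | _, PInf => PInf
  | NInf, _ | _, NInf => NInf
  end.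

Definition inf_of_sign (pos : bool) : fbar := if pos then PInf else NInf.

Definition fmul (v w : fbar) : fbar :=
  match v, w with
  | Fin x, Fin y => rnd (fval x * fval y)
  | NaN, _ | _, NaN => NaN
  | PInf, PInf | NInf, NInf => PInf
  | PInf, NInf | NInf, PInf => NInf
  | PInf, Fin y | Fin y, PInf =>
      if Req_EM_T (fval y) 0 then NaN
      else inf_of_sign (if Rlt_dec 0 (fval y) then true else false)
  | NInf, Fin y | Fin y, NInf =>
      if Req_EM_T (fval y) 0 then NaN
      else inf_of_sign (if Rlt_dec 0 (fval y) then false else true)
  end.

Definition fsucc (x : float) : fbar :=
  epsilon (inhabits NaN) (fun y => y <> NaN /\ flt (Fin x) y /\
     forall z, z <> NaN -> flt (Fin x) z -> fle y z).

Definition fbetween (a b v : fbar) : Prop :=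
  (fle a v /\ fle v b) \/ (fle b v /\ fle v a).

Definition abs_in (v : fbar) (lo hi : R) : Prop :=
  exists s, v = Fin s /\ lo <= Rabs (fval s) <= hi.

Definition cond_C1 (sigma : fbar -> fbar) : Prop :=
  exists c1 c2 : float,
    (exists z, sigma (Fin c1) = Fin z /\ fval z = 0) /\
    abs_in (sigma (Fin c2)) (eps M / 2 + 2 * eps M ^ 2) (5 / 4 - 2 * eps M) /\
    powerRZ 2 (emin E + 1) <= Rmax (Rabs (fval c1)) (Rabs (fval c2)) /\
    (forall v, fbetween (Fin c1) (Fin c2) v ->
        fbetween (sigma (Fin c1)) (sigma (Fin c2)) (sigma v)).

Definition cond_C2 (sigma : fbar -> fbar) (eta : float) : Prop :=
  powerRZ 2 (emin E + 5) <= Rabs (fval eta) <= 4 - 8 * eps M /\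
  abs_in (sigma (Fin eta)) (powerRZ 2 (emin E + 5))
         (powerRZ 2 (emax E - 6) * Rabs (fval eta)) /\
  abs_in (sigma (fsucc eta)) (powerRZ 2 (emin E + 5))
         (powerRZ 2 (emax E - 6) * Rabs (fval eta)) /\
  (forall x y : float, fval x <= fval eta -> fle (fsucc eta) (Fin y) ->
     (fle (sigma (Fin x)) (sigma (Fin eta)) /\
      flt (sigma (Fin eta)) (sigma (fsucc eta)) /\
      fle (sigma (fsucc eta)) (sigma (Fin y))) \/
     (fle (sigma (Fin eta)) (sigma (Fin x)) /\
      flt (sigma (fsucc eta)) (sigma (Fin eta)) /\
      fle (sigma (Fin y)) (sigma (fsucc eta)))).

Definition cond_C3 (sigma : fbar -> fbar) (eta : float) : Prop :=
  exists lam : R,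
    0 <= lam /\
    (exists se, sigma (Fin eta) = Fin se /\
       lam <= powerRZ 2 (emax E - 7) *
              Rmin (Rabs (fval se)) (powerRZ 2 (Z.of_nat M + 3))) /\
    (forall x y : float, fval x <= fval eta -> fle (fsucc eta) (Fin y) ->
       exists sx se sy sp ep : float,
         sigma (Fin x) = Fin sx /\ sigma (Fin eta) = Fin se /\
         fsucc eta = Fin ep /\ sigma (fsucc eta) = Fin sp /\
         sigma (Fin y) = Fin sy /\
         Rabs (fval sx - fval se) <= lam * Rabs (fval x - fval eta) /\
         Rabs (fval sy - fval sp) <= lam * Rabs (fval y - fval ep)).

Definition condition1 (sigma : fbar -> fbar) : Prop :=
  cond_C1 sigma /\ exists eta : float, cond_C2 sigma eta /\ cond_C3 sigma eta.

Record layer := Layer { lW : list (list float) ; lb : list float }.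

Definition layer_dims (l : layer) (n m : nat) : Prop :=
  length (lW l) = m /\ length (lb l) = m /\ Forall (fun row => length row = n) (lW l).

Fixpoint wf_net (din dout : nat) (net : list layer) : Prop :=
  match net with
  | [] => False
  | l :: rest =>
      match rest with
      | [] => layer_dims l din dout
      | _ => exists dmid, layer_dims l din dmid /\ wf_net dmid dout rest
      end
  end.

(* ((x_1 (x) w_1) (+) ... (+) (x_n (x) w_n)) (+) b, left to right;
   for n = 0 the (empty) sum is omitted, i.e. the result is b (= 0 (+) b). *)
Definition aff_row (row : list float) (bi : float) (x : list fbar) : fbar :=
  match map (fun p => fmul (fst p) (Fin (snd p))) (combine x row) with
  | [] => Fin bi
  | p :: ps => fadd (fold_left fadd ps p) (Fin bi)
  end.

Definition aff (l : layer) (x : list fbar) : list fbar :=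
  map (fun rb => aff_row (fst rb) (snd rb) x) (combine (lW l) (lb l)).

Fixpoint net_eval (sigma : fbar -> fbar) (net : list layer) (x : list fbar)
  : list fbar :=
  match net with
  | [] => x
  | [l] => aff l x
  | l :: rest => net_eval sigma rest (map sigma (aff l x))
  end.

Inductive itv := Itv (a b : fbar) | Top.

Definition valid_itv (I : itv) : Prop :=
  match I with
  | Itv a b => a <> NaN /\ b <> NaN /\ fle a b
  | Top => True
  end.

Definition gamma (I : itv) (v : fbar) : Prop :=
  match I with
  | Itv a b => v <> NaN /\ fle a v /\ fle v b
  | Top => True
  end.

Definition in_box (B : list itv) (xs : list fbar) : Prop := Forall2 gamma B xs.

Definition setmin (S : fbar -> Prop) : fbar :=
  epsilon (inhabits NaN) (fun v => S v /\ forall w, S w -> fle v w).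
Definition setmax (S : fbar -> Prop) : fbar :=
  epsilon (inhabits NaN) (fun v => S v /\ forall w, S w -> fle w v).

Definition sigma_sharp (sigma : fbar -> fbar) (I : itv) : itv :=
  let S := fun v => exists u, gamma I u /\ v = sigma u in
  if excluded_middle_informative (S NaN) then Top
  else Itv (setmin S) (setmax S).

Definition itv_op (op : fbar -> fbar -> fbar) (I J : itv) : itv :=
  match I, J with
  | Itv a b, Itv c d =>
      let s1 := op a c in let s2 := op a d in let s3 := op b c in let s4 := op b d in
      if (isNaN s1 || isNaN s2 || isNaN s3 || isNaN s4)%bool then Top
      else Itv (fmin (fmin (fmin s1 s2) s3) s4) (fmax (fmax (fmax s1 s2) s3) s4)
  | _, _ => Top
  end.

Definition aff_row_sharp (row : list float) (bi : float) (X : list itv) : itv :=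
  match map (fun p => itv_op fmul (fst p) (Itv (Fin (snd p)) (Fin (snd p))))
            (combine X row) with
  | [] => Itv (Fin bi) (Fin bi)
  | p :: ps => itv_op fadd (fold_left (itv_op fadd) ps p) (Itv (Fin bi) (Fin bi))
  end.

Definition aff_sharp (l : layer) (X : list itv) : list itv :=
  map (fun rb => aff_row_sharp (fst rb) (snd rb) X) (combine (lW l) (lb l)).

Fixpoint net_sharp (sigma : fbar -> fbar) (net : list layer) (X : list itv)
  : list itv :=
  match net with
  | [] => X
  | [l] => aff_sharp l X
  | l :: rest => net_sharp sigma rest (map (sigma_sharp sigma) (aff_sharp l X))
  end.

Definition box_in_unit (B : list itv) : Prop :=
  forall xs, in_box B xs ->
    Forall (fun v => exists x : float, v = Fin x /\ -1 <= fval x <= 1) xs.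

Definition fhat_image (f : list R -> R) (B : list itv) (v : fbar) : Prop :=
  exists xs : list float, in_box B (map Fin xs) /\ v = rnd (f (map fval xs)).

End Float.

Arguments NaN {E M}.

(* Main.v *)
(* All interval computations are kept exact by coding a bit in two values of a unit. For a box B
   a unit then spans the interval between the codes of the minimum and of the maximum of the bit
   over B.

   A unit with constant value sigma(c2), scaled by suitable float weights, produces an increment in
   (g/2, g] for every float spacing g, and adding such an increment to a float steps to the next
   one. With a second value large enough to absorb these increments, a row can send the two codes of
   a bit to any prescribed pair of floats (only c1, c2 of opposite signs and huge modulus need an
   intermediate unit). A first layer row compares an input coordinate with a threshold up to a large
   error; rows with bias eta contract this error, since between eta and its successor the rounding
   jumps while sigma is lambda-Lipschitz on both sides, until the pair (eta, eta+) is hit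
   exactly. Disjunctions are computed by one more row at eta, negations by exchanging the two codes.

   Hence for every float p the bits [f^ >= p] (a disjunction over the boxes on which f^ >= p) are
   available, with the right minima and maxima over every box. The output row adds, for every
   positive p, the increment that leads from the predecessor of p to p, weighted by [f^ >= p], and
   then symmetrically for the negative p, so that it evaluates to the minimum and the maximum of f^. *)

Require Import Defs.
From Stdlib Require Import Bool Reals Lra Lia ZArith List Classical ClassicalEpsilon.
From Stdlib Require Import FunctionalExtensionality PropExtensionality ProofIrrelevance.
Import ListNotations.
Open Scope R_scope.

(** Interval arithmetic forgets that several inputs depend on the same bit, so a row is exact only
    if every term moves in one direction with that bit. Such a row amounts to two scalar sums run
    side by side, one for each value of the bit: all terms fed by the constant contribute the same
    increment to both. The two accumulators can then be steered independently only through rounding: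
    an increment below half a spacing is absorbed by the larger one and moves the smaller one. This
    forces statements about pairs of runs, and it makes small targets, where spacings no longer
    shrink, the delicate ones. The rounding enters through a short list of properties stable under
    conjugation by negation, so that each construction is done for one sign. Overflow is tracked
    apart by [in_range], because only the output row is allowed to reach infinities. The constants
    of the condition on sigma are tight in this argument: the lower amplitude bound serves the top
    spacing, 5/4 the bottom one, and the powers 2^(emax-6) and 2^(emax-7) make one layer contract
    errors by a factor 1/8 before rounding. *)

Lemma Rabs_le_inv x a : Rabs x <= a -> - a <= x <= a.
Proof. unfold Rabs; destruct (Rcase_abs x); lra. Qed.

(** * Powers of two and maxima of bounded sets of integers *)

Definition bp (k : Z) : R := powerRZ 2 k.

Lemma bp_add a b : bp (a + b) = bp a * bp b.
Proof. apply powerRZ_add; lra. Qed.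

Lemma bp_pos a : 0 < bp a.
Proof. apply powerRZ_lt; lra. Qed.

Lemma bp_0 : bp 0 = 1. Proof. reflexivity. Qed.
Lemma bp_1 : bp 1 = 2. Proof. unfold bp; simpl; lra. Qed.

Lemma bp_nat k : (0 <= k)%Z -> bp k = IZR (2 ^ k).
Proof.
  intros H; rewrite <- (Z2Nat.id k H); unfold bp.
  rewrite <- pow_powerRZ, <- pow_IZR; reflexivity.
Qed.

Lemma bp_le a b : (a <= b)%Z -> bp a <= bp b.
Proof.
  intros H; replace b with (a + (b - a))%Z by lia; rewrite bp_add.
  pose proof (bp_pos a); rewrite (bp_nat (b - a)) by lia.
  assert (1 <= IZR (2 ^ (b - a))) by (apply IZR_le; pose proof (Z.pow_pos_nonneg 2 (b - a)); lia).
  nra.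
Qed.

Lemma bp_S a : bp (a + 1) = 2 * bp a.
Proof. rewrite bp_add, bp_1; ring. Qed.

Lemma bp_lt a b : (a < b)%Z -> bp a < bp b.
Proof.
  intros H; pose proof (bp_le (a + 1) b ltac:(lia)); rewrite bp_S in H0.
  pose proof (bp_pos a); lra.
Qed.

Lemma bp_lt_inv a b : bp a < bp b -> (a < b)%Z.
Proof.
  intros H; destruct (Z_lt_le_dec a b) as [|C]; trivial.
  apply bp_le in C; lra.
Qed.

Lemma bp_le_inv a b : bp a <= bp b -> (a <= b)%Z.
Proof.
  intros H; destruct (Z_lt_le_dec b a) as [C|]; trivial.
  apply bp_lt in C; lra.
Qed.

Lemma bp_mul_IZR a b : (0 <= a)%Z -> IZR (2 ^ a) * bp b = bp (a + b).
Proof. intros; rewrite <- bp_nat, <- bp_add by trivial; reflexivity. Qed.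

Lemma bp_P k a : bp (Z.pos k + a) = IZR (2 ^ Z.pos k) * bp a.
Proof. rewrite bp_mul_IZR; trivial; lia. Qed.

Lemma bp_inv a : bp (- a) = / bp a.
Proof.
  assert (bp (-a) * bp a = 1) by (rewrite <- bp_add; replace (-a + a)%Z with 0%Z by lia; apply bp_0).
  pose proof (bp_pos a); field_simplify_eq; lra.
Qed.

Lemma dyadic (x : R) : 0 < x -> exists j, bp j < x <= bp (j + 1).
Proof.
  intros Hx.
  destruct (archimed x) as [A _].
  destruct (archimed (/ x)) as [B _].
  assert (0 < / x) by (apply Rinv_0_lt_compat; lra).
  assert (P : forall n : Z, (0 < n)%Z -> IZR n < bp n).
  { intros n Hn; rewrite bp_nat by lia; apply IZR_lt.
    apply Z.pow_gt_lin_r; lia. }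
  set (u := up x) in *; set (v := up (/ x)) in *.
  assert (0 < u)%Z by (apply lt_IZR; lra).
  assert (0 < v)%Z by (apply lt_IZR; lra).
  pose proof (P u H0); pose proof (P v H1).
  assert (L : bp (- v) < x).
  { rewrite bp_inv. rewrite <- (Rinv_inv x). apply Rinv_0_lt_contravar; lra. }
  assert (G : forall n : nat, x <= bp (- v + Z.of_nat n) -> exists j, bp j < x <= bp (j + 1)).
  { induction n as [|n IH]; intros Hn.
    - replace (- v + Z.of_nat 0)%Z with (- v)%Z in Hn by lia; lra.
    - destruct (Rle_dec x (bp (- v + Z.of_nat n))) as [C|C]; [auto|].
      exists (- v + Z.of_nat n)%Z; split; [lra|].
      replace (- v + Z.of_nat n + 1)%Z with (- v + Z.of_nat (S n))%Z by lia; trivial. }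
  apply (G (Z.to_nat (u + v))).
  replace (- v + Z.of_nat (Z.to_nat (u + v)))%Z with u by lia; lra.
Qed.

Lemma dyadic' (x : R) : 0 < x -> exists j, bp j <= x < bp (j + 1).
Proof.
  intros Hx; destruct (dyadic x Hx) as [j [H1 H2]].
  destruct (Rle_lt_or_eq_dec _ _ H2) as [H3|H3].
  - exists j; lra.
  - exists (j + 1)%Z; rewrite (bp_S (j + 1)), <- H3; lra.
Qed.

Lemma Zfloor_ex (x : R) : exists n : Z, IZR n <= x < IZR n + 1.
Proof.
  exists (up x - 1)%Z; destruct (archimed x); rewrite minus_IZR; lra.
Qed.

Lemma floor_mult (x g : R) : 0 < g -> exists n : Z, IZR n * g <= x < (IZR n + 1) * g.
Proof.
  intros Hg; destruct (Zfloor_ex (x / g)) as [n [H1 H2]]; exists n.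
  assert (x = x / g * g) by (field; lra).
  split; rewrite H; apply Rmult_le_compat_r || apply Rmult_lt_compat_r; lra.
Qed.

(** Floats are integer multiples of [omega], so a largest float with a given property is obtained as
    a maximum of integers. *)
Lemma Zmax_ex (P : Z -> Prop) (n0 B : Z) :
  P n0 -> (forall n, P n -> (n <= B)%Z) -> exists n, P n /\ forall m, P m -> (m <= n)%Z.
Proof.
  intros H0 HB.
  assert (G : forall k n, P n -> (B - n < Z.of_nat k)%Z -> exists n, P n /\ forall m, P m -> (m <= n)%Z).
  { induction k as [|k IH]; intros n Hn Hk; [pose proof (HB n Hn); lia|].
    destruct (classic (exists m, P m /\ (n < m)%Z)) as [[m [Hm1 Hm2]]|C].
    - apply (IH m Hm1); lia.
    - exists n; split; trivial; intros m Hm.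
      destruct (Z_le_gt_dec m n); trivial; exfalso; apply C; exists m; split; trivial; lia. }
  apply (G (Z.to_nat (B - n0 + 1)) n0 H0); pose proof (HB _ H0); lia.
Qed.

Lemma sgn_mul_abs n p : n <> 0%Z -> (0 <= p)%Z -> Z.abs (Z.sgn n * p) = p.
Proof. intros; rewrite Z.abs_mul. replace (Z.abs (Z.sgn n)) with 1%Z by lia. lia. Qed.

Lemma pow2_pos (M : nat) : (1 <= 2 ^ Z.of_nat M)%Z.
Proof. pose proof (Z.pow_pos_nonneg 2 (Z.of_nat M)); lia. Qed.
Lemma pow2_S (M : nat) : (2 ^ (Z.of_nat M + 1) = 2 * 2 ^ Z.of_nat M)%Z.
Proof. rewrite Z.pow_add_r by lia; lia. Qed.

Class FP (E M : nat) : Prop := {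
  fp_E : (5 <= E)%nat; fp_M : (3 <= M)%nat; fp_EM : (M <= 2 ^ (E - 1))%nat }.

(** * Floats *)

Section Floats.
Context {E M : nat} {fp : FP E M}.
Local Set Default Proof Using "fp".

Local Notation Mz := (Z.of_nat M).
Local Notation pow_M_pos := (pow2_pos M).
Local Notation pow_M1 := (pow2_S M).
Local Notation em := (emin E).
Local Notation eM := (emax E).
Local Notation F := (isF E M).
Local Notation w := (omega E M).
Local Notation Om := (Omega E M).

Lemma emin_emax : em = (1 - eM)%Z.
Proof. unfold emin, emax; lia. Qed.

Lemma emax_ge : (15 <= eM)%Z.
Proof.
  pose proof fp_E. unfold emax. assert (2 ^ 4 <= 2 ^ (Z.of_nat E - 1))%Z by (apply Z.pow_le_mono_r; lia). lia.
Qed.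

Lemma M_ge : (3 <= Mz)%Z. Proof. pose proof fp_M; lia. Qed.

Lemma M_le : (Mz <= eM + 1)%Z.
Proof.
  pose proof fp_EM; pose proof fp_E. unfold emax.
  assert (H1 : (2 ^ (Z.of_nat E - 1))%Z = Z.of_nat (2 ^ (E - 1))).
  { rewrite Nat2Z.inj_pow, Nat2Z.inj_sub by lia; reflexivity. }
  rewrite H1; lia.
Qed.

Lemma w_bp : w = bp (em - Mz). Proof. reflexivity. Qed.
Lemma w_pos : 0 < w. Proof. apply bp_pos. Qed.

Lemma Om_bp : Om = bp (eM + 1) - bp (eM - Mz).
Proof.
  unfold Omega. fold (bp eM) (bp (- Mz)).
  rewrite bp_S. unfold Z.sub. rewrite (bp_add eM (- Mz)). ring.
Qed.

Lemma Om_lt : Om < bp (eM + 1).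
Proof. rewrite Om_bp; pose proof (bp_pos (eM - Mz)); lra. Qed.

Lemma Om_mult : Om = IZR (2 ^ (Mz + 1) - 1) * bp (eM - Mz).
Proof.
  rewrite minus_IZR, Rmult_minus_distr_r, bp_mul_IZR by lia. rewrite Om_bp.
  replace (Mz + 1 + (eM - Mz))%Z with (eM + 1)%Z by lia. ring.
Qed.

Lemma Om_ge : bp eM <= Om.
Proof.
  rewrite Om_bp, bp_S. pose proof (bp_le (eM - Mz) eM ltac:(lia)). lra.
Qed.

Lemma pow_M_8 : (8 <= 2 ^ Mz)%Z.
Proof. change 8%Z with (2 ^ 3)%Z; pose proof M_ge; apply Z.pow_le_mono_r; lia. Qed.

Lemma F_le_Om x : F x -> Rabs x <= Om.
Proof.
  intros (n & e & Hn & He & ->).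
  fold (bp (e - Mz)). rewrite Rabs_mult, (Rabs_pos_eq (bp _)) by (left; apply bp_pos).
  rewrite Om_mult, <- abs_IZR.
  apply Rmult_le_compat.
  - apply IZR_le; lia.
  - left; apply bp_pos.
  - apply IZR_le; lia.
  - apply bp_le; lia.
Qed.

(** The significand may equal 2^(M+1) and the exponent has no upper bound: the bound [Om] on the
    value allows both to be repaired by shifting, which spares every caller a case distinction at
    the ends of binades. *)
Lemma F_intro n a : (Z.abs n <= 2 ^ (Mz + 1))%Z -> (em - Mz <= a)%Z ->
  Rabs (IZR n * bp a) <= Om -> F (IZR n * bp a).
Proof.
  intros Hn Ha HO.
  destruct (Z.eq_dec n 0) as [->|N0].
  { exists 0%Z, em. split; [|split]; [pose proof pow_M_pos; rewrite pow_M1; change (Z.abs 0) with 0%Z; lia| pose proof emax_ge; rewrite emin_emax; lia|rewrite !Rmult_0_l; reflexivity]. }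
  destruct (Z_le_gt_dec a (eM - Mz)) as [A|A].
  - destruct (Z.eq_dec (Z.abs n) (2 ^ (Mz + 1))) as [Q|Q].
    +
      (* A significand 2^(M+1) is traded for 2^M at the next exponent, which is still legal since
         the value stays below 2^(eM+1). *)
      assert (a + 1 <= eM - Mz)%Z.
      { assert (bp (Mz + 1 + a) < bp (eM + 1)).
        { eapply Rle_lt_trans; [|apply Om_lt].
          rewrite Rabs_mult, (Rabs_pos_eq (bp _)) in HO by (left; apply bp_pos).
          rewrite <- abs_IZR, Q, bp_mul_IZR in HO by lia; trivial. }
        apply bp_lt_inv in H; lia. }
      exists (Z.sgn n * 2 ^ Mz)%Z, (a + 1 + Mz)%Z. split; [|split].
      * pose proof pow_M_pos. rewrite sgn_mul_abs by lia. rewrite pow_M1; lia.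
      * lia.
      * replace (a + 1 + Mz - Mz)%Z with (a + 1)%Z by lia. fold (bp (a + 1)); rewrite bp_S.
        rewrite pow_M1 in Q.
        replace n with (Z.sgn n * (2 * 2 ^ Mz))%Z at 1 by (rewrite <- Q, Z.mul_comm; apply Z.abs_sgn).
        rewrite !mult_IZR; ring.
    + exists n, (a + Mz)%Z. split; [lia|split; [lia|]].
      replace (a + Mz - Mz)%Z with a by lia; reflexivity.
  - exists (n * 2 ^ (a - (eM - Mz)))%Z, eM.
    assert (P : IZR n * bp a = IZR (n * 2 ^ (a - (eM - Mz))) * bp (eM - Mz)).
    { rewrite mult_IZR, Rmult_assoc, bp_mul_IZR by lia. do 2 f_equal; lia. }
    rewrite P in *. split; [|split]; [|pose proof emax_ge; rewrite emin_emax; lia|reflexivity].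
    rewrite Rabs_mult, (Rabs_pos_eq (bp _)), <- abs_IZR in HO by (left; apply bp_pos).
    rewrite Om_mult in HO. apply Rmult_le_reg_r in HO; [|apply bp_pos].
    apply le_IZR in HO. lia.
Qed.

Lemma F_canon x : F x -> exists n a, (Z.abs n < 2 ^ (Mz + 1))%Z /\ (em - Mz <= a <= eM - Mz)%Z /\
  x = IZR n * bp a /\ (a = (em - Mz)%Z \/ (2 ^ Mz <= Z.abs n)%Z).
Proof.
  intros (n & e & Hn & He & ->).
  assert (G : forall k n a, (a - (em - Mz) <= Z.of_nat k)%Z -> (Z.abs n < 2 ^ (Mz + 1))%Z -> (em - Mz <= a <= eM - Mz)%Z ->
     exists n' a', (Z.abs n' < 2 ^ (Mz + 1))%Z /\ (em - Mz <= a' <= eM - Mz)%Z /\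
       IZR n * bp a = IZR n' * bp a' /\ (a' = (em - Mz)%Z \/ (2 ^ Mz <= Z.abs n')%Z)).
  { clear n e Hn He. induction k as [|k IH]; intros n a Hk Hn Ha.
    - exists n, a; repeat split; trivial; try lia.
    - destruct (Z_le_gt_dec (2 ^ Mz) (Z.abs n)) as [C|C].
      + exists n, a; repeat split; trivial; lia.
      + destruct (Z.eq_dec a (em - Mz)) as [->|D]; [exists n, (em - Mz)%Z; repeat split; trivial; lia|].
        destruct (IH (2 * n)%Z (a - 1)%Z) as (n' & a' & H1 & H2 & H3 & H4); try lia.
        { rewrite pow_M1; lia. }
        exists n', a'; repeat split; trivial; try lia.
        rewrite <- H3, mult_IZR. replace a with (a - 1 + 1)%Z at 1 by lia. rewrite bp_S; ring. }
  destruct (G (Z.to_nat (e - em)) n (e - Mz)%Z) as (n' & a' & H1 & H2 & H3 & H4); try lia.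
  exists n', a'; repeat split; trivial; lia.
Qed.

Lemma F_0 : F 0.
Proof.
  replace 0 with (IZR 0 * bp (em - Mz)) by ring.
  apply F_intro; [change (Z.abs 0) with 0%Z; pose proof pow_M_pos; rewrite pow_M1; lia|lia|].
  rewrite Rmult_0_l, Rabs_R0. pose proof Om_ge; pose proof (bp_pos eM); lra.
Qed.

Lemma F_opp x : F x -> F (- x).
Proof.
  intros (n & e & H1 & H2 & ->); exists (- n)%Z, e; repeat split; try lia.
  rewrite opp_IZR; ring.
Qed.

Lemma F_mult x : F x -> exists n, x = IZR n * w.
Proof.
  intros (n & e & H1 & H2 & ->). exists (n * 2 ^ (e - em))%Z.
  rewrite w_bp, mult_IZR, Rmult_assoc, bp_mul_IZR by lia. fold (bp (e - Mz)).
  do 2 f_equal; lia.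
Qed.

(* binade exponent of a real, clipped below at the subnormal range *)
Lemma cexp_ex x : Rabs x < bp (eM + 1) -> exists a, (em - Mz <= a <= eM - Mz)%Z /\
  Rabs x < bp (Mz + 1 + a) /\ (a = (em - Mz)%Z \/ bp (Mz + a) <= Rabs x).
Proof.
  intros Hx.
  assert (G : forall k a, (a - (em - Mz) <= Z.of_nat k)%Z -> (em - Mz <= a <= eM - Mz)%Z -> Rabs x < bp (Mz + 1 + a) ->
     exists a, (em - Mz <= a <= eM - Mz)%Z /\
  Rabs x < bp (Mz + 1 + a) /\ (a = (em - Mz)%Z \/ bp (Mz + a) <= Rabs x)).
  { clear Hx; induction k as [|k IH]; intros a Hk Ha Hx.
    - exists a; repeat split; trivial; try lia; left; lia.
    - destruct (Rle_dec (bp (Mz + a)) (Rabs x)) as [C|C]; [exists a; tauto|].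
      destruct (Z.eq_dec a (em - Mz)) as [D|D]; [exists a; tauto|].
      apply (IH (a - 1)%Z); try lia. replace (Mz + 1 + (a - 1))%Z with (Mz + a)%Z by lia. lra. }
  apply (G (Z.to_nat (eM - em)) (eM - Mz)%Z); pose proof emax_ge; rewrite ?emin_emax; try lia.
  replace (Mz + 1 + (eM - Mz))%Z with (eM + 1)%Z by lia; trivial.
Qed.

Lemma mult_int n a k b : (b <= a)%Z -> IZR n * bp a = IZR k * bp b -> k = (n * 2 ^ (a - b))%Z.
Proof.
  intros H Q. replace a with ((a - b) + b)%Z in Q at 1 by lia.
  rewrite <- bp_mul_IZR, <- Rmult_assoc, <- mult_IZR in Q by lia.
  apply Rmult_eq_reg_r in Q; [|pose proof (bp_pos b); lra]. apply eq_IZR in Q; lia.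
Qed.

Lemma F_rescale n a b : (b <= a)%Z -> IZR n * bp a = IZR (n * 2 ^ (a - b)) * bp b.
Proof.
  intros H; rewrite mult_IZR, Rmult_assoc, bp_mul_IZR by lia. do 2 f_equal; lia.
Qed.

(** A float of exponent at least a is a multiple of 2^a, and one of smaller exponent has modulus
    below 2^(M+a). So no float lies strictly between two consecutive multiples of 2^a when a is the
    least exponent or when both have modulus at least 2^(M+a). *)
Lemma no_float_between n a z : F z -> (em - Mz <= a)%Z ->
  (a = (em - Mz)%Z \/ (2 ^ Mz <= n)%Z \/ (n + 1 <= - 2 ^ Mz)%Z) ->
  z <= IZR n * bp a \/ (IZR n + 1) * bp a <= z.
Proof.
  intros Hz Ha Hn. pose proof (bp_pos a) as Pa.
  destruct (F_canon z Hz) as (k & c & Hk & Hc & -> & _).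
  destruct (Z_le_gt_dec a c) as [L|L].
  - rewrite (F_rescale k c a L). set (q := (k * 2 ^ (c - a))%Z).
    destruct (Z_le_gt_dec q n) as [D|D]; [left|right].
    + apply Rmult_le_compat_r; [lra|apply IZR_le; lia].
    + apply Rmult_le_compat_r; [lra|]. rewrite <- plus_IZR; apply IZR_le; lia.
  - assert (B : Rabs (IZR k * bp c) < bp (Mz + a)).
    { rewrite Rabs_mult, (Rabs_pos_eq (bp c)), <- abs_IZR by (left; apply bp_pos).
      apply Rlt_le_trans with (IZR (2 ^ (Mz + 1)) * bp c).
      - apply Rmult_lt_compat_r; [apply bp_pos|apply IZR_lt; lia].
      - rewrite bp_mul_IZR by lia; apply bp_le; lia. }
    destruct Hn as [Hn|[Hn|Hn]]; [lia| |].
    + left. apply Rabs_def2 in B. rewrite <- bp_mul_IZR in B by lia.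
      apply IZR_le in Hn. nra.
    + right. apply Rabs_def2 in B. rewrite <- bp_mul_IZR in B by lia.
      apply IZR_le in Hn. rewrite plus_IZR, opp_IZR in Hn. nra.
Qed.

(** Counterpart of [even_float] on reals: floats are handled as reals satisfying [isF], and the
    subset type returns only with the interval semantics. *)
Definition even_F (y : R) := exists m e : Z, (Z.abs m < 2 ^ (Mz + 1))%Z /\ (em <= e <= eM)%Z /\
  y = IZR m * bp (e - Mz) /\ (e = em \/ (2 ^ Mz <= Z.abs m)%Z) /\ Z.even m = true.

Definition near_even (x y : R) := F y /\ (forall z, F z -> Rabs (x - y) <= Rabs (x - z)) /\
  (forall z, F z -> Rabs (x - z) = Rabs (x - y) -> z <> y -> even_F y).

Lemma bracket x : Rabs x <= Om -> ~ F x -> exists n a, (em - Mz <= a <= eM - Mz)%Z /\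
  IZR n * bp a < x < (IZR n + 1) * bp a /\ F (IZR n * bp a) /\ F ((IZR n + 1) * bp a) /\
  (Z.abs n <= 2 ^ (Mz + 1))%Z /\ (Z.abs (n + 1) <= 2 ^ (Mz + 1))%Z /\
  (a = (em - Mz)%Z \/ (2 ^ Mz <= n)%Z \/ (n + 1 <= - 2 ^ Mz)%Z).
Proof.
  intros HO NF.
  destruct (cexp_ex x) as (a & Ha & Hx & Hc); [pose proof Om_lt; lra|].
  pose proof (bp_pos a) as Pa.
  destruct (floor_mult x (bp a) Pa) as (n & Hn1 & Hn2).
  rewrite <- bp_mul_IZR in Hx by lia. apply Rabs_def2 in Hx.
  assert (B1 : (n < 2 ^ (Mz + 1))%Z) by (apply lt_IZR; nra).
  assert (B2 : (- 2 ^ (Mz + 1) < n + 1)%Z) by (apply lt_IZR; rewrite plus_IZR, opp_IZR; nra).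
  assert (C : a = (em - Mz)%Z \/ (2 ^ Mz <= n)%Z \/ (n + 1 <= - 2 ^ Mz)%Z).
  { destruct Hc as [Hc|Hc]; [tauto|right]. rewrite <- bp_mul_IZR in Hc by lia.
    destruct (Rle_dec 0 x) as [P|P].
    - left. rewrite Rabs_pos_eq in Hc by trivial.
      assert (2 ^ Mz < n + 1)%Z; [|lia]. apply lt_IZR; rewrite plus_IZR; nra.
    - right. rewrite Rabs_left in Hc by lra.
      destruct (Rle_lt_or_eq_dec _ _ Hn1) as [L|L].
      + assert (n < - 2 ^ Mz)%Z; [|lia]. apply lt_IZR; rewrite opp_IZR; nra.
      + exfalso; apply NF; rewrite <- L. apply F_intro; try lia. rewrite L; trivial. }
  assert (K : (Z.abs n <= 2 ^ (Mz + 1) /\ Z.abs (n + 1) <= 2 ^ (Mz + 1))%Z) by lia.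
  assert (Om_a : exists N, Om = IZR N * bp a).
  { rewrite Om_mult. exists ((2 ^ (Mz + 1) - 1) * 2 ^ (eM - Mz - a))%Z. apply F_rescale; lia. }
  destruct Om_a as [N HN].
  apply Rabs_le_inv in HO.
  assert (IZR n * bp a <> x).
  { intros Q; apply NF; rewrite <- Q; apply F_intro; try lia. rewrite Q. apply Rabs_le; lra. }
  assert (LO : - Om <= IZR n * bp a).
  { rewrite HN. assert (- N <= n)%Z.
    { assert (- N < n + 1)%Z; [|lia]. apply lt_IZR; rewrite plus_IZR, opp_IZR; nra. }
    apply IZR_le in H0; rewrite opp_IZR in H0; nra. }
  assert (HI : (IZR n + 1) * bp a <= Om).
  { rewrite HN. assert (n < N)%Z by (apply lt_IZR; nra).
    assert (n + 1 <= N)%Z by lia. apply IZR_le in H1; rewrite plus_IZR in H1; nra. }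
  exists n, a. repeat split; try lia; try lra.
  - apply F_intro; try lia. apply Rabs_le; nra.
  - rewrite <- plus_IZR; apply F_intro; try lia. rewrite plus_IZR. apply Rabs_le; nra.
Qed.

Lemma even_F_intro n a : (Z.abs n <= 2 ^ (Mz + 1))%Z -> (em - Mz <= a <= eM - Mz)%Z ->
  (a = (em - Mz)%Z \/ (2 ^ Mz <= Z.abs n)%Z) -> Rabs (IZR n * bp a) <= Om ->
  Z.even n = true -> even_F (IZR n * bp a).
Proof.
  intros Hn Ha Hc HO He.
  destruct (Z.eq_dec (Z.abs n) (2 ^ (Mz + 1))) as [Q|Q].
  - assert (a + 1 <= eM - Mz)%Z.
    { assert (bp (Mz + 1 + a) < bp (eM + 1)).
      { eapply Rle_lt_trans; [|apply Om_lt].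
        rewrite Rabs_mult, (Rabs_pos_eq (bp _)) in HO by (left; apply bp_pos).
        rewrite <- abs_IZR, Q, bp_mul_IZR in HO by lia; trivial. }
      apply bp_lt_inv in H; lia. }
    exists (Z.sgn n * 2 ^ Mz)%Z, (a + 1 + Mz)%Z.
    assert (AB : (Z.abs (Z.sgn n * 2 ^ Mz) = 2 ^ Mz)%Z).
    { pose proof pow_M_pos; rewrite pow_M1 in Q. apply sgn_mul_abs; lia. }
    split; [|split; [|split; [|split]]].
    + rewrite AB, pow_M1; pose proof pow_M_pos; lia.
    + lia.
    + replace (a + 1 + Mz - Mz)%Z with (a + 1)%Z by lia. rewrite bp_S.
      rewrite pow_M1 in Q.
      replace n with (Z.sgn n * (2 * 2 ^ Mz))%Z at 1 by (rewrite <- Q, Z.mul_comm; apply Z.abs_sgn).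
      rewrite !mult_IZR; ring.
    + right; lia.
    + rewrite Z.even_mul. apply orb_true_iff; right. rewrite Z.even_pow; trivial; pose proof M_ge; lia.
  - exists n, (a + Mz)%Z. replace (a + Mz - Mz)%Z with a by lia. repeat split; trivial; try lia.
Qed.

(** [rnd] is defined by choice, so a nearest float that respects the tie rule has to be exhibited
    before anything is known about its values. Beyond [Om] it is the extreme float; otherwise one of
    the two ends of the bracket. *)
Lemma near_even_ex x : exists y, near_even x y.
Proof.
  assert (FO : F Om).
  { rewrite Om_mult; apply F_intro; [lia|pose proof emax_ge; pose proof emin_emax; lia|].
    rewrite <- Om_mult, Rabs_pos_eq; [lra|pose proof Om_ge; pose proof (bp_pos eM); lra]. }
  pose proof Om_ge; pose proof (bp_pos eM).
  destruct (Rle_dec (Rabs x) Om) as [HO|HO].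
  2:{ destruct (Rle_dec 0 x) as [P|P].
    - rewrite Rabs_pos_eq in HO by trivial. exists Om. split; [trivial|split].
      + intros z Hz; apply F_le_Om, Rabs_le_inv in Hz. rewrite !Rabs_pos_eq; lra.
      + intros z Hz; apply F_le_Om, Rabs_le_inv in Hz. rewrite !Rabs_pos_eq; lra.
    - rewrite Rabs_left in HO by lra. exists (- Om). split; [apply F_opp; trivial|split].
      + intros z Hz; apply F_le_Om, Rabs_le_inv in Hz. rewrite !Rabs_left1; lra.
      + intros z Hz; apply F_le_Om, Rabs_le_inv in Hz. rewrite !Rabs_left1; lra. }
  destruct (classic (F x)) as [FX|NF].
  { exists x; split; [trivial|split]; intros z Hz.
    - replace (x - x) with 0 by ring; rewrite Rabs_R0; apply Rabs_pos.
    - replace (x - x) with 0 by ring; rewrite Rabs_R0. intros Q N; exfalso; apply N.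
      destruct (Req_dec (x - z) 0); [lra|]. apply Rabs_no_R0 in H1; lra. }
  destruct (bracket x HO NF) as (n & a & Ha & Hx & F1 & F2 & Hn & Hn1 & Hc).
  set (lo := IZR n * bp a) in *. set (hi := (IZR n + 1) * bp a) in *.
  assert (T : forall z, F z -> z <= lo \/ hi <= z) by (intros z Hz; apply no_float_between; trivial; lia).
  assert (NL : x - lo <= hi - x -> forall z, F z -> Rabs (x - lo) <= Rabs (x - z)).
  { intros L z Hz; rewrite (Rabs_pos_eq (x - lo)) by lra.
    destruct (T z Hz); [rewrite Rabs_pos_eq; lra|rewrite Rabs_left; lra]. }
  assert (NH : hi - x <= x - lo -> forall z, F z -> Rabs (x - hi) <= Rabs (x - z)).
  { intros L z Hz; rewrite (Rabs_left (x - hi)) by lra.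
    destruct (T z Hz); [rewrite Rabs_pos_eq; lra|rewrite Rabs_left; lra]. }
  assert (EL : Z.even n = true -> even_F lo).
  { intros; apply even_F_intro; trivial; try lia. apply F_le_Om; trivial. }
  assert (EH : Z.even (n + 1) = true -> even_F hi).
  { intros; unfold hi; rewrite <- plus_IZR. apply even_F_intro; trivial; try lia.
    rewrite plus_IZR; apply F_le_Om; trivial. }
  destruct (Rtotal_order (x - lo) (hi - x)) as [L|[L|L]].
  - exists lo; split; [trivial|split; [apply NL; lra|]].
    intros z Hz Q N; exfalso. rewrite (Rabs_pos_eq (x - lo)) in Q by lra.
    destruct (T z Hz); [rewrite Rabs_pos_eq in Q; lra|rewrite Rabs_left in Q; lra].
  - destruct (Z.even n) eqn:EV.
    + exists lo; split; [trivial|split; [apply NL; lra|]]. intros; apply EL; trivial.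
    + exists hi; split; [trivial|split; [apply NH; lra|]]. intros; apply EH.
      rewrite Z.even_add, EV; reflexivity.
  - exists hi; split; [trivial|split; [apply NH; lra|]].
    intros z Hz Q N; exfalso. rewrite (Rabs_left (x - hi)) in Q by lra.
    destruct (T z Hz); [rewrite Rabs_pos_eq in Q; lra|rewrite Rabs_left in Q; lra].
Qed.

(** Of the tie rule only one instance is retained, the midpoint above 2^(M+1) w, together with its
    negative. It serves [reach_low], where w is exactly half a spacing; the negative makes the
    record stable under conjugation by negation. *)
Record rspec (rd : R -> R) : Prop := {
  rs_F : forall x, F (rd x);
  rs_near : forall x z, F z -> Rabs (x - rd x) <= Rabs (x - z);
  rs_tie : rd (IZR (2 ^ (Mz + 1) + 1) * w) = IZR (2 ^ (Mz + 1)) * w;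
  rs_tieN : rd (- (IZR (2 ^ (Mz + 1) + 1) * w)) = - (IZR (2 ^ (Mz + 1)) * w) }.

Lemma rspec_opp rd : rspec rd -> rspec (fun x => - rd (- x)).
Proof.
  intros [A B C D]; split.
  - intros; apply F_opp; trivial.
  - intros x z Hz. rewrite <- (Rabs_Ropp (x - z)), <- (Rabs_Ropp (x - _)).
    replace (- (x - - rd (- x))) with (- x - rd (- x)) by ring.
    replace (- (x - z)) with (- x - - z) by ring. apply B, F_opp; trivial.
  - rewrite D; ring.
  - rewrite Ropp_involutive, C; reflexivity.
Qed.

(** The argument is the midpoint of P 2w and (P+1) 2w with P = 2^M, and P is even. The sign s treats
    the midpoint and its negative together. *)
Lemma near_even_tie (s y : R) : s = 1 \/ s = -1 ->
  near_even (s * (IZR (2 ^ (Mz + 1) + 1) * w)) y -> y = s * (IZR (2 ^ (Mz + 1)) * w).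
Proof.
  intros Hs (FY & HN & HE). pose proof w_pos as Pw. pose proof pow_M_8 as P8.
  set (a := (em - Mz + 1)%Z).
  assert (Ba : bp a = 2 * w) by (unfold a; rewrite bp_S, <- w_bp; ring).
  set (P := (2 ^ Mz)%Z) in *.
  assert (X : IZR (2 ^ (Mz + 1) + 1) * w = (IZR P + / 2) * bp a).
  { rewrite Ba, plus_IZR, pow_M1, mult_IZR. fold P. lra. }
  assert (LO : IZR (2 ^ (Mz + 1)) * w = IZR P * bp a).
  { rewrite Ba, pow_M1, mult_IZR. fold P. lra. }
  rewrite X in HN, HE. rewrite LO. pose proof (bp_pos a) as Pa.
  assert (Bd : forall k, (Z.abs k <= P + 1)%Z -> F (IZR k * bp a)).
  { intros k Hk; apply F_intro.
    - rewrite pow_M1. fold P. lia.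
    - unfold a; lia.
    - rewrite Rabs_mult, (Rabs_pos_eq (bp a)), <- abs_IZR by lra.
      apply Rle_trans with (IZR (2 ^ (Mz + 1)) * bp a).
      + apply Rmult_le_compat_r; [lra|]. apply IZR_le. rewrite pow_M1; fold P; lia.
      + rewrite bp_mul_IZR by lia. eapply Rle_trans; [|apply Om_ge]. apply bp_le.
        unfold a; pose proof emax_ge; rewrite emin_emax; lia. }
  assert (T : y <= IZR P * bp a \/ (IZR P + 1) * bp a <= y).
  { apply no_float_between; trivial; [unfold a; lia|right; left; unfold P; lia]. }
  assert (T' : y <= IZR (- P - 1) * bp a \/ (IZR (- P - 1) + 1) * bp a <= y).
  { apply no_float_between; trivial; [unfold a; lia|right; right; unfold P; lia]. }
  rewrite minus_IZR, opp_IZR in T'.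
  (* P + 1 has no even representation: at exponents of at least a the significand would divide the
     odd number P + 1, and at the least exponent it would be 2(P+1), which is too large. *)
  assert (ODD : forall q, (q = P + 1)%Z -> s * (IZR q * bp a) = y -> even_F y -> False).
  { intros q Hq Hy (m & e & Hm & He & Hme & Hc & Hev).
    assert (Hme2 : IZR (m * (if Req_EM_T s 1 then 1 else -1)) * bp (e - Mz) = IZR q * bp a).
    { rewrite mult_IZR, Rmult_comm. destruct (Req_EM_T s 1) as [->|N].
      - rewrite <- Hy in Hme. lra.
      - destruct Hs as [Hs| ->]; [contradiction|]. rewrite <- Hy in Hme. lra. }
    set (m' := (m * (if Req_EM_T s 1 then 1 else -1))%Z) in *.
    assert (Em : Z.even m' = true).
    { unfold m'; rewrite Z.even_mul, Hev; reflexivity. }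
    assert (Am : (Z.abs m' < 2 ^ (Mz + 1))%Z) by (unfold m'; destruct (Req_EM_T s 1); lia).
    rewrite pow_M1 in Am. fold P in Am.
    destruct (Z_le_gt_dec a (e - Mz)) as [L|L].
    - apply (mult_int _ _ _ _ L) in Hme2.
      assert (Z.even q = false).
      { rewrite Hq, Z.even_add. unfold P. rewrite Z.even_pow by (pose proof M_ge; lia). reflexivity. }
      rewrite Hme2, Z.even_mul, Em in H. discriminate.
    - assert (Q : (e - Mz = em - Mz)%Z) by (unfold a in L; lia).
      symmetry in Hme2. assert (L' : (e - Mz <= a)%Z) by lia.
      apply (mult_int _ _ _ _ L') in Hme2.
      replace (a - (e - Mz))%Z with 1%Z in Hme2 by (unfold a; lia).
      simpl Z.pow in Hme2. lia. }
  destruct Hs as [-> | ->].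
  - pose proof (HN _ (Bd P ltac:(lia))) as H1.
    replace (1 * ((IZR P + / 2) * bp a) - IZR P * bp a) with (bp a / 2) in H1 by field.
    rewrite (Rabs_pos_eq (bp a / 2)) in H1 by lra. apply Rabs_le_inv in H1.
    destruct T as [T|T].
    + assert (y = IZR P * bp a) by nra. lra.
    + exfalso. assert (Y : y = (IZR P + 1) * bp a) by nra.
      apply (ODD (P + 1)%Z); trivial; [rewrite plus_IZR, Y; ring|].
      apply (HE (IZR P * bp a)).
      * apply Bd; lia.
      * rewrite Y. rewrite Rabs_pos_eq, Rabs_left; nra.
      * rewrite Y; nra.
  - pose proof (HN _ (Bd (- P)%Z ltac:(lia))) as H1.
    rewrite opp_IZR in H1.
    replace (-1 * ((IZR P + / 2) * bp a) - - IZR P * bp a) with (- (bp a / 2)) in H1 by field.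
    rewrite (Rabs_Ropp), (Rabs_pos_eq (bp a / 2)) in H1 by lra. apply Rabs_le_inv in H1.
    destruct T' as [T'|T'].
    + exfalso. assert (Y : y = - (IZR P + 1) * bp a) by nra.
      apply (ODD (P + 1)%Z); trivial; [rewrite plus_IZR, Y; ring|].
      apply (HE (IZR (- P) * bp a)).
      * apply Bd; lia.
      * rewrite Y, opp_IZR. rewrite Rabs_left, Rabs_pos_eq; nra.
      * rewrite Y, opp_IZR; nra.
    + assert (y = - IZR P * bp a) by nra. lra.
Qed.

Lemma rspec_choice (rd : R -> R) : (forall x, near_even x (rd x)) -> rspec rd.
Proof.
  intros H; split.
  - intros x; apply (H x).
  - intros x z Hz; destruct (H x) as (_ & N & _); auto.
  - rewrite <- (Rmult_1_l (IZR (2 ^ (Mz + 1)) * w)). apply near_even_tie; [auto|].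
    rewrite Rmult_1_l; apply H.
  - replace (- (IZR (2 ^ (Mz + 1)) * w)) with (-1 * (IZR (2 ^ (Mz + 1)) * w)) by ring.
    apply near_even_tie; [auto|].
    replace (-1 * (IZR (2 ^ (Mz + 1) + 1) * w)) with (- (IZR (2 ^ (Mz + 1) + 1) * w)) by ring. apply H.
Qed.

End Floats.

(** * Spacing between consecutive floats *)

Section Spacing.
Context {E M : nat} {fp : FP E M}.
Local Set Default Proof Using "fp".

Local Notation Mz := (Z.of_nat M).
Local Notation pow_M_pos := (pow2_pos M).
Local Notation pow_M1 := (pow2_S M).
Local Notation em := (emin E).
Local Notation eM := (emax E).
Local Notation F := (isF E M).
Local Notation w := (omega E M).
Local Notation Om := (Omega E M).

Lemma F_bp a : (em - Mz <= a <= eM)%Z -> F (bp a).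
Proof.
  intros H; rewrite <- (Rmult_1_l (bp a)). apply F_intro; [|lia|].
  - change (Z.abs 1) with 1%Z. pose proof pow_M_pos; rewrite pow_M1; lia.
  - rewrite Rmult_1_l, Rabs_pos_eq by (left; apply bp_pos). pose proof Om_ge; pose proof (bp_le a eM ltac:(lia)); lra.
Qed.

Lemma F_small k a : (Z.abs k <= 2 ^ (Mz + 1))%Z -> (em - Mz <= a <= eM - Mz - 1)%Z -> F (IZR k * bp a).
Proof.
  intros Hk Ha; apply F_intro; trivial; try lia.
  rewrite Rabs_mult, <- abs_IZR, (Rabs_pos_eq (bp a)) by (left; apply bp_pos).
  apply Rle_trans with (IZR (2 ^ (Mz + 1)) * bp a).
  - apply Rmult_le_compat_r; [left; apply bp_pos|apply IZR_le; trivial].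
  - rewrite bp_mul_IZR by lia. eapply Rle_trans; [|apply Om_ge]. apply bp_le; lia.
Qed.

Lemma em_lt_eM : (em - Mz <= eM - Mz - 1)%Z /\ (em <= -14)%Z.
Proof. pose proof (emax_ge (E:=E)); pose proof (emin_emax (E:=E)); lia. Qed.

Lemma F_w k : (Z.abs k <= 2 ^ (Mz + 1))%Z -> F (IZR k * w).
Proof. intros; rewrite w_bp; apply F_small; trivial; pose proof em_lt_eM; lia. Qed.

Lemma Fpos_rep y : F y -> 0 <= y -> exists n a, (0 <= n < 2 ^ (Mz + 1))%Z /\ (em - Mz <= a <= eM - Mz)%Z /\
  y = IZR n * bp a /\ (a = (em - Mz)%Z \/ (2 ^ Mz <= n)%Z).
Proof.
  intros H H0; destruct (F_canon y H) as (n & a & Hn & Ha & -> & Hc).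
  assert (0 <= n)%Z.
  { apply le_IZR. pose proof (bp_pos a). apply Rmult_le_reg_r with (bp a); lra. }
  exists n, a; repeat split; trivial; lia.
Qed.

Lemma gap_up n a z : (0 <= n)%Z -> (em - Mz <= a)%Z -> (a = (em - Mz)%Z \/ (2 ^ Mz <= n)%Z) ->
  F z -> IZR n * bp a < z -> IZR n * bp a + bp a <= z.
Proof.
  intros Hn Ha Hc Hz L. destruct (no_float_between n a z Hz Ha ltac:(tauto)); lra.
Qed.

Lemma F_next n a : (0 <= n < 2 ^ (Mz + 1))%Z -> (em - Mz <= a <= eM - Mz)%Z -> IZR n * bp a < Om ->
  F (IZR n * bp a + bp a).
Proof.
  intros Hn Ha L. replace (IZR n * bp a + bp a) with (IZR (n + 1) * bp a) by (rewrite plus_IZR; ring).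
  assert (HN : Om = IZR ((2 ^ (Mz + 1) - 1) * 2 ^ (eM - Mz - a)) * bp a).
  { rewrite Om_mult at 1. apply F_rescale; lia. }
  pose proof (bp_pos a) as Pa.
  apply F_intro; try lia.
  rewrite Rabs_mult, <- abs_IZR, (Rabs_pos_eq (bp a)) by lra. rewrite HN.
  apply Rmult_le_compat_r; [lra|]. apply IZR_le. rewrite HN in L.
  apply Rmult_lt_reg_r in L; trivial. apply lt_IZR in L. lia.
Qed.

Lemma next_up y : F y -> 0 <= y < Om -> exists n a, (0 <= n < 2 ^ (Mz + 1))%Z /\ (em - Mz <= a <= eM - Mz)%Z /\
  y = IZR n * bp a /\ (a = (em - Mz)%Z \/ (2 ^ Mz <= n)%Z) /\ F (y + bp a) /\
  (forall z, F z -> y < z -> y + bp a <= z).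
Proof.
  intros Hy H. destruct (Fpos_rep y Hy ltac:(lra)) as (n & a & Hn & Ha & Q & Hc).
  exists n, a. repeat split; trivial; try lia.
  - rewrite Q; apply F_next; trivial; lra.
  - intros z Hz L. subst y. apply gap_up; trivial; lia.
Qed.

Lemma gap_dn n a z : (1 <= n)%Z -> (em - Mz <= a)%Z -> (a = (em - Mz)%Z \/ (2 ^ Mz < n)%Z) ->
  F z -> z < IZR n * bp a -> z <= IZR n * bp a - bp a.
Proof.
  intros Hn Ha Hc Hz L.
  destruct (no_float_between (n - 1) a z Hz Ha) as [D|D].
  - destruct Hc; [left; trivial|right; left; lia].
  - rewrite minus_IZR in D; lra.
  - rewrite minus_IZR in D. lra.
Qed.

(** At n = 2^M the spacing below is half of the spacing above; half is therefore the bound that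
    holds throughout a binade. *)
Lemma gap_dn_half n a z : (2 ^ Mz <= n)%Z -> (em - Mz <= a)%Z ->
  F z -> z < IZR n * bp a -> z <= IZR n * bp a - bp a / 2 .
Proof.
  intros Hn Ha Hz L. pose proof (bp_pos a). pose proof pow_M_pos.
  destruct (Z.eq_dec a (em - Mz)) as [Q|Q].
  { apply gap_dn in L; trivial; try lia; lra. }
  assert (Q' : bp a = 2 * bp (a - 1)) by (rewrite <- bp_S; f_equal; lia).
  rewrite Q' in L |- *.
  destruct (no_float_between (2 * n - 1) (a - 1) z Hz ltac:(lia)) as [D|D].
  - right; left; lia.
  - rewrite minus_IZR, mult_IZR in D; lra.
  - rewrite minus_IZR, mult_IZR in D; lra.
Qed.

Lemma F_lt_w x y : F x -> F y -> x < y -> x + w <= y.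
Proof.
  intros Hx Hy P. destruct (F_mult x Hx) as [n ->]. destruct (F_mult y Hy) as [m ->].
  pose proof (w_pos (E:=E) (M:=M)).
  assert (n < m)%Z by (apply lt_IZR; nra). assert (IZR n + 1 <= IZR m) by (rewrite <- plus_IZR; apply IZR_le; lia). nra.
Qed.

Lemma F_Om : F Om.
Proof.
  pose proof Om_ge; pose proof (bp_pos eM); pose proof em_lt_eM.
  rewrite Om_mult. apply F_intro; [lia|lia|]. rewrite <- Om_mult, Rabs_pos_eq; lra.
Qed.

End Spacing.

(** * Rounding *)

Section Rounding.
Context {E M : nat} {fp : FP E M}.
Variable rd : R -> R.
Hypothesis Hr : rspec (E:=E) (M:=M) rd.
Local Set Default Proof Using "fp Hr".

Local Notation F := (isF E M).
Local Notation w := (omega E M).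
Local Notation Om := (Omega E M).

Lemma rd_F x : F (rd x). Proof. apply (rs_F _ Hr). Qed.

Lemma rd_near x z : F z -> Rabs (x - rd x) <= Rabs (x - z).
Proof. apply (rs_near _ Hr). Qed.

Lemma rd_id x : F x -> rd x = x.
Proof.
  intros H; pose proof (rd_near x x H) as N. replace (x - x) with 0 in N by ring. rewrite Rabs_R0 in N.
  apply Rabs_le_inv in N; lra.
Qed.

(** Adding the squares of the two nearness inequalities gives (y - x)(rd y - rd x) >= 0. *)
Lemma rd_le x y : x <= y -> rd x <= rd y.
Proof.
  intros H; destruct (Req_dec x y) as [->|N]; [lra|].
  pose proof (rd_near x (rd y) (rd_F y)) as A. pose proof (rd_near y (rd x) (rd_F x)) as B.
  apply Rsqr_le_abs_1 in A, B. unfold Rsqr in A, B.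
  apply Rnot_lt_le; intros C. nra.
Qed.

Lemma rd_ub x z : F z -> x <= z -> rd x <= z.
Proof. intros H L; rewrite <- (rd_id z H); apply rd_le; trivial. Qed.
Lemma rd_lb x z : F z -> z <= x -> z <= rd x.
Proof. intros H L; rewrite <- (rd_id z H); apply rd_le; trivial. Qed.

Lemma rd_0 : rd 0 = 0. Proof. apply rd_id, F_0. Qed.

(** The float x is itself a candidate at distance |T|. In effect, adding T moves x by at most 2|T|,
    whatever the spacing. *)
Lemma rd_add_err x T : F x -> Rabs (rd (x + T) - (x + T)) <= Rabs T.
Proof.
  intros H. rewrite Rabs_minus_sym. eapply Rle_trans; [apply (rd_near _ x H)|].
  right; f_equal; ring.
Qed.

Lemma rd_absorb_up y g T : F y -> (forall z, F z -> y < z -> y + g <= z) -> 0 <= T < g / 2 -> rd (y + T) = y.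
Proof.
  intros Hy G HT. pose proof (rd_lb (y + T) y Hy ltac:(lra)) as L.
  destruct (Req_dec (rd (y + T)) y) as [|N]; trivial; exfalso.
  pose proof (G _ (rd_F (y + T)) ltac:(lra)).
  pose proof (rd_near (y + T) y Hy) as A. rewrite Rabs_left1, Rabs_pos_eq in A; lra.
Qed.

Lemma rd_absorb_dn y g T : F y -> (forall z, F z -> z < y -> z <= y - g) -> - (g / 2) < T <= 0 -> rd (y + T) = y.
Proof.
  intros Hy G HT. pose proof (rd_ub (y + T) y Hy ltac:(lra)) as L.
  destruct (Req_dec (rd (y + T)) y) as [|N]; trivial; exfalso.
  pose proof (G _ (rd_F (y + T)) ltac:(lra)).
  pose proof (rd_near (y + T) y Hy) as A. rewrite Rabs_pos_eq, Rabs_left1 in A; lra.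
Qed.

(** Every T in (g/2, g] acts as the exact spacing g. This tolerance by a factor two is what makes
    arbitrary amplitudes of the constant usable. *)
Lemma rd_step_up y g T : F y -> F (y + g) -> (forall z, F z -> y < z -> y + g <= z) -> g / 2 < T <= g -> rd (y + T) = y + g.
Proof.
  intros Hy Hg G HT. pose proof (rd_ub (y + T) _ Hg ltac:(lra)) as L.
  destruct (Rle_dec (rd (y + T)) y) as [N|N].
  - exfalso. pose proof (rd_near (y + T) _ Hg) as A. rewrite Rabs_pos_eq, Rabs_left1 in A; lra.
  - pose proof (G _ (rd_F (y + T)) ltac:(lra)); lra.
Qed.

Lemma rd_step_dn y g T : F y -> F (y - g) -> (forall z, F z -> z < y -> z <= y - g) -> - g <= T < - (g / 2) -> rd (y + T) = y - g.
Proof.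
  intros Hy Hg G HT. pose proof (rd_lb (y + T) _ Hg ltac:(lra)) as L.
  destruct (Rle_dec y (rd (y + T))) as [N|N].
  - exfalso. pose proof (rd_near (y + T) _ Hg) as A. rewrite Rabs_left1, Rabs_pos_eq in A; lra.
  - pose proof (G _ (rd_F (y + T)) ltac:(lra)); lra.
Qed.

Lemma rd_w y : exists n, rd y = IZR n * w.
Proof. apply F_mult, rd_F. Qed.

(** Outside the least exponent the spacing is at most |y|/8, because M >= 3 gives significands of at
    least 8. *)
Lemma rd_err y : Rabs y <= Om -> Rabs (rd y - y) <= w / 2 + Rabs y / 16.
Proof.
  intros HO. destruct (classic (F y)) as [FY|NF].
  { rewrite (rd_id y FY). replace (y - y) with 0 by ring. rewrite Rabs_R0.
    pose proof (Rabs_pos y); pose proof (w_pos (E:=E) (M:=M)); lra. }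
  destruct (bracket y HO NF) as (n & a & Ha & Hy & F1 & F2 & _ & _ & Hc).
  assert (A : Rabs (rd y - y) <= bp a / 2).
  { rewrite Rabs_minus_sym. pose proof (rd_near y _ F1) as N1. pose proof (rd_near y _ F2) as N2.
    rewrite (Rabs_pos_eq (y - IZR n * bp a)) in N1 by lra.
    rewrite (Rabs_left1 (y - (IZR n + 1) * bp a)) in N2 by lra. lra. }
  eapply Rle_trans; [apply A|]. pose proof (Rabs_pos y).
  destruct Hc as [->|Hc]; [rewrite <- w_bp; lra|].
  assert (8 * bp a <= Rabs y); [|pose proof (w_pos (E:=E) (M:=M)); lra].
  pose proof (bp_pos a). pose proof pow_M_8.
  destruct Hc as [Hc|Hc].
  - assert (8 <= IZR n) by (apply IZR_le; lia). rewrite Rabs_pos_eq; nra.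
  - assert (IZR n + 1 <= -8) by (rewrite <- plus_IZR; apply IZR_le; lia). rewrite Rabs_left1; nra.
Qed.

End Rounding.

Lemma eps_bp M : eps M = bp (- Z.of_nat M - 1).
Proof. reflexivity. Qed.

(** * Weights that turn the constant into one float spacing *)

Section UnitWeights.
Context {E M : nat} {fp : FP E M}.
Variable rd : R -> R.
Hypothesis Hr : rspec (E:=E) (M:=M) rd.
Variable z : R.
Hypothesis Hz : isF E M z /\ eps M / 2 + 2 * eps M ^ 2 <= z <= 5 / 4 - 2 * eps M.
Local Set Default Proof Using "fp Hr Hz".

Local Notation Mz := (Z.of_nat M).
Local Notation pow_M_pos := (pow2_pos M).
Local Notation pow_M1 := (pow2_S M).
Local Notation em := (emin E).
Local Notation eM := (emax E).
Local Notation F := (isF E M).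
Local Notation w := (omega E M).
Local Notation Om := (Omega E M).
Local Notation wpos := (w_pos (E:=E) (M:=M)).

Lemma z_bounds : 0 < z < 5 / 4.
Proof.
  destruct Hz as [_ H]. pose proof (bp_pos (- Mz - 1)). rewrite eps_bp in H. nra.
Qed.

Lemma F_pos_next_le v : F v -> 0 < v < Om -> exists v', F v' /\ v < v' /\ v' <= 2 * v /\ (2 * w <= v -> v' <= 3 / 2 * v).
Proof.
  intros Hv H. destruct (next_up v Hv ltac:(lra)) as (n & a & Hn & Ha & Q & Hc & Fn & _).
  pose proof (bp_pos a) as Pa. exists (v + bp a).
  assert (1 <= n)%Z by (assert (0 < n)%Z; [apply lt_IZR; rewrite Q in H; nra|lia]).
  assert (1 <= IZR n) by (apply IZR_le; lia).
  repeat split; trivial; try lra; [rewrite Q; nra|].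
  intros L. assert (2 <= IZR n); [|rewrite Q; nra].
  destruct Hc as [->|Hc].
  - rewrite <- w_bp in Q. rewrite Q in L. pose proof wpos. apply Rmult_le_reg_r with w; lra.
  - pose proof (pow_M_8 (E:=E) (M:=M)). apply IZR_le; lia.
Qed.

(* w' is taken as the largest float with rd (z * w') <= 2^a *)
Lemma unit_weight a : (em - Mz <= a <= eM - Mz)%Z ->
  exists v, F v /\ 0 < v /\ bp a / 2 < rd (z * v) <= bp a.
Proof.
  intros Ha. pose proof z_bounds as Bz. pose proof wpos as Pw. set (g := bp a).
  assert (Fg : F g) by (apply F_bp; lia).
  assert (gw : w <= g) by (rewrite w_bp; apply bp_le; lia).
  set (P := fun n : Z => F (IZR n * w) /\ rd (z * (IZR n * w)) <= g).
  pose proof em_lt_eM as [Hem _].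
  assert (rdw : forall y, 3 / 4 * w <= y < 3 / 2 * w -> rd y = w).
  { intros y Hy.
    pose proof (rd_near rd Hr y w ltac:(rewrite w_bp; apply F_bp; lia)) as N.
    destruct (rd_w rd Hr y) as [n Hn]. rewrite Hn in *.
    assert (Rabs (y - w) < w / 2) by (apply Rabs_def1; lra).
    assert (B := Rle_lt_trans _ _ _ N H). apply Rabs_def2 in B.
    assert (0 < n)%Z by (apply lt_IZR; nra). assert (n < 2)%Z by (apply lt_IZR; nra).
    replace n with 1%Z by lia. ring. }
  assert (P1 : P 1%Z).
  { split; [apply F_w; pose proof (pow_M_8 (E:=E)); lia|]. rewrite Rmult_1_l.
    destruct (Rle_dec (3 / 4 * w) (z * w)); [rewrite rdw; nra|].
    eapply Rle_trans; [apply (rd_ub rd Hr _ w); [rewrite w_bp; apply F_bp; lia|nra]|trivial]. }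
  destruct (archimed (Om / w)) as [HB _]; set (B := up (Om / w)) in *.
  destruct (Zmax_ex P 1%Z B P1) as (n & [Fv Lv] & Max).
  { intros m [Fm _]. apply F_le_Om, Rabs_le_inv in Fm. apply le_IZR.
    apply Rmult_le_reg_r with w; trivial. assert (Om = Om / w * w) by (field; lra). nra. }
  set (v := IZR n * w) in *.
  assert (n1 : (1 <= n)%Z) by (apply Max; trivial).
  assert (n1' : 1 <= IZR n) by (apply IZR_le; lia).
  assert (vw : w <= v) by (unfold v; nra).
  assert (Ov : v <= Om) by (apply F_le_Om, Rabs_le_inv in Fv; lra).
  exists v; repeat split; trivial; try lra.
  destruct (Rle_lt_or_eq_dec _ _ Ov) as [Lo|Lo].
  2:{
    (* Here v = Om and no larger weight exists. The lower bound on z is made for this case: with e =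
       eps M, z Om is at least 2^eM e (1 + 3e - 4e^2), hence at least the float f = 2^eM e (1 + 2e),
       which exceeds half of the top spacing 2e 2^eM. *)
    destruct Hz as [_ [Hz1 _]]. rewrite eps_bp in Hz1. set (e := bp (- Mz - 1)) in *.
    assert (e0 : 0 < e) by apply bp_pos.
    assert (e1 : e <= / 16).
    { replace (/ 16) with (bp (-4)) by (unfold bp; simpl; field).
      apply bp_le; pose proof M_ge; lia. }
    assert (Q1 : bp (eM - Mz) = 2 * e * bp eM).
    { unfold e. rewrite <- bp_S, <- bp_add. f_equal; lia. }
    assert (Q2 : Om = bp eM * (2 - 2 * e)) by (rewrite Om_bp, bp_S, Q1; ring).
    pose proof (bp_pos eM) as PM.
    assert (gM : g <= 2 * e * bp eM) by (rewrite <- Q1; apply bp_le; lia).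
    set (f := IZR (2 ^ Mz + 1) * bp (eM - Mz - 1 - Mz)).
    assert (Ff : F f).
    { apply F_small; pose proof (emin_emax (E:=E)); pose proof emax_ge; pose proof M_le; pose proof pow_M_pos; rewrite ?pow_M1; lia. }
    assert (Qf : f = bp eM * e * (1 + 2 * e)).
    { unfold f. rewrite plus_IZR, Rmult_plus_distr_r, bp_mul_IZR by lia.
      replace (Mz + (eM - Mz - 1 - Mz))%Z with (eM + (- Mz - 1))%Z by lia.
      replace (eM - Mz - 1 - Mz)%Z with (eM + (- Mz - 1) + (- Mz - 1) + 1)%Z by lia.
      rewrite bp_S, !bp_add. fold e. ring. }
    apply Rlt_le_trans with f; [rewrite Qf; nra|].
    apply (rd_lb rd Hr); trivial. rewrite Lo, Qf, Q2.
    apply Rle_trans with ((e / 2 + 2 * e ^ 2) * (bp eM * (2 - 2 * e))); [|nra].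
    replace ((e / 2 + 2 * e ^ 2) * (bp eM * (2 - 2 * e))) with (bp eM * e * (1 + 3 * e - 4 * e * e)) by field.
    apply Rmult_le_compat_l; nra. }
  destruct (F_pos_next_le v Fv ltac:(lra)) as (v' & Fv' & L1 & L2 & L3).
  destruct (F_mult v' Fv') as [n' Hn'].
  assert (Gv : g < rd (z * v')).
  { apply Rnot_le_lt; intros C. assert (n' <= n)%Z by (apply Max; split; rewrite <- Hn'; trivial).
    apply IZR_le in H. unfold v in L1. nra. }
  assert (zv' : g < z * v').
  { apply Rnot_le_lt; intros C; apply (rd_ub rd Hr _ g Fg) in C; lra. }
  (* The next weight v' overshoots g and is at most 2v, or 3/2 v once v >= 2w, so z v is not far
     below g. The spacings w and 2w are treated apart because 3/4 g is not a float there. *)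
  destruct (Z.eq_dec a (em - Mz)) as [A0|A0].
  {
    assert (g = w) by (unfold g; rewrite A0; reflexivity).
    assert (3 / 2 * w <= z * v').
    { apply Rnot_lt_le; intros C. rewrite (rdw (z * v')) in Gv; lra. }
    assert (3 / 4 * w <= z * v) by nra.
    destruct (Rlt_dec (z * v) (3 / 2 * w)); [rewrite rdw; lra|].
    assert (w <= rd (z * v)); [|lra].
    apply (rd_lb rd Hr); [rewrite w_bp; apply F_bp; lia|lra]. }
  assert (g2 : 2 * w <= g).
  { rewrite w_bp, <- bp_S; apply bp_le; lia. }
  assert (F2w : F (2 * w)) by (apply (F_w 2); pose proof (pow_M_8 (E:=E) (M:=M)); rewrite pow_M1; lia).
  assert (n2 : 2 * w <= v).
  { destruct (Z.eq_dec n 1) as [->|D].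
    (* v = w cannot be maximal: z < 5/4 gives z v' < 5/2 w, which rounds to at most 2w. This is the
       source of the upper amplitude bound. *)
    - exfalso. unfold v in *. rewrite Rmult_1_l in *.
      assert (z * v' < 5 / 2 * w) by nra.
      assert (rd (z * v') <= 2 * w); [|lra].
      apply Rnot_lt_le; intros C. destruct (rd_w rd Hr (z * v')) as [k Hk]. rewrite Hk in C.
      assert (2 < k)%Z by (apply lt_IZR; nra). assert (3 <= IZR k) by (apply IZR_le; lia).
      pose proof (rd_near rd Hr (z * v') (2 * w) F2w) as N. rewrite Hk in N.
      rewrite Rabs_left1, (Rabs_pos_eq (z * v' - 2 * w)) in N; nra.
    - assert (2 <= IZR n) by (apply IZR_le; lia). unfold v; nra. }
  specialize (L3 n2).
  destruct (Z.eq_dec a (em - Mz + 1)) as [A1|A1].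
  {
    assert (G : g = 2 * w) by (unfold g; rewrite A1, bp_S, <- w_bp; ring).
    assert (5 / 2 * w <= z * v').
    { apply Rnot_lt_le; intros C.
      destruct (rd_w rd Hr (z * v')) as [k Hk]. rewrite Hk in Gv.
      assert (2 < k)%Z by (apply lt_IZR; nra). assert (3 <= IZR k) by (apply IZR_le; lia).
      pose proof (rd_near rd Hr (z * v') (2 * w) F2w) as N. rewrite Hk in N.
      rewrite Rabs_left1, (Rabs_pos_eq (z * v' - 2 * w)) in N; nra. }
    assert (5 / 3 * w <= z * v) by nra.
    apply Rnot_le_lt; intros C. rewrite G in C.
    assert (z * v < 2 * w).
    { apply Rnot_le_lt; intros D. apply (rd_lb rd Hr _ _ F2w) in D. lra. }
    pose proof (rd_near rd Hr (z * v) (2 * w) F2w) as N.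
    rewrite Rabs_pos_eq, Rabs_left1 in N; lra. }
  (* 3/4 g is a float, and z v > 2/3 g is nearer to it than to any float up to g/2. *)
  assert (F34 : F (3 * bp (a - 2))).
  { apply (F_small 3); [pose proof (pow_M_8 (E:=E) (M:=M)); rewrite pow_M1; lia|lia]. }
  assert (Q34 : g = 4 * bp (a - 2)).
  { unfold g. replace a with (a - 2 + 1 + 1)%Z at 1 by lia. rewrite !bp_S; ring. }
  assert (2 / 3 * g < z * v) by nra.
  apply Rnot_le_lt; intros C.
  assert (z * v < 3 * bp (a - 2)).
  { apply Rnot_le_lt; intros D. apply (rd_lb rd Hr _ _ F34) in D. lra. }
  pose proof (rd_near rd Hr (z * v) _ F34) as N.
  rewrite Rabs_pos_eq, Rabs_left1 in N; lra.
Qed.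

End UnitWeights.

(** * Sums of constant increments *)

Section Runs.
Variables (E M : nat) (rd : R -> R) (z : R).

(* below this bound [rnd] does not overflow *)
Definition in_range (x : R) : Prop := Rabs x < Omega E M + rnd_c E M.

Definition good (v : R) : Prop := isF E M v /\ in_range (z * v).

Definition run (x : R) (ws : list R) : R := fold_left (fun acc v => rd (acc + rd (z * v))) ws x.

Fixpoint safe (x : R) (ws : list R) : Prop :=
  match ws with
  | [] => True
  | v :: ws' => in_range (x + rd (z * v)) /\ safe (rd (x + rd (z * v))) ws'
  end.

Lemma run_app x ws ws' : run x (ws ++ ws') = run (run x ws) ws'.
Proof. apply fold_left_app. Qed.

Lemma safe_app x ws ws' : safe x (ws ++ ws') <-> safe x ws /\ safe (run x ws) ws'.
Proof.
  revert x; induction ws as [|v ws IH]; intros x; simpl; [tauto|].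
  rewrite IH; tauto.
Qed.

(* The same increments take x to x' and y to y'. *)
Definition reach (x y x' y' : R) : Prop := exists ws, Forall good ws /\
  safe x ws /\ safe y ws /\ run x ws = x' /\ run y ws = y'.

Lemma reach_refl x y : reach x y x y.
Proof. exists []; simpl; repeat split; auto. Qed.

Lemma reach_trans x y x1 y1 x2 y2 : reach x y x1 y1 -> reach x1 y1 x2 y2 -> reach x y x2 y2.
Proof.
  intros (ws & G & S1 & S2 & R1 & R2) (ws' & G' & S1' & S2' & R1' & R2').
  exists (ws ++ ws'). rewrite !run_app, !safe_app, R1, R2. repeat split; trivial.
  apply Forall_app; auto.
Qed.

Lemma reach_step x y v : good v -> in_range (x + rd (z * v)) -> in_range (y + rd (z * v)) ->
  reach x y (rd (x + rd (z * v))) (rd (y + rd (z * v))).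
Proof. intros G A B; exists [v]; simpl; repeat split; auto. Qed.

Lemma run_mono (H : forall x y, x <= y -> rd x <= rd y) ws x y : x <= y -> run x ws <= run y ws.
Proof.
  revert x y; induction ws as [|v ws IH]; intros x y L; simpl; trivial.
  apply IH, H; lra.
Qed.

End Runs.

Lemma inr_opp E M x : in_range E M x -> in_range E M (- x).
Proof. unfold in_range; rewrite Rabs_Ropp; trivial. Qed.

(** Conjugating the rounding by negation matches negating all weights. Results for positive targets,
    applied to the conjugate rounding, then give the mirrored results. *)
Lemma run_opp rd z ws x : run (fun t => - rd (- t)) z (- x) ws = - run rd z x (map Ropp ws).
Proof.
  revert x; induction ws as [|v ws IH]; intros x; simpl; trivial.
  rewrite <- IH. f_equal. f_equal. f_equal. replace (z * - v) with (- (z * v)) by ring. ring.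
Qed.

Lemma safe_opp E M rd z ws x : safe E M (fun t => - rd (- t)) z (- x) ws -> safe E M rd z x (map Ropp ws).
Proof.
  revert x; induction ws as [|v ws IH]; intros x; simpl; trivial.
  replace (z * - v) with (- (z * v)) by ring.
  replace (- x + - rd (- (z * v))) with (- (x + rd (- (z * v)))) by ring.
  intros [H1 H2]; split.
  - apply inr_opp in H1. rewrite Ropp_involutive in H1; trivial.
  - apply IH. rewrite Ropp_involutive in H2; trivial.
Qed.

Lemma good_opp E M {fp : FP E M} z ws : Forall (good E M z) ws -> Forall (good E M z) (map Ropp ws).
Proof.
  intros G. apply Forall_map. eapply Forall_impl; [|apply G]. intros v [F1 F2]; split.
  - apply F_opp; trivial.
  - replace (z * - v) with (- (z * v)) by ring. apply inr_opp; trivial.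
Qed.

Lemma reach_opp E M {fp : FP E M} rd z x y x' y' :
  reach E M (fun t => - rd (- t)) z (- x) (- y) (- x') (- y') -> reach E M rd z x y x' y'.
Proof.
  intros (ws & G & S1 & S2 & R1 & R2). rewrite run_opp in R1, R2.
  exists (map Ropp ws). repeat split; try lra; [apply good_opp|apply safe_opp|apply safe_opp]; trivial.
Qed.

Lemma rnd_c_pos E M : 0 < rnd_c E M.
Proof. unfold rnd_c. apply Rmult_lt_0_compat; apply bp_pos. Qed.

Lemma inr_le E M x : Rabs x <= Omega E M -> in_range E M x.
Proof. intros H; unfold in_range; pose proof (rnd_c_pos E M); lra. Qed.

Section UnitGood.
Context {E M : nat} {fp : FP E M}.
Variable rd : R -> R.
Hypothesis Hr : rspec (E:=E) (M:=M) rd.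
Variable z : R.
Hypothesis Hz : isF E M z /\ eps M / 2 + 2 * eps M ^ 2 <= z <= 5 / 4 - 2 * eps M.
Local Set Default Proof Using "fp Hr Hz".

Local Notation Mz := (Z.of_nat M).
Local Notation em := (emin E).
Local Notation eM := (emax E).
Local Notation Om := (Omega E M).
Local Notation good := (good E M z).

(** [rspec] does not see overflow; but a product z v beyond [Om] would be rounded to [Om], far above
    2^a. *)
Lemma unit_good a : (em - Mz <= a <= eM - Mz)%Z ->
  exists v, good v /\ bp a / 2 < rd (z * v) <= bp a.
Proof.
  intros Ha. destruct (unit_weight rd Hr z Hz a Ha) as (v & Fv & v0 & H).
  exists v; repeat split; trivial; try lra. apply inr_le.
  pose proof (z_bounds rd Hr z Hz). rewrite Rabs_pos_eq by nra.
  apply Rnot_lt_le; intros C.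
  pose proof (rd_lb rd Hr (z * v) Om F_Om ltac:(lra)).
  assert (bp a < Om); [|lra]. eapply Rlt_le_trans; [|apply Om_ge].
  apply bp_lt. pose proof M_ge. lia.
Qed.

End UnitGood.

(** * Ladders and threshold chains of increments *)

Section Chains.
Context {E M : nat} {fp : FP E M}.
Variable rd : R -> R.
Hypothesis Hr : rspec (E:=E) (M:=M) rd.
Variable z : R.
Hypothesis Hz : isF E M z /\ eps M / 2 + 2 * eps M ^ 2 <= z <= 5 / 4 - 2 * eps M.
Local Set Default Proof Using "fp Hr Hz".

Local Notation Mz := (Z.of_nat M).
Local Notation em := (emin E).
Local Notation eM := (emax E).
Local Notation F := (isF E M).
Local Notation w := (omega E M).
Local Notation Om := (Omega E M).
Local Notation wpos := (w_pos (E:=E) (M:=M)).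
Local Notation inr := (in_range E M).
Local Notation good := (good E M z).
Local Notation run := (run rd z).
Local Notation safe := (safe E M rd z).
Local Notation reach := (reach E M rd z).

Lemma unit_good_neg a : (em - Mz <= a <= eM - Mz)%Z ->
  exists v, good v /\ - bp a <= rd (z * v) < - (bp a / 2).
Proof.
  intros Ha. destruct (unit_good _ (rspec_opp _ Hr) z Hz a Ha) as (v & [Fv Ov] & H).
  exists (- v). split; [split; [apply F_opp; trivial|]|].
  - replace (z * - v) with (- (z * v)) by ring. apply inr_opp; trivial.
  - replace (z * - v) with (- (z * v)) by ring. lra.
Qed.

Lemma F_le_bp_gap y a n c : F y -> y = IZR n * bp a -> (a = (em - Mz)%Z \/ (2 ^ Mz <= n)%Z) ->
  (em - Mz <= c)%Z -> y < bp (Mz + 1 + c) -> bp a <= bp c.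
Proof.
  intros Fy Q Hc Ec L. apply bp_le. destruct Hc as [->|Hc]; [lia|].
  assert (Mz + a < Mz + 1 + c)%Z; [|lia]. apply bp_lt_inv.
  rewrite <- bp_mul_IZR by lia. eapply Rle_lt_trans; [|apply L]. rewrite Q.
  apply Rmult_le_compat_r; [left; apply bp_pos|apply IZR_le; lia].
Qed.

(* x climbs to x' one float at a time while y absorbs the increments *)
Lemma ladder_up y c x x' : F y -> (em - Mz <= c <= eM - Mz)%Z ->
  (forall T, 0 <= T <= bp c -> rd (y + T) = y /\ inr (y + T)) ->
  F x -> F x' -> 0 <= x <= x' -> x' <= bp (Mz + 1 + c) -> reach x y x' y.
Proof.
  intros Fy Hc Ab Fx Fx' Hx Lx.
  destruct (F_mult x Fx) as [n Hn]. destruct (F_mult x' Fx') as [n' Hn']. pose proof wpos as Pw.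
  assert (G : forall k n, (n' - n)%Z = Z.of_nat k -> F (IZR n * w) -> 0 <= IZR n * w -> reach (IZR n * w) y x' y).
  { clear x Fx Hx n Hn. intros k; induction k as [k IH] using lt_wf_ind. intros n Hk Fn Pn.
    destruct (Z.eq_dec n n') as [->|D]; [rewrite <- Hn'; apply reach_refl|].
    assert (Ln : IZR n + 1 <= IZR n') by (rewrite <- plus_IZR; apply IZR_le; lia).
    assert (Lo : x' <= Om) by (apply F_le_Om, Rabs_le_inv in Fx'; lra).
    destruct (next_up (IZR n * w) Fn ltac:(nra)) as (m & a & Hm & Ha & Q & Hca & Fnx & Gap).
    destruct (unit_good rd Hr z Hz a Ha) as (v & Gv & Hv).
    assert (Ba : bp a <= bp c) by (apply (F_le_bp_gap (IZR n * w) a m); trivial; try lia; nra).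
    assert (Nx : IZR n * w + bp a <= x') by (apply Gap; trivial; nra).
    pose proof (bp_pos a) as Pa. destruct (Ab (rd (z * v)) ltac:(lra)) as [Ab1 Ab2].
    assert (St : rd (IZR n * w + rd (z * v)) = IZR n * w + bp a) by (apply (rd_step_up rd Hr); trivial).
    assert (R1 : reach (IZR n * w) y (IZR n * w + bp a) y).
    { rewrite <- St. rewrite <- Ab1 at 2. apply reach_step; trivial.
      apply inr_le. rewrite Rabs_pos_eq; lra. }
    eapply reach_trans; [apply R1|].
    destruct (F_mult _ Fnx) as [n2 Hn2]. rewrite Hn2 in *.
    assert (n < n2)%Z by (apply lt_IZR; nra). assert (n2 <= n')%Z by (apply le_IZR; nra).
    apply (IH (Z.to_nat (n' - n2))); try lia; trivial. nra. }
  rewrite Hn in *. apply (G (Z.to_nat (n' - n)) n); trivial; try lra.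
  assert (n <= n')%Z by (apply le_IZR; nra). lia.
Qed.

(** The sign of the weights is recorded because [drives_split] applies them to an input with two
    values, where the direction of motion depends on it. *)
Lemma climb_ex x : F x -> 0 <= x ->
  exists ws, Forall (fun v => good v /\ 0 <= v) ws /\ safe 0 ws /\ run 0 ws = x.
Proof.
  intros Fx Hx. destruct (F_mult x Fx) as [n' Hn']. pose proof wpos as Pw.
  assert (G : forall k n, (n' - n)%Z = Z.of_nat k -> F (IZR n * w) -> 0 <= IZR n * w ->
    exists ws, Forall (fun v => good v /\ 0 <= v) ws /\ safe (IZR n * w) ws /\ run (IZR n * w) ws = x).
  { intros k; induction k as [k IH] using lt_wf_ind. intros n Hk Fn Pn.
    destruct (Z.eq_dec n n') as [->|D]; [rewrite <- Hn'; exists []; simpl; auto|].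
    assert (Ln : IZR n + 1 <= IZR n') by (rewrite <- plus_IZR; apply IZR_le; lia).
    assert (Lo : x <= Om) by (apply F_le_Om, Rabs_le_inv in Fx; lra).
    destruct (next_up (IZR n * w) Fn ltac:(nra)) as (m & a & Hm & Ha & Q & Hca & Fnx & Gap).
    destruct (unit_good rd Hr z Hz a Ha) as (v & Gv & Hv).
    assert (Nx : IZR n * w + bp a <= x) by (apply Gap; trivial; nra).
    pose proof (bp_pos a) as Pa.
    assert (St : rd (IZR n * w + rd (z * v)) = IZR n * w + bp a) by (apply (rd_step_up rd Hr); trivial).
    assert (v0 : 0 <= v).
    { apply Rnot_lt_le; intros C. pose proof (z_bounds rd Hr z Hz).
      pose proof (rd_ub rd Hr (z * v) 0 F_0 ltac:(nra)). lra. }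
    destruct (F_mult _ Fnx) as [n2 Hn2].
    assert (n < n2)%Z by (apply lt_IZR; nra). assert (n2 <= n')%Z by (apply le_IZR; nra).
    destruct (IH (Z.to_nat (n' - n2)) ltac:(lia) n2 ltac:(lia)) as (ws & W1 & W2 & W3); [rewrite <- Hn2; trivial|lra|].
    exists (v :: ws). simpl. rewrite St, Hn2. repeat split; trivial; [constructor; auto|].
    apply inr_le; rewrite Rabs_pos_eq; lra. }
  assert (0 <= n')%Z by (apply le_IZR; nra).
  specialize (G (Z.to_nat n') 0%Z ltac:(lia)). rewrite Rmult_0_l in G. apply G; [apply F_0|lra].
Qed.

Lemma climb x : F x -> 0 <= x -> reach 0 0 x x.
Proof.
  intros Fx Hx. destruct (climb_ex x Fx Hx) as (ws & W1 & W2 & W3). exists ws. repeat split; trivial.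
  eapply Forall_impl; [|apply W1]. simpl; tauto.
Qed.

(** Sterbenz's lemma: the difference is a multiple of the finer of the two units and its modulus is
    at most each operand, so its significand fits. *)
Lemma sterbenz x y : F x -> F y -> y / 2 <= x <= 2 * y -> F (x - y).
Proof.
  intros Fx Fy H.
  destruct (F_canon x Fx) as (n & a & Hn & Ha & Qx & _).
  destruct (F_canon y Fy) as (m & b & Hm & Hb & Qy & _).
  pose proof (F_le_Om y Fy) as Oy. rewrite Rabs_pos_eq in Oy by lra.
  assert (B : Rabs (x - y) <= x /\ Rabs (x - y) <= y) by (split; apply Rabs_le; lra).
  pose proof (bp_pos a); pose proof (bp_pos b).
  destruct (Z_le_gt_dec a b) as [L|L].
  - rewrite (F_rescale m b a L) in Qy.
    replace (x - y) with (IZR (n - m * 2 ^ (b - a)) * bp a) in * by (rewrite minus_IZR, Qx, Qy; ring).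
    apply F_intro; try lia; [|lra].
    destruct B as [B _]. rewrite Rabs_mult, <- abs_IZR, (Rabs_pos_eq (bp a)), Qx in B by lra.
    apply Rmult_le_reg_r in B; trivial. apply le_IZR in B. lia.
  - rewrite (F_rescale n a b ltac:(lia)) in Qx.
    replace (x - y) with (IZR (n * 2 ^ (a - b) - m) * bp b) in * by (rewrite minus_IZR, Qx, Qy; ring).
    apply F_intro; try lia; [|lra].
    destruct B as [_ B]. rewrite Rabs_mult, <- abs_IZR, (Rabs_pos_eq (bp b)), Qy in B by lra.
    apply Rmult_le_reg_r in B; trivial. apply le_IZR in B. lia.
Qed.

Lemma run_F x ws : F x -> F (run x ws).
Proof.
  revert x; induction ws as [|v ws IH]; intros x Hx; simpl; trivial. apply IH, rd_F; trivial.
Qed.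

(* A chain with target v sends 0 to v and every positive float strictly above v,
   while moving any float x by only a bounded multiple of v. *)
Record chain (v : R) (ws : list R) : Prop := {
  ch_good : Forall good ws;
  ch_safe : forall x, F x -> Rabs x <= bp (eM - 1) -> safe x ws;
  ch_0 : run 0 ws = v;
  ch_pos : forall x, F x -> w <= x -> v < run x ws;
  ch_bnd : forall x, F x -> x <= run x ws <= x + 16 / 7 * v;
  ch_tight : forall x Z, F x -> 0 <= x -> (x <= 11 / 14 * v \/ x + v <= bp (em + 1)) ->
    F Z -> x + 25 / 14 * v <= Z -> run x ws <= Z }.

Lemma w_good : exists v, good v /\ rd (z * v) = w.
Proof.
  pose proof em_lt_eM as [He _].
  destruct (unit_good rd Hr z Hz (em - Mz) ltac:(lia)) as (v & Gv & Hv). exists v; split; trivial.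
  rewrite <- w_bp in Hv. destruct (rd_w rd Hr (z * v)) as [n Hn]. rewrite Hn in *. pose proof wpos.
  assert (0 < n)%Z by (apply lt_IZR; nra). assert (n < 2)%Z by (apply lt_IZR; nra).
  replace n with 1%Z by lia; ring.
Qed.

Lemma bp_em1 : bp (em + 1) = IZR (2 ^ (Mz + 1)) * w.
Proof. rewrite w_bp, bp_mul_IZR by lia. f_equal; lia. Qed.

Lemma bpeM_big : bp (em + 1) <= bp (eM - 6) /\ bp (eM - 1) = 32 * bp (eM - 6) /\ bp (eM - 1) + bp (eM - 1) <= Om.
Proof.
  pose proof (emin_emax (E:=E)); pose proof emax_ge. split; [apply bp_le; lia|]. split.
  - replace (eM - 1)%Z with (5 + (eM - 6))%Z by lia. rewrite bp_P. reflexivity.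
  - pose proof Om_ge. replace eM with (eM - 1 + 1)%Z in H1 at 1 by lia. rewrite bp_S in H1. lra.
Qed.

Lemma chain_base n : (0 <= n < 2 ^ (Mz + 1))%Z -> exists ws, chain (IZR n * w) ws.
Proof.
  intros Hn. destruct w_good as (u & Gu & Hu). pose proof wpos as Pw.
  set (k := Z.to_nat n). replace n with (Z.of_nat k) in * by lia. clearbody k. clear n.
  rewrite <- INR_IZR_INZ. destruct Hn as [_ Hk].
  assert (B : INR k + 1 <= IZR (2 ^ (Mz + 1))).
  { rewrite INR_IZR_INZ, <- plus_IZR. apply IZR_le; lia. }
  assert (St : forall x i, run x (repeat u (S i)) = rd (run x (repeat u i) + w)).
  { intros x i. replace (S i) with (i + 1)%nat by lia. rewrite repeat_app, run_app. simpl. rewrite Hu; reflexivity. }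
  assert (Fs : forall x i, F x -> F (run x (repeat u i))) by (intros; apply run_F; trivial).
  assert (A1 : forall x i, F x -> x <= run x (repeat u i) <= x + 2 * (INR i * w)).
  { intros x i Fx; induction i as [|i IH]; [simpl; lra|]. rewrite St, S_INR.
    pose proof (rd_add_err rd Hr _ w (Fs x i Fx)) as Er. rewrite (Rabs_pos_eq w) in Er by lra.
    apply Rabs_le_inv in Er. lra. }
  assert (A2 : forall j i, (j + Z.of_nat i <= 2 ^ (Mz + 1))%Z -> (0 <= j)%Z -> run (IZR j * w) (repeat u i) = IZR (j + Z.of_nat i) * w).
  { intros j i; induction i as [|i IH]; intros L Pj; [simpl; rewrite Z.add_0_r; reflexivity|].
    rewrite St, IH by lia. replace (IZR (j + Z.of_nat i) * w + w) with (IZR (j + Z.of_nat (S i)) * w).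
    - apply (rd_id rd Hr), F_w; lia.
    - rewrite Nat2Z.inj_succ. unfold Z.succ. rewrite Z.add_assoc, (plus_IZR (j + Z.of_nat i)). ring. }
  (* Adding w is exact up to 2^(em+1) = 2^(M+1) w; past that point each increment moves the
     accumulator by at most 2w. *)
  assert (A3 : forall x i, F x -> 0 <= x -> run x (repeat u i) <= x + INR i * w \/
       run x (repeat u i) <= 2 * (x + INR i * w) - bp (em + 1)).
  { intros x i Fx Px; induction i as [|i IH]; [left; simpl; lra|]. rewrite St, S_INR.
    pose proof (rd_add_err rd Hr _ w (Fs x i Fx)) as Er. rewrite (Rabs_pos_eq w) in Er by lra.
    apply Rabs_le_inv in Er. destruct IH as [IH|IH]; [|right; lra].
    set (r := run x (repeat u i)) in *.
    destruct (Rle_dec (r + w) (bp (em + 1))) as [C|C].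
    - left. destruct (F_mult r ltac:(apply Fs; trivial)) as [m Hm].
      assert (rd (r + w) = r + w); [|lra]. apply (rd_id rd Hr).
      replace (r + w) with (IZR (m + 1) * w) by (rewrite Hm, plus_IZR; ring). apply F_w.
      assert (0 <= r) by (destruct (A1 x i Fx); unfold r in *; lra).
      rewrite bp_em1, Hm in C. assert (0 <= m)%Z by (apply le_IZR; nra).
      assert (m + 1 <= 2 ^ (Mz + 1))%Z by (apply le_IZR; rewrite plus_IZR; nra). lia.
    - right. destruct (F_mult r ltac:(apply Fs; trivial)) as [m Hm].
      assert (bp (em + 1) <= r); [|lra]. rewrite bp_em1, Hm in *.
      assert (2 ^ (Mz + 1) < m + 1)%Z by (apply lt_IZR; rewrite plus_IZR; nra).
      assert (IZR (2 ^ (Mz + 1)) <= IZR m) by (apply IZR_le; lia). nra. }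
  destruct bpeM_big as (Big1 & Big2 & Big3).
  assert (Kw : INR k * w < bp (em + 1)) by (rewrite bp_em1; nra).
  exists (repeat u k). split.
  - apply Forall_forall. intros v Hv. apply repeat_spec in Hv. subst; trivial.
  - intros x Fx Lx. apply Rabs_le_inv in Lx.
    assert (SF : forall i, (i <= k)%nat -> safe x (repeat u i)).
    { induction i as [|i IH]; [simpl; trivial|]. intros Li.
      replace (S i) with (i + 1)%nat by lia. rewrite repeat_app, safe_app. split; [apply IH; lia|].
      simpl; split; [|trivial]. rewrite Hu. apply inr_le.
      pose proof (A1 x i Fx). apply le_INR in Li. rewrite S_INR in Li. pose proof (pos_INR i).
      apply Rabs_le. nra. }
    apply SF; lia.
  - replace 0 with (IZR 0 * w) by ring. rewrite A2 by lia. rewrite INR_IZR_INZ; reflexivity.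
  - intros x Fx Lx. apply Rlt_le_trans with (run w (repeat u k)).
    + replace w with (IZR 1 * w) at 2 by ring. rewrite A2 by lia. rewrite plus_IZR, INR_IZR_INZ. nra.
    + apply run_mono; trivial. apply rd_le; trivial.
  - intros x Fx. pose proof (A1 x k Fx). pose proof (pos_INR k). nra.
  (* Since v < 2^(em+1), the assumption x <= 11/14 v turns 2(x + v) - 2^(em+1) into at most x +
     25/14 v. This is where 11/14 comes from. *)
  - intros x Z Fx Px Or FZ LZ. destruct (A3 x k Fx Px) as [C|C]; pose proof (pos_INR k); [nra|].
    destruct Or; nra.
Qed.

(** The target is split greedily: T = z 2^j is an exact product in (v/2, v], and a chain for the
    largest float lo that T does not carry beyond v is put in front. By maximality of lo, anything
    strictly above lo is carried strictly above v, so strictness propagates through the recursion.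
    The bound on v keeps 2^j within the floats, as z exceeds eps/2. *)
Lemma chain_ex v : F v -> 0 <= v <= bp (eM - Mz - 2) -> exists ws, chain v ws.
Proof.
  intros Fv Hv. destruct (F_mult v Fv) as [n Hn]. pose proof wpos as Pw.
  assert (G : forall k n, (n = Z.of_nat k) -> F (IZR n * w) -> IZR n * w <= bp (eM - Mz - 2) -> exists ws, chain (IZR n * w) ws).
  2:{ assert (0 <= n)%Z by (apply le_IZR; nra). rewrite Hn in *. apply (G (Z.to_nat n) n); trivial; try lia; lra. }
  clear v Fv Hv n Hn. intros k; induction k as [k IH] using lt_wf_ind. intros n Hk Fv Lv.
  destruct (Z_lt_le_dec n (2 ^ (Mz + 1))) as [C|C]; [apply chain_base; lia|].
  set (v := IZR n * w) in *.
  assert (v1 : bp (em + 1) <= v) by (rewrite bp_em1; unfold v; apply IZR_le in C; nra).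
  pose proof (z_bounds rd Hr z Hz) as zb. pose proof (bp_pos (em + 1)) as Pem.
  destruct (dyadic' (v / z)) as (j & Hj1 & Hj2).
  { apply Rdiv_lt_0_compat; lra. }
  rewrite bp_S in Hj2. set (T := z * bp j).
  assert (vz : v = v / z * z) by (field; lra).
  assert (T1 : T <= v) by (unfold T; nra). assert (T2 : v < 2 * T) by (unfold T; nra).
  assert (ez : bp (- Mz - 2) < z).
  { destruct Hz as [_ [H _]]. rewrite eps_bp in H. pose proof (bp_pos (- Mz - 1)).
    replace (bp (- Mz - 1)) with (2 * bp (- Mz - 2)) in * by (rewrite <- bp_S; f_equal; lia). nra. }
  assert (J1 : (em - 1 < j)%Z).
  { apply bp_lt_inv. replace (em + 1)%Z with (em - 1 + 1 + 1)%Z in v1 by lia. rewrite !bp_S in v1.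
    pose proof (bp_pos (em - 1)). unfold T in T2. nra. }
  assert (J2 : (j < eM)%Z).
  { apply bp_lt_inv. apply Rmult_lt_reg_l with (bp (- Mz - 2)); [apply bp_pos|].
    rewrite <- (bp_add _ eM). replace (- Mz - 2 + eM)%Z with (eM - Mz - 2)%Z by lia.
    apply Rlt_le_trans with T; [|lra]. unfold T. pose proof (bp_pos j). nra. }
  assert (Fj : F (bp j)) by (apply F_bp; lia).
  assert (LOm : bp (eM - Mz - 2) < Om).
  { eapply Rlt_le_trans; [|apply Om_ge]. apply bp_lt; lia. }
  assert (FT : F T).
  { destruct Hz as [Fz _]. destruct (F_canon z Fz) as (m & c & Hm & Hc & Qz & _).
    unfold T. rewrite Qz, Rmult_assoc, <- bp_add. apply F_intro; try lia.
    - assert (em < Mz + 1 + c + j)%Z; [|lia]. apply bp_lt_inv.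
      apply Rle_lt_trans with T; [rewrite bp_S in v1; lra|].
      unfold T. rewrite Qz, Rmult_assoc, <- bp_add.
      replace (Mz + 1 + c + j)%Z with (Mz + 1 + (c + j))%Z by lia. rewrite <- (bp_mul_IZR (Mz + 1) (c + j)) by lia.
      apply Rmult_lt_compat_r; [apply bp_pos|apply IZR_lt; lia].
    - rewrite bp_add, <- Rmult_assoc, <- Qz. fold T. rewrite Rabs_pos_eq; lra. }
  assert (Frd : rd (z * bp j) = T) by (apply (rd_id rd Hr); trivial).
  assert (Fd : F (v - T)) by (apply sterbenz; trivial; lra).
  destruct (F_mult _ Fd) as [d Hd].
  (* lo is the largest float that T takes to v *)
  destruct (archimed (Om / w)) as [HB _]; set (B := up (Om / w)) in *.
  destruct (Zmax_ex (fun m => F (IZR m * w) /\ rd (IZR m * w + T) <= v) d B) as (l & [Fl Ll] & Max).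
  { rewrite <- Hd; split; trivial. replace (v - T + T) with v by ring. rewrite (rd_id rd Hr v Fv); lra. }
  { intros m [Fm _]. apply F_le_Om, Rabs_le_inv in Fm. apply le_IZR.
    apply Rmult_le_reg_r with w; trivial. assert (Om = Om / w * w) by (field; lra). nra. }
  set (lo := IZR l * w) in *.
  assert (lo1 : v - T <= lo).
  { rewrite Hd. unfold lo. assert (d <= l)%Z.
    { apply Max. rewrite <- Hd. replace (v - T + T) with v by ring. rewrite (rd_id rd Hr v Fv). split; trivial; lra. }
    apply IZR_le in H. nra. }
  destruct (next_up v Fv ltac:(lra)) as (m & a & Hm & Ha & Q & Hca & Fnx & Gap).
  assert (ga : bp a <= v / 8).
  { pose proof (pow_M_8 (E:=E) (M:=M)). pose proof (bp_pos a).
    destruct Hca as [Hca|Hca].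
    - exfalso. rewrite Hca, <- w_bp in Q. unfold v in Q. apply Rmult_eq_reg_r in Q; [|lra]. apply eq_IZR in Q. lia.
    - assert (8 <= IZR m) by (apply IZR_le; lia). nra. }
  (* The spacing at v is at most v/8, so a sum beyond v + v/16 would round above v. *)
  assert (lo2 : lo + T <= 17 / 16 * v).
  { apply Rnot_lt_le; intros D.
    pose proof (rd_near rd Hr (lo + T) _ Fnx) as N.
    destruct (Rle_dec (v + bp a) (lo + T)) as [K|K].
    - apply (rd_lb rd Hr _ _ Fnx) in K. pose proof (bp_pos a). lra.
    - rewrite Rabs_pos_eq, Rabs_left1 in N; lra. }
  assert (lo3 : rd (lo + T) = v).
  { apply Rle_antisym; trivial. apply (rd_lb rd Hr); trivial; lra. }
  assert (lo0 : 0 <= lo) by lra.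
  assert (0 <= l)%Z by (apply le_IZR; unfold lo in lo0; nra).
  assert (l < n)%Z by (apply lt_IZR; unfold lo, v in *; nra).
  destruct (IH (Z.to_nat l) ltac:(lia) l ltac:(lia) Fl ltac:(unfold lo in *; lra)) as (ws & Ch).
  fold lo in Ch. destruct Ch as [c1 c2 c3 c4 c5 c6].
  assert (Run : forall x, run x (ws ++ [bp j]) = rd (run x ws + T)).
  { intros x; rewrite run_app; simpl. rewrite Frd; reflexivity. }
  destruct bpeM_big as (_ & Big2 & Big3). pose proof (bp_pos (eM - 6)).
  assert (v6 : v <= bp (eM - 5)) by (eapply Rle_trans; [apply Lv|apply bp_le; pose proof M_ge; lia]).
  replace (bp (eM - 5)) with (2 * bp (eM - 6)) in v6 by (rewrite <- bp_S; f_equal; lia).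
  assert (Err : forall x, F x -> run x ws <= rd (run x ws + T) <= run x ws + 2 * T).
  { intros x Fx. pose proof (rd_add_err rd Hr _ T (run_F x ws Fx)) as Er.
    rewrite (Rabs_pos_eq T) in Er by lra. apply Rabs_le_inv in Er. lra. }
  exists (ws ++ [bp j]). split.
  - apply Forall_app; split; trivial. constructor; [|constructor]. split; trivial.
    apply inr_le. fold T. rewrite Rabs_pos_eq; lra.
  - intros x Fx Lx. rewrite safe_app; split; [auto|]. simpl; split; trivial. rewrite Frd.
    apply inr_le. pose proof (c5 x Fx). apply Rabs_le_inv in Lx. apply Rabs_le. lra.
  - rewrite Run, c3; trivial.
  - intros x Fx Lx. rewrite Run. apply Rnot_le_lt; intros D.
    pose proof (c4 x Fx Lx) as L. destruct (F_mult _ (run_F x ws Fx)) as [r Hr']. rewrite Hr' in *.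
    assert (r <= l)%Z by (apply Max; split; trivial; rewrite <- Hr'; apply run_F; trivial).
    apply IZR_le in H2. unfold lo in L. nra.
  (* 16/7 solves the recursion: T > v/2 and lo + T <= 17/16 v give lo < 9/16 v, hence 16/7 lo + 2T =
     2(lo + T) + 2/7 lo <= 16/7 v. *)
  - intros x Fx. rewrite Run. pose proof (c5 x Fx). pose proof (Err x Fx). lra.
  (* Bounding by a float Z removes the last rounding error: 16/7 lo + T = (lo + T) + 9/7 lo <= 25/14
     v. *)
  - intros x Z Fx Px _ FZ LZ. rewrite Run. apply (rd_ub rd Hr); trivial. pose proof (c5 x Fx). lra.
Qed.

End Chains.

(** * Scaling by powers of two and the relative distance of floats *)

Section Scaling.
Context {E M : nat} {fp : FP E M}.
Variable rd : R -> R.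
Hypothesis Hr : rspec (E:=E) (M:=M) rd.
Local Set Default Proof Using "fp Hr".

Local Notation Mz := (Z.of_nat M).
Local Notation pow_M_pos := (pow2_pos M).
Local Notation pow_M1 := (pow2_S M).
Local Notation em := (emin E).
Local Notation F := (isF E M).
Local Notation w := (omega E M).
Local Notation Om := (Omega E M).
Local Notation wpos := (w_pos (E:=E) (M:=M)).

(* multiplying a float by a power of two is exact outside the subnormal range *)
Lemma scale_err u s k : F u -> s = 1 \/ s = -1 -> Rabs (u * bp k) <= Om ->
  Rabs (rd (u * (s * bp k)) - u * (s * bp k)) <= w / 2.
Proof.
  intros Fu Hs HO. pose proof wpos as Pw.
  assert (HO' : Rabs (u * (s * bp k)) <= Om).
  { destruct Hs as [-> | ->]; [rewrite Rmult_1_l; trivial|].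
    replace (u * (-1 * bp k)) with (- (u * bp k)) by ring. rewrite Rabs_Ropp; trivial. }
  destruct (F_canon u Fu) as (m & c & Hm & Hc & Q & _).
  assert (Q' : exists m', (Z.abs m' < 2 ^ (Mz + 1))%Z /\ u * (s * bp k) = IZR m' * bp (c + k)).
  { destruct Hs as [-> | ->].
    - exists m; split; trivial. rewrite Q, bp_add; ring.
    - exists (- m)%Z; split; [lia|]. rewrite Q, bp_add, opp_IZR; ring. }
  destruct Q' as (m' & Hm' & Q'). rewrite Q' in *.
  destruct (Z_le_gt_dec (em - Mz) (c + k)) as [L|L].
  - rewrite (rd_id rd Hr); [|apply F_intro; trivial; lia].
    rewrite Rminus_diag, Rabs_R0. lra.
  - set (x := IZR m' * bp (c + k)) in *.
    assert (Hx : Rabs x < IZR (2 ^ (Mz + 1)) * w).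
    { unfold x. rewrite Rabs_mult, <- abs_IZR, (Rabs_pos_eq (bp _)) by (left; apply bp_pos).
      apply Rlt_le_trans with (IZR (2 ^ (Mz + 1)) * bp (c + k)).
      - apply Rmult_lt_compat_r; [apply bp_pos|apply IZR_lt; trivial].
      - apply Rmult_le_compat_l; [apply IZR_le; pose proof pow_M_pos; rewrite pow_M1; lia|].
        rewrite w_bp; apply bp_le; lia. }
    apply Rabs_def2 in Hx. destruct (floor_mult x w Pw) as (n & Hn1 & Hn2).
    assert (n < 2 ^ (Mz + 1))%Z by (apply lt_IZR; nra).
    assert (- 2 ^ (Mz + 1) < n + 1)%Z by (apply lt_IZR; rewrite plus_IZR, opp_IZR; nra).
    pose proof (rd_near rd Hr x (IZR n * w) ltac:(apply F_w; lia)) as N1.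
    pose proof (rd_near rd Hr x (IZR (n + 1) * w) ltac:(apply F_w; lia)) as N2.
    rewrite plus_IZR in N2.
    rewrite (Rabs_pos_eq (x - IZR n * w)) in N1 by lra.
    rewrite (Rabs_left1 (x - (IZR n + 1) * w)) in N2 by lra.
    rewrite Rabs_minus_sym. lra.
Qed.

(** Either both floats are multiples of half the unit of a, or b is so much smaller that the
    difference is at least half of |a|. *)
Lemma F_diff_ge a b : F a -> F b -> a <> b -> Rabs a * bp (- Mz - 2) <= Rabs (b - a).
Proof.
  intros Fa Fb N.
  destruct (F_canon a Fa) as (m & c & Hm & Hc & Qa & Ha).
  destruct (F_canon b Fb) as (m' & c' & Hm' & Hc' & Qb & Hb).
  assert (La : Rabs a < bp (Mz + 1 + c)).
  { rewrite Qa, Rabs_mult, <- abs_IZR, (Rabs_pos_eq (bp _)) by (left; apply bp_pos).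
    rewrite <- bp_mul_IZR by lia. apply Rmult_lt_compat_r; [apply bp_pos|apply IZR_lt; trivial]. }
  pose proof (Rabs_pos a). pose proof (bp_pos (- Mz - 2)).
  destruct (Z_le_gt_dec (c - 1) c') as [L|L].
  - assert (Q : exists j, b - a = IZR j * bp (c - 1)).
    { exists (m' * 2 ^ (c' - (c - 1)) - m * 2 ^ (c - (c - 1)))%Z.
      rewrite Qa, Qb, (F_rescale m' c' (c - 1)), (F_rescale m c (c - 1)), minus_IZR by lia. ring. }
    destruct Q as [j Q]. apply Rle_trans with (bp (c - 1)).
    + replace (c - 1)%Z with (Mz + 1 + c + (- Mz - 2))%Z by lia. rewrite bp_add.
      apply Rmult_le_compat_r; lra.
    + rewrite Q, Rabs_mult, <- abs_IZR, (Rabs_pos_eq (bp _)) by (left; apply bp_pos).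
      assert (j <> 0)%Z.
      { intros ->. rewrite Rmult_0_l in Q. apply N; lra. }
      assert (1 <= IZR (Z.abs j)) by (apply IZR_le; lia). pose proof (bp_pos (c - 1)). nra.
  - assert (Lb : Rabs b < bp (Mz + 1 + c')).
    { rewrite Qb, Rabs_mult, <- abs_IZR, (Rabs_pos_eq (bp _)) by (left; apply bp_pos).
      rewrite <- bp_mul_IZR by lia. apply Rmult_lt_compat_r; [apply bp_pos|apply IZR_lt; trivial]. }
    destruct Ha as [Ha|Ha]; [lia|].
    assert (La' : bp (Mz + c) <= Rabs a).
    { rewrite Qa, Rabs_mult, <- abs_IZR, (Rabs_pos_eq (bp _)) by (left; apply bp_pos).
      rewrite <- bp_mul_IZR by lia. apply Rmult_le_compat_r; [left; apply bp_pos|apply IZR_le; trivial]. }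
    assert (bp (Mz + 1 + c') <= bp (Mz + c - 1)) by (apply bp_le; lia).
    replace (Mz + c)%Z with (Mz + c - 1 + 1)%Z in La' by lia. rewrite bp_S in La'.
    assert (bp (- Mz - 2) <= / 2).
    { replace (/ 2) with (bp (-1)) by (unfold bp; simpl; field). apply bp_le; lia. }
    pose proof (Rabs_triang_inv a b) as T. rewrite Rabs_minus_sym in T. nra.
Qed.

End Scaling.

(** * Contraction towards eta *)

Section Contract.
Context {E M : nat} {fp : FP E M}.
Variable rd : R -> R.
Hypothesis Hr : rspec (E:=E) (M:=M) rd.
Variable z : R.
Hypothesis Hz : isF E M z /\ eps M / 2 + 2 * eps M ^ 2 <= z <= 5 / 4 - 2 * eps M.

Local Notation Mz := (Z.of_nat M).
Local Notation pow_M1 := (pow2_S M).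
Local Notation em := (emin E).
Local Notation eM := (emax E).
Local Notation F := (isF E M).
Local Notation w := (omega E M).
Local Notation Om := (Omega E M).
Local Notation wpos := (w_pos (E:=E) (M:=M)).
Local Notation inr := (in_range E M).
Local Notation good := (good E M z).
Local Notation run := (run rd z).
Local Notation safe := (safe E M rd z).

Variables (n a : Z) (e0 e1 : R).
Let G := bp a.
Hypothesis He0 : e0 = IZR n * G.
Hypothesis He1 : e1 = e0 + G.
Hypothesis Fe0 : F e0.
Hypothesis Fe1 : F e1.
Hypothesis Hn : (2 ^ Mz <= Z.abs n <= 2 ^ (Mz + 1))%Z.
Hypothesis Hn1 : (2 ^ Mz <= Z.abs (n + 1) <= 2 ^ (Mz + 1))%Z.
Hypothesis Hadj : forall x, F x -> x <= e0 \/ e1 <= x.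
Hypothesis Hlo : bp (em + 5) <= Rabs e0 < 4.

Variables (al be lam : R).
Hypothesis Fal : F al.
Hypothesis Fbe : F be.
Hypothesis Hab : al <> be.
Hypothesis Hal : bp (em + 5) <= Rabs al <= bp (eM - 6) * Rabs e0.
Hypothesis Hbe : bp (em + 5) <= Rabs be <= bp (eM - 6) * Rabs e0.
Hypothesis Hlam : 0 <= lam <= bp (eM - 7) * Rmin (Rabs al) (bp (Mz + 3)).
Local Set Default Proof Using "All".

Lemma Gpos : 0 < G. Proof. apply bp_pos. Qed.

Lemma e0_abs : Rabs e0 = IZR (Z.abs n) * G.
Proof. rewrite He0, Rabs_mult, <- abs_IZR, (Rabs_pos_eq G); trivial. left; apply Gpos. Qed.

Lemma G_ge : 16 * w <= G /\ (em - Mz + 4 <= a)%Z.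
Proof.
  pose proof Gpos. pose proof wpos. pose proof e0_abs as A.
  assert (K : bp (em + 5) <= IZR (2 ^ (Mz + 1)) * bp a).
  { fold G. eapply Rle_trans; [apply Hlo|]. rewrite A. apply Rmult_le_compat_r; [lra|apply IZR_le; lia]. }
  rewrite bp_mul_IZR in K by lia. apply bp_le_inv in K.
  split; [|lia]. unfold G. apply Rle_trans with (bp (em - Mz + 4)); [|apply bp_le; lia].
  rewrite w_bp, (Z.add_comm _ 4), bp_P. change (2 ^ 4)%Z with 16%Z; lra.
Qed.

Lemma G_le : G <= bp (1 - Mz) /\ (a <= 1 - Mz)%Z.
Proof.
  assert (K : bp (Mz + a) < bp 2).
  { rewrite <- bp_mul_IZR by lia. fold G. apply Rle_lt_trans with (Rabs e0).
    - rewrite e0_abs. apply Rmult_le_compat_r; [left; apply Gpos|apply IZR_le; lia].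
    - replace (bp 2) with 4 by (unfold bp; simpl; ring). lra. }
  apply bp_lt_inv in K. split; [apply bp_le|]; lia.
Qed.

(** e1 is minus a power of two. Only then is the spacing just above e1 equal to G/2 instead of at
    least G, so that overshoots beyond e1 are harder to absorb. *)
Definition bad : Prop := (n + 1 = - 2 ^ Mz)%Z.

(** With |n| = 2^M + 1 and G = 16 w the modulus of e0 would be below 2^(em+5) = 2^M 32 w. *)
Lemma bad_G : bad -> 32 * w <= G.
Proof.
  intros B. destruct G_ge as [G1 G2]. pose proof pow_M_8. pose proof wpos. unfold bad in B.
  destruct (Z.eq_dec a (em - Mz + 4)) as [Q|Q].
  - exfalso. assert (G = 16 * w) by (unfold G; rewrite Q, w_bp, (Z.add_comm _ 4), bp_P; change (2 ^ 4)%Z with 16%Z; ring).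
    destruct Hlo as [L _]. rewrite e0_abs, H1 in L.
    replace (em + 5)%Z with (Mz + (5 + (em - Mz)))%Z in L by lia.
    rewrite <- bp_mul_IZR, bp_P, <- w_bp in L by lia.
    replace (Z.abs n) with (2 ^ Mz + 1)%Z in L by lia. rewrite plus_IZR in L. change (2 ^ 5)%Z with 32%Z in L.
    assert (8 <= IZR (2 ^ Mz)) by (apply IZR_le; lia). nra.
  - unfold G. apply Rle_trans with (bp (5 + (em - Mz))); [rewrite bp_P, <- w_bp; change (2 ^ 5)%Z with 32%Z; lra|apply bp_le; lia].
Qed.

Lemma above_e1 x : F x -> e1 < x -> e1 + G / 2 <= x /\ (~ bad -> e1 + G <= x).
Proof.
  intros Fx L. destruct G_ge as [_ G2]. pose proof Gpos as PG. pose proof pow_M_8 as P8.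
  assert (Q1 : e1 = IZR (n + 1) * bp a) by (rewrite He1, He0, plus_IZR; unfold G; ring).
  assert (NB : ~ bad -> e1 + G <= x).
  { intros NB. destruct (no_float_between (n + 1) a x Fx ltac:(lia)) as [D|D]; [| |unfold G; lra].
    - unfold bad in NB. right. lia.
    - lra. }
  split; [|exact NB].
  destruct (classic bad) as [B|B]; [|specialize (NB B); lra].
  unfold bad in B.
  assert (Q : bp a = 2 * bp (a - 1)) by (rewrite <- bp_S; f_equal; lia).
  destruct (no_float_between (2 * (n + 1)) (a - 1) x Fx ltac:(lia)) as [D|D].
  - right; right. lia.
  - rewrite mult_IZR in D. nra.
  - rewrite mult_IZR in D. unfold G. nra.
Qed.

Lemma below_e0 x : F x -> x < e0 -> x <= e0 - G / 2.
Proof.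
  intros Fx L. destruct G_ge as [_ G2]. pose proof Gpos as PG. pose proof pow_M_8 as P8.
  assert (Q : bp a = 2 * bp (a - 1)) by (rewrite <- bp_S; f_equal; lia).
  destruct (no_float_between (2 * n - 1) (a - 1) x Fx ltac:(lia)) as [D|D].
  - right. lia.
  - rewrite minus_IZR, mult_IZR in D. rewrite He0 in *. unfold G in *. nra.
  - rewrite minus_IZR, mult_IZR in D. rewrite He0 in *. unfold G in *. nra.
Qed.

(* the scaling factor: just large enough to keep alpha and beta apart *)
Lemma weight_ex : exists k, (em - Mz <= k <= -4)%Z /\ w < Rabs (be - al) * bp k /\
  (Rabs (be - al) * bp k <= 2 * w \/ Rabs (be - al) * bp k <= bp (- Mz - 4) * Rabs e0) /\
  lam * bp k <= / 8.
Proof.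
  pose proof wpos as Pw. pose proof (emin_emax (E:=E)) as EE. pose proof emax_ge as E15. pose proof M_ge as M3.
  assert (B8 : bp (-3) = / 8) by (unfold bp; simpl; field).
  assert (d0 : 0 < Rabs (be - al)) by (apply Rabs_pos_lt; lra).
  set (d := Rabs (be - al)) in *.
  assert (d32 : 32 * w <= d).
  { destruct (F_canon al Fal) as (m & c & Hm & Hc & Qa & _).
    destruct (F_canon be Fbe) as (m' & c' & Hm' & Hc' & Qb & _).
    assert (K : forall m c x, (Z.abs m < 2 ^ (Mz + 1))%Z -> x = IZR m * bp c -> bp (em + 5) <= Rabs x -> (em + 5 - Mz <= c)%Z).
    { clear - fp. intros m c x Hm -> L. rewrite Rabs_mult, <- abs_IZR, (Rabs_pos_eq (bp _)) in L by (left; apply bp_pos).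
      assert (bp (em + 5) < bp (Mz + 1 + c)).
      { rewrite <- (bp_mul_IZR (Mz + 1) c) by lia. eapply Rle_lt_trans; [apply L|].
        apply Rmult_lt_compat_r; [apply bp_pos|apply IZR_lt; trivial]. }
      apply bp_lt_inv in H. lia. }
    assert (Ca := K m c al Hm Qa ltac:(lra)). assert (Cb := K m' c' be Hm' Qb ltac:(lra)).
    assert (Q : exists j, be - al = IZR j * bp (em + 5 - Mz)).
    { exists (m' * 2 ^ (c' - (em + 5 - Mz)) - m * 2 ^ (c - (em + 5 - Mz)))%Z.
      rewrite Qa, Qb, (F_rescale m' c' (em + 5 - Mz)), (F_rescale m c (em + 5 - Mz)), minus_IZR by lia. ring. }
    destruct Q as [j Q]. unfold d. rewrite Q, Rabs_mult, <- abs_IZR, (Rabs_pos_eq (bp _)) by (left; apply bp_pos).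
    assert (j <> 0)%Z by (intros ->; rewrite Rmult_0_l in Q; lra).
    assert (1 <= IZR (Z.abs j)) by (apply IZR_le; lia).
    replace (em + 5 - Mz)%Z with (5 + (em - Mz))%Z by lia. rewrite bp_P, <- w_bp. change (2 ^ 5)%Z with 32%Z. nra. }
  (* A small gap d is scaled into (w, 2w]; the bound d >= 32 w is what makes this exponent at most
     -4. For d > 1 the smallest positive float is weight enough. *)
  destruct (Rle_dec d 1) as [C|C].
  - destruct (dyadic' (2 * w / d)) as (k & K1 & K2); [apply Rdiv_lt_0_compat; lra|].
    rewrite bp_S in K2. assert (Qd : 2 * w = 2 * w / d * d) by (field; lra).
    pose proof (bp_pos k) as Pk.
    assert (k1 : d * bp k <= 2 * w) by nra. assert (k2 : w < d * bp k) by nra.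
    exists k. split; [split|split; [|split]]; trivial; try lra.
    + assert (em - Mz < k)%Z; [|lia]. apply bp_lt_inv. rewrite <- w_bp. nra.
    + apply bp_le_inv. replace (bp (-4)) with (/ 16) by (unfold bp; simpl; field). nra.
    (* The relative gap of distinct floats gives |al| <= 2^(M+2) d, so lam 2^k <= 2^(eM-7) 2^(M+2)
       2w, which is 1/8 because em + eM = 1. *)
    + pose proof (F_diff_ge rd Hr al be Fal Fbe Hab) as Df. fold d in Df.
      pose proof (Rmin_l (Rabs al) (bp (Mz + 3))). pose proof (bp_pos (eM - 7)).
      assert (L1 : lam <= bp (eM - 7) * Rabs al) by nra.
      assert (L2 : Rabs al <= d * bp (Mz + 2)).
      { replace (Mz + 2)%Z with (- (- Mz - 2))%Z by lia. rewrite bp_inv.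
        pose proof (bp_pos (- Mz - 2)). apply Rmult_le_reg_r with (bp (- Mz - 2)); trivial.
        field_simplify; lra. }
      apply Rle_trans with (bp (eM - 7) * (d * bp (Mz + 2)) * bp k).
      { apply Rmult_le_compat_r; [lra|]. nra. }
      replace (bp (eM - 7) * (d * bp (Mz + 2)) * bp k) with (bp (eM - 7) * bp (Mz + 2) * (d * bp k)) by ring.
      rewrite <- B8. apply Rle_trans with (bp (eM - 7) * bp (Mz + 2) * bp (em - Mz + 1)).
      * apply Rmult_le_compat_l; [|rewrite bp_S, <- w_bp; lra].
        apply Rmult_le_pos; left; apply bp_pos.
      * rewrite <- !bp_add. apply bp_le. lia.
  (* With em + eM = 1, both constants of the condition fit exactly: 2 2^(eM-6) w = 2^(-M-4) and
     2^(eM-7) 2^(M+3) w = 1/8. *)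
  - exists (em - Mz)%Z. rewrite <- w_bp. split; [lia|split; [nra|split]].
    + right. apply Rle_trans with (2 * (bp (eM - 6) * Rabs e0) * w).
      * apply Rmult_le_compat_r; [lra|]. unfold d.
        pose proof (Rabs_triang be (- al)) as T. rewrite Rabs_Ropp in T. unfold Rminus. lra.
      * replace (2 * (bp (eM - 6) * Rabs e0) * w) with (2 * bp (eM - 6) * w * Rabs e0) by ring.
        apply Rmult_le_compat_r; [apply Rabs_pos|]. rewrite w_bp, <- bp_S, <- bp_add. apply bp_le. lia.
    + pose proof (Rmin_r (Rabs al) (bp (Mz + 3))). pose proof (bp_pos (eM - 7)).
      rewrite <- B8. apply Rle_trans with (bp (eM - 7) * bp (Mz + 3) * w).
      * apply Rmult_le_compat_r; [lra|]. nra.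
      * rewrite w_bp, <- !bp_add. apply bp_le. lia.
Qed.

(** v is the tipping point of the bias e0: the largest float that, added to e0, still does not reach
    e1. A chain with target v sends 0 to v, hence to e0, and every positive float beyond v, hence to
    e1 or above. *)
Lemma thresh_ex : exists v ws, chain (E:=E) (M:=M) rd z v ws /\ 0 <= v <= G / 2 /\ rd (v + e0) = e0 /\
  (forall x, F x -> v < x -> e1 <= rd (x + e0)) /\ (forall f, F f -> 0 <= f < G / 2 -> f <= v).
Proof.
  pose proof wpos as Pw. pose proof Gpos as PG. destruct G_ge as [G1 G2]. destruct G_le as [G3 G4].
  pose proof (emin_emax (E:=E)) as EE. pose proof emax_ge as E15. pose proof M_ge as M3.
  assert (Z0 : rd (0 + e0) = e0) by (rewrite Rplus_0_l; apply (rd_id rd Hr); trivial).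
  assert (Up : forall x, F x -> G / 2 < x -> e1 <= rd (x + e0)).
  { intros x Fx L. destruct (Hadj _ (rd_F rd Hr (x + e0))) as [C|C]; trivial. exfalso.
    destruct (Rle_dec G x) as [D|D].
    - assert (e1 <= rd (x + e0)) by (apply (rd_lb rd Hr); trivial; lra). lra.
    - pose proof (rd_near rd Hr (x + e0) e1 Fe1) as N. rewrite Rabs_pos_eq, Rabs_left1 in N; lra. }
  destruct (archimed (Om / w)) as [HB _]; set (B := up (Om / w)) in *.
  destruct (Zmax_ex (fun m => F (IZR m * w) /\ rd (IZR m * w + e0) <= e0) 0%Z B) as (l & [Fl Ll] & Max).
  { rewrite Rmult_0_l. split; [apply F_0|lra]. }
  { intros m [Fm _]. apply F_le_Om, Rabs_le_inv in Fm. apply le_IZR.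
    apply Rmult_le_reg_r with w; trivial. assert (Om = Om / w * w) by (field; lra). nra. }
  set (v := IZR l * w) in *.
  assert (Mx : forall f, F f -> rd (f + e0) <= e0 -> f <= v).
  { intros f Ff L. destruct (F_mult f Ff) as [m Hm]. rewrite Hm in *.
    assert (m <= l)%Z by (apply Max; auto). apply IZR_le in H. unfold v; nra. }
  assert (v0 : 0 <= v) by (apply Mx; [apply F_0|lra]).
  assert (v1 : v <= G / 2).
  { apply Rnot_lt_le; intros C. apply Up in C; trivial. lra. }
  destruct (chain_ex rd Hr z Hz v Fl) as (ws & Ch).
  { split; trivial. apply Rle_trans with (bp (1 - Mz)); [lra|apply bp_le; lia]. }
  exists v, ws. split; [trivial|]. split; [lra|]. split; [|split].
  - apply Rle_antisym; trivial. apply (rd_lb rd Hr); trivial; lra.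
  - intros x Fx L. destruct (Hadj _ (rd_F rd Hr (x + e0))) as [C|C]; trivial. apply Mx in C; trivial. lra.
  - intros f Ff Hf. apply Mx; trivial. rewrite Rplus_comm, (rd_absorb_up rd Hr e0 G f); trivial; try lra.
    intros x Fx L. destruct (Hadj x Fx); lra.
Qed.

Definition sg : R := if Rlt_dec al be then 1 else -1.

Lemma sg_cases : (sg = 1 \/ sg = -1) /\ sg * (be - al) = Rabs (be - al).
Proof.
  unfold sg; destruct (Rlt_dec al be) as [L|L]; split; auto.
  - rewrite Rabs_pos_eq; lra.
  - rewrite Rabs_left1; lra.
Qed.

(** [low] and [high] describe values after activation, [plow] and [phigh] before it. In all four D
    is the distance before activation, so [lam] D bounds the distance after it. *)
Definition low (D u : R) : Prop := F u /\ sg * (u - al) <= 0 /\ Rabs (u - al) <= lam * D.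
Definition high (D u : R) : Prop := F u /\ 0 <= sg * (u - be) /\ Rabs (u - be) <= lam * D.
Definition plow (D p : R) : Prop := F p /\ e0 - D <= p <= e0.
Definition phigh (D p : R) : Prop := F p /\ e1 <= p <= e1 + D.

(** 17/64 = 2 (17/16) (1/8): scaling by the weight gives D/8, rounding the sum costs 17/16, and
    adding the bias at most doubles. The constant terms collect the gap h, the errors w and the
    chain's overshoot G/7. *)
Definition step (D : R) : R := 17 / 64 * D + (if excluded_middle_informative bad then 107 / 200 else 3 / 4) * G.
(** Just above the fixed points (64/47) (3/4) G and (64/47) (107/200) G of [step], and low enough
    for the last errors to be absorbed by e0 and e1. *)
Definition small (D : R) : Prop := D <= (if excluded_middle_informative bad then 3 / 4 else 103 / 100) * G.

(* One layer at eta reduces the distance D between the values coding a bit and e0 or e1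
   to step D; the pair (e0, e1) is hit exactly once D is small. *)
Lemma contract : exists kw ws1 ws2, F kw /\ Forall good ws1 /\ Forall good ws2 /\ 0 < sg * kw /\
  safe 0 ws1 /\
  (forall u, F u -> inr (u * kw) /\ inr (run 0 ws1 + rd (u * kw)) /\
     safe (rd (run 0 ws1 + rd (u * kw))) ws2 /\ inr (run (rd (run 0 ws1 + rd (u * kw))) ws2 + e0)) /\
  (forall D u, 0 <= D -> low D u -> plow (step D) (rd (run (rd (run 0 ws1 + rd (u * kw))) ws2 + e0))) /\
  (forall D u, 0 <= D -> high D u -> phigh (step D) (rd (run (rd (run 0 ws1 + rd (u * kw))) ws2 + e0))) /\
  (forall D u, 0 <= D -> small D -> low D u -> rd (run (rd (run 0 ws1 + rd (u * kw))) ws2 + e0) = e0) /\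
  (forall D u, 0 <= D -> small D -> high D u -> rd (run (rd (run 0 ws1 + rd (u * kw))) ws2 + e0) = e1).
Proof.
  pose proof wpos as Pw. pose proof Gpos as PG. destruct G_ge as [G1 G2]. destruct G_le as [G3 G4].
  pose proof (emin_emax (E:=E)) as EE. pose proof emax_ge as E15. pose proof M_ge as M3.
  destruct weight_ex as (k & Hk & Hh1 & Hh2 & Hlk). set (h := Rabs (be - al) * bp k) in *.
  destruct thresh_ex as (v & ws2 & Ch & Hv & Qv & Mx & Mn).
  destruct sg_cases as [Hs Hsd]. set (s := sg) in *. set (kw := s * bp k).
  pose proof (bp_pos k) as Pk.
  assert (k16 : bp k <= / 16).
  { replace (/ 16) with (bp (-4)) by (unfold bp; simpl; field). apply bp_le; lia. }
  assert (Fkw : F kw).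
  { unfold kw. assert (F (bp k)) by (apply F_bp; lia). destruct Hs as [-> | ->].
    - rewrite Rmult_1_l; trivial.
    - replace (-1 * bp k) with (- bp k) by ring. apply F_opp; trivial. }
  destruct (bpeM_big rd Hr z Hz) as (Big1 & Big2 & Big3). pose proof (bp_pos (em + 1)) as Pem.
  assert (G1' : G <= 1).
  { rewrite <- bp_0. unfold G. apply bp_le. lia. }
  assert (PO : 1024 <= bp (eM - 1)).
  { replace 1024 with (bp 10) by (unfold bp; simpl; ring). apply bp_le. lia. }
  assert (Om2 : Om < 4 * bp (eM - 1)).
  { pose proof (Om_lt (E:=E) (M:=M)). replace (eM + 1)%Z with (eM - 1 + 1 + 1)%Z in H by lia. rewrite !bp_S in H. lra. }
  assert (Su : forall u, F u -> Rabs (u * bp k) <= Om / 16).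
  { intros u Fu. apply F_le_Om in Fu. rewrite Rabs_mult, (Rabs_pos_eq (bp k)) by lra. pose proof (Rabs_pos u). nra. }
  assert (Su' : forall u, F u -> Rabs (u * kw) <= Om / 16).
  { intros u Fu. specialize (Su u Fu). unfold kw. destruct Hs as [-> | ->]; [rewrite Rmult_1_l; trivial|].
    replace (u * (-1 * bp k)) with (- (u * bp k)) by ring. rewrite Rabs_Ropp; trivial. }
  assert (Er : forall u, F u -> Rabs (rd (u * kw) - u * kw) <= w / 2).
  { intros u Fu. apply (scale_err rd Hr); trivial. specialize (Su u Fu). lra. }
  assert (w1 : w <= / 16) by lra.
  assert (Rk : forall u, F u -> Rabs (rd (u * kw)) <= Om / 16 + 1).
  { intros u Fu. specialize (Su' u Fu). specialize (Er u Fu). apply Rabs_le_inv in Su', Er. apply Rabs_le. lra. }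
  set (a0 := rd (al * kw)).
  (* Constant increments first bring the accumulator to -rd (al kw), so that the value al lands on 0
     exactly. *)
  assert (Pre : exists ws1, Forall good ws1 /\ safe 0 ws1 /\ run 0 ws1 = - a0).
  { assert (Fa0 : F (- a0)) by (apply F_opp, rd_F; trivial).
    destruct (Rle_dec 0 (- a0)) as [C|C].
    - destruct (climb rd Hr z Hz (- a0) Fa0 C) as (ws & ? & ? & ? & ? & ?). exists ws; auto.
    - assert (R1 : reach E M rd z 0 0 (- a0) (- a0)).
      { apply reach_opp; trivial. rewrite Ropp_0. apply (climb _ (rspec_opp _ Hr) z Hz); [apply F_opp; trivial|lra]. }
      destruct R1 as (ws & ? & ? & ? & ? & ?). exists ws; auto. }
  destruct Pre as (ws1 & Gd1 & Sf1 & Run1).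
  (* The accumulator x u after the scaled input is at most 0 on the side of al and at least w on the
     side of be; the chain ws2 amplifies this dichotomy. *)
  set (y := fun u => - a0 + rd (u * kw)). set (x := fun u => rd (y u)).
  assert (Fx : forall u, F (x u)) by (intros; apply (rd_F rd Hr)).
  assert (Ya : al * kw - w / 2 <= a0 <= al * kw + w / 2).
  { specialize (Er al Fal). fold a0 in Er. apply Rabs_le_inv in Er. lra. }
  assert (Yb : 0 < rd (be * kw) - a0).
  { specialize (Er be Fbe). apply Rabs_le_inv in Er.
    assert (be * kw - al * kw = h) by (unfold kw, h; rewrite <- Hsd; ring). lra. }
  assert (Ylow : forall D u, 0 <= D -> low D u -> - (D / 8 + w) <= y u <= 0).
  { intros D u HD (Fu & L1 & L2). fold s in L1. unfold y. split.
    - specialize (Er u Fu). apply Rabs_le_inv in Er, L2.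
      assert (- (D / 8) <= u * kw - al * kw); [|lra]. unfold kw.
      replace (u * (s * bp k) - al * (s * bp k)) with (s * (u - al) * bp k) by ring.
      assert (- (lam * D) <= s * (u - al)) by (destruct Hs as [-> | ->]; lra). nra.
    - assert (rd (u * kw) <= a0); [|lra]. apply (rd_le rd Hr). unfold kw. nra. }
  assert (Yhigh : forall D u, 0 <= D -> high D u -> 0 < y u <= h + D / 8 + w).
  { intros D u HD (Fu & L1 & L2). fold s in L1. unfold y. split.
    - assert (rd (be * kw) <= rd (u * kw)); [|lra]. apply (rd_le rd Hr). unfold kw. nra.
    - specialize (Er u Fu). apply Rabs_le_inv in Er, L2.
      assert (u * kw - al * kw <= h + D / 8); [|lra]. unfold kw.
      replace (u * (s * bp k) - al * (s * bp k)) with (s * (u - be) * bp k + s * (be - al) * bp k) by ring.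
      rewrite Hsd. fold h.
      assert (s * (u - be) <= lam * D) by (destruct Hs as [-> | ->]; lra). unfold h. nra. }
  assert (Fbig : forall u, F u -> Rabs (y u) <= Om / 8 + 2).
  { intros u Fu. pose proof (Rk u Fu). pose proof (Rk al Fal). fold a0 in H0. apply Rabs_le_inv in H, H0.
    unfold y. apply Rabs_le. lra. }
  assert (Xbig : forall u, F u -> Rabs (x u) <= bp (eM - 1)).
  { intros u Fu. pose proof (Fbig u Fu) as B. pose proof (rd_err rd Hr (y u) ltac:(lra)) as R1.
    fold (x u) in R1. apply Rabs_le_inv in B, R1.
    assert (Rabs (y u) <= Om / 8 + 2) by (apply Rabs_le; lra). apply Rabs_le. lra. }
  assert (Xerr : forall u, F u -> Rabs (x u) <= 17 / 16 * Rabs (y u) + w / 2).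
  { intros u Fu. pose proof (Fbig u Fu) as B. pose proof (rd_err rd Hr (y u) ltac:(lra)) as R1.
    fold (x u) in R1. pose proof (Rabs_triang (x u - y u) (y u)).
    replace (x u - y u + y u) with (x u) in H by ring. lra. }
  assert (Xlow : forall D u, 0 <= D -> low D u -> - (17 / 16 * (D / 8 + w) + w / 2) <= x u <= 0).
  { intros D u HD L. pose proof (Ylow D u HD L) as [A1 A2].
    split; [|apply (rd_ub rd Hr); [apply F_0|lra]].
    pose proof (Xerr u ltac:(apply L)) as X. rewrite (Rabs_left1 (y u)) in X by lra. apply Rabs_le_inv in X. lra. }
  assert (Xhigh : forall D u, 0 <= D -> high D u -> w <= x u <= 17 / 16 * (h + D / 8 + w) + w / 2).
  { intros D u HD L. pose proof (Yhigh D u HD L) as [A1 A2]. split.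
    - unfold x. apply (rd_lb rd Hr); [rewrite w_bp; apply F_bp; lia|].
      assert (Ku : F (rd (u * kw))) by (apply rd_F; trivial).
      assert (Ka : F a0) by (apply rd_F; trivial).
      unfold y in *. pose proof (F_lt_w a0 (rd (u * kw)) Ka Ku ltac:(lra)). lra.
    - pose proof (Xerr u ltac:(apply L)) as X. rewrite (Rabs_pos_eq (y u)) in X by lra. apply Rabs_le_inv in X. lra. }
  set (p := fun u => rd (run (x u) ws2 + e0)).
  assert (Pe : forall u, rd (run (rd (run 0 ws1 + rd (u * kw))) ws2 + e0) = p u).
  { intros u. rewrite Run1. reflexivity. }
  assert (Fp : forall u, F (p u)) by (intros; apply (rd_F rd Hr)).
  destruct Ch as [c1 c2 c3 c4 c5 c6].
  assert (Plow0 : forall D u, 0 <= D -> low D u -> p u <= e0).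
  { intros D u HD L. unfold p. apply Rle_trans with (rd (v + e0)); [|lra]. apply (rd_le rd Hr). rewrite <- c3.
    apply Rplus_le_compat_r. apply run_mono; [apply (rd_le rd Hr)|]. apply (Xlow D u HD L). }
  assert (Plow1 : forall u, rd (e0 + x u) <= p u).
  { intros u. unfold p. apply (rd_le rd Hr). pose proof (c5 (x u) (Fx u)). lra. }
  assert (Phigh0 : forall D u, 0 <= D -> high D u -> e1 <= p u).
  { intros D u HD L. unfold p. apply Mx; [apply (run_F rd Hr z Hz), Fx|]. apply c4; [apply Fx|]. apply (Xhigh D u HD L). }
  (* |e0| <= 2^(M+1) G yields h <= G/8. In the bad case |n| is only 2^M + 1, which nearly halves the
     bound and pays for the halved spacing above e1. *)
  assert (NB : forall P : Prop, ~ bad -> (h + w <= 3 / 16 * G -> P) -> P).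
  { intros P NB HP. apply HP. assert (h <= / 8 * G); [|lra]. destruct Hh2 as [C|C]; [lra|].
    eapply Rle_trans; [apply C|]. rewrite e0_abs.
    apply Rle_trans with (bp (- Mz - 4) * (bp (Mz + 1) * G)).
    - apply Rmult_le_compat_l; [left; apply bp_pos|]. apply Rmult_le_compat_r; [lra|].
      rewrite bp_nat by lia. apply IZR_le; lia.
    - rewrite <- Rmult_assoc, <- bp_add. replace (- Mz - 4 + (Mz + 1))%Z with (-3)%Z by lia.
      right; unfold bp; simpl; field. }
  assert (BB : forall P : Prop, bad -> (h + w <= 13 / 128 * G -> 32 * w <= G -> P) -> P).
  { intros P B HP. pose proof (bad_G B) as B32. apply HP; trivial.
    assert (h <= 9 / 128 * G); [|lra]. destruct Hh2 as [C|C]; [lra|].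
    eapply Rle_trans; [apply C|]. rewrite e0_abs. unfold bad in B.
    replace (Z.abs n) with (2 ^ Mz + 1)%Z by (pose proof pow_M_8; lia).
    rewrite plus_IZR, <- bp_nat by lia.
    replace (bp (- Mz - 4) * ((bp Mz + 1) * G)) with ((bp (- Mz - 4) * bp Mz + bp (- Mz - 4)) * G) by ring.
    apply Rmult_le_compat_r; [lra|]. rewrite <- bp_add. replace (- Mz - 4 + Mz)%Z with (-4)%Z by lia.
    assert (bp (- Mz - 4) <= bp (-7)) by (apply bp_le; lia).
    replace (bp (-4)) with (/ 16) by (unfold bp; simpl; field).
    replace (bp (-7)) with (/ 128) in H by (unfold bp; simpl; field). lra. }
  assert (HW : h + w <= 3 / 16 * G).
  { destruct (classic bad) as [B|B]; [apply (BB _ B); intros; lra|apply (NB _ B); auto]. }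
  (* 15/32 G is a float below G/2, so the tipping point v is at least that large. *)
  assert (v15 : 32 * w <= G -> 15 / 32 * G <= v).
  { intros L. assert (Q : G = 32 * bp (a - 5)).
    { unfold G. replace a with (5 + (a - 5))%Z at 1 by lia. rewrite bp_P. reflexivity. }
    assert (em - Mz <= a - 5)%Z.
    { apply bp_le_inv. rewrite <- w_bp. lra. }
    replace (15 / 32 * G) with (15 * bp (a - 5)) by (rewrite Q; field).
    apply Mn; [apply (F_small 15); [pose proof pow_M_8; rewrite pow_M1; lia|lia]|pose proof (bp_pos (a - 5)); lra]. }
  exists kw, ws1, ws2. repeat split; trivial.
  - unfold kw. destruct Hs as [-> | ->]; nra.
  - apply inr_le. specialize (Su' u H). lra.
  - apply inr_le. rewrite Run1. specialize (Fbig u H). unfold y in Fbig. lra.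
  - apply c2; rewrite Run1; [apply (Fx u)|apply (Xbig u H)].
  - apply inr_le. rewrite Run1. fold (y u). fold (x u). specialize (Xbig u H). apply Rabs_le_inv in Xbig.
    pose proof (c5 (x u) (Fx u)). destruct Hlo as [_ L4]. apply Rabs_def2 in L4. apply Rabs_le. lra.
  - rewrite Pe; apply Fp.
  - rewrite Pe. apply Rle_trans with (rd (e0 + x u)); [|apply Plow1].
    pose proof (rd_add_err rd Hr e0 (x u) Fe0) as R1. pose proof (Xlow D u H H0) as X.
    rewrite (Rabs_left1 (x u)) in R1 by lra. apply Rabs_le_inv in R1.
    unfold step. destruct (excluded_middle_informative bad) as [B|B]; lra.
  - rewrite Pe. apply (Plow0 D u H H0).
  - rewrite Pe; apply Fp.
  - rewrite Pe. apply (Phigh0 D u H H0).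
  - rewrite Pe. pose proof (Xhigh D u H H0) as X. pose proof (c5 (x u) (Fx u)) as C5.
    (* t is the overshoot beyond G; since v <= G/2, the chain's own displacement 16/7 v is at most G
       + G/7. *)
    set (t := run (x u) ws2 - G) in *.
    assert (Tb : t <= 17 / 16 * (h + D / 8 + w) + w / 2 + G / 7) by (unfold t; lra).
    destruct (Rle_dec t 0) as [C|C].
    + assert (p u <= e1); [apply (rd_ub rd Hr); trivial; unfold t in C; lra|].
      assert (0 <= step D); [|lra]. unfold step. destruct (excluded_middle_informative bad); lra.
    + assert (Pu : p u = rd (e1 + t)) by (unfold p, t; f_equal; lra). rewrite Pu.
      pose proof (rd_add_err rd Hr e1 t Fe1) as R1. rewrite (Rabs_pos_eq t) in R1 by lra. apply Rabs_le_inv in R1.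
      unfold step. destruct (excluded_middle_informative bad) as [B|B]; [apply (BB _ B); intros|]; lra.
  - intros D u H H0 H1. rewrite Pe. apply Rle_antisym; [apply (Plow0 D u H H1)|].
    assert (Q : rd (e0 + x u) = e0).
    { apply (rd_absorb_dn rd Hr e0 (G / 2)); trivial; [apply below_e0|].
      pose proof (Xlow D u H H1) as X. split; [|lra].
      unfold small in H0. destruct (excluded_middle_informative bad) as [B|B]; lra. }
    rewrite <- Q at 1. apply Plow1.
  - intros D u H H0 H1. rewrite Pe. apply Rle_antisym; [|apply (Phigh0 D u H H1)].
    pose proof (Xhigh D u H H1) as X. unfold small in H0.
    (* The two alternatives of [ch_tight]: v is close to G/2 when G >= 32 w, and when G = 16 w the
       whole sum stays where adding w is exact. *)
    assert (X2 : x u <= 11 / 14 * v \/ x u + v <= bp (em + 1)).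
    { destruct (Rle_dec (32 * w) G) as [C|C].
      - left. specialize (v15 C). destruct (excluded_middle_informative bad); lra.
      - right. assert (G = 16 * w).
        { assert (a < em - Mz + 5)%Z.
          { apply bp_lt_inv. rewrite (Z.add_comm _ 5), bp_P, <- w_bp. change (2 ^ 5)%Z with 32%Z. fold G. lra. }
          unfold G. replace a with (4 + (em - Mz))%Z by lia. rewrite bp_P, <- w_bp. change (2 ^ 4)%Z with 16%Z; ring. }
        rewrite (bp_em1 rd Hr z Hz). assert (16 <= IZR (2 ^ (Mz + 1))) by (apply IZR_le; rewrite pow_M1; pose proof pow_M_8; lia).
        assert (x u + v <= 16 * w); [|nra]. destruct (excluded_middle_informative bad); lra. }
    assert (B3 : bp a = 8 * bp (a - 3)).
    { replace a with (3 + (a - 3))%Z at 1 by lia. rewrite bp_P. reflexivity. }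
    pose proof pow_M_8 as P8. pose proof pow_M1 as PM1.
    (* e1 has to absorb the overshoot: G/8 is below half of the spacing G/2 in the bad case, 3/8 G
       is below half of G otherwise. The bounds 9/8 G and 11/8 G on the run are floats, as
       [ch_tight] requires. *)
    destruct (excluded_middle_informative bad) as [B|B].
    + assert (C : run (x u) ws2 <= 9 * bp (a - 3)).
      { apply c6; trivial; try lra; [apply (F_small 9); lia|]. apply (BB _ B); intros. fold G in B3. lra. }
      assert (Q : rd (e1 + G / 8) = e1).
      { apply (rd_absorb_up rd Hr e1 (G / 2)); trivial; [|lra]. intros; apply above_e1; trivial. }
      rewrite <- Q. apply (rd_le rd Hr). fold G in B3. lra.
    + assert (C : run (x u) ws2 <= 11 * bp (a - 3)).
      { apply c6; trivial; try lra; [apply (F_small 11); lia|]. fold G in B3. lra. }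
      assert (Q : rd (e1 + 3 / 8 * G) = e1).
      { apply (rd_absorb_up rd Hr e1 G); trivial; [|lra]. intros; apply above_e1; trivial. }
      rewrite <- Q. apply (rd_le rd Hr). fold G in B3. lra.
Qed.

(** j counts the true inputs, each contributing w. The threshold chain separates 0 from every
    positive value, so it computes a disjunction. *)
Lemma or_row : exists u ws, good u /\ rd (z * u) = w /\ Forall good ws /\
  forall j, (0 <= j <= 2)%Z -> safe (IZR j * w) ws /\ inr (run (IZR j * w) ws + e0) /\
    rd (run (IZR j * w) ws + e0) = if Z.eq_dec j 0 then e0 else e1.
Proof.
  destruct (w_good rd Hr z Hz) as (u & Gu & Hu). destruct thresh_ex as (v & ws & Ch & Hv & Qv & Mx & Mn).
  pose proof wpos as Pw. pose proof Gpos as PG. destruct G_ge as [G1 G2]. destruct G_le as [G3 G4].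
  pose proof pow_M_8 as P8. pose proof pow_M1 as PM1. pose proof (emin_emax (E:=E)) as EE. pose proof emax_ge as E15.
  destruct (bpeM_big rd Hr z Hz) as (Big1 & Big2 & Big3). pose proof (bp_pos (em + 1)) as Pem.
  assert (G1' : G <= 1).
  { rewrite <- bp_0. unfold G. apply bp_le. pose proof M_ge. lia. }
  assert (PO : 1024 <= bp (eM - 1)).
  { replace 1024 with (bp 10) by (unfold bp; simpl; ring). apply bp_le. lia. }
  exists u, ws. destruct Ch as [c1 c2 c3 c4 c5 c6]. repeat split; trivial; try apply Gu.
  - apply c2; [apply F_w; lia|]. assert (0 <= IZR j <= 2) by (split; apply IZR_le; lia). rewrite Rabs_pos_eq by nra. nra.
  - assert (0 <= IZR j <= 2) by (split; apply IZR_le; lia).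
    pose proof (c5 (IZR j * w) ltac:(apply F_w; lia)) as C5. destruct Hlo as [_ L4]. apply Rabs_def2 in L4.
    apply inr_le, Rabs_le. nra.
  - destruct (Z.eq_dec j 0) as [->|N]; [rewrite Rmult_0_l, c3; trivial|].
    assert (Hj : 1 <= IZR j <= 2) by (split; apply IZR_le; lia). assert (Hjw : w <= IZR j * w <= 2 * w) by nra.
    assert (Fj : F (IZR j * w)) by (apply F_w; lia).
    apply Rle_antisym; [|apply Mx; [apply (run_F rd Hr z Hz); trivial|apply c4; trivial; lra]].
    assert (B3 : bp a = 8 * bp (a - 3)).
    { replace a with (3 + (a - 3))%Z at 1 by lia. rewrite bp_P. reflexivity. }
    assert (B4 : bp a = 16 * bp (a - 4)).
    { replace a with (4 + (a - 4))%Z at 1 by lia. rewrite bp_P. reflexivity. }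
    pose proof (bp_pos (a - 4)) as Pa4. fold G in B3, B4.
    (* 7/16 G is a float below G/2; this makes 2w small enough relative to v for [ch_tight]. *)
    assert (V : 7 * bp (a - 4) <= v) by (apply Mn; [apply (F_small 7); lia|lra]).
    assert (C : run (IZR j * w) ws <= 9 * bp (a - 3)).
    { apply c6; trivial; try lra. apply (F_small 9); lia. }
    assert (Q : rd (e1 + G / 8) = e1).
    { apply (rd_absorb_up rd Hr e1 (G / 2)); trivial; [|lra]. intros; apply above_e1; trivial. }
    rewrite <- Q. apply (rd_le rd Hr). lra.
Qed.

(** The iteration is affine with ratio 17/64 and converges to its fixed point, which lies strictly
    inside [small]. The start 2 [Om] bounds the distance of any two floats. *)
Lemma small_ex : exists N, small (Nat.iter N step (2 * Om)) /\ forall i, 0 <= Nat.iter i step (2 * Om).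
Proof.
  pose proof Gpos as PG. pose proof (Om_ge (E:=E) (M:=M)). pose proof (bp_pos eM).
  set (c := if excluded_middle_informative bad then 107 / 200 else 3 / 4) in *.
  assert (c0 : 0 < c) by (unfold c; destruct (excluded_middle_informative bad); lra).
  assert (St : forall D, step D = 17 / 64 * D + c * G) by reflexivity.
  assert (B : forall i, 0 <= Nat.iter i step (2 * Om) <= 64 / 47 * c * G + (17 / 64) ^ i * (2 * Om)).
  { induction i as [|i IH]; simpl; [nra|]. rewrite St. simpl in IH. nra. }
  destruct (pow_lt_1_zero (17 / 64) ltac:(rewrite Rabs_pos_eq; lra) (G / (1000 * Om))) as [N HN].
  { apply Rdiv_lt_0_compat; lra. }
  exists N. split; [|intros; apply B]. specialize (HN N (le_n _)). apply Rabs_def2 in HN. destruct HN as [HN _].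
  assert (HN' : (17 / 64) ^ N * (2 * Om) <= G / 500).
  { apply Rle_trans with (G / (1000 * Om) * (2 * Om)); [apply Rmult_le_compat_r; lra|right; field; lra]. }
  destruct (B N) as [_ BN]. unfold small. unfold c in BN.
  destruct (excluded_middle_informative bad); lra.
Qed.

(** The weight 2^(a-c) maps the grid of x at the threshold onto the grid of eta, and the bias shifts
    the pair of indices k, k+1 to n, n+1. Only the two floats around the threshold need exact
    images; monotone rounding settles all others, whose distance from e0 or e1 remains
    uncontrolled. *)
Lemma threshold_row k c : (0 <= k < 2 ^ (Mz + 1))%Z -> (em - Mz <= c)%Z -> (c = (em - Mz)%Z \/ (2 ^ Mz <= k)%Z) ->
  IZR k * bp c < 1 ->
  exists wt b s, F wt /\ F b /\ (s = 1 \/ s = -1) /\ 0 < s * wt /\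
  forall x, F x -> Rabs x <= 1 -> inr (x * wt) /\ inr (rd (x * wt) + b) /\
    (x <= IZR k * bp c -> if Rlt_dec 0 s then rd (rd (x * wt) + b) <= e0 else e1 <= rd (rd (x * wt) + b)) /\
    (IZR k * bp c + bp c <= x -> if Rlt_dec 0 s then e1 <= rd (rd (x * wt) + b) else rd (rd (x * wt) + b) <= e0).
Proof.
  intros Hk Hc Hkc L1. pose proof Gpos as PG. destruct G_ge as [G1 G2]. destruct G_le as [G3 G4].
  pose proof pow_M_8 as P8. pose proof pow_M1 as PM1. pose proof (emin_emax (E:=E)) as EE. pose proof emax_ge as E15.
  pose proof M_ge as M3. pose proof (bp_pos c) as Pc. pose proof (bp_pos (a - c)) as Pac.
  assert (Hc2 : (c <= - Mz - 1 \/ c = em - Mz)%Z).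
  { destruct Hkc as [Hkc|Hkc]; [auto|left]. assert (Mz + c < 0)%Z; [|lia]. apply bp_lt_inv.
    rewrite <- (bp_mul_IZR Mz c), bp_0 by lia. eapply Rle_lt_trans; [|apply L1].
    apply Rmult_le_compat_r; [lra|apply IZR_le; lia]. }
  assert (Fb : F (bp (a - c))) by (apply F_bp; lia).
  assert (Q : bp c * bp (a - c) = G) by (unfold G; rewrite <- bp_add; f_equal; lia).
  assert (Fi : forall i, (Z.abs i <= 2 ^ (Mz + 1))%Z -> F (IZR i * G)) by (intros; apply F_small; lia).
  assert (Bi : forall i, (Z.abs i <= 2 ^ (Mz + 1))%Z -> Rabs (IZR i * G) <= 4).
  { intros i Hi. rewrite Rabs_mult, <- abs_IZR, (Rabs_pos_eq G) by lra.
    apply Rle_trans with (IZR (2 ^ (Mz + 1)) * bp (1 - Mz)).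
    - apply Rmult_le_compat; try lra; [apply IZR_le; lia|apply IZR_le; lia].
    - rewrite bp_mul_IZR by lia. replace (Mz + 1 + (1 - Mz))%Z with 2%Z by lia. unfold bp; simpl; lra. }
  assert (BO : bp eM + 4 <= Om).
  { rewrite Om_bp, bp_S. assert (bp (eM - Mz) <= bp (eM - 1)) by (apply bp_le; lia).
    assert (bp eM = 2 * bp (eM - 1)) by (rewrite <- bp_S; f_equal; lia).
    assert (bp 3 <= bp (eM - 1)) by (apply bp_le; lia). change (bp 3) with (2 * (2 * (2 * 1))) in H1. lra. }
  assert (In : forall x s i, F x -> Rabs x <= 1 -> s = 1 \/ s = -1 -> (Z.abs i <= 2 ^ (Mz + 1))%Z ->
     inr (x * (s * bp (a - c))) /\ inr (rd (x * (s * bp (a - c))) + IZR i * G)).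
  { intros x s i Fx Lx Hs Hi.
    assert (B : Rabs (x * (s * bp (a - c))) <= bp eM).
    { rewrite !Rabs_mult, (Rabs_pos_eq (bp (a - c))) by lra.
      replace (Rabs s) with 1 by (destruct Hs as [-> | ->]; [rewrite Rabs_R1|rewrite Rabs_left]; lra).
      assert (bp (a - c) <= bp eM) by (apply bp_le; lia). pose proof (Rabs_pos x). nra. }
    pose proof (Om_ge (E:=E) (M:=M)). pose proof (bp_pos eM). split; [apply inr_le; lra|].
    assert (Rabs (rd (x * (s * bp (a - c)))) <= bp eM).
    { apply Rabs_le_inv in B. apply Rabs_le. split; [apply (rd_lb rd Hr)|apply (rd_ub rd Hr)]; try lra;
        [apply F_opp|]; apply F_bp; lia. }
    specialize (Bi i Hi). apply inr_le. eapply Rle_trans; [apply Rabs_triang|]. lra. }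
  (* The orientation follows the sign of n so that the bias has a coefficient n - k or n + 1 + k of
     modulus at most 2^(M+1). For n < 0 the comparison comes out reversed. *)
  destruct (Z_le_gt_dec 0 n) as [Sn|Sn].
  - exists (1 * bp (a - c)), (IZR (n - k) * G), 1. repeat split; auto; try lra.
    + rewrite Rmult_1_l; trivial.
    + apply Fi; lia.
    + apply (In x 1 (n - k)%Z); auto; lia.
    + apply (In x 1 (n - k)%Z); auto; lia.
    + intros Lx. destruct (Rlt_dec 0 1); [|lra]. rewrite Rmult_1_l. apply (rd_ub rd Hr); trivial.
      pose proof (rd_ub rd Hr (x * bp (a - c)) (IZR k * G) ltac:(apply Fi; lia)) as U.
      rewrite He0, minus_IZR. enough (rd (x * bp (a - c)) <= IZR k * G) by lra. apply U. rewrite <- Q. nra.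
    + intros Lx. destruct (Rlt_dec 0 1); [|lra]. rewrite Rmult_1_l. apply (rd_lb rd Hr); trivial.
      pose proof (rd_lb rd Hr (x * bp (a - c)) (IZR (k + 1) * G) ltac:(apply Fi; lia)) as U.
      rewrite plus_IZR in U. rewrite He1, He0, minus_IZR. enough ((IZR k + 1) * G <= rd (x * bp (a - c))) by lra.
      apply U. rewrite <- Q. nra.
  - exists (-1 * bp (a - c)), (IZR (n + 1 + k) * G), (-1). repeat split; auto; try lra.
    + replace (-1 * bp (a - c)) with (- bp (a - c)) by ring. apply F_opp; trivial.
    + apply Fi; lia.
    + apply (In x (-1) (n + 1 + k)%Z); auto; lia.
    + apply (In x (-1) (n + 1 + k)%Z); auto; lia.
    + intros Lx. destruct (Rlt_dec 0 (-1)); [lra|]. apply (rd_lb rd Hr); trivial.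
      pose proof (rd_lb rd Hr (x * (-1 * bp (a - c))) (IZR (- k) * G) ltac:(apply Fi; lia)) as U.
      rewrite opp_IZR in U. rewrite He1, He0, !plus_IZR. enough (- IZR k * G <= rd (x * (-1 * bp (a - c)))) by lra.
      apply U. rewrite <- Q. nra.
    + intros Lx. destruct (Rlt_dec 0 (-1)); [lra|]. apply (rd_ub rd Hr); trivial.
      pose proof (rd_ub rd Hr (x * (-1 * bp (a - c))) (IZR (- (k + 1)) * G) ltac:(apply Fi; lia)) as U.
      rewrite opp_IZR, plus_IZR in U. rewrite He0, !plus_IZR. enough (rd (x * (-1 * bp (a - c))) <= - (IZR k + 1) * G) by lra.
      apply U. rewrite <- Q. nra.
Qed.

End Contract.

Lemma rnd_c_bp E M : rnd_c E M = bp (emax E - Z.of_nat M - 1).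
Proof.
  unfold rnd_c. rewrite eps_bp. fold (bp (emax E)). rewrite <- bp_add. f_equal; lia.
Qed.

(** * Reaching pairs of floats *)

Section Pairs.
Context {E M : nat} {fp : FP E M}.
Variable rd : R -> R.
Hypothesis Hr : rspec (E:=E) (M:=M) rd.
Variable z : R.
Hypothesis Hz : isF E M z /\ eps M / 2 + 2 * eps M ^ 2 <= z <= 5 / 4 - 2 * eps M.
Local Set Default Proof Using "fp Hr Hz".

Local Notation Mz := (Z.of_nat M).
Local Notation pow_M_pos := (pow2_pos M).
Local Notation pow_M1 := (pow2_S M).
Local Notation em := (emin E).
Local Notation eM := (emax E).
Local Notation F := (isF E M).
Local Notation w := (omega E M).
Local Notation Om := (Omega E M).
Local Notation wpos := (w_pos (E:=E) (M:=M)).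
Local Notation inr := (in_range E M).
Local Notation good := (good E M z).
Local Notation reach := (reach E M rd z).

(** The margin [rnd_c] beyond [Om] is half of the top spacing, so even y = [Om] may receive
    increments that are going to be absorbed. *)
Lemma inr_near y T a : F y -> (a <= eM - Mz)%Z -> Rabs T <= bp a / 4 -> inr (y + T).
Proof.
  intros Fy Ha HT. apply F_le_Om in Fy. unfold in_range. rewrite rnd_c_bp.
  pose proof (Rabs_triang y T). pose proof (bp_le a (eM - Mz) Ha) as L.
  replace (eM - Mz)%Z with (eM - Mz - 1 + 1)%Z in L by lia. rewrite bp_S in L.
  pose proof (bp_pos (eM - Mz - 1)). lra.
Qed.

Lemma rep_big y k : F y -> bp (em + k) <= y -> (1 <= k)%Z ->
  exists n a, (2 ^ Mz <= n < 2 ^ (Mz + 1))%Z /\ (em - Mz + k <= a <= eM - Mz)%Z /\ y = IZR n * bp a.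
Proof.
  intros Fy L Hk. pose proof (bp_pos (em + k)).
  destruct (Fpos_rep y Fy ltac:(lra)) as (n & a & Hn & Ha & Q & Hc).
  assert (em + k < Mz + 1 + a)%Z.
  { apply bp_lt_inv. eapply Rle_lt_trans; [apply L|]. rewrite Q, <- (bp_mul_IZR (Mz + 1) a) by lia.
    apply Rmult_lt_compat_r; [apply bp_pos|apply IZR_lt; lia]. }
  exists n, a. repeat split; trivial; lia.
Qed.

(** Such floats have exponent at least em + 5, hence a unit of at least 32 w. This gives the
    separation of the codes al and be from the bound 2^(em+5) of the condition. *)
Lemma multiple32 y : F y -> bp (em + 5) <= Rabs y -> exists j, y = IZR j * (32 * w).
Proof.
  assert (K : forall y, F y -> bp (em + 5) <= y -> exists j, y = IZR j * (32 * w)).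
  { clear y. intros y Fy L. destruct (rep_big y 5 Fy L ltac:(lia)) as (k & c & _ & Hc & Q).
    exists (k * 2 ^ (c - (em - Mz + 5)))%Z. rewrite Q, (F_rescale k c (em - Mz + 5)) by lia. f_equal.
    rewrite (Z.add_comm _ 5), bp_P, <- w_bp. reflexivity. }
  intros Fy L. destruct (Rle_dec 0 y) as [C|C].
  - rewrite Rabs_pos_eq in L by trivial. auto.
  - rewrite Rabs_left1 in L by lra. destruct (K (- y) (F_opp _ Fy) L) as [j Hj]. exists (- j)%Z. rewrite opp_IZR. lra.
Qed.

Lemma apart32 x y : F x -> F y -> bp (em + 5) <= Rabs x -> bp (em + 5) <= Rabs y -> x <> y -> 32 * w <= Rabs (y - x).
Proof.
  intros Fx Fy Lx Ly N. pose proof wpos. destruct (multiple32 x Fx Lx) as [i ->], (multiple32 y Fy Ly) as [j ->].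
  replace (IZR j * (32 * w) - IZR i * (32 * w)) with (IZR (j - i) * (32 * w)) by (rewrite minus_IZR; ring).
  rewrite Rabs_mult, <- abs_IZR, (Rabs_pos_eq (32 * w)) by lra.
  assert (i <> j) by (intros ->; auto). assert (1 <= IZR (Z.abs (j - i))) by (apply IZR_le; lia). nra.
Qed.

(* y absorbs the moves that prepare x; only the last increment changes y *)
Lemma step_plus y n a : F y -> (2 ^ Mz <= n < 2 ^ (Mz + 1))%Z -> (em - Mz + 3 <= a <= eM - Mz)%Z ->
  y = IZR n * bp a -> y < Om -> reach 0 y 0 (y + bp a).
Proof.
  intros Fy Hn Ha Q LO. pose proof pow_M_pos as P1. pose proof (bp_pos a) as Pa. pose proof M_ge as M3.
  assert (y0 : 0 < y) by (rewrite Q; apply Rmult_lt_0_compat; [apply IZR_lt; lia|trivial]).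
  destruct (unit_good rd Hr z Hz a ltac:(lia)) as (v & Gv & Hv). set (S := rd (z * v)) in *.
  assert (B3 : bp a = 8 * bp (a - 3)).
  { replace a with (3 + (a - 3))%Z at 1 by lia. rewrite bp_P. reflexivity. }
  assert (R1 : reach 0 y (- S) y).
  { apply reach_opp; trivial. rewrite Ropp_0, Ropp_involutive.
    apply (ladder_up _ (rspec_opp _ Hr) z Hz (- y) (a - 3)%Z); try lia; try lra.
    - apply F_opp; trivial.
    - intros T HT. replace (- (- y + T)) with (y + - T) by ring. split.
      + rewrite (rd_absorb_dn rd Hr y (bp a / 2) (- T)); trivial; [|lra].
        intros x Fx Lx. rewrite Q in *. apply gap_dn_half; trivial; lia.
      + replace (- y + T) with (- (y + - T)) by ring. apply inr_opp, (inr_near y (- T) a); trivial; try lia.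
        rewrite Rabs_Ropp, Rabs_pos_eq; lra.
    - apply F_0.
    - apply (rd_F rd Hr).
    - apply Rle_trans with (bp a); [lra|apply bp_le; lia]. }
  eapply reach_trans; [apply R1|].
  assert (Fn : F (y + bp a)) by (rewrite Q; apply F_next; try lia; lra).
  assert (Q1 : rd (y + S) = y + bp a).
  { apply (rd_step_up rd Hr); trivial. intros x Fx Lx. rewrite Q in *. apply gap_up; trivial; lia. }
  assert (Q2 : rd (- S + S) = 0) by (rewrite Rplus_opp_l; apply (rd_0 rd Hr)).
  rewrite <- Q1 at 1. rewrite <- Q2 at 1. apply reach_step; trivial; apply inr_le.
  - fold S. rewrite Rplus_opp_l, Rabs_R0. lra.
  - fold S. apply F_le_Om, Rabs_le_inv in Fn. rewrite Rabs_pos_eq; lra.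
Qed.

(** x is prepared at -S by increments of at most a quarter of the target spacing, all absorbed by y;
    the last increment S returns x to 0 and lowers y. The bound 2^(em+2) leaves room for spacings
    four times finer. *)
Lemma step_minus y : F y -> bp (em + 2) < y ->
  exists y', F y' /\ y' < y /\ (forall x, F x -> x < y -> x <= y') /\ reach 0 y 0 y'.
Proof.
  intros Fy L. pose proof pow_M_pos as P1. pose proof M_ge as M3.
  destruct (rep_big y 2 Fy ltac:(lra) ltac:(lia)) as (n & a & Hn & Ha & Q).
  pose proof (bp_pos a) as Pa.
  assert (y0 : 0 < y) by (pose proof (bp_pos (em + 2)); lra).
  assert (K : exists b, (em - Mz + 2 <= b <= a)%Z /\ F (y - bp b) /\ (forall x, F x -> x < y -> x <= y - bp b)).
  { destruct (Z.eq_dec n (2 ^ Mz)) as [D|D].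
    - exists (a - 1)%Z.
      assert (em + 2 < Mz + a)%Z.
      { apply bp_lt_inv. rewrite <- (bp_mul_IZR Mz a), <- D, <- Q by lia. trivial. }
      assert (B : bp a = 2 * bp (a - 1)) by (rewrite <- bp_S; f_equal; lia).
      split; [lia|split].
      + replace (y - bp (a - 1)) with (IZR (2 * n - 1) * bp (a - 1)) by (rewrite Q, B, minus_IZR, mult_IZR; ring).
        apply F_small; [rewrite pow_M1; lia|lia].
      + intros x Fx Lx. replace (bp (a - 1)) with (bp a / 2) by lra. rewrite Q in *. apply gap_dn_half; trivial; lia.
    - exists a. split; [lia|split].
      + replace (y - bp a) with (IZR (n - 1) * bp a) by (rewrite Q, minus_IZR; ring).
        apply F_intro; try lia. apply F_le_Om in Fy. rewrite minus_IZR, Rmult_minus_distr_r, Rmult_1_l, <- Q.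
        apply Rabs_le_inv in Fy. assert (1 <= IZR n) by (apply IZR_le; lia). apply Rabs_le. nra.
      + intros x Fx Lx. rewrite Q in *. apply gap_dn; trivial; lia. }
  destruct K as (b & Hb & Fb & Gap). pose proof (bp_pos b) as Pb.
  exists (y - bp b). repeat split; trivial; [lra|].
  destruct (unit_good_neg rd Hr z Hz b ltac:(lia)) as (v & Gv & Hv). set (S := rd (z * v)) in *.
  assert (B2 : bp b = 4 * bp (b - 2)).
  { replace b with (2 + (b - 2))%Z at 1 by lia. rewrite bp_P. reflexivity. }
  assert (Bab : bp b <= bp a) by (apply bp_le; lia).
  assert (R1 : reach 0 y (- S) y).
  { apply (ladder_up rd Hr z Hz y (b - 2)%Z); trivial; try lia; try lra.
    - intros T HT. split.
      + apply (rd_absorb_up rd Hr y (bp a)); trivial; [|lra].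
        intros x Fx Lx. rewrite Q in *. apply gap_up; trivial; lia.
      + apply (inr_near y T a); trivial; try lia. rewrite Rabs_pos_eq; lra.
    - apply F_0.
    - apply F_opp, (rd_F rd Hr).
    - apply Rle_trans with (bp b); [lra|apply bp_le; lia]. }
  eapply reach_trans; [apply R1|].
  assert (Q1 : rd (y + S) = y - bp b) by (apply (rd_step_dn rd Hr); trivial; lra).
  assert (Q2 : rd (- S + S) = 0) by (rewrite Rplus_opp_l; apply (rd_0 rd Hr)).
  rewrite <- Q1 at 1. rewrite <- Q2 at 1. apply reach_step; trivial; apply inr_le.
  - fold S. rewrite Rplus_opp_l, Rabs_R0. pose proof (Om_ge (E:=E) (M:=M)); pose proof (bp_pos eM); lra.
  - fold S. apply F_le_Om, Rabs_le_inv in Fb. apply F_le_Om, Rabs_le_inv in Fy. apply Rabs_le; lra.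
Qed.

Lemma climb_right t U : F t -> F U -> bp (em + 3) <= t -> t <= U -> reach 0 t 0 U.
Proof.
  intros Ft FU Lt L. pose proof wpos as Pw.
  destruct (F_mult t Ft) as [n Hn]. destruct (F_mult U FU) as [n' Hn'].
  assert (G : forall k n, (n' - n)%Z = Z.of_nat k -> F (IZR n * w) -> bp (em + 3) <= IZR n * w -> reach 0 (IZR n * w) 0 U).
  { intros k; induction k as [k IH] using lt_wf_ind. intros m Hk Fm Pm.
    destruct (Z.eq_dec m n') as [->|D]; [rewrite <- Hn'; apply reach_refl|].
    assert (Ln : IZR m + 1 <= IZR n') by (rewrite <- plus_IZR; apply IZR_le; lia).
    assert (Lo : U <= Om) by (apply F_le_Om, Rabs_le_inv in FU; lra).
    destruct (rep_big _ 3 Fm Pm ltac:(lia)) as (c & a & Hc & Ha & Q).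
    assert (LO : IZR m * w < Om) by nra.
    pose proof pow_M_pos as P1. pose proof (bp_pos a) as Pa.
    assert (Fnx : F (IZR m * w + bp a)) by (rewrite Q; apply F_next; try lia; lra).
    assert (Nx : IZR m * w + bp a <= U).
    { rewrite Q. apply gap_up; trivial; try lia. rewrite <- Q. nra. }
    eapply reach_trans; [apply (step_plus _ c a); trivial; lia|].
    destruct (F_mult _ Fnx) as [n2 Hn2]. rewrite Hn2 in *.
    assert (m < n2)%Z by (apply lt_IZR; nra). assert (n2 <= n')%Z by (apply le_IZR; nra).
    apply (IH (Z.to_nat (n' - n2))); try lia; trivial. lra. }
  rewrite Hn in *. apply (G (Z.to_nat (n' - n))); trivial.
  assert (n <= n')%Z by (apply le_IZR; nra). lia.
Qed.

Lemma descend_right t U : F t -> F U -> bp (em + 2) <= U -> U <= t -> reach 0 t 0 U.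
Proof.
  intros Ft FU Lt L. pose proof wpos as Pw.
  destruct (F_mult t Ft) as [n Hn]. destruct (F_mult U FU) as [n' Hn'].
  assert (G : forall k n, (n - n')%Z = Z.of_nat k -> F (IZR n * w) -> reach 0 (IZR n * w) 0 U).
  { intros k; induction k as [k IH] using lt_wf_ind. intros m Hk Fm.
    destruct (Z.eq_dec m n') as [->|D]; [rewrite <- Hn'; apply reach_refl|].
    assert (Ln : IZR n' + 1 <= IZR m) by (rewrite <- plus_IZR; apply IZR_le; lia).
    destruct (step_minus _ Fm ltac:(nra)) as (y' & Fy' & L' & Gap & Re).
    eapply reach_trans; [apply Re|].
    assert (U <= y') by (apply Gap; trivial; nra).
    destruct (F_mult _ Fy') as [n2 Hn2]. rewrite Hn2 in *.
    assert (n2 < m)%Z by (apply lt_IZR; nra). assert (n' <= n2)%Z by (apply le_IZR; nra).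
    apply (IH (Z.to_nat (n2 - n'))); try lia; trivial. }
  rewrite Hn in *. apply (G (Z.to_nat (n - n'))); trivial.
  assert (n' <= n)%Z by (apply le_IZR; nra). lia.
Qed.

Lemma reach_right t U : F t -> F U -> bp (em + 3) <= t -> bp (em + 2) <= U -> reach 0 t 0 U.
Proof.
  intros. destruct (Rle_dec t U); [apply climb_right|apply descend_right]; trivial; lra.
Qed.

Lemma neg_good j : j = 1%Z \/ j = 2%Z -> exists v, good v /\ rd (z * v) = - (IZR j * w).
Proof.
  intros Hj. pose proof em_lt_eM as [He _]. pose proof wpos as Pw. pose proof emax_ge as E15.
  pose proof (emin_emax (E:=E)) as EE.
  destruct (unit_good_neg rd Hr z Hz (em - Mz + (j - 1)) ltac:(lia)) as (v & Gv & Hv).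
  assert (B : bp (em - Mz + (j - 1)) = IZR j * w).
  { destruct Hj as [-> | ->]; [rewrite Rmult_1_l, w_bp; f_equal; lia|].
    replace (em - Mz + (2 - 1))%Z with (em - Mz + 1)%Z by lia. rewrite bp_S, <- w_bp; ring. }
  rewrite B in Hv. exists v; split; trivial. destruct (rd_w rd Hr (z * v)) as [n Hn]. rewrite Hn in *.
  assert (- j <= n)%Z by (apply le_IZR; rewrite opp_IZR; nra).
  assert (2 * n < - j)%Z by (apply lt_IZR; rewrite mult_IZR, opp_IZR; nra).
  assert (n = - j)%Z by lia.
  subst n. rewrite opp_IZR; ring.
Qed.

Lemma descend_both j x y (k : nat) : j = 1%Z \/ j = 2%Z ->
  (forall i, (0 <= i <= Z.of_nat k)%Z -> F (IZR (x - j * i) * w) /\ F (IZR (y - j * i) * w)) ->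
  reach (IZR x * w) (IZR y * w) (IZR (x - j * Z.of_nat k) * w) (IZR (y - j * Z.of_nat k) * w).
Proof.
  intros Hj. destruct (neg_good j Hj) as (v & Gv & Hv). induction k as [|k IH]; intros HF.
  - rewrite Z.mul_0_r, !Z.sub_0_r. apply reach_refl.
  - eapply reach_trans; [apply IH; intros; apply HF; lia|].
    destruct (HF (Z.of_nat (S k)) ltac:(lia)) as [F1 F2].
    assert (A : forall t, IZR (t - j * Z.of_nat (S k)) * w = IZR (t - j * Z.of_nat k) * w + rd (z * v)).
    { intros t. rewrite Hv, Nat2Z.inj_succ, !minus_IZR, !mult_IZR, succ_IZR. ring. }
    rewrite A in F1, F2. rewrite !A.
    pose proof (reach_step E M rd z (IZR (x - j * Z.of_nat k) * w) (IZR (y - j * Z.of_nat k) * w) v Gv) as R.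
    rewrite (rd_id rd Hr _ F1), (rd_id rd Hr _ F2) in R.
    apply R; apply inr_le; apply F_le_Om; trivial.
Qed.

(** Below 2^(em+2) the spacing of y is too close to w for the preparation by absorption. So x is
    raised while y is still at 2^(em+2), and then both descend together in exact steps of 2w, the
    spacing of y in this binade. *)
Lemma reach_mid i j : (0 <= j)%Z -> (2 * j <= 2 ^ (Mz + 1))%Z -> (0 <= i <= 2 ^ (Mz + 1))%Z ->
  reach 0 (bp (em + 2)) (IZR (i - 2 * j) * w) (IZR (2 * 2 ^ (Mz + 1) - 2 * j) * w).
Proof.
  intros Hj Hj2 Hi. pose proof wpos as Pw. pose proof em_lt_eM as [He He2]. pose proof M_ge as M3. pose proof emax_ge as E15.
  pose proof (emin_emax (E:=E)) as EE. pose proof pow_M_8 as P8. pose proof pow_M1 as PM1.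
  assert (Q2 : bp (em + 2) = IZR (2 * 2 ^ (Mz + 1)) * w).
  { rewrite mult_IZR, Rmult_assoc, <- (bp_em1 rd Hr z Hz), <- bp_S. f_equal; lia. }
  eapply reach_trans with (x1 := IZR i * w) (y1 := bp (em + 2)).
  - apply (ladder_up rd Hr z Hz _ (em - Mz)); try lia.
    + apply F_bp; lia.
    + intros T HT. rewrite <- w_bp in HT. assert (B4 : bp (em - Mz + 2) = 4 * w).
      { rewrite (Z.add_comm _ 2), bp_P, <- w_bp. reflexivity. }
      assert (Q : bp (em + 2) = IZR (2 ^ Mz) * bp (em - Mz + 2)) by (rewrite bp_mul_IZR by lia; f_equal; lia).
      split.
      * apply (rd_absorb_up rd Hr _ (bp (em - Mz + 2))); [apply F_bp; lia| |lra].
        intros x Fx Lx. rewrite Q in *. apply gap_up; trivial; lia.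
      * apply (inr_near _ T (em - Mz + 2)); [apply F_bp; lia|lia|]. rewrite Rabs_pos_eq; lra.
    + apply F_0.
    + apply F_w; lia.
    + split; [lra|]. apply Rmult_le_pos; [apply IZR_le; lia|lra].
    + replace (Mz + 1 + (em - Mz))%Z with (em + 1)%Z by lia. rewrite (bp_em1 rd Hr z Hz).
      apply Rmult_le_compat_r; [lra|apply IZR_le; lia].
  - rewrite Q2. replace j with (Z.of_nat (Z.to_nat j)) by lia. apply descend_both; [auto|].
    intros t Ht. split; [apply F_w; lia|].
    replace (IZR (2 * 2 ^ (Mz + 1) - 2 * t) * w) with (IZR (2 ^ (Mz + 1) - t) * bp (em - Mz + 1)).
    + apply F_small; lia.
    + rewrite bp_S, <- w_bp, !minus_IZR, !mult_IZR. ring.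
Qed.

(** At y = 2^(M+1) w the increment w is half a spacing, and the tie rule keeps y in place while x
    climbs to the excess of y over its target. Then both descend by that excess in exact steps w. *)
Lemma reach_low n : (0 <= n <= 2 ^ (Mz + 1))%Z -> reach 0 (bp (em + 2)) 0 (IZR n * w).
Proof.
  intros Hn. pose proof wpos as Pw. pose proof pow_M1 as PM1. pose proof (bp_em1 rd Hr z Hz) as Q1.
  set (K := (2 ^ (Mz + 1))%Z) in *.
  assert (R1 : reach 0 (bp (em + 2)) 0 (IZR K * w)).
  { pose proof (reach_mid K (2 ^ Mz) ltac:(lia) ltac:(lia) ltac:(lia)) as R.
    replace (K - 2 * 2 ^ Mz)%Z with 0%Z in R by lia. rewrite Rmult_0_l in R.
    fold K in R. replace (2 * K - 2 * 2 ^ Mz)%Z with K in R by lia. trivial. }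
  eapply reach_trans; [apply R1|].
  assert (R2 : reach 0 (IZR K * w) (IZR (K - n) * w) (IZR K * w)).
  { destruct (w_good rd Hr z Hz) as (u & Gu & Hu).
    assert (G : forall i : nat, (Z.of_nat i <= K)%Z -> reach 0 (IZR K * w) (IZR (Z.of_nat i) * w) (IZR K * w)).
    { induction i as [|i IH]; intros Hi; [rewrite Rmult_0_l; apply reach_refl|].
      eapply reach_trans; [apply IH; lia|].
      assert (A : IZR (Z.of_nat (S i)) * w = IZR (Z.of_nat i) * w + rd (z * u)).
      { rewrite Hu, Nat2Z.inj_succ, succ_IZR; ring. }
      assert (T : rd (IZR K * w + rd (z * u)) = IZR K * w).
      { rewrite Hu. replace (IZR K * w + w) with (IZR (K + 1) * w) by (rewrite plus_IZR; ring).
        apply (rs_tie _ Hr). }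
      assert (Fi : F (IZR (Z.of_nat (S i)) * w)) by (apply F_w; fold K; lia).
      rewrite A in Fi |- *. rewrite <- (rd_id rd Hr _ Fi). rewrite <- T at 2.
      apply reach_step; trivial.
      - apply inr_le, F_le_Om; trivial.
      - apply inr_le. rewrite Hu, <- Q1. destruct (bpeM_big rd Hr z Hz) as (B1 & B2 & B3).
        pose proof (bp_pos (em + 1)). assert (w <= bp (em + 1)) by (rewrite w_bp; apply bp_le; lia).
        rewrite Rabs_pos_eq; lra. }
    replace (K - n)%Z with (Z.of_nat (Z.to_nat (K - n))) by lia. apply G. lia. }
  eapply reach_trans; [apply R2|].
  pose proof (descend_both 1 (K - n) K (Z.to_nat (K - n)) ltac:(auto)) as R3.
  replace (Z.of_nat (Z.to_nat (K - n))) with (K - n)%Z in R3 by lia.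
  replace (K - n - 1 * (K - n))%Z with 0%Z in R3 by lia. replace (K - 1 * (K - n))%Z with n in R3 by lia.
  rewrite Rmult_0_l in R3. apply R3. intros; split; apply F_w; fold K; lia.
Qed.

Lemma absorb_by U n a : F U -> (2 ^ Mz <= n < 2 ^ (Mz + 1))%Z -> (em - Mz <= a <= eM - Mz)%Z -> U = IZR n * bp a ->
  (forall T, 0 <= T <= bp a / 4 -> rd (U + T) = U /\ inr (U + T)) /\
  (forall T, - (bp a / 8) <= T <= 0 -> rd (U + T) = U /\ inr (U + T)).
Proof.
  intros FU Hn Ha Q. pose proof (bp_pos a) as Pa. pose proof pow_M_pos. split; intros T HT; split.
  - apply (rd_absorb_up rd Hr U (bp a)); trivial; [|lra]. intros x Fx Lx. rewrite Q in *. apply gap_up; trivial; lia.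
  - apply (inr_near U T a); trivial; try lia. rewrite Rabs_pos_eq; lra.
  - apply (rd_absorb_dn rd Hr U (bp a / 2)); trivial; [|lra]. intros x Fx Lx. rewrite Q in *. apply gap_dn_half; trivial; lia.
  - apply (inr_near U T a); trivial; try lia. rewrite Rabs_left1; lra.
Qed.

(** The slack l is smaller than the gap below U, so x can climb to l while U absorbs the increments.
    Where the spacing of U is w this forces l = 0, and where it is 2w it forces l = 0 or l = w. *)
Lemma reach_slack t U l : F t -> bp (em + 3) <= t -> F U -> 0 < U -> F l -> 0 <= l ->
  (forall x, F x -> x < U -> x < U - l) -> reach 0 t l U.
Proof.
  intros Ft Lt FU PU Fl Pl Gap. pose proof wpos as Pw. pose proof pow_M1 as PM1. pose proof (bp_em1 rd Hr z Hz) as Q1.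
  pose proof M_ge as M3. pose proof pow_M_8 as P8.
  assert (Q2 : bp (em + 2) = 2 * bp (em + 1)) by (rewrite <- bp_S; f_equal; lia).
  pose proof (emin_emax (E:=E)) as EE. pose proof emax_ge as E15.
  destruct (Rle_dec (bp (em + 2)) U) as [C|C].
  - eapply reach_trans; [apply (reach_right t U); trivial|].
    destruct (rep_big U 2 FU C ltac:(lia)) as (n & a & Hn & Ha & Q). pose proof (bp_pos a) as Pa.
    destruct (absorb_by U n a FU Hn ltac:(lia) Q) as [Ab _].
    assert (B2 : bp a = 4 * bp (a - 2)).
    { replace a with (2 + (a - 2))%Z at 1 by lia. rewrite bp_P. reflexivity. }
    apply (ladder_up rd Hr z Hz U (a - 2)); trivial; try lia; try lra.
    + intros T HT. apply Ab. lra.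
    + apply F_0.
    + apply Rle_trans with (bp a); [|apply bp_le; lia].
      assert (U - bp a < U - l); [|lra]. apply Gap; [|lra].
      replace (U - bp a) with (IZR (n - 1) * bp a) by (rewrite Q, minus_IZR; ring).
      apply F_intro; try lia. apply F_le_Om in FU. rewrite minus_IZR, Rmult_minus_distr_r, Rmult_1_l, <- Q.
      apply Rabs_le_inv in FU. assert (1 <= IZR n) by (apply IZR_le; lia). apply Rabs_le. nra.
  - eapply reach_trans; [apply (reach_right t (bp (em + 2))); trivial; [apply F_bp; lia|lra]|].
    destruct (F_mult U FU) as [n Hn]. destruct (F_mult l Fl) as [i Hi].
    assert (0 <= i)%Z by (apply le_IZR; nra).
    destruct (Rle_dec U (bp (em + 1))) as [D|D].
    + assert (n <= 2 ^ (Mz + 1))%Z by (apply le_IZR; rewrite Q1 in D; nra).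
      assert (0 < n)%Z by (apply lt_IZR; nra).
      assert (i = 0%Z).
      { assert (U - w < U - l).
        { apply Gap; [|lra]. replace (U - w) with (IZR (n - 1) * w) by (rewrite Hn, minus_IZR; ring). apply F_w; lia. }
        assert (i < 1)%Z by (apply lt_IZR; nra). lia. }
      subst i. rewrite Hi, Hn, Rmult_0_l. apply reach_low. lia.
    + destruct (rep_big U 1 FU ltac:(lra) ltac:(lia)) as (m & a & Hm & Ha & Q).
      assert (a = (em - Mz + 1)%Z).
      { assert (Mz + a < em + 2)%Z; [|lia]. apply bp_lt_inv. rewrite <- (bp_mul_IZR Mz a) by lia.
        apply Rle_lt_trans with U; [|lra]. rewrite Q. apply Rmult_le_compat_r; [left; apply bp_pos|apply IZR_le; lia]. }
      subst a. rewrite bp_S, <- w_bp in Q.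
      assert (2 ^ Mz < m)%Z.
      { apply lt_IZR. rewrite Q, Q1, PM1, mult_IZR in D. nra. }
      assert (i <= 1)%Z.
      { assert (U - 2 * w < U - l).
        { apply Gap; [|lra]. replace (U - 2 * w) with (IZR (m - 1) * bp (em - Mz + 1)) by (rewrite Q, minus_IZR, bp_S, <- w_bp; ring).
          apply F_small; lia. }
        assert (i < 2)%Z by (apply lt_IZR; nra). lia. }
      pose proof (reach_mid (i + 2 * (2 ^ (Mz + 1) - m)) (2 ^ (Mz + 1) - m) ltac:(lia) ltac:(lia) ltac:(lia)) as R.
      replace (i + 2 * (2 ^ (Mz + 1) - m) - 2 * (2 ^ (Mz + 1) - m))%Z with i in R by lia.
      replace (2 * 2 ^ (Mz + 1) - 2 * (2 ^ (Mz + 1) - m))%Z with (2 * m)%Z in R by lia.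
      rewrite Hi, Q. replace (IZR m * (2 * w)) with (IZR (2 * m) * w) by (rewrite mult_IZR; ring). trivial.
Qed.

Definition attains (t p q : R) : Prop := exists x y b, reach 0 t x y /\ F b /\
  rd (x + b) = p /\ rd (y + b) = q /\ inr (x + b) /\ inr (y + b).

(** q is so much larger than |p| that it absorbs every increment on the way from 0 to p; the bias is
    0 and the difference q - p may exceed [Om]. *)
Lemma attain_far t p q : F t -> bp (em + 3) <= t -> F p -> F q -> bp (em + 3) <= q -> Rabs p <= q / 8 ->
  attains t p q.
Proof.
  intros Ft Lt Fp Fq Lq Hp. pose proof (bp_pos (em + 3)) as Pe. pose proof M_ge as M3.
  assert (R1 : reach 0 t 0 q).
  { apply reach_right; trivial. eapply Rle_trans; [|apply Lq]. apply bp_le; lia. }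
  assert (R2 : reach 0 q p q).
  { destruct (rep_big q 3 Fq Lq ltac:(lia)) as (n & a & Hn & Ha & Q). pose proof (bp_pos a) as Pa.
    destruct (absorb_by q n a Fq Hn ltac:(lia) Q) as [Ab1 Ab2].
    assert (B3 : bp a = 8 * bp (a - 3)).
    { replace a with (3 + (a - 3))%Z at 1 by lia. rewrite bp_P. reflexivity. }
    assert (Lp : Rabs p <= bp (Mz + 1 + (a - 3))).
    { assert (8 * bp (Mz + 1 + (a - 3)) = bp (Mz + 1 + a)).
      { replace (Mz + 1 + a)%Z with (3 + (Mz + 1 + (a - 3)))%Z by lia. rewrite bp_P. reflexivity. }
      assert (q < bp (Mz + 1 + a)); [|lra].
      rewrite Q, <- (bp_mul_IZR (Mz + 1) a) by lia. apply Rmult_lt_compat_r; [trivial|apply IZR_lt; lia]. }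
    destruct (Rle_dec 0 p) as [C|C].
    - rewrite Rabs_pos_eq in Lp by trivial.
      apply (ladder_up rd Hr z Hz q (a - 3)); trivial; try lia; try lra; [|apply F_0].
      intros T HT. apply Ab1. lra.
    - rewrite Rabs_left1 in Lp by lra. apply reach_opp; trivial. rewrite Ropp_0.
      apply (ladder_up _ (rspec_opp _ Hr) z Hz (- q) (a - 3)); try lia; try lra; try (apply F_opp; trivial); [|apply F_0].
      intros T HT. destruct (Ab2 (- T) ltac:(lra)) as [A1 A2].
      replace (- (- q + T)) with (q + - T) by ring. split; [lra|].
      replace (- q + T) with (- (q + - T)) by ring. apply inr_opp; trivial. }
  exists p, q, 0. rewrite !Rplus_0_r, !(rd_id rd Hr) by trivial.
  repeat split; trivial; try (apply inr_le, F_le_Om; trivial); [|apply F_0].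
  eapply reach_trans; eauto.
Qed.

Lemma round_up_ex x : 0 < x <= Om -> exists U, F U /\ x <= U /\ (forall y, F y -> y < U -> y < x).
Proof.
  intros Hx. destruct (classic (F x)) as [Fx|NF].
  - exists x. repeat split; trivial; lra.
  - destruct (bracket x ltac:(rewrite Rabs_pos_eq; lra) NF) as (n & a & Ha & L & F1 & F2 & _ & _ & Hc).
    exists ((IZR n + 1) * bp a). repeat split; trivial; try lra.
    intros y Fy Ly. destruct (no_float_between n a y Fy ltac:(lia) Hc); lra.
Qed.

(** The bias shifts both values, so only the difference D = q - p has to be produced. As D need not
    be a float, U is D rounded up, the first accumulator starts at the slack l = U - D, and the bias
    is q - U. *)
Lemma attain_near t p q : F t -> bp (em + 3) <= t -> F p -> F q -> 0 < q -> Rabs p <= q -> p <> q ->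
  q - p <= Om -> ~ (bp (em + 3) <= q /\ Rabs p <= q / 8) -> attains t p q.
Proof.
  intros Ft Lt Fp Fq Pq Hp Npq HO NA. pose proof M_ge as M3. pose proof pow_M_8 as P8. pose proof pow_M1 as PM1.
  apply Rabs_le_inv in Hp.
  set (D := q - p) in *. assert (D0 : 0 < D) by (unfold D; lra).
  destruct (round_up_ex D ltac:(lra)) as (U & FU & LU & GU).
  (* If D is not a float, then D >= q/2, since otherwise Sterbenz's lemma applies to q and p. Hence
     q/2 <= U <= 2q, and the same lemma makes q - U a float. If D is a float, then q - U = p. *)
  assert (Fb : F (q - U) /\ (~ F D -> D >= q / 2)).
  { assert (ND : ~ F D -> D >= q / 2).
    { intros ND. apply Rnot_lt_ge; intros C. apply ND. unfold D. apply sterbenz with (rd := rd) (z := z); trivial; unfold D in C; lra. }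
    split; trivial.
    destruct (classic (F D)) as [FD|NF].
    - assert (U = D).
      { destruct (Rle_lt_or_eq_dec _ _ LU) as [L|L]; [|lra]. specialize (GU D FD L). lra. }
      rewrite H. unfold D. replace (q - (q - p)) with p by ring. trivial.
    - specialize (ND NF). apply (sterbenz rd Hr z Hz); trivial. split; [|lra].
      assert (U <= 2 * q); [|lra]. apply Rnot_lt_le; intros C.
      assert (F (2 * q)).
      { destruct (F_canon q Fq) as (n & a & Hn & Ha & Q & _).
        assert (Q' : 2 * q = IZR n * bp (a + 1)) by (rewrite bp_S, Q; ring).
        rewrite Q'. apply F_intro; try lia. rewrite <- Q'. apply F_le_Om, Rabs_le_inv in FU. rewrite Rabs_pos_eq; lra. }
      specialize (GU _ H C). unfold D in GU. lra. }
  destruct Fb as [Fb ND].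
  set (l := U - D). assert (l0 : 0 <= l) by (unfold l; lra).
  assert (Fl : F l).
  { destruct (classic (F D)) as [FD|NF].
    - assert (U = D).
      { destruct (Rle_lt_or_eq_dec _ _ LU) as [L|L]; [|lra]. specialize (GU D FD L). lra. }
      unfold l. rewrite H, Rminus_diag. apply F_0.
    - specialize (ND NF).
      destruct (Fpos_rep U FU ltac:(lra)) as (nU & aU & HnU & HaU & QU & HcU).
      destruct (F_canon q Fq) as (nq & aq & Hnq & Haq & Qq & _).
      destruct (F_canon p Fp) as (np & ap & Hnp & Hap & Qp & _).
      pose proof (bp_pos aU) as PaU.
      assert (U2 : U <= 2 * q).
      { destruct (Rle_dec (2 * q) Om) as [C|C].
        - apply Rnot_lt_le; intros C'.
          assert (F (2 * q)).
          { assert (Q' : 2 * q = IZR nq * bp (aq + 1)) by (rewrite bp_S, Qq; ring).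
            rewrite Q'. apply F_intro; try lia. rewrite <- Q'. rewrite Rabs_pos_eq; lra. }
          specialize (GU _ H C'). unfold D in GU. lra.
        - apply F_le_Om, Rabs_le_inv in FU. lra. }
      assert (Bnd : forall n c x, (Z.abs n < 2 ^ (Mz + 1))%Z -> x = IZR n * bp c -> Rabs x < bp (Mz + 1 + c)).
      { intros n c x Hn ->. rewrite Rabs_mult, <- abs_IZR, (Rabs_pos_eq (bp _)) by (left; apply bp_pos).
        rewrite <- (bp_mul_IZR (Mz + 1) c) by lia. apply Rmult_lt_compat_r; [apply bp_pos|apply IZR_lt; trivial]. }
      pose proof (Bnd nq aq q Hnq Qq) as Lq. rewrite Rabs_pos_eq in Lq by lra.
      pose proof (Bnd np ap p Hnp Qp) as Lp.
      (* q, p and U are multiples of 2^mu because |p| > q/8 outside the far case and U <= 2q. So l,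
         smaller than the unit of U, has a significand below 16. *)
      set (mu := Z.max (em - Mz) (aU - 4)).
      assert (LaU : aU = (em - Mz)%Z \/ bp (Mz + aU) <= U).
      { destruct HcU as [HcU|HcU]; [left; trivial|right]. rewrite QU, <- bp_mul_IZR by lia.
        apply Rmult_le_compat_r; [lra|apply IZR_le; lia]. }
      assert (Aq : (mu <= aq)%Z).
      { unfold mu. destruct LaU as [LaU|LaU]; [lia|].
        assert (Mz + aU < Mz + 1 + aq + 1)%Z; [|lia]. apply bp_lt_inv. rewrite (bp_S (Mz + 1 + aq)). lra. }
      assert (Ap : (mu <= ap)%Z).
      { unfold mu. destruct LaU as [LaU|LaU]; [lia|].
        destruct (Rle_dec (bp (em + 3)) q) as [C|C].
        - assert (q / 8 < Rabs p) by (apply Rnot_le_lt; intros C'; apply NA; auto).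
          assert (Mz + aU < Mz + 1 + ap + 4)%Z; [|lia]. apply bp_lt_inv.
          rewrite (Z.add_comm _ 4), bp_P. change (2 ^ 4)%Z with 16%Z. lra.
        - assert (Mz + aU < em + 3 + 1)%Z; [|lia]. apply bp_lt_inv. rewrite (bp_S (em + 3)). lra. }
      assert (Lu : l < bp aU).
      { assert (U - bp aU < D); [|unfold l; lra]. apply GU; [|lra].
        assert (1 <= nU)%Z.
        { assert (0 < nU)%Z; [|lia]. apply lt_IZR. apply Rmult_lt_reg_r with (bp aU); [trivial|]. rewrite <- QU. lra. }
        replace (U - bp aU) with (IZR (nU - 1) * bp aU) by (rewrite QU, minus_IZR; ring).
        apply F_intro; try lia. apply F_le_Om in FU. rewrite minus_IZR, Rmult_minus_distr_r, Rmult_1_l, <- QU.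
        apply Rabs_le_inv in FU. assert (1 <= IZR nU) by (apply IZR_le; lia). apply Rabs_le. nra. }
      pose proof (bp_pos mu) as Pmu.
      assert (Ql : exists k, l = IZR k * bp mu).
      { exists (nU * 2 ^ (aU - mu) - nq * 2 ^ (aq - mu) + np * 2 ^ (ap - mu))%Z.
        rewrite plus_IZR, minus_IZR, Rmult_plus_distr_r, Rmult_minus_distr_r.
        rewrite <- !F_rescale by (unfold mu; lia). unfold l, D. lra. }
      destruct Ql as [k Qk].
      assert (bp aU <= 16 * bp mu).
      { change 16 with (IZR (2 ^ 4)). rewrite <- bp_P. apply bp_le. unfold mu; lia. }
      assert (0 <= k)%Z by (apply le_IZR; nra).
      assert (k < 16)%Z by (apply lt_IZR; nra).
      rewrite Qk. apply F_intro; try (unfold mu; lia). rewrite <- Qk, Rabs_pos_eq by lra.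
      apply F_le_Om, Rabs_le_inv in FU. unfold l. lra. }
  exists l, U, (q - U). split; [|split; trivial].
  - apply reach_slack; trivial; try lra. intros x Fx Lx. unfold l. replace (U - (U - D)) with D by ring. auto.
  - replace (l + (q - U)) with p by (unfold l, D; ring). replace (U + (q - U)) with q by ring.
    rewrite !(rd_id rd Hr) by trivial. repeat split; trivial; apply inr_le, F_le_Om; trivial.
Qed.

Lemma attain t p q : F t -> bp (em + 3) <= t -> F p -> F q -> 0 < q -> Rabs p <= q -> p <> q ->
  (q - p <= Om \/ (bp (em + 3) <= q /\ Rabs p <= q / 8)) -> attains t p q.
Proof.
  intros Ft Lt Fp Fq Pq Hp N Or.
  destruct (classic (bp (em + 3) <= q /\ Rabs p <= q / 8)) as [[A1 A2]|A].
  - apply attain_far; trivial.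
  - apply attain_near; trivial. tauto.
Qed.

(** Any product with |al| <= eps/2 has modulus at most (eps/2) [Om], which is below half of the top
    spacing. Q strictly above 2^eM ensures that the spacing below Q is not halved. *)
Lemma top_absorbs Q al v : F Q -> bp eM < Q -> Rabs al <= eps M / 2 -> F v ->
  rd (Q + rd (al * v)) = Q /\ inr (Q + rd (al * v)) /\ inr (al * v).
Proof.
  intros FQ LQ Hal Fv. pose proof M_ge as M3. pose proof M_le as ME. pose proof emax_ge as E15. pose proof pow_M_pos as P1.
  pose proof (emin_emax (E:=E)) as EE. rewrite eps_bp in Hal.
  replace (bp (- Mz - 1)) with (2 * bp (- Mz - 2)) in Hal by (rewrite <- bp_S; f_equal; lia).
  apply F_le_Om in Fv. pose proof (bp_pos (- Mz - 2)) as Pm.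
  set (f := IZR (2 ^ (Mz + 1) - 1) * bp (eM - 2 * Mz - 2)).
  assert (Qf : f = bp (- Mz - 2) * Om).
  { unfold f. rewrite Om_mult. replace (eM - 2 * Mz - 2)%Z with (- Mz - 2 + (eM - Mz))%Z by lia. rewrite bp_add. ring. }
  assert (Ff : F f) by (apply F_small; lia).
  assert (Bv : Rabs (al * v) <= f).
  { rewrite Rabs_mult, Qf. apply Rmult_le_compat; try apply Rabs_pos; lra. }
  assert (Lf : f < bp (eM - Mz - 1)).
  { rewrite Qf. apply Rlt_le_trans with (bp (- Mz - 2) * bp (eM + 1)).
    - apply Rmult_lt_compat_l; trivial. apply Om_lt.
    - rewrite <- bp_add. apply bp_le. lia. }
  assert (BT : Rabs (rd (al * v)) <= f).
  { apply Rabs_le_inv in Bv. apply Rabs_le. split.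
    - apply (rd_lb rd Hr); [apply F_opp; trivial|lra].
    - apply (rd_ub rd Hr); trivial; lra. }
  assert (f0 : 0 <= f) by (pose proof (Rabs_pos (al * v)); lra).
  assert (K : exists n, (2 ^ Mz < n < 2 ^ (Mz + 1))%Z /\ Q = IZR n * bp (eM - Mz)).
  { destruct (rep_big Q 1 FQ) as (n & a & Hn & Ha & Q1); try lia.
    { apply Rle_trans with (bp eM); [apply bp_le; lia|lra]. }
    assert (a = (eM - Mz)%Z).
    { assert (eM < Mz + 1 + a)%Z; [|lia]. apply bp_lt_inv. eapply Rlt_trans; [apply LQ|].
      rewrite Q1, <- (bp_mul_IZR (Mz + 1) a) by lia. apply Rmult_lt_compat_r; [apply bp_pos|apply IZR_lt; lia]. }
    subst a. exists n; split; trivial. split; [|lia]. apply lt_IZR.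
    apply Rmult_lt_reg_r with (bp (eM - Mz)); [apply bp_pos|]. rewrite bp_mul_IZR, <- Q1 by lia.
    replace (Mz + (eM - Mz))%Z with eM by lia. trivial. }
  destruct K as (n & Hn & Q1).
  assert (B2 : bp (eM - Mz) = 2 * bp (eM - Mz - 1)) by (rewrite <- bp_S; f_equal; lia).
  set (T := rd (al * v)) in *. split; [|split].
  - apply Rabs_le_inv in BT. destruct (Rle_dec 0 T) as [C|C].
    + apply (rd_absorb_up rd Hr Q (bp (eM - Mz))); trivial; [|lra].
      intros x Fx Lx. rewrite Q1 in *. apply gap_up; trivial; lia.
    + apply (rd_absorb_dn rd Hr Q (bp (eM - Mz))); trivial; [|lra].
      intros x Fx Lx. rewrite Q1 in *. apply gap_dn; trivial; lia.
  - unfold in_range. rewrite rnd_c_bp. apply F_le_Om in FQ. pose proof (Rabs_triang Q T). lra.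
  - apply inr_le. eapply Rle_trans; [apply Bv|]. pose proof (Om_ge (E:=E) (M:=M)).
    assert (bp (eM - Mz - 1) <= bp eM) by (apply bp_le; lia). lra.
Qed.

End Pairs.

(** * Scalar rows driven by one bit *)

Section ScalarRows.
Variables (E M : nat) (rd : R -> R).

Definition srun (x : R) (ps : list R) : R := fold_left (fun acc p => rd (acc + rd p)) ps x.

Fixpoint ssafe (x : R) (ps : list R) : Prop :=
  match ps with
  | [] => True
  | p :: ps' => in_range E M p /\ in_range E M (x + rd p) /\ ssafe (rd (x + rd p)) ps'
  end.

Lemma srun_app x ps ps' : srun x (ps ++ ps') = srun (srun x ps) ps'.
Proof. apply fold_left_app. Qed.

Lemma ssafe_app x ps ps' : ssafe x (ps ++ ps') <-> ssafe x ps /\ ssafe (srun x ps) ps'.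
Proof.
  revert x; induction ps as [|v ps IH]; intros x; simpl; [tauto|].
  rewrite IH; tauto.
Qed.

Lemma srun_run z x ws : srun x (map (Rmult z) ws) = run rd z x ws.
Proof. revert x; induction ws as [|v ws IH]; intros x; simpl; [trivial|apply IH]. Qed.

Lemma ssafe_safe z x ws : Forall (good E M z) ws -> safe E M rd z x ws -> ssafe x (map (Rmult z) ws).
Proof.
  intros G; revert x; induction G as [|v ws [_ H] G IH]; intros x; simpl; [trivial|].
  intros [S1 S2]. auto.
Qed.

(* A term ((u0, u1), v) is an input with weight v that takes the value u0 or u1
   according to the bit which drives the row. *)
Definition psel (c : bool) (t : (R * R) * R) : R := (if c then snd (fst t) else fst (fst t)) * snd t.

Definition row_outputs (c : bool) (ts : list ((R * R) * R)) (b y : R) : Prop :=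
  ssafe 0 (map (psel c) ts) /\ in_range E M (srun 0 (map (psel c) ts) + b) /\ rd (srun 0 (map (psel c) ts) + b) = y.

(* One affine row, fed with the constant ze and with an input that is A or B according to a bit,
   outputs P or Q accordingly; all terms move in the same direction, so interval evaluation is exact. *)
Definition drives (ze A B P Q : R) : Prop := exists ts b, isF E M b /\
  Forall (fun t => isF E M (snd t) /\ (fst t = (ze, ze) \/ fst t = (A, B))) ts /\
  (Forall (fun t => psel false t <= psel true t) ts \/ Forall (fun t => psel true t <= psel false t) ts) /\
  row_outputs false ts b P /\ row_outputs true ts b Q.

Definition tswap (t : (R * R) * R) : (R * R) * R := ((snd (fst t), fst (fst t)), snd t).

Lemma psel_swap c t : psel c (tswap t) = psel (negb c) t.
Proof. destruct c; reflexivity. Qed.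

Lemma outputs_swap c ts b y : row_outputs c ts b y -> row_outputs (negb c) (map tswap ts) b y.
Proof.
  unfold row_outputs. rewrite map_map. erewrite map_ext; [intros H; exact H|].
  intros t; simpl. rewrite psel_swap, negb_involutive; trivial.
Qed.

Lemma drives_swap ze A B P Q : drives ze A B P Q -> drives ze B A Q P.
Proof.
  intros (ts & b & Fb & HF & Hd & O1 & O2). exists (map tswap ts), b. split; [trivial|].
  split; [|split; [|split; [apply (outputs_swap true)|apply (outputs_swap false)]; trivial]].
  - apply Forall_map. eapply Forall_impl; [|apply HF]. intros t [H1 [H2|H2]]; split; trivial; unfold tswap; rewrite H2; auto.
  - rewrite !Forall_map. destruct Hd as [Hd|Hd]; [right|left]; eapply Forall_impl; try apply Hd; intros t H; rewrite !psel_swap; trivial.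
Qed.

End ScalarRows.

Definition topp (t : (R * R) * R) : (R * R) * R := (fst t, - snd t).

Lemma psel_opp c t : psel c (topp t) = - psel c t.
Proof. unfold psel, topp; simpl; ring. Qed.

Lemma drives_opp E M {fp : FP E M} rd ze A B P Q :
  drives E M (fun x => - rd (- x)) ze A B (- P) (- Q) -> drives E M rd ze A B P Q.
Proof.
  intros (ts & b & Fb & HF & Hd & O1 & O2).
  assert (S : forall ps x, srun (fun x => - rd (- x)) (- x) ps = - srun rd x (map Ropp ps)).
  { induction ps as [|p ps IH]; intros x; simpl; trivial. rewrite <- IH. f_equal. f_equal. f_equal. ring. }
  assert (T : forall ps x, ssafe E M (fun x => - rd (- x)) (- x) ps -> ssafe E M rd x (map Ropp ps)).
  { induction ps as [|p ps IH]; intros x; simpl; trivial.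
    replace (- x + - rd (- p)) with (- (x + rd (- p))) by ring. rewrite !Ropp_involutive.
    intros (H1 & H2 & H3). apply inr_opp in H1, H2. rewrite Ropp_involutive in H2. auto. }
  assert (N : forall c y, row_outputs E M (fun x => - rd (- x)) c ts b (- y) -> row_outputs E M rd c (map topp ts) (- b) y).
  { intros c y (H1 & H2 & H3). unfold row_outputs.
    replace (map (psel c) (map topp ts)) with (map Ropp (map (psel c) ts))
      by (rewrite !map_map; apply map_ext; intros; rewrite psel_opp; trivial).
    rewrite <- Ropp_0 in H1, H2, H3. rewrite S in H2, H3.
    replace (- srun rd 0 (map Ropp (map (psel c) ts)) + b) with (- (srun rd 0 (map Ropp (map (psel c) ts)) + - b)) in H2, H3 by ring.
    apply inr_opp in H2. rewrite Ropp_involutive in H2, H3. repeat split; trivial; [apply T; trivial|lra]. }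
  exists (map topp ts), (- b). split; [apply F_opp; trivial|]. split; [|split; [|split; apply N; trivial]].
  - apply Forall_map. eapply Forall_impl; [|apply HF]. intros t [H1 H2]; split; trivial. apply F_opp; trivial.
  - rewrite !Forall_map. destruct Hd as [Hd|Hd]; [right|left]; eapply Forall_impl; try apply Hd; intros t H; rewrite !psel_opp; apply Ropp_le_contravar; trivial.
Qed.

(** * Rows that realise a prescribed pair of outputs *)

Section PairRows.
Context {E M : nat} {fp : FP E M}.
Variable rd : R -> R.
Hypothesis Hr : rspec (E:=E) (M:=M) rd.
Variable z : R.
Hypothesis Hz : isF E M z /\ eps M / 2 + 2 * eps M ^ 2 <= z <= 5 / 4 - 2 * eps M.
Variable ze : R.
Hypothesis Hze : ze = z \/ ze = - z.
Local Set Default Proof Using "fp Hr Hz Hze".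

Local Notation Mz := (Z.of_nat M).
Local Notation pow_M1 := (pow2_S M).
Local Notation em := (emin E).
Local Notation eM := (emax E).
Local Notation F := (isF E M).
Local Notation w := (omega E M).
Local Notation Om := (Omega E M).
Local Notation wpos := (w_pos (E:=E) (M:=M)).
Local Notation inr := (in_range E M).
Local Notation good := (good E M z).
Local Notation run := (run rd z).
Local Notation safe := (safe E M rd z).
Local Notation reach := (reach E M rd z).
Local Notation srun := (srun rd).
Local Notation ssafe := (ssafe E M rd).
Local Notation outputs := (row_outputs E M rd).
Local Notation drives := (drives E M rd ze).

Definition zsg : R := if Req_EM_T ze z then 1 else -1.

Lemma zsg_mul : zsg * ze = z /\ (zsg = 1 \/ zsg = -1).
Proof. unfold zsg. destruct (Req_EM_T ze z); destruct Hze; lra. Qed.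

Lemma zsg_F v : F v -> F (zsg * v).
Proof.
  intros Fv. destruct zsg_mul as [_ [-> | ->]]; [rewrite Rmult_1_l; trivial|].
  replace (-1 * v) with (- v) by ring. apply F_opp; trivial.
Qed.

Definition cterm (v : R) : (R * R) * R := ((ze, ze), zsg * v).

Lemma psel_cterm c v : psel c (cterm v) = z * v.
Proof.
  destruct zsg_mul as [H _]. unfold psel, cterm; simpl. rewrite <- H. destruct c; ring.
Qed.

Lemma psel_cterms c ws : map (psel c) (map cterm ws) = map (Rmult z) ws.
Proof. rewrite map_map. apply map_ext, psel_cterm. Qed.

Lemma cterm_F ws X : Forall good ws -> Forall (fun t => F (snd t) /\ (fst t = (ze, ze) \/ X t)) (map cterm ws).
Proof.
  intros G. apply Forall_map. eapply Forall_impl; [|apply G]. intros v [H _]; simpl. split; auto. apply zsg_F; trivial.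
Qed.

(** A power of two brings the gap of the codes to at least 2^(em+4), and constant increments cancel
    the image of A. The rounding errors cost at most half of that gap, which leaves t >= 2^(em+3),
    where [reach_right] can start. *)
Lemma start_pair A B : F A -> F B -> 32 * w <= Rabs (B - A) ->
  exists kw ws t, F kw /\ Forall good ws /\ F t /\ bp (em + 3) <= t /\ safe 0 ws /\
    inr (A * kw) /\ inr (B * kw) /\ inr (run 0 ws + rd (A * kw)) /\ inr (run 0 ws + rd (B * kw)) /\
    rd (run 0 ws + rd (A * kw)) = 0 /\ rd (run 0 ws + rd (B * kw)) = t.
Proof.
  intros FA FB HD. pose proof wpos as Pw.
  pose proof (emin_emax (E:=E)) as EE. pose proof emax_ge as E15. pose proof M_ge as M3. pose proof M_le as ME.
  set (d := Rabs (B - A)) in *.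
  (* For d < 1 the exponent normalises the gap. The codes themselves do not overflow, since distinct
     floats have a relative gap of at least 2^(-M-2); and d >= 32 w keeps the exponent at most M -
     1, hence at most eM. *)
  assert (K : exists k, (em - Mz <= k <= eM)%Z /\ bp (em + 4) <= d * bp k /\ (d * bp k <= 1 \/ (k = em + 4)%Z) /\
     Rabs (A * bp k) <= Om /\ Rabs (B * bp k) <= Om).
  { assert (Big : forall u k, F u -> (k <= 0)%Z -> Rabs (u * bp k) <= Om).
    { intros u k Fu Hk. apply F_le_Om in Fu. rewrite Rabs_mult, (Rabs_pos_eq (bp k)) by (left; apply bp_pos).
      pose proof (bp_le k 0 Hk) as Lk. rewrite bp_0 in Lk. pose proof (Rabs_pos u). pose proof (bp_pos k). nra. }
    destruct (Rle_dec 1 d) as [C|C].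
    - exists (em + 4)%Z. split; [lia|]. pose proof (bp_pos (em + 4)). split; [nra|]. split; [auto|].
      split; apply Big; trivial; lia.
    - destruct (dyadic' d ltac:(lra)) as (j & J1 & J2).
      assert (Hj : (em - Mz + 5 <= j)%Z).
      { assert (em - Mz + 5 < j + 1)%Z; [|lia]. apply bp_lt_inv. eapply Rle_lt_trans; [|apply J2].
        rewrite (Z.add_comm _ 5), bp_P, <- w_bp. change (2 ^ 5)%Z with 32%Z. lra. }
      assert (Hj0 : (j < 0)%Z).
      { apply bp_lt_inv. rewrite bp_0. lra. }
      assert (Bd : forall u v, F u -> F v -> u <> v -> Rabs (v - u) = d -> Rabs u < bp (Mz + 3 + j)).
      { intros u v Fu Fv N Q. pose proof (F_diff_ge rd Hr u v Fu Fv N) as L. rewrite Q in L.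
        apply Rmult_lt_reg_r with (bp (- Mz - 2)); [apply bp_pos|]. rewrite <- bp_add.
        replace (Mz + 3 + j + (- Mz - 2))%Z with (j + 1)%Z by lia. lra. }
      assert (NAB : A <> B).
      { intros ->. unfold d in HD. rewrite Rminus_diag, Rabs_R0 in HD. lra. }
      exists (em + 4 - j)%Z. split; [lia|]. pose proof (bp_pos (em + 4 - j)).
      assert (Q4 : bp (em + 4) = bp j * bp (em + 4 - j)) by (rewrite <- bp_add; f_equal; lia).
      assert (Q5 : bp (em + 5) = bp (j + 1) * bp (em + 4 - j)) by (rewrite <- bp_add; f_equal; lia).
      assert (L1 : bp (em + 5) <= 1) by (rewrite <- bp_0; apply bp_le; lia).
      assert (SB : forall u, Rabs u < bp (Mz + 3 + j) -> Rabs (u * bp (em + 4 - j)) <= Om).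
      { intros u Hu. rewrite Rabs_mult, (Rabs_pos_eq (bp (em + 4 - j))) by lra.
        apply Rle_trans with (bp (Mz + 3 + j) * bp (em + 4 - j)); [nra|]. rewrite <- bp_add.
        apply Rle_trans with (bp eM); [apply bp_le; lia|apply Om_ge]. }
      split; [rewrite Q4; nra|]. split; [left; nra|].
      split; apply SB; [apply (Bd A B)|apply (Bd B A)]; trivial.
      + intros ->; auto.
      + unfold d; apply Rabs_minus_sym. }
  destruct K as (k & Hk & L & Up & OA & OB). pose proof (bp_pos k) as Pk.
  set (s := if Rle_dec A B then 1 else -1).
  assert (Hs : (s = 1 \/ s = -1) /\ s * (B - A) = d).
  { unfold s, d. destruct (Rle_dec A B); [rewrite Rabs_pos_eq by lra|rewrite Rabs_left1 by lra]; split; auto; lra. }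
  destruct Hs as [Hs Hd]. set (kw := s * bp k).
  assert (Fkw : F kw).
  { unfold kw. assert (F (bp k)) by (apply F_bp; lia). destruct Hs as [-> | ->]; [rewrite Rmult_1_l; trivial|].
    replace (-1 * bp k) with (- bp k) by ring. apply F_opp; trivial. }
  assert (Ab : forall u, Rabs (u * kw) = Rabs (u * bp k)).
  { intros u. unfold kw. destruct Hs as [-> | ->]; [rewrite Rmult_1_l; trivial|].
    replace (u * (-1 * bp k)) with (- (u * bp k)) by ring. apply Rabs_Ropp. }
  set (a0 := rd (A * kw)). set (b0 := rd (B * kw)).
  assert (Fa0 : F a0) by apply (rd_F rd Hr). assert (Fb0 : F b0) by apply (rd_F rd Hr).
  pose proof (scale_err rd Hr A s k FA Hs OA) as EA. pose proof (scale_err rd Hr B s k FB Hs OB) as EB.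
  fold kw in EA, EB. fold a0 in EA. fold b0 in EB. apply Rabs_le_inv in EA, EB.
  assert (Dif : B * kw - A * kw = d * bp k) by (unfold kw; rewrite <- Hd; ring).
  assert (Lw : w <= bp (em + 3)) by (rewrite w_bp; apply bp_le; lia).
  assert (L34 : bp (em + 4) = 2 * bp (em + 3)) by (rewrite <- bp_S; f_equal; lia).
  assert (In1 : Rabs (b0 - a0) <= Om).
  { pose proof (Om_ge (E:=E) (M:=M)). pose proof (bp_pos (em + 3)).
    assert (bp 2 <= bp eM) by (apply bp_le; lia). change (bp 2) with (2 * (2 * 1)) in H1.
    destruct Up as [Up|Up].
    - assert (w <= 1) by (rewrite <- bp_0, w_bp; apply bp_le; lia). apply Rabs_le. lra.
    - assert (d <= 2 * Om).
      { unfold d. apply F_le_Om, Rabs_le_inv in FA, FB. apply Rabs_le. lra. }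
      assert (bp k <= / 4).
      { replace (/ 4) with (bp (-2)) by (unfold bp; simpl; field). apply bp_le. lia. }
      assert (d * bp k <= Om / 2) by nra.
      assert (w <= 1) by (rewrite <- bp_0, w_bp; apply bp_le; lia). apply Rabs_le. lra. }
  assert (Pre : exists ws, Forall good ws /\ safe 0 ws /\ run 0 ws = - a0).
  { assert (Fn : F (- a0)) by (apply F_opp; trivial).
    destruct (Rle_dec 0 (- a0)) as [C|C].
    - destruct (climb rd Hr z Hz (- a0) Fn C) as (ws & ? & ? & ? & ? & ?). exists ws; auto.
    - assert (R1 : reach 0 0 (- a0) (- a0)).
      { apply reach_opp; trivial. rewrite Ropp_0. apply (climb _ (rspec_opp _ Hr) z Hz); [apply F_opp; trivial|lra]. }
      destruct R1 as (ws & ? & ? & ? & ? & ?). exists ws; auto. }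
  destruct Pre as (ws & G & Sf & Rn).
  exists kw, ws, (rd (b0 - a0)). rewrite Rn. fold a0 b0.
  replace (- a0 + b0) with (b0 - a0) by ring. rewrite Rplus_opp_l.
  repeat split; trivial; try (apply inr_le; rewrite ?Ab; trivial).
  - apply (rd_F rd Hr).
  - apply (rd_lb rd Hr); [apply F_bp; lia|]. lra.
  - rewrite Rabs_R0. pose proof (Om_ge (E:=E) (M:=M)); pose proof (bp_pos eM); lra.
  - apply (rd_0 rd Hr).
Qed.

Lemma one_driver A B kw ws1 ws2 b P Q : F kw -> Forall good ws1 -> Forall good ws2 -> F b -> safe 0 ws1 ->
  (forall u y, (u, y) = (A, P) \/ (u, y) = (B, Q) -> inr (u * kw) /\ inr (run 0 ws1 + rd (u * kw)) /\
     safe (rd (run 0 ws1 + rd (u * kw))) ws2 /\ inr (run (rd (run 0 ws1 + rd (u * kw))) ws2 + b) /\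
     rd (run (rd (run 0 ws1 + rd (u * kw))) ws2 + b) = y) ->
  drives A B P Q.
Proof.
  intros Fk G1 G2 Fb S1 H. exists (map cterm ws1 ++ ((A, B), kw) :: map cterm ws2), b.
  assert (O : forall (c : bool) y, ((if c then B else A), y) = (A, P) \/ ((if c then B else A), y) = (B, Q) ->
     outputs c (map cterm ws1 ++ ((A, B), kw) :: map cterm ws2) b y).
  { intros c y Hc. destruct (H _ _ Hc) as (H1 & H2 & H3 & H4 & H5). unfold row_outputs.
    rewrite map_app, map_cons, !psel_cterms.
    replace (psel c ((A, B), kw)) with ((if c then B else A) * kw) by reflexivity.
    rewrite srun_app, ssafe_app. simpl. rewrite !srun_run. repeat split; trivial; apply ssafe_safe; trivial. }
  split; [trivial|]. split; [|split; [|split; apply O; auto]].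
  - apply Forall_app; split; [apply cterm_F; trivial|]. constructor; [simpl; auto|apply cterm_F; trivial].
  - assert (C : forall ws c c', Forall (fun t => psel c t <= psel c' t) (map cterm ws)).
    { intros ws c c'. apply Forall_map, Forall_forall. intros v _. rewrite !psel_cterm. lra. }
    destruct (Rle_dec (A * kw) (B * kw)) as [L|L]; [left|right];
      apply Forall_app; split; auto; constructor; auto; unfold psel; simpl; lra.
Qed.

Lemma drives_attain A B P Q : F A -> F B -> 32 * w <= Rabs (B - A) -> F P -> F Q -> 0 < Q -> Rabs P <= Q -> P <> Q ->
  (Q - P <= Om \/ (bp (em + 3) <= Q /\ Rabs P <= Q / 8)) -> drives A B P Q.
Proof.
  intros FA FB HD FP FQ PQ LP N Or.
  destruct (start_pair A B FA FB HD) as (kw & ws1 & t & Fk & G1 & Ft & Lt & S1 & I1 & I2 & I3 & I4 & R0 & Rt).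
  destruct (attain rd Hr z Hz t P Q Ft Lt FP FQ PQ LP N Or) as (x & y & b & (ws2 & G2 & S2 & S3 & Rx & Ry) & Fb & Ex & Ey & Ix & Iy).
  apply (one_driver A B kw ws1 ws2 b); trivial.
  intros u v [H|H]; injection H as -> ->; [rewrite R0, Rx|rewrite Rt, Ry]; repeat split; trivial.
Qed.

(* When c1 and c2 are so far apart that their difference overflows, the pair is produced
   with the help of an input whose two values are ze and a value negligible next to Q. *)
Lemma drives_split al P Q : F al -> 0 < zsg * al <= eps M / 2 -> 32 * w <= Rabs (al - ze) ->
  F P -> F Q -> P < 0 -> Rabs P <= Q -> Om < Q - P -> drives ze al P Q.
Proof.
  intros Fal Hal HD FP FQ P0 LP HO. pose proof M_ge as M3. pose proof emax_ge as E15.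
  pose proof (emin_emax (E:=E)) as EE. rewrite Rabs_left1 in LP by lra.
  destruct zsg_mul as [Zm Zs]. pose proof (z_bounds rd Hr z Hz) as Zb. pose proof pow_M_8 as P8.
  assert (Fze : F ze) by (destruct Hze as [-> | ->]; [apply Hz|apply F_opp, Hz]).
  (* A float below 2^eM is at most 2^eM - 2^(eM-M-1), so Q - P <= 2Q would not exceed [Om]. *)
  assert (LQ : bp eM <= Q).
  { apply Rnot_lt_le; intros C.
    assert (Qe : bp eM = IZR (2 ^ (Mz + 1)) * bp (eM - Mz - 1)) by (rewrite bp_mul_IZR by lia; f_equal; lia).
    rewrite Qe in C. apply gap_dn in C; trivial; try (rewrite ?pow_M1; lia). rewrite <- Qe in C.
    rewrite Om_bp, bp_S in HO. replace (eM - Mz)%Z with (eM - Mz - 1 + 1)%Z in HO by lia. rewrite bp_S in HO. lra. }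
  (* Absorption needs a value strictly above 2^eM. If Q = 2^eM, the targets are moved up by 2^(eM-1)
     and the bias takes this back. *)
  assert (K : exists P' Q' b, F P' /\ F Q' /\ F b /\ P' <= 0 /\ bp eM < Q' /\ P' + b = P /\ Q' + b = Q).
  { destruct (Rle_lt_or_eq_dec _ _ LQ) as [L|L].
    - exists P, Q, 0. repeat split; trivial; try lra. apply F_0.
    - assert (B1 : bp eM = 2 * bp (eM - 1)) by (rewrite <- bp_S; f_equal; lia).
      assert (B3 : bp (eM - Mz) <= bp (eM - 1)) by (apply bp_le; lia).
      rewrite Om_bp, bp_S in HO. pose proof (bp_pos (eM - 1)).
      assert (Fb : F (bp (eM - 1))) by (apply F_bp; lia).
      exists (P + bp (eM - 1)), (3 * bp (eM - 1)), (- bp (eM - 1)). repeat split; try lra.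
      + replace (P + bp (eM - 1)) with (bp (eM - 1) - - P) by ring.
        apply (sterbenz rd Hr z Hz); trivial; [apply F_opp; trivial|lra].
      + replace (3 * bp (eM - 1)) with (IZR (3 * 2 ^ (Mz - 1)) * bp (eM - Mz)).
        * apply F_intro; try lia.
          -- replace (Mz + 1)%Z with (Mz - 1 + 2)%Z by lia. rewrite Z.pow_add_r by lia.
             assert (0 < 2 ^ (Mz - 1))%Z by (apply Z.pow_pos_nonneg; lia). change (2 ^ 2)%Z with 4%Z. lia.
          -- rewrite mult_IZR, Rmult_assoc, (bp_mul_IZR (Mz - 1)) by lia. replace (Mz - 1 + (eM - Mz))%Z with (eM - 1)%Z by lia.
             rewrite Rabs_pos_eq by lra. rewrite Om_bp, bp_S.
             assert (bp (eM - Mz) <= bp (eM - 3)) by (apply bp_le; lia).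
             assert (bp (eM - 1) = 4 * bp (eM - 3)) by (replace (eM - 1)%Z with (2 + (eM - 3))%Z by lia; rewrite bp_P; reflexivity).
             lra.
        * rewrite mult_IZR, Rmult_assoc, (bp_mul_IZR (Mz - 1)) by lia. do 2 f_equal. lia.
      + apply F_opp; trivial. }
  destruct K as (P' & Q' & b & FP' & FQ' & Fb & P0' & LQ' & EP & EQ).
  destruct (start_pair ze al Fze Fal HD) as (kw & ws1 & t & Fk & G1 & Ft & Lt & S1 & I1 & I2 & I3 & I4 & R0 & Rt).
  assert (Lem : bp (em + 2) <= bp eM) by (apply bp_le; lia).
  destruct (reach_right rd Hr z Hz t Q' Ft FQ' Lt ltac:(lra)) as (ws2 & G2 & S2 & S3 & R2 & R3).
  destruct (climb_ex _ (rspec_opp _ Hr) z Hz (- P') ltac:(apply F_opp; trivial) ltac:(lra)) as (vs & Gv & Sv & Rv).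
  assert (Gv' : Forall good vs) by (eapply Forall_impl; [|apply Gv]; simpl; tauto).
  rewrite <- Ropp_0 in Sv, Rv. rewrite run_opp in Rv. apply safe_opp in Sv.
  (* These terms act on the input with values ze and al: at ze they are the steps that lead from 0
     down to P', at al they are negligible and Q' absorbs them. *)
  set (vt := fun v => ((ze, al), - (zsg * v))).
  assert (E1 : map (psel false) (map vt vs) = map (Rmult z) (map Ropp vs)).
  { rewrite !map_map. apply map_ext. intros v. unfold psel, vt; simpl. rewrite <- Zm; ring. }
  assert (Ab : forall us, Forall good us -> ssafe Q' (map (psel true) (map vt us)) /\ srun Q' (map (psel true) (map vt us)) = Q').
  { intros us Gu; induction Gu as [|v us [Fv _] Gu IH]; simpl; [auto|].
    replace (psel true (vt v)) with (al * - (zsg * v)) by reflexivity.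
    assert (Hal' : Rabs al <= eps M / 2).
    { destruct Zs as [Z1 | Z1]; rewrite Z1 in Hal; [rewrite Rabs_pos_eq|rewrite Rabs_left1]; lra. }
    destruct (top_absorbs rd Hr z Hz Q' al (- (zsg * v)) FQ' LQ' Hal') as (T1 & T2 & T3); [apply F_opp, zsg_F; trivial|].
    rewrite T1. tauto. }
  destruct (Ab vs Gv') as [Ab1 Ab2].
  set (ts := map cterm ws1 ++ ((ze, al), kw) :: map cterm ws2 ++ map vt vs).
  assert (O : forall (c : bool) y, (if c then Q else P) = y -> outputs c ts b y).
  { intros c y <-. unfold row_outputs, ts.
    rewrite map_app, map_cons, map_app, !psel_cterms.
    replace (psel c ((ze, al), kw)) with ((if c then al else ze) * kw) by reflexivity.
    rewrite srun_app, ssafe_app. simpl. rewrite srun_app, ssafe_app, !srun_run.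
    destruct c.
    - rewrite Rt, R3, Ab2, EQ, (rd_id rd Hr Q FQ). repeat split; trivial; try (apply ssafe_safe; trivial).
      apply inr_le, F_le_Om; trivial.
    - rewrite R0, R2, E1, srun_run. replace (run 0 (map Ropp vs)) with P' by lra.
      rewrite EP, (rd_id rd Hr P FP). repeat split; trivial; try (apply ssafe_safe; trivial).
      + apply good_opp; trivial.
      + apply inr_le, F_le_Om; trivial. }
  exists ts, b. split; [trivial|]. split; [|split; [|split; apply O; trivial]].
  - apply Forall_app; split; [apply cterm_F; trivial|]. constructor; [simpl; auto|].
    apply Forall_app; split; [apply cterm_F; trivial|]. apply Forall_map. eapply Forall_impl; [|apply Gv'].
    intros v [Fv _]. simpl. split; auto. apply F_opp, zsg_F; trivial.
  - assert (C : forall ws, Forall (fun t => psel false t <= psel true t) (map cterm ws)).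
    { intros ws. apply Forall_map, Forall_forall. intros v _. rewrite !psel_cterm. lra. }
    left. apply Forall_app; split; auto. constructor.
    + unfold psel; simpl. apply Rnot_lt_le; intros L. pose proof (bp_pos (em + 3)).
      pose proof (rd_le rd Hr (al * kw) (ze * kw) ltac:(lra)) as L1.
      pose proof (rd_le rd Hr (run 0 ws1 + rd (al * kw)) (run 0 ws1 + rd (ze * kw)) ltac:(lra)). lra.
    + apply Forall_app; split; auto. apply Forall_map. eapply Forall_impl; [|apply Gv].
      intros v [_ v0]. unfold psel, vt; simpl. destruct Hz as [_ [Hz1 _]].
      assert (0 <= eps M ^ 2) by (apply pow2_ge_0). nra.
Qed.

End PairRows.

Section AnyPair.
Context {E M : nat} {fp : FP E M}.
Variable rd : R -> R.
Hypothesis Hr : rspec (E:=E) (M:=M) rd.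
Variable z : R.
Hypothesis Hz : isF E M z /\ eps M / 2 + 2 * eps M ^ 2 <= z <= 5 / 4 - 2 * eps M.
Variable ze : R.
Hypothesis Hze : ze = z \/ ze = - z.
Local Set Default Proof Using "fp Hr Hz Hze".

Local Notation em := (emin E).
Local Notation F := (isF E M).
Local Notation w := (omega E M).
Local Notation Om := (Omega E M).

(** The pairs that one row can produce directly: the difference does not overflow, or one value
    dominates the other. *)
Definition near_pair (P Q : R) : Prop := Rabs (Q - P) <= Om \/
  (bp (em + 3) <= Rabs Q /\ Rabs P <= Rabs Q / 8) \/ (bp (em + 3) <= Rabs P /\ Rabs Q <= Rabs P / 8).

Lemma drives_pair A B P Q : F A -> F B -> 32 * w <= Rabs (B - A) -> F P -> F Q -> P <> Q -> near_pair P Q ->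
  drives E M rd ze A B P Q.
Proof.
  assert (K : forall A B P Q, F A -> F B -> 32 * w <= Rabs (B - A) -> F P -> F Q -> P <> Q -> near_pair P Q ->
    Rabs P <= Rabs Q -> drives E M rd ze A B P Q).
  { clear A B P Q. intros A B P Q FA FB HD FP FQ N NP L. pose proof (Rabs_pos P) as RP. unfold near_pair in NP.
    pose proof (bp_pos (em + 3)).
    assert (NP' : Rabs (Q - P) <= Om \/ (bp (em + 3) <= Rabs Q /\ Rabs P <= Rabs Q / 8)).
    { destruct NP as [NP|[NP|[N1 N2]]]; auto. exfalso. lra. }
    destruct (Rtotal_order Q 0) as [C|[->|C]].
    - apply drives_opp; trivial. rewrite (Rabs_left Q) in * by lra.
      apply (drives_attain _ (rspec_opp _ Hr) z Hz ze Hze); trivial; try (apply F_opp; trivial); try lra.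
      + rewrite Rabs_Ropp; trivial.
      + rewrite Rabs_Ropp. destruct NP' as [NP'|NP']; auto. apply Rabs_le_inv in NP'. left; lra.
    - exfalso. rewrite Rabs_R0 in L. apply N. destruct (Req_dec P 0) as [D|D]; trivial. apply Rabs_pos_lt in D. lra.
    - rewrite (Rabs_pos_eq Q) in * by lra. apply (drives_attain rd Hr z Hz ze Hze); trivial.
      destruct NP' as [NP'|NP']; auto. apply Rabs_le_inv in NP'. left; lra. }
  intros FA FB HD FP FQ N NP. destruct (Rle_dec (Rabs P) (Rabs Q)) as [L|L]; [apply K; trivial|].
  apply drives_swap, K; auto; try lra.
  - rewrite Rabs_minus_sym; trivial.
  - unfold near_pair in *. rewrite Rabs_minus_sym. tauto.
Qed.

(** The value of larger modulus must be the one that absorbs, hence be coded by al. Which order of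
    the driving input results depends on P and Q; both orders are available to the caller. *)
Lemma drives_split_any al P Q : F al -> 0 < al / ze -> Rabs al <= eps M / 2 -> 32 * w <= Rabs (al - ze) ->
  F P -> F Q -> Om < Rabs (Q - P) -> drives E M rd ze ze al P Q \/ drives E M rd ze al ze P Q.
Proof.
  assert (K : forall P Q, F al -> 0 < al / ze -> Rabs al <= eps M / 2 -> 32 * w <= Rabs (al - ze) ->
    F P -> F Q -> Rabs P <= Rabs Q -> Om < Rabs (Q - P) -> drives E M rd ze ze al P Q).
  { clear P Q. intros P Q Fal Sg Hal HD FP FQ L HO.
    assert (Hal' : 0 < zsg z ze * al <= eps M / 2).
    { destruct (zsg_mul rd Hr z Hz ze Hze) as [Z1 Z2]. pose proof (z_bounds rd Hr z Hz) as [Zb _].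
      assert (Q1 : zsg z ze * al = z * (al / ze)).
      { transitivity (zsg z ze * ze * (al / ze)); [field|rewrite Z1; ring]. intros C. rewrite C in Hze. lra. }
      split; [rewrite Q1; apply Rmult_lt_0_compat; trivial|].
      apply Rabs_le_inv in Hal. destruct Z2 as [-> | ->]; lra. }
    pose proof (F_le_Om P FP) as OP. pose proof (F_le_Om Q FQ) as OQ. apply Rabs_le_inv in OP, OQ.
    pose proof (Rabs_pos P) as RP.
    destruct (Rtotal_order Q 0) as [C|[->|C]].
    - rewrite (Rabs_left Q) in L by lra.
      assert (0 < P).
      { apply Rnot_le_lt; intros C2. rewrite (Rabs_left1 P) in L by lra. rewrite Rabs_left1 in HO; lra. }
      apply drives_opp; trivial. rewrite (Rabs_left (Q - P)) in HO by lra.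
      apply (drives_split _ (rspec_opp _ Hr) z Hz ze Hze); trivial; try (apply F_opp; trivial); try lra.
      rewrite Rabs_Ropp; trivial.
    - rewrite Rabs_R0 in L. rewrite Rminus_0_l, Rabs_Ropp in HO. pose proof (Om_ge (E:=E) (M:=M)); pose proof (bp_pos (emax E)); lra.
    - rewrite (Rabs_pos_eq Q) in L by lra. assert (P < 0).
      { apply Rnot_le_lt; intros C2. rewrite (Rabs_pos_eq P) in L by lra. rewrite Rabs_pos_eq in HO; lra. }
      rewrite Rabs_pos_eq in HO by lra. apply (drives_split rd Hr z Hz ze Hze); trivial. }
  intros. destruct (Rle_dec (Rabs P) (Rabs Q)) as [L|L]; [left; apply K; trivial|right].
  apply drives_swap, K; trivial; try lra. rewrite Rabs_minus_sym; trivial.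
Qed.

End AnyPair.

(** * Interval rows *)

Section Intervals.
Context {E M : nat} {fp : FP E M}.
Local Set Default Proof Using "fp".

Local Notation F := (isF E M).
Local Notation Om := (Omega E M).
Local Notation inr := (in_range E M).
Local Notation float := (float E M).
Local Notation fbar := (fbar E M).

Lemma float_eq (x y : float) : fval x = fval y -> x = y.
Proof.
  destruct x as [x Hx], y as [y Hy]; unfold fval; simpl. intros ->. f_equal. apply proof_irrelevance.
Qed.

(* junk value 0 outside the set of floats *)
Definition toF (x : R) : float :=
  match excluded_middle_informative (F x) with
  | left H => exist _ x H
  | right _ => exist _ 0 F_0
  end.

Lemma fval_toF x : F x -> fval (toF x) = x.
Proof. intros H; unfold toF. destruct (excluded_middle_informative (F x)); tauto. Qed.

Lemma fval_F (x : float) : F (fval x).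
Proof. apply (proj2_sig x). Qed.

Lemma toF_fval (x : float) : toF (fval x) = x.
Proof. apply float_eq, fval_toF, fval_F. Qed.

Definition fin (x : R) : fbar := Fin (toF x).

Lemma Fin_fin (x : float) : Fin x = fin (fval x).
Proof. unfold fin; rewrite toF_fval; trivial. Qed.

(** The choice made inside [rnd], as a total function on reals without overflow. It agrees with
    [rnd] within [in_range]. *)
Definition rdn (x : R) : R :=
  match epsilon (inhabits NaN) (fun v => exists y : float, v = Fin y /\ nearest_even x y) with
  | Fin y => fval y
  | _ => 0
  end.

Lemma rdn_spec x : near_even (E:=E) (M:=M) x (rdn x) /\
  epsilon (inhabits NaN) (fun v => exists y : float, v = Fin y /\ nearest_even x y) = fin (rdn x).
Proof.
  unfold rdn. set (P := fun v => exists y : float, v = Fin y /\ nearest_even x y).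
  assert (H : exists v, P v).
  { destruct (near_even_ex (E:=E) (M:=M) x) as (y & Fy & N1 & N2). exists (fin y), (toF y). split; trivial. split.
    - intros t. rewrite (fval_toF y Fy). apply N1, fval_F.
    - intros t. rewrite (fval_toF y Fy). intros H1 H2. unfold even_float. rewrite (fval_toF y Fy).
      apply (N2 (fval t) (fval_F t) H1). intros C. apply H2. rewrite <- C, toF_fval; trivial. }
  apply (epsilon_spec (inhabits NaN)) in H. destruct H as (y & -> & N1 & N2).
  split; [|apply Fin_fin]. split; [apply fval_F|]. split.
  - intros t Ft. specialize (N1 (toF t)). rewrite fval_toF in N1; trivial.
  - intros t Ft H1 H2. apply (N2 (toF t)); rewrite ?fval_toF; trivial.
    intros C. apply H2. rewrite <- C, fval_toF; trivial.
Qed.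

Lemma rdn_rspec : rspec (E:=E) (M:=M) rdn.
Proof. apply rspec_choice. intros x; apply rdn_spec. Qed.

Lemma rnd_cases x : rnd E M x = if Rle_dec x (- Om - rnd_c E M) then NInf
  else if Rle_dec (Om + rnd_c E M) x then PInf else fin (rdn x).
Proof. unfold rnd. rewrite (proj2 (rdn_spec x)); trivial. Qed.

Lemma rnd_fin x : inr x -> rnd E M x = fin (rdn x).
Proof.
  intros H. apply Rabs_def2 in H. rewrite rnd_cases.
  destruct (Rle_dec x _); [lra|]. destruct (Rle_dec _ x); [lra|trivial].
Qed.

Lemma rnd_F x : F x -> rnd E M x = fin x.
Proof.
  intros H. rewrite rnd_fin; [|apply inr_le, F_le_Om; trivial]. rewrite (rd_id _ rdn_rspec); trivial.
Qed.

Lemma fle_fin x y : F x -> F y -> fle (fin x) (fin y) <-> x <= y.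
Proof.
  intros Fx Fy. unfold fle, fin, fleb. rewrite !fval_toF by trivial.
  destruct (Rle_dec x y); split; auto; discriminate.
Qed.

Lemma fle_not_NaN (a b : fbar) : fle a b -> a <> NaN /\ b <> NaN.
Proof. destruct a, b; unfold fle; simpl; split; try discriminate. Qed.

Lemma fle_refl (a : fbar) : a <> NaN -> fle a a.
Proof.
  destruct a; unfold fle; simpl; try congruence. intros _. destruct (Rle_dec _ _); trivial; lra.
Qed.

Lemma fle_trans (a b c : fbar) : fle a b -> fle b c -> fle a c.
Proof.
  destruct a as [x| | |], b as [y| | |], c as [t| | |]; unfold fle; simpl; try discriminate; auto.
  repeat destruct Rle_dec; auto; try discriminate; lra.
Qed.

Lemma fle_antisym (a b : fbar) : fle a b -> fle b a -> a = b.
Proof.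
  destruct a as [x| | |], b as [y| | |]; unfold fle; simpl; try discriminate; auto.
  repeat destruct Rle_dec; try discriminate. intros _ _. f_equal. apply float_eq; lra.
Qed.

Lemma fle_total (a b : fbar) : a <> NaN -> b <> NaN -> fle a b \/ fle b a.
Proof.
  destruct a as [x| | |], b as [y| | |]; unfold fle; simpl; auto; try congruence.
  destruct (Rle_dec (fval x) (fval y)), (Rle_dec (fval y) (fval x)); auto; lra.
Qed.

Lemma fmin_l (a b : fbar) : fle a b -> fmin a b = a.
Proof. unfold fmin, fle. intros ->; trivial. Qed.

Lemma fmin_r (a b : fbar) : fle b a -> fmin a b = b.
Proof.
  unfold fmin. intros H. destruct (fleb a b) eqn:Q; trivial. apply fle_antisym; trivial.
Qed.

Lemma fmax_r (a b : fbar) : fle a b -> fmax a b = b.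
Proof. unfold fmax, fle. intros ->; trivial. Qed.

Lemma fmax_l (a b : fbar) : fle b a -> fmax a b = a.
Proof.
  unfold fmax. intros H. destruct (fleb a b) eqn:Q; trivial. symmetry; apply fle_antisym; trivial.
Qed.

Lemma not_NaN_isNaN (a : fbar) : a <> NaN -> isNaN a = false.
Proof. destruct a; simpl; congruence. Qed.

Lemma rnd_not_NaN x : rnd E M x <> NaN.
Proof.
  rewrite rnd_cases. destruct (Rle_dec x _); [discriminate|]. destruct (Rle_dec _ x); discriminate.
Qed.

Lemma rnd_le x y : x <= y -> fle (rnd E M x) (rnd E M y).
Proof.
  intros L. rewrite !rnd_cases. pose proof (rd_le _ rdn_rspec x y L) as L'.
  repeat destruct Rle_dec; try lra; unfold fle; simpl; trivial.
  rewrite !fval_toF by apply (rs_F _ rdn_rspec). destruct Rle_dec; trivial; lra.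
Qed.

Lemma fadd_le (a b : fbar) s t : F s -> F t -> fle a b -> s <= t -> fle (fadd a (fin s)) (fadd b (fin t)).
Proof.
  intros Fs Ft H L. unfold fin. destruct a as [x| | |], b as [y| | |]; unfold fle in H; simpl in H |- *; try discriminate; try reflexivity.
  - rewrite !fval_toF by trivial. apply rnd_le. destruct (Rle_dec (fval x) (fval y)); [lra|discriminate].
  - pose proof (rnd_not_NaN (fval x + fval (toF s))) as N.
    destruct (rnd E M (fval x + fval (toF s))); unfold fle; simpl; congruence.
  - pose proof (rnd_not_NaN (fval y + fval (toF t))) as N.
    destruct (rnd E M (fval y + fval (toF t))); unfold fle; simpl; congruence.
Qed.

Lemma itv_add (a b : fbar) s t : F s -> F t -> fle a b -> s <= t ->
  itv_op (@fadd E M) (Itv a b) (Itv (fin s) (fin t)) = Itv (fadd a (fin s)) (fadd b (fin t)).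
Proof.
  intros Fs Ft H L. simpl. destruct (fle_not_NaN _ _ H) as [Na Nb].
  assert (L12 : fle (fadd a (fin s)) (fadd a (fin t))) by (apply fadd_le; trivial; apply fle_refl; trivial).
  assert (L34 : fle (fadd b (fin s)) (fadd b (fin t))) by (apply fadd_le; trivial; apply fle_refl; trivial).
  assert (L13 : fle (fadd a (fin s)) (fadd b (fin s))) by (apply fadd_le; trivial; lra).
  assert (L24 : fle (fadd a (fin t)) (fadd b (fin t))) by (apply fadd_le; trivial; lra).
  destruct (fle_not_NaN _ _ L12) as [N1 N2], (fle_not_NaN _ _ L34) as [N3 N4].
  rewrite !not_NaN_isNaN by trivial. simpl.
  rewrite (fmin_l _ _ L12), (fmin_l _ _ L13), (fmin_l _ _ (fle_trans _ _ _ L13 L34)), (fmax_r _ _ L12).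
  f_equal. destruct (fle_total (fadd a (fin t)) (fadd b (fin s)) N2 N3) as [C|C].
  - rewrite (fmax_r _ _ C), (fmax_r _ _ L34); trivial.
  - rewrite (fmax_l _ _ C), (fmax_r _ _ L24); trivial.
Qed.

Definition tlo (t : (R * R) * R) : R := Rmin (fst (fst t) * snd t) (snd (fst t) * snd t).
Definition thi (t : (R * R) * R) : R := Rmax (fst (fst t) * snd t) (snd (fst t) * snd t).

Lemma tlo_le t : tlo t <= thi t.
Proof. unfold tlo, thi. eapply Rle_trans; [apply Rmin_l|apply Rmax_l]. Qed.

Definition pair_itv (p : R * R) : itv E M := Itv (fin (fst p)) (fin (snd p)).

Definition wf_pair (p : R * R) : Prop := F (fst p) /\ F (snd p) /\ fst p <= snd p.

Definition wft (t : (R * R) * R) : Prop := wf_pair (fst t) /\ F (snd t) /\ inr (tlo t) /\ inr (thi t).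

Lemma itv_mul t : wft t ->
  itv_op (@fmul E M) (pair_itv (fst t)) (Itv (fin (snd t)) (fin (snd t))) = Itv (fin (rdn (tlo t))) (fin (rdn (thi t))).
Proof.
  destruct t as [[l u] v]. intros ((Fl & Fu & L) & Fv & J1 & J2). unfold tlo, thi, fin in *; simpl in *.
  rewrite !fval_toF by trivial.
  assert (K : forall x y, x <= y -> inr x -> inr y ->
    (if (isNaN (rnd E M x) || isNaN (rnd E M x) || isNaN (rnd E M y) || isNaN (rnd E M y))%bool then Top E M
     else Itv (fmin (fmin (fmin (rnd E M x) (rnd E M x)) (rnd E M y)) (rnd E M y))
              (fmax (fmax (fmax (rnd E M x) (rnd E M x)) (rnd E M y)) (rnd E M y))) = Itv (fin (rdn x)) (fin (rdn y)) /\
    (if (isNaN (rnd E M y) || isNaN (rnd E M y) || isNaN (rnd E M x) || isNaN (rnd E M x))%bool then Top E M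
     else Itv (fmin (fmin (fmin (rnd E M y) (rnd E M y)) (rnd E M x)) (rnd E M x))
              (fmax (fmax (fmax (rnd E M y) (rnd E M y)) (rnd E M x)) (rnd E M x))) = Itv (fin (rdn x)) (fin (rdn y))).
  { intros x y Lxy Ix Iy. pose proof (rnd_le x y Lxy) as Lr. rewrite (rnd_fin x Ix), (rnd_fin y Iy) in *. simpl.
    assert (Rx : fle (fin (rdn x)) (fin (rdn x))) by (apply fle_refl; discriminate).
    assert (Ry : fle (fin (rdn y)) (fin (rdn y))) by (apply fle_refl; discriminate).
    fold (fin (rdn x)) (fin (rdn y)).
    rewrite !(fmin_l _ _ Rx), !(fmin_l _ _ Ry), !(fmax_r _ _ Rx), !(fmax_r _ _ Ry).
    rewrite !(fmin_l _ _ Lr), !(fmax_r _ _ Lr), !(fmin_r _ _ Lr), !(fmax_l _ _ Lr).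
    rewrite ?(fmin_l _ _ Lr), ?(fmax_r _ _ Lr), ?(fmin_r _ _ Lr), ?(fmax_l _ _ Lr), ?(fmin_l _ _ Rx), ?(fmax_r _ _ Ry). auto. }
  destruct (Rle_dec (l * v) (u * v)) as [C|C].
  - rewrite Rmin_left, Rmax_right in * by lra. apply (K _ _ C); trivial.
  - rewrite Rmin_right, Rmax_left in * by lra. apply (K (u * v) (l * v)); trivial; lra.
Qed.

Definition fsum (acc : fbar) (ps : list R) : fbar := fold_left (fun acc p => fadd acc (fin (rdn p))) ps acc.

Definition row_itv (ts : list ((R * R) * R)) (b : R) : itv E M :=
  aff_row_sharp (map (fun t => toF (snd t)) ts) (toF b) (map (fun t => pair_itv (fst t)) ts).

Lemma fold_add ts a b : Forall wft ts -> fle a b ->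
  fold_left (itv_op (@fadd E M)) (map (fun t => Itv (fin (rdn (tlo t))) (fin (rdn (thi t)))) ts) (Itv a b) =
    Itv (fsum a (map tlo ts)) (fsum b (map thi ts)) /\ fle (fsum a (map tlo ts)) (fsum b (map thi ts)).
Proof.
  intros W; revert a b; induction W as [|t ts Wt W IH]; intros a b H; [simpl; auto|].
  cbn [map fold_left fsum]. rewrite itv_add; trivial; try apply (rs_F _ rdn_rspec).
  - apply IH, fadd_le; trivial; try apply (rs_F _ rdn_rspec). apply (rd_le _ rdn_rspec), tlo_le.
  - apply (rd_le _ rdn_rspec), tlo_le.
Qed.

Lemma combine_map {A B C : Type} (f : A -> B) (g : A -> C) l : combine (map f l) (map g l) = map (fun x => (f x, g x)) l.
Proof. induction l; simpl; congruence. Qed.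

Lemma fadd_fin0 x : F x -> fadd (fin 0) (fin x) = fin x.
Proof. intros Fx. simpl. rewrite !fval_toF, Rplus_0_l by (trivial; apply F_0). apply rnd_F; trivial. Qed.

(** Addition is monotone in both operands, so the endpoints can be summed separately. The sums are
    kept in [fbar] because the output row may pass to infinity. *)
Lemma rowI_eq ts b : Forall wft ts -> F b ->
  row_itv ts b = Itv (fadd (fsum (fin 0) (map tlo ts)) (fin b)) (fadd (fsum (fin 0) (map thi ts)) (fin b)).
Proof.
  intros W Fb. unfold row_itv, aff_row_sharp. rewrite combine_map, map_map. fold (fin b).
  destruct W as [|t ts Wt W]; [cbn [map fsum fold_left]; rewrite fadd_fin0; trivial|].
  cbn [map fsum fold_left fst snd]. rewrite !fadd_fin0 by apply (rs_F _ rdn_rspec). fold (fin (snd t)). rewrite itv_mul by trivial.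
  rewrite (map_ext_in _ (fun t => Itv (fin (rdn (tlo t))) (fin (rdn (thi t))))).
  - destruct (fold_add ts (fin (rdn (tlo t))) (fin (rdn (thi t))) W) as [Q L].
    + apply fle_fin; try apply (rs_F _ rdn_rspec). apply (rd_le _ rdn_rspec), tlo_le.
    + rewrite Q. apply itv_add; trivial; lra.
  - intros t' Ht'. apply itv_mul. rewrite Forall_forall in W; auto.
Qed.

Lemma fsum_fin x ps : F x -> ssafe E M rdn x ps -> fsum (fin x) ps = fin (srun rdn x ps).
Proof.
  revert x; induction ps as [|p ps IH]; intros x Fx; simpl; trivial. intros (I1 & pair_itv & S).
  rewrite !fval_toF by (trivial; apply (rs_F _ rdn_rspec)). rewrite rnd_fin by trivial. apply IH; trivial.
  apply (rs_F _ rdn_rspec).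
Qed.

Lemma srun_F x ps : F x -> F (srun rdn x ps).
Proof.
  revert x; induction ps as [|p ps IH]; intros x Fx; simpl; trivial. apply IH, (rs_F _ rdn_rspec).
Qed.

Lemma ssafe_inr x ps : ssafe E M rdn x ps -> Forall inr ps.
Proof.
  revert x; induction ps as [|p ps IH]; intros x; simpl; auto. intros (I1 & pair_itv & S). constructor; eauto.
Qed.

Definition wfin (t : (R * R) * R) : Prop := wf_pair (fst t) /\ F (snd t).

Lemma wfin_wft ts : Forall wfin ts -> Forall inr (map tlo ts) -> Forall inr (map thi ts) -> Forall wft ts.
Proof.
  rewrite !Forall_map, !Forall_forall. intros W L H t Ht. specialize (W t Ht). repeat split; try apply W; auto.
Qed.

Lemma rowI_fin ts b l u : Forall wfin ts -> F b -> ssafe E M rdn 0 (map tlo ts) -> ssafe E M rdn 0 (map thi ts) ->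
  inr (srun rdn 0 (map tlo ts) + b) -> inr (srun rdn 0 (map thi ts) + b) ->
  rdn (srun rdn 0 (map tlo ts) + b) = l -> rdn (srun rdn 0 (map thi ts) + b) = u -> row_itv ts b = pair_itv (l, u).
Proof.
  intros W Fb S1 S2 J1 J2 <- <-. rewrite rowI_eq; trivial.
  - rewrite !fsum_fin by (trivial; apply F_0). unfold pair_itv; simpl. rewrite !fval_toF by (trivial; apply srun_F, F_0).
    rewrite !rnd_fin; trivial.
  - apply wfin_wft; trivial; eapply ssafe_inr; eauto.
Qed.

Lemma fadd_0 (a : fbar) : fadd a (fin 0) = a.
Proof.
  destruct a as [x| | |]; simpl; trivial. rewrite fval_toF, Rplus_0_r by apply F_0. rewrite rnd_F by apply fval_F. symmetry; apply Fin_fin.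
Qed.

Lemma fsum_zeros a (xs : list (R * R)) :
  fsum a (map tlo (map (fun p => (p, 0)) xs)) = a /\ fsum a (map thi (map (fun p => (p, 0)) xs)) = a.
Proof.
  assert (Z : rdn 0 = 0) by apply (rd_0 _ rdn_rspec).
  induction xs as [|p xs IH]; [simpl; auto|]. cbn [map fsum fold_left].
  replace (tlo (p, 0)) with 0 by (unfold tlo; simpl; rewrite !Rmult_0_r, Rmin_left; lra).
  replace (thi (p, 0)) with 0 by (unfold thi; simpl; rewrite !Rmult_0_r, Rmax_left; lra).
  rewrite Z, fadd_0. apply IH.
Qed.

Lemma wft_zeros xs : Forall wf_pair xs -> Forall wft (map (fun p => (p, 0)) xs).
Proof.
  rewrite Forall_map. apply Forall_impl. intros [l u] W. split; [trivial|]. split; [apply F_0|].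
  unfold tlo, thi; simpl. rewrite !Rmult_0_r, Rmin_left, Rmax_left by lra.
  assert (inr 0); [|auto]. apply inr_le, F_le_Om, F_0.
Qed.

(** Finite inputs with weight 0 contribute exactly 0, so units may share a layer without disturbing
    each other. *)
Lemma rowI_pad xs ts ys b : Forall wf_pair xs -> Forall wf_pair ys -> Forall wft ts -> F b ->
  row_itv (map (fun p => (p, 0)) xs ++ ts ++ map (fun p => (p, 0)) ys) b = row_itv ts b.
Proof.
  intros Wx Wy W Fb. rewrite !rowI_eq; trivial.
  - rewrite !map_app. unfold fsum. rewrite !fold_left_app.
    fold (fsum (fin 0) (map tlo (map (fun p => (p, 0)) xs))) (fsum (fin 0) (map thi (map (fun p => (p, 0)) xs))).
    destruct (fsum_zeros (fin 0) xs) as [-> ->].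
    fold (fsum (fin 0) (map tlo ts)) (fsum (fin 0) (map thi ts)).
    set (c := fsum (fin 0) (map tlo ts)). set (d := fsum (fin 0) (map thi ts)).
    fold (fsum c (map tlo (map (fun p => (p, 0)) ys))) (fsum d (map thi (map (fun p => (p, 0)) ys))).
    rewrite (proj1 (fsum_zeros c ys)), (proj2 (fsum_zeros d ys)). trivial.
  - apply Forall_app; split; [apply wft_zeros; trivial|]. apply Forall_app; split; trivial. apply wft_zeros; trivial.
Qed.

End Intervals.

Lemma list_choice {A B : Type} (P : A -> B -> Prop) l : Forall (fun x => exists y, P x y) l -> exists l', Forall2 P l l'.
Proof.
  induction 1 as [|x l [y Hy] _ [l' IH]]; [exists []; constructor|exists (y :: l'); constructor; trivial].
Qed.

Lemma Forall2_map_eq {A B C : Type} (f : A -> C) (g : B -> C) l l' : Forall2 (fun x y => f x = g y) l l' -> map f l = map g l'.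
Proof. induction 1; simpl; congruence. Qed.

(** * Networks *)

Section Nets.
Context {E M : nat} {fp : FP E M}.
Variable sigma : fbar E M -> fbar E M.
Variable d : nat.
Local Set Default Proof Using "fp".

Local Notation F := (isF E M).
Local Notation wfp := (wf_pair (E:=E) (M:=M)).
Local Notation wft := (wft (E:=E) (M:=M)).
Local Notation I2 := (pair_itv (E:=E) (M:=M)).
Local Notation rowI := (row_itv (E:=E) (M:=M)).
Local Notation toF := (toF (E:=E) (M:=M)).

Definition adm (B : list (R * R)) : Prop := length B = d /\ Forall (fun p => wfp p /\ -1 <= fst p /\ snd p <= 1) B.

Definition inst (cs : list ((list (R * R) -> R * R) * R)) (B : list (R * R)) : list ((R * R) * R) :=
  map (fun c => (fst c B, snd c)) cs.

(* [unit_pre k phi]: some network unit of depth k computes phi before activation. *)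
Fixpoint unit_pre (k : nat) (phi : list (R * R) -> itv E M) : Prop :=
  match k with
  | O => exists row b, Forall F row /\ length row = d /\ F b /\
      forall B, adm B -> Forall wft (combine B row) /\ phi B = rowI (combine B row) b
  | S k => exists cs b, Forall (fun c => F (snd c) /\ exists phi', unit_pre k phi' /\
        forall B, adm B -> wfp (fst c B) /\ sigma_sharp sigma (phi' B) = I2 (fst c B)) cs /\ F b /\
      forall B, adm B -> Forall wft (inst cs B) /\ phi B = rowI (inst cs B) b
  end.

Definition unit_post (k : nat) (psi : list (R * R) -> R * R) : Prop := exists phi, unit_pre k phi /\
  forall B, adm B -> wfp (psi B) /\ sigma_sharp sigma (phi B) = I2 (psi B).

Lemma wf_net_snoc din m m' net l : wf_net din m net -> layer_dims l m m' -> wf_net (E:=E) (M:=M) din m' (net ++ [l]).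
Proof.
  revert din; induction net as [|l0 net IH]; intros din; [simpl; tauto|].
  destruct net as [|l1 net]; [simpl; intros; exists m; auto|].
  intros (mid & H1 & H2) H3. exists mid; split; trivial. apply IH; trivial.
Qed.

Lemma net_sharp_snoc net l X : net <> [] ->
  net_sharp sigma (net ++ [l]) X = aff_sharp l (map (sigma_sharp sigma) (net_sharp sigma net X)).
Proof.
  revert X; induction net as [|l0 net IH]; intros X H; [congruence|].
  destruct net as [|l1 net]; [reflexivity|].
  change (net_sharp sigma ((l1 :: net) ++ [l]) (map (sigma_sharp sigma) (aff_sharp l0 X)) =
    aff_sharp l (map (sigma_sharp sigma) (net_sharp sigma (l1 :: net) (map (sigma_sharp sigma) (aff_sharp l0 X))))).
  apply IH; discriminate.
Qed.

Definition mk_layer (rows : list (list R * R)) : layer E M :=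
  Layer (map (fun r => map toF (fst r)) rows) (map (fun r => toF (snd r)) rows).

Lemma mk_layer_dims rows n : Forall (fun r => length (fst r) = n) rows -> layer_dims (mk_layer rows) n (length rows).
Proof.
  intros H. unfold layer_dims, mk_layer; simpl. rewrite !length_map. repeat split; trivial.
  apply Forall_map. eapply Forall_impl; [|apply H]. intros r Hr. rewrite length_map; trivial.
Qed.

Lemma mk_layer_sharp rows X : aff_sharp (mk_layer rows) X = map (fun r => aff_row_sharp (map toF (fst r)) (toF (snd r)) X) rows.
Proof. unfold aff_sharp, mk_layer; simpl. rewrite combine_map, map_map. reflexivity. Qed.

Lemma map_fst_combine {A B : Type} (l : list A) (l' : list B) : length l = length l' -> map fst (combine l l') = l.
Proof. revert l'; induction l as [|x l IH]; intros [|y l']; simpl; try discriminate; trivial. intros H; rewrite IH; auto. Qed.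

Lemma map_snd_combine {A B : Type} (l : list A) (l' : list B) : length l = length l' -> map snd (combine l l') = l'.
Proof. revert l'; induction l as [|x l IH]; intros [|y l']; simpl; try discriminate; trivial. intros H; rewrite IH; auto. Qed.

Lemma pad_row l1 cs l2 b B : Forall wfp (map (fun c => fst c B) (l1 ++ cs ++ l2)) -> Forall wft (inst cs B) -> F b ->
  aff_row_sharp (map toF (map (fun _ => 0) l1 ++ map snd cs ++ map (fun _ => 0) l2)) (toF b)
    (map (fun c => I2 (fst c B)) (l1 ++ cs ++ l2)) = rowI (inst cs B) b.
Proof.
  intros W Wt Fb. rewrite !map_app, !Forall_app in W. destruct W as (W1 & _ & W2).
  rewrite <- (rowI_pad _ (inst cs B) _ b W1 W2 Wt Fb). unfold row_itv, inst.
  rewrite !map_app, !map_map. reflexivity.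
Qed.

(** Induction on the depth: the hidden layer is the concatenation of all children, with repetitions,
    and each row has weight 0 outside the block of its own children. *)
Lemma realize k phis : Forall (unit_pre k) phis -> exists net, wf_net d (length phis) net /\ net <> [] /\
  forall B, adm B -> net_sharp sigma net (map I2 B) = map (fun phi => phi B) phis.
Proof.
  revert phis; induction k as [|k IH]; intros phis H.
  - assert (C : exists rows, Forall2 (fun phi r => length (fst r) = d /\
        forall B, adm B -> phi B = aff_row_sharp (map toF (fst r)) (toF (snd r)) (map I2 B)) phis rows).
    { apply list_choice. eapply Forall_impl; [|apply H]. intros phi (row & b & FR & L & Fb & Q). exists (row, b). split; trivial.
      intros B HB. destruct (Q B HB) as [_ ->]. unfold row_itv. destruct HB as [LB _].
      rewrite <- (map_map snd toF), <- (map_map fst I2), map_fst_combine, map_snd_combine by congruence. reflexivity. }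
    destruct C as [rows C]. exists [mk_layer rows]. split; [|split; [discriminate|]].
    + simpl. rewrite (Forall2_length C). apply mk_layer_dims. clear H. induction C; constructor; tauto.
    + intros B HB. simpl. rewrite mk_layer_sharp. symmetry. apply Forall2_map_eq. eapply Forall2_impl; [|apply C].
      intros phi r [_ Q]. apply Q; trivial.
  - assert (C : exists css, Forall2 (fun phi c => F (snd c) /\ Forall (fun c => F (snd c) /\ unit_post k (fst c)) (fst c) /\
        forall B, adm B -> Forall wft (inst (fst c) B) /\ phi B = rowI (inst (fst c) B) (snd c)) phis css).
    { apply list_choice. eapply Forall_impl; [|apply H]. intros phi (cs & b & H1 & H2 & H3). exists (cs, b); auto. }
    destruct C as [css C]. set (hs := concat (map fst css)).
    assert (Hh : Forall (fun c => exists phi', unit_pre k phi' /\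
       forall B, adm B -> wfp (fst c B) /\ sigma_sharp sigma (phi' B) = I2 (fst c B)) hs).
    { unfold hs. apply Forall_concat, Forall_map. clear H. induction C as [|phi c ? ? (_ & Hc & _)]; constructor; trivial.
      eapply Forall_impl; [|apply Hc]. intros a [_ Ha]; exact Ha. }
    apply list_choice in Hh. destruct Hh as [phis' Hh].
    destruct (IH phis') as (net & N1 & N2 & N3).
    { clear - Hh. induction Hh; constructor; tauto. }
    assert (Wh : forall B, adm B -> Forall wfp (map (fun c => fst c B) hs) /\
       map (sigma_sharp sigma) (map (fun phi => phi B) phis') = map (fun c => I2 (fst c B)) hs).
    { intros B HB. clear - Hh HB. induction Hh as [|c phi hs phis' [_ Q] _ [IH1 IH2]]; simpl; auto.
      destruct (Q B HB) as [Q1 Q2]. split; [constructor; trivial|]. rewrite Q2, IH2; trivial. }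
    assert (D : exists rows, Forall2 (fun phi r => length (fst r) = length hs /\
        forall B, adm B -> aff_row_sharp (map toF (fst r)) (toF (snd r)) (map (fun c => I2 (fst c B)) hs) = phi B) phis rows).
    { apply list_choice. apply Forall_forall. intros phi Hphi.
      assert (K : exists c, In c css /\ F (snd c) /\ forall B, adm B -> Forall wft (inst (fst c) B) /\ phi B = rowI (inst (fst c) B) (snd c)).
      { clear - C Hphi. induction C as [|phi0 c phis css (Q1 & Q2 & Q3) C IH]; [destruct Hphi|].
        destruct Hphi as [->|Hphi]; [exists c; simpl; auto|]. destruct (IH Hphi) as (c' & ? & ?). exists c'; simpl; auto. }
      destruct K as (c & Ic & Fb & Q). apply in_split in Ic. destruct Ic as (l1 & l2 & Ic).
      assert (Eh : hs = concat (map fst l1) ++ fst c ++ concat (map fst l2)).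
      { unfold hs. rewrite Ic, map_app, concat_app. reflexivity. }
      exists (map (fun _ => 0) (concat (map fst l1)) ++ map snd (fst c) ++ map (fun _ => 0) (concat (map fst l2)), snd c).
      split.
      - simpl. rewrite Eh, !length_app, !length_map. reflexivity.
      - intros B HB. destruct (Q B HB) as [Q1 ->]. rewrite Eh. apply pad_row; trivial. rewrite <- Eh. apply Wh; trivial. }
    destruct D as [rows D]. exists (net ++ [mk_layer rows]). split; [|split].
    + apply wf_net_snoc with (m := length phis'); trivial. rewrite (Forall2_length D), <- (Forall2_length Hh).
      apply mk_layer_dims. clear - D. induction D; constructor; tauto.
    + destruct net; discriminate.
    + intros B HB. rewrite net_sharp_snoc, N3, mk_layer_sharp by trivial. destruct (Wh B HB) as [_ ->].
      symmetry. apply Forall2_map_eq. eapply Forall2_impl; [|apply D]. intros phi r [_ Q]. symmetry; apply Q; trivial.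
Qed.

End Nets.

(** * Intervals that code a bit *)

Section BitIntervals.
Context {E M : nat} {fp : FP E M}.
Local Set Default Proof Using "fp".
Local Notation F := (isF E M).
Local Notation wfp := (wf_pair (E:=E) (M:=M)).

(* The interval spanned by an input which is P when a bit is false and Q when it is true,
   where s gives the minimum and the maximum of the bit. *)
Definition pr (s : bool * bool) (P Q : R) : R * R :=
  let lo := if fst s then Q else P in let hi := if snd s then Q else P in
  if Rle_dec P Q then (lo, hi) else (hi, lo).

Definition valid (s : bool * bool) : Prop := fst s = true -> snd s = true.

Lemma pr_same s P : pr s P P = (P, P).
Proof. unfold pr. destruct s as [[] []]; simpl; destruct (Rle_dec P P); trivial. Qed.

Lemma pr_wfp s P Q : valid s -> F P -> F Q -> wfp (pr s P Q).
Proof.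
  intros V FP FQ. unfold pr, wf_pair. destruct s as [[] []]; simpl; destruct (Rle_dec P Q); simpl; repeat split; trivial; try lra;
    discriminate V; trivial.
Qed.

Definition flip (s : bool * bool) : bool * bool := (negb (snd s), negb (fst s)).

(** Negation is a change of reading: the same interval, with the two codes exchanged, represents the
    negated bit. *)
Lemma pr_flip s P Q : pr (flip s) Q P = pr s P Q.
Proof.
  unfold pr, flip. destruct s as [[] []]; simpl; destruct (Rle_dec P Q), (Rle_dec Q P); trivial; try (f_equal; lra); exfalso; lra.
Qed.

Lemma valid_flip s : valid s -> valid (flip s).
Proof. destruct s as [[] []]; unfold valid; simpl; auto. Qed.

End BitIntervals.

(** * The activation on finite intervals *)

Section Activation.
Context {E M : nat} {fp : FP E M}.
Variable sigma : fbar E M -> fbar E M.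
Local Set Default Proof Using "fp".

Local Notation F := (isF E M).
Local Notation w := (omega E M).
Local Notation fbar := (fbar E M).
Local Notation fin := (fin (E:=E) (M:=M)).
Local Notation wfp := (wf_pair (E:=E) (M:=M)).
Local Notation I2 := (pair_itv (E:=E) (M:=M)).

Lemma gamma_I2 l u v : F l -> F u -> gamma (I2 (l, u)) v <-> exists x, v = fin x /\ F x /\ l <= x <= u.
Proof.
  intros Fl Fu. unfold gamma, pair_itv; cbn [fst snd]. split.
  - intros (N & L1 & L2). destruct v as [x| | |]; [|discriminate L2|discriminate L1|congruence].
    exists (fval x). rewrite Fin_fin in L1, L2 |- *. pose proof (fval_F x) as Fx.
    apply fle_fin in L1; trivial. apply fle_fin in L2; trivial. auto.
  - intros (x & -> & Fx & L1 & L2). repeat split; [discriminate|apply fle_fin; trivial|apply fle_fin; trivial].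
Qed.

Lemma argmin (g : R -> R) l u : F l -> F u -> l <= u ->
  exists x, F x /\ l <= x <= u /\ forall y, F y -> l <= y <= u -> g x <= g y.
Proof.
  intros Fl Fu L. pose proof (w_pos (E:=E) (M:=M)) as Pw.
  destruct (F_mult l Fl) as [n Hn]. destruct (F_mult u Fu) as [m Hm].
  assert (G : forall k : nat, exists x, F x /\ l <= x <= IZR (n + Z.of_nat k) * w /\
    forall y, F y -> l <= y <= IZR (n + Z.of_nat k) * w -> g x <= g y).
  { induction k as [|k (x & Fx & Hx & Mx)].
    - rewrite Z.add_0_r, <- Hn. exists l. repeat split; trivial; try lra. intros y _ Hy. replace y with l by lra. lra.
    - rewrite Nat2Z.inj_succ. unfold Z.succ. rewrite Z.add_assoc, plus_IZR, Rmult_plus_distr_r, Rmult_1_l.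
      set (t := IZR (n + Z.of_nat k) * w) in *.
      assert (K : forall y, F y -> l <= y <= t + w -> y <= t \/ y = t + w).
      { intros y Fy Hy. destruct (F_mult y Fy) as [j Hj].
        destruct (Z_le_gt_dec j (n + Z.of_nat k)) as [C|C].
        - left. unfold t. rewrite Hj. apply Rmult_le_compat_r; [lra|apply IZR_le; trivial].
        - right. assert (IZR (n + Z.of_nat k) + 1 <= IZR j) by (rewrite <- plus_IZR; apply IZR_le; lia).
          unfold t in *. nra. }
      destruct (classic (F (t + w) /\ g (t + w) < g x)) as [[Ft Lt]|N].
      + exists (t + w). repeat split; trivial; try lra. intros y Fy Hy.
        destruct (K y Fy Hy) as [C| ->]; [|lra]. specialize (Mx y Fy ltac:(lra)). lra.
      + exists x. repeat split; trivial; try lra. intros y Fy Hy.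
        destruct (K y Fy Hy) as [C|C]; [apply Mx; trivial; lra|]. subst y. apply Rnot_lt_le; auto. }
  assert (n <= m)%Z by (apply le_IZR; nra).
  specialize (G (Z.to_nat (m - n))). replace (n + Z.of_nat (Z.to_nat (m - n)))%Z with m in G by lia. rewrite <- Hm in G. exact G.
Qed.

Lemma setmin_eq (S : fbar -> Prop) v : S v -> (forall u, S u -> fle v u) -> setmin S = v.
Proof.
  intros H1 H2. unfold setmin.
  destruct (epsilon_spec (inhabits NaN) (fun v => S v /\ forall u, S u -> fle v u)) as [G1 G2]; [exists v; auto|].
  apply fle_antisym; auto.
Qed.

Lemma setmax_eq (S : fbar -> Prop) v : S v -> (forall u, S u -> fle u v) -> setmax S = v.
Proof.
  intros H1 H2. unfold setmax.
  destruct (epsilon_spec (inhabits NaN) (fun v => S v /\ forall u, S u -> fle u v)) as [G1 G2]; [exists v; auto|].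
  apply fle_antisym; auto.
Qed.

Definition sr (x : R) : R := match sigma (fin x) with Fin y => fval y | _ => 0 end.

Hypothesis Hfin : forall x, F x -> sigma (fin x) = fin (sr x) /\ F (sr x).
Local Set Default Proof Using "fp Hfin".

Lemma sharp_ex l u : wfp (l, u) -> exists x1 x2, F x1 /\ F x2 /\ l <= x1 <= u /\ l <= x2 <= u /\
  sigma_sharp sigma (I2 (l, u)) = I2 (sr x1, sr x2) /\ forall x, F x -> l <= x <= u -> sr x1 <= sr x <= sr x2.
Proof.
  intros (Fl & Fu & L). simpl in *.
  destruct (argmin sr l u Fl Fu L) as (x1 & F1 & H1 & M1).
  destruct (argmin (fun x => - sr x) l u Fl Fu L) as (x2 & F2 & H2 & M2).
  exists x1, x2. repeat split; trivial; try lra; try (apply M1; trivial); try (specialize (M2 x H H0); lra).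
  unfold sigma_sharp.
  assert (S : forall v, (exists t, gamma (I2 (l, u)) t /\ v = sigma t) <-> exists x, F x /\ l <= x <= u /\ v = fin (sr x)).
  { intros v; split.
    - intros (t & Ht & ->). apply gamma_I2 in Ht; trivial. destruct Ht as (x & -> & Fx & Hx). exists x. rewrite (proj1 (Hfin x Fx)). auto.
    - intros (x & Fx & Hx & ->). exists (fin x). rewrite (proj1 (Hfin x Fx)). split; trivial. apply gamma_I2; trivial. exists x; auto. }
  destruct (excluded_middle_informative _) as [C|C].
  - apply S in C. destruct C as (x & _ & _ & C). discriminate C.
  - unfold pair_itv; cbn [fst snd]. f_equal.
    + apply setmin_eq; [apply S; eauto|]. intros v Hv. apply S in Hv. destruct Hv as (x & Fx & Hx & ->).
      apply fle_fin; try (apply Hfin; trivial). apply M1; trivial.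
    + apply setmax_eq; [apply S; eauto|]. intros v Hv. apply S in Hv. destruct Hv as (x & Fx & Hx & ->).
      apply fle_fin; try (apply Hfin; trivial). specialize (M2 x Fx Hx); lra.
Qed.

(** The property that makes sigma exact on the interval from P to Q: its extremes are attained at
    the ends. It is assumed for c1, c2 and holds for eta and its successor, which have no float
    between them. *)
Definition betw (P Q : R) : Prop := forall x, F x -> P <= x <= Q \/ Q <= x <= P ->
  sr P <= sr x <= sr Q \/ sr Q <= sr x <= sr P.

Lemma sharp_pr s P Q : valid s -> F P -> F Q -> betw P Q ->
  sigma_sharp sigma (I2 (pr s P Q)) = I2 (pr s (sr P) (sr Q)).
Proof.
  intros V FP FQ HB.
  assert (One : forall x, F x -> sigma_sharp sigma (I2 (x, x)) = I2 (sr x, sr x)).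
  { intros x Fx. destruct (sharp_ex x x) as (x1 & x2 & _ & _ & H1 & H2 & -> & _); [unfold wf_pair; simpl; repeat split; trivial; lra|].
    replace x1 with x by lra. replace x2 with x by lra. trivial. }
  assert (Two : forall l u, (l = P /\ u = Q \/ l = Q /\ u = P) -> l <= u ->
     sigma_sharp sigma (I2 (l, u)) = I2 (Rmin (sr P) (sr Q), Rmax (sr P) (sr Q))).
  { intros l u Hlu L.
    assert (Flu : F l /\ F u) by (destruct Hlu as [[-> ->]|[-> ->]]; auto).
    destruct (sharp_ex l u) as (x1 & x2 & F1 & F2 & H1 & H2 & -> & H); [unfold wf_pair; simpl; tauto|].
    assert (IP : sr x1 <= sr P <= sr x2) by (apply H; trivial; destruct Hlu as [[-> ->]|[-> ->]]; lra).
    assert (IQ : sr x1 <= sr Q <= sr x2) by (apply H; trivial; destruct Hlu as [[-> ->]|[-> ->]]; lra).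
    assert (B1 : sr P <= sr x1 <= sr Q \/ sr Q <= sr x1 <= sr P) by (apply HB; trivial; destruct Hlu as [[-> ->]|[-> ->]]; lra).
    assert (B2 : sr P <= sr x2 <= sr Q \/ sr Q <= sr x2 <= sr P) by (apply HB; trivial; destruct Hlu as [[-> ->]|[-> ->]]; lra).
    do 2 f_equal; [unfold Rmin|unfold Rmax]; destruct (Rle_dec (sr P) (sr Q)); lra. }
  unfold pr. destruct s as [[] []]; simpl;
    try (destruct (Rle_dec P Q), (Rle_dec (sr P) (sr Q)); apply One; trivial; fail).
  - discriminate V; trivial.
  - destruct (Rle_dec P Q); rewrite Two; auto; try lra;
      destruct (Rle_dec (sr P) (sr Q)); [rewrite Rmin_left, Rmax_right|rewrite Rmin_right, Rmax_left|rewrite Rmin_left, Rmax_right|rewrite Rmin_right, Rmax_left]; trivial; lra.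
Qed.

End Activation.

(** * Bits carried by network units *)

Section Rows.
Context {E M : nat} {fp : FP E M}.
Variable sigma : fbar E M -> fbar E M.
Variable d : nat.
Hypothesis Hfin : forall x, isF E M x -> sigma (fin (E:=E) (M:=M) x) = fin (sr sigma x) /\ isF E M (sr sigma x).
Local Set Default Proof Using "fp Hfin".

Local Notation F := (isF E M).
Local Notation inr := (in_range E M).
Local Notation fbar := (fbar E M).
Local Notation fin := (fin (E:=E) (M:=M)).
Local Notation wfp := (wf_pair (E:=E) (M:=M)).
Local Notation I2 := (pair_itv (E:=E) (M:=M)).
Local Notation rowI := (row_itv (E:=E) (M:=M)).
Local Notation rdn := (rdn (E:=E) (M:=M)).
Local Notation rdn_le := (rd_le _ (rdn_rspec (E:=E) (M:=M))).
Local Notation sr := (sr sigma).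
Local Notation adm := (adm (E:=E) (M:=M) d).
Local Notation pre := (unit_pre sigma d).
Local Notation post := (unit_post sigma d).
Local Notation sig := (list (R * R) -> bool * bool).
Local Notation betw := (betw sigma).

Definition vs (s : sig) : Prop := forall B, adm B -> valid (s B).

(* The pair s B is the minimum and the maximum over the box B of the bit coded by the unit. *)
Definition X (k : nat) (s : sig) (P Q : R) : Prop :=
  exists psi, post k psi /\ forall B, adm B -> psi B = pr (s B) P Q.

Lemma post_X k s phi P Q : pre k phi -> vs s -> F P -> F Q -> betw P Q ->
  (forall B, adm B -> phi B = I2 (pr (s B) P Q)) -> X k s (sr P) (sr Q).
Proof.
  intros Hp V FP FQ HB H. exists (fun B => pr (s B) (sr P) (sr Q)). split; trivial.
  exists phi; split; trivial. intros B HBa. rewrite (H B HBa). split.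
  - apply pr_wfp; auto; apply Hfin; trivial.
  - apply sharp_pr; auto.
Qed.

Lemma X_flip k s P Q : X k s P Q -> X k (fun B => flip (s B)) Q P.
Proof. intros (psi & H1 & H2). exists psi; split; trivial. intros B HB. rewrite pr_flip; auto. Qed.

Lemma pre_const k b : F b -> pre k (fun _ => I2 (b, b)).
Proof.
  intros Fb.
  assert (Q : fadd (fin 0) (fin b) = fin b) by (apply fadd_fin0; trivial).
  destruct k as [|k]; simpl.
  - exists (repeat 0 d), b. split; [|split; [apply repeat_length|split; [trivial|]]].
    + apply Forall_forall. intros x Hx. apply repeat_spec in Hx. subst; apply F_0.
    + intros B (LB & HB).
      assert (K : combine B (repeat 0 d) = map (fun p => (p, 0)) B).
      { rewrite <- LB. clear. induction B; simpl; congruence. }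
      rewrite K. assert (W : Forall wfp B) by (eapply Forall_impl; [|apply HB]; simpl; tauto).
      split; [apply wft_zeros; trivial|]. rewrite <- (app_nil_r (map _ B)).
      rewrite (rowI_pad B [] [] b W) by (trivial; constructor).
      rewrite rowI_eq; trivial. simpl map. unfold fsum; cbn [fold_left]. rewrite Q. reflexivity.
  - exists [], b. split; [constructor|]. split; trivial. intros B HB. split; [constructor|].
    rewrite rowI_eq; [|constructor|trivial]. simpl map. unfold fsum; cbn [fold_left]. rewrite Q. reflexivity.
Qed.

(** A degenerate pair gives the same interval for every bit, so a constant qualifies as a unit for
    any s. *)
Lemma X_const k s c : F c -> X k s (sr c) (sr c).
Proof.
  intros Fc. destruct (post_X k (fun _ => (true, true)) _ c c (pre_const k c Fc)) as (psi & H1 & H2); trivial.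
  - intros B _ _; trivial.
  - intros x Fx Hx. replace x with c by lra. lra.
  - intros B _. rewrite pr_same; trivial.
  - exists psi; split; trivial. intros B HB. rewrite (H2 B HB), !pr_same; trivial.
Qed.

Lemma srun_le x y (ps qs : list R) : Forall2 Rle ps qs -> x <= y -> srun rdn x ps <= srun rdn y qs.
Proof using fp.
  intros H; revert x y; induction H as [|p q ps qs L H IH]; intros x y Lxy; simpl; trivial.
  apply IH, rdn_le. pose proof (rdn_le p q L). lra.
Qed.

Lemma tlo_pr s a b v : valid s ->
  (psel false ((a, b), v) <= psel true ((a, b), v) ->
     tlo (pr s a b, v) = psel (fst s) ((a, b), v) /\ thi (pr s a b, v) = psel (snd s) ((a, b), v)) /\
  (psel true ((a, b), v) <= psel false ((a, b), v) ->
     tlo (pr s a b, v) = psel (snd s) ((a, b), v) /\ thi (pr s a b, v) = psel (fst s) ((a, b), v)).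
Proof using fp.
  intros V. unfold psel, tlo, thi, pr; simpl.
  destruct s as [[] []]; simpl; destruct (Rle_dec a b); simpl; split; intros L; split;
    (apply Rmin_left || apply Rmin_right || apply Rmax_left || apply Rmax_right); try lra; discriminate V; trivial.
Qed.

(** All terms move in one direction with the bit, so the lower endpoints of the terms together form
    the scalar row for one value of the bit, and the upper endpoints that for another. The scalar
    computations therefore give the interval exactly. *)
Lemma drives_pre k s ze A B P Q : drives E M rdn ze A B P Q -> vs s -> F A -> F B -> F ze -> X k s A B -> X k s ze ze ->
  exists phi, pre (S k) phi /\ forall b, adm b -> phi b = I2 (pr (s b) P Q).
Proof.
  intros (ts & b & Fb & HF & Hd & (Sf & If & Of) & (St & It & Ot)) V FA FB Fze XA Xz.
  assert (C : exists cs, Forall2 (fun t c => (F (snd c) /\ post k (fst c)) /\ F (fst (fst t)) /\ F (snd (fst t)) /\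
     forall b, adm b -> (fst c b, snd c) = (pr (s b) (fst (fst t)) (snd (fst t)), snd t)) ts cs).
  { apply list_choice. eapply Forall_impl; [|apply HF]. intros [[u1 u2] v] [Fv [Q1|Q1]]; simpl in *; injection Q1 as -> ->.
    - destruct Xz as (psi & P1 & P2). exists (psi, v); simpl. repeat split; trivial. intros; rewrite P2; trivial.
    - destruct XA as (psi & P1 & P2). exists (psi, v); simpl. repeat split; trivial. intros; rewrite P2; trivial. }
  destruct C as [cs C]. exists (fun B => rowI (inst cs B) b).
  assert (K : forall B, adm B -> Forall (wfin (E:=E) (M:=M)) (inst cs B) /\
    (Forall (fun t => psel false t <= psel true t) ts ->
       map tlo (inst cs B) = map (psel (fst (s B))) ts /\ map thi (inst cs B) = map (psel (snd (s B))) ts) /\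
    (Forall (fun t => psel true t <= psel false t) ts ->
       map tlo (inst cs B) = map (psel (snd (s B))) ts /\ map thi (inst cs B) = map (psel (fst (s B))) ts)).
  { intros B0 HB. clear - C HB V fp Hfin. induction C as [|t c ts cs ((Fc & Hc) & F1 & F2 & Q) C (IH1 & IH2 & IH3)]; simpl; auto.
    rewrite (Q B0 HB). destruct t as [[u1 u2] v]; simpl in *. specialize (Q B0 HB). injection Q as Q1 Q2.
    destruct (tlo_pr (s B0) u1 u2 v (V B0 HB)) as [T1 T2]. split; [|split].
    - constructor; trivial. split; simpl; [apply pr_wfp; auto|congruence].
    - intros H. inversion H; subst. destruct (T1 H2) as [-> ->]. destruct (IH2 H3) as [-> ->]. auto.
    - intros H. inversion H; subst. destruct (T2 H2) as [-> ->]. destruct (IH3 H3) as [-> ->]. auto. }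
  assert (Res : forall B, adm B -> Forall (wft (E:=E) (M:=M)) (inst cs B) /\ rowI (inst cs B) b = I2 (pr (s B) P Q)).
  { intros B0 HB. destruct (K B0 HB) as (W & K1 & K2).
    assert (Sc : forall c : bool, ssafe E M rdn 0 (map (psel c) ts) /\ inr (srun rdn 0 (map (psel c) ts) + b) /\
        rdn (srun rdn 0 (map (psel c) ts) + b) = if c then Q else P) by (intros []; auto).
    assert (Mono : forall c c', Forall (fun t => psel c t <= psel c' t) ts -> (if c then Q else P) <= (if c' then Q else P)).
    { intros c c' H. destruct (Sc c) as (_ & _ & <-), (Sc c') as (_ & _ & <-). apply rdn_le, Rplus_le_compat_r, srun_le; [|lra].
      clear - H. induction H; simpl; constructor; trivial. }
    assert (Sel : exists c c', map tlo (inst cs B0) = map (psel c) ts /\ map thi (inst cs B0) = map (psel c') ts /\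
        (if c then Q else P, if c' then Q else P) = pr (s B0) P Q).
    { specialize (V B0 HB). destruct Hd as [Hd|Hd].
      - destruct (K1 Hd). exists (fst (s B0)), (snd (s B0)). repeat split; trivial. apply Mono in Hd.
        unfold pr. destruct (Rle_dec P Q); [trivial|contradiction].
      - destruct (K2 Hd). exists (snd (s B0)), (fst (s B0)). repeat split; trivial. apply Mono in Hd.
        unfold pr. destruct (Rle_dec P Q); [|trivial]. replace Q with P by lra. destruct (s B0) as [[] []]; trivial. }
    destruct Sel as (c & c' & E1 & E2 & <-). destruct (Sc c) as (S1 & I1 & O1), (Sc c') as (S2 & J2 & O2).
    split.
    - apply wfin_wft; trivial; rewrite ?E1, ?E2; eapply ssafe_inr; eauto.
    - apply rowI_fin; rewrite ?E1, ?E2; trivial. }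
  split; [|intros; apply Res; trivial].
  exists cs, b. split; [|split; trivial].
  - clear - C. induction C as [|t c ts cs [H _] C IH]; constructor; trivial.
  - intros B0 HB. split; trivial. apply Res; trivial.
Qed.

End Rows.

(** * Output sums *)

Definition asb (P : Prop) : bool := if excluded_middle_informative P then true else false.

Lemma asb_true P : P -> asb P = true.
Proof. intros H. unfold asb. destruct (excluded_middle_informative P); tauto. Qed.

Lemma asb_false P : ~ P -> asb P = false.
Proof. intros H. unfold asb. destruct (excluded_middle_informative P); tauto. Qed.

Lemma asb_iff P Q : (P <-> Q) -> asb P = asb Q.
Proof. intros H. unfold asb. destruct (excluded_middle_informative P), (excluded_middle_informative Q); tauto. Qed.

Section Ladder.
Context {E M : nat} {fp : FP E M}.
Variable z : R.
Hypothesis Hz : isF E M z /\ eps M / 2 + 2 * eps M ^ 2 <= z <= 5 / 4 - 2 * eps M.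
Local Set Default Proof Using "fp Hz".

Local Notation Mz := (Z.of_nat M).
Local Notation eM := (emax E).
Local Notation F := (isF E M).
Local Notation w := (omega E M).
Local Notation Om := (Omega E M).
Local Notation inr := (in_range E M).
Local Notation good := (good E M z).
Local Notation fbar := (fbar E M).
Local Notation fin := (fin (E:=E) (M:=M)).
Local Notation rdn := (rdn (E:=E) (M:=M)).
Local Notation Hr := (rdn_rspec (E:=E) (M:=M)).
Local Notation fsum := (fsum (E:=E) (M:=M)).

(* With b = true the order of fbar, with b = false its opposite. *)
Definition dle (b : bool) (x y : fbar) : Prop := if b then fle x y else fle y x.
Definition dsg (b : bool) : R := if b then 1 else -1.
Definition dinf (b : bool) : fbar := if b then PInf else NInf.

Lemma dle_trans b x y t : dle b x y -> dle b y t -> dle b x t.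
Proof using fp. destruct b; simpl; intros; eapply fle_trans; eauto. Qed.

Lemma dle_total b x y : x <> NaN -> y <> NaN -> dle b x y \/ dle b y x.
Proof using fp. destruct b; simpl; intros N1 N2; destruct (fle_total x y N1 N2); auto. Qed.

Lemma dsg_F b x : F x -> F (dsg b * x).
Proof using fp.
  intros Fx. destruct b; simpl; [rewrite Rmult_1_l; trivial|]. replace (-1 * x) with (- x) by ring. apply F_opp; trivial.
Qed.

Lemma dle_fin b s t : F s -> F t -> dle b (fin (dsg b * s)) (fin (dsg b * t)) <-> s <= t.
Proof using fp.
  intros Fs Ft. pose proof (dsg_F b s Fs). pose proof (dsg_F b t Ft).
  destruct b; simpl in *; rewrite fle_fin by trivial; split; lra.
Qed.

Lemma dle_inf b (x : fbar) : x <> NaN -> dle b x (dinf b).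
Proof using fp. destruct b, x; unfold dle, fle; simpl; congruence. Qed.

Lemma dle_fin_inf b t : ~ dle b (fin t) (dinf (negb b)).
Proof using fp. destruct b; unfold dle, fle; simpl; congruence. Qed.

Lemma fbar_cases b (y : fbar) : y <> NaN -> (exists t, F t /\ y = fin (dsg b * t)) \/ y = dinf b \/ y = dinf (negb b).
Proof using fp.
  intros N. destruct y as [t| | |]; [left|destruct b; simpl; auto|destruct b; simpl; auto|congruence].
  exists (dsg b * fval t). split; [apply dsg_F, fval_F|]. rewrite Fin_fin. f_equal. destruct b; simpl; ring.
Qed.

(** Rounding seen in direction b; with it the ladders on both sides of 0 come from one proof about
    nonnegative floats. *)
Definition drd (b : bool) (x : R) : R := dsg b * rdn (dsg b * x).

Lemma drd_rspec b : rspec (E:=E) (M:=M) (drd b).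
Proof using fp.
  replace (drd b) with (if b then rdn else fun x => - rdn (- x)).
  - destruct b; [|apply rspec_opp]; apply Hr.
  - apply functional_extensionality. intros x. unfold drd, dsg. destruct b.
    + rewrite !Rmult_1_l; trivial.
    + replace (-1 * x) with (- x) by ring. ring.
Qed.

Lemma rdn_dsg b x : rdn (dsg b * x) = dsg b * drd b x.
Proof using fp. unfold drd. destruct b; simpl; ring. Qed.

Lemma rnd_dsg b y : inr y -> rnd E M (dsg b * y) = fin (dsg b * drd b y).
Proof using fp.
  intros H. rewrite rnd_fin, rdn_dsg; trivial. destruct b; simpl; [rewrite Rmult_1_l; trivial|].
  replace (-1 * y) with (- y) by ring. apply inr_opp; trivial.
Qed.

Lemma rnd_dinf b y : Om + rnd_c E M <= y -> rnd E M (dsg b * y) = dinf b.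
Proof using fp.
  intros H. pose proof (rnd_c_pos E M). pose proof (Om_ge (E:=E) (M:=M)). pose proof (bp_pos eM).
  rewrite rnd_cases. destruct b; simpl.
  - destruct (Rle_dec (1 * y) _); [lra|]. destruct (Rle_dec _ (1 * y)); [trivial|lra].
  - destruct (Rle_dec (-1 * y) _); [trivial|lra].
Qed.

(* An entry (b, th, v) contributes z * v to the sum for y when y is beyond the threshold th. *)
Definition contrib (p : (bool * fbar) * R) (y : fbar) : R :=
  if asb (dle (fst (fst p)) (snd (fst p)) y) then z * snd p else 0.

Definition gsum (acc : fbar) (ps : list ((bool * fbar) * R)) (y : fbar) : fbar :=
  fsum acc (map (fun p => contrib p y) ps).

Definition entry_ok (b : bool) (x : R) (p : (bool * fbar) * R) : Prop :=
  fst (fst p) = b /\ good (snd p) /\ 0 <= dsg b * (z * snd p) /\ snd (fst p) <> NaN /\ ~ dle b (snd (fst p)) (fin (dsg b * x)).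

Lemma gsum_false acc ps y : Forall (fun p => ~ dle (fst (fst p)) (snd (fst p)) y) ps -> gsum acc ps y = acc.
Proof.
  intros H. unfold gsum, fsum. induction H as [|p ps Hp H IH]; simpl; trivial.
  unfold contrib at 2. rewrite asb_false, (rd_0 _ Hr), fadd_0; trivial.
Qed.

Lemma gsum_app acc ps qs y : gsum acc (ps ++ qs) y = gsum (gsum acc ps y) qs y.
Proof. unfold gsum, fsum. rewrite map_app, fold_left_app. reflexivity. Qed.

(** Downward induction from [Om]. Each entry adds the spacing from one float to the next and is
    switched on by that next float; all later thresholds lie further out, so the sum stops precisely
    at y. *)
Lemma ladder_from b x : F x -> 0 <= x -> exists ps, Forall (entry_ok b x) ps /\
  forall y, y <> NaN -> dle b (fin (dsg b * x)) y -> gsum (fin (dsg b * x)) ps y = y.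
Proof.
  intros Fx Hx. pose proof (w_pos (E:=E) (M:=M)) as Pw. pose proof M_ge as M3. pose proof emax_ge as E15.
  pose proof (emin_emax (E:=E)) as EE. pose proof (rd_0 _ Hr) as R0. pose proof (z_bounds _ Hr z Hz) as Zb.
  destruct (F_mult x Fx) as [n Hn]. destruct (F_mult Om F_Om) as [N HN].
  assert (T1 : forall v : R, rdn (z * (dsg b * v)) = dsg b * drd b (z * v)).
  { intros v. replace (z * (dsg b * v)) with (dsg b * (z * v)) by ring. apply rdn_dsg. }
  assert (Vp : forall v, 0 < drd b (z * v) -> 0 <= dsg b * (z * (dsg b * v))).
  { intros v Hv. replace (dsg b * (z * (dsg b * v))) with (z * v) by (destruct b; simpl; ring).
    apply Rnot_lt_le; intros C. pose proof (rd_ub _ (drd_rspec b) (z * v) 0 F_0 ltac:(lra)). lra. }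
  assert (Gd : forall v, good v -> good (dsg b * v)).
  { intros v [Fv Iv]. split; [apply dsg_F; trivial|]. destruct b; simpl.
    - rewrite Rmult_1_l; trivial.
    - replace (z * (-1 * v)) with (- (z * v)) by ring. apply inr_opp; trivial. }
  assert (St : forall x v, F x -> fadd (fin (dsg b * x)) (fin (rdn (z * (dsg b * v)))) = rnd E M (dsg b * (x + drd b (z * v)))).
  { intros t v Ft. rewrite T1 by trivial. simpl. rewrite !fval_toF; [f_equal; ring| |apply dsg_F; trivial].
    apply dsg_F, (rs_F _ (drd_rspec b)). }
  assert (Eq : forall t t' y, F t -> F t' -> (forall s, F s -> t < s -> t' <= s) -> y <> NaN ->
     dle b (fin (dsg b * t)) y -> ~ dle b (fin (dsg b * t')) y -> y = fin (dsg b * t)).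
  { intros t t' y Ft Ft' Gap Ny L1 L2. destruct (fbar_cases b y Ny) as [(s & Fs & ->)|[-> | ->]].
    - apply dle_fin in L1; trivial. rewrite dle_fin in L2 by trivial. do 2 f_equal.
      destruct (Rle_lt_or_eq_dec _ _ L1) as [C|C]; [|auto]. elim L2. apply Gap; trivial.
    - elim L2. apply dle_inf. discriminate.
    - elim (dle_fin_inf b _ L1). }
  assert (G : forall k n, (N - n)%Z = Z.of_nat k -> F (IZR n * w) -> 0 <= IZR n * w ->
     exists ps, Forall (entry_ok b (IZR n * w)) ps /\
       forall y, y <> NaN -> dle b (fin (dsg b * (IZR n * w))) y -> gsum (fin (dsg b * (IZR n * w))) ps y = y).
  { clear x Fx Hx n Hn. intros k; induction k as [k IH] using lt_wf_ind. intros n Hk Fn Pn.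
    destruct (Z.eq_dec n N) as [->|D].
    (* The last entry leads from [Om] to infinity: an increment above half of the top spacing
       exceeds [rnd_c] and overflows. *)
    - rewrite <- HN in *. destruct (unit_good _ (drd_rspec b) z Hz (eM - Mz) ltac:(lia)) as (v & Gv & Hv).
      pose proof (bp_pos (eM - Mz)). pose proof (F_Om (E:=E) (M:=M)) as FO.
      exists [((b, dinf b), dsg b * v)]. split.
      + constructor; [|constructor]. split; [trivial|]. split; [apply Gd; trivial|]. split; [apply Vp; lra|].
        split; [destruct b; discriminate|]. simpl. intros C. destruct b; unfold dle, fle in C; simpl in C; discriminate.
      + intros y Ny L. unfold gsum, fsum; cbn [map fold_left]. unfold contrib; cbn [fst snd].
        destruct (fbar_cases b y Ny) as [(s & Fs & ->)|[-> | ->]].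
        * rewrite asb_false; [rewrite R0, fadd_0|].
          -- apply dle_fin in L; trivial. do 2 f_equal. apply F_le_Om, Rabs_le_inv in Fs. lra.
          -- intros C. destruct b; unfold dle, fle in C; simpl in C; discriminate.
        * rewrite asb_true by (apply dle_inf; destruct b; discriminate). rewrite St by trivial. apply rnd_dinf.
          rewrite rnd_c_bp. replace (eM - Mz)%Z with (eM - Mz - 1 + 1)%Z in Hv by lia. rewrite bp_S in Hv. lra.
        * elim (dle_fin_inf b _ L).
    - assert (LO : IZR n * w < Om).
      { rewrite HN. apply Rmult_lt_compat_r; trivial. apply IZR_lt; lia. }
      destruct (next_up (IZR n * w) Fn ltac:(lra)) as (m & a & Hm & Ha & Q & Hca & Fnx & Gap).
      destruct (unit_good _ (drd_rspec b) z Hz a Ha) as (v & Gv & Hv). pose proof (bp_pos a) as Pa.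
      assert (Nx : IZR n * w + bp a <= Om) by (apply Gap; trivial; apply F_Om).
      set (x := IZR n * w) in *.
      assert (Stx : drd b (x + drd b (z * v)) = x + bp a) by (apply (rd_step_up _ (drd_rspec b)); trivial).
      destruct (F_mult _ Fnx) as [n2 Hn2].
      assert (n < n2)%Z by (apply lt_IZR; unfold x in *; nra).
      assert (n2 <= N)%Z by (apply le_IZR; rewrite Hn2, HN in Nx; nra).
      destruct (IH (Z.to_nat (N - n2)) ltac:(lia) n2 ltac:(lia)) as (ps & P1 & P2); [rewrite <- Hn2; trivial|rewrite <- Hn2; lra|].
      rewrite <- Hn2 in P1, P2.
      assert (P1' : Forall (entry_ok b x) ps).
      { eapply Forall_impl; [|apply P1]. intros p (A1 & A2 & A3 & A4 & A5). repeat split; trivial; try apply A2.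
        intros C. apply A5. eapply dle_trans; [apply C|]. apply dle_fin; trivial. lra. }
      exists (((b, fin (dsg b * (x + bp a))), dsg b * v) :: ps). split.
      + constructor; trivial. split; [trivial|]. split; [apply Gd; trivial|]. split; [apply Vp; lra|].
        split; [discriminate|]. simpl. rewrite dle_fin by trivial. lra.
      + intros y Ny L. change (gsum (fin (dsg b * x)) (((b, fin (dsg b * (x + bp a))), dsg b * v) :: ps) y) with
          (gsum (fadd (fin (dsg b * x)) (fin (rdn (contrib ((b, fin (dsg b * (x + bp a))), dsg b * v) y)))) ps y).
        unfold contrib; cbn [fst snd]. destruct (classic (dle b (fin (dsg b * (x + bp a))) y)) as [C|C].
        * rewrite asb_true, St by trivial. rewrite rnd_dsg, Stx; [apply P2; trivial|].
          apply inr_le. rewrite Rabs_pos_eq; lra.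
        * rewrite asb_false, R0, fadd_0 by trivial. pose proof (Eq x (x + bp a) y Fn Fnx Gap Ny L C) as ->.
          apply gsum_false. eapply Forall_impl; [|apply P1']. intros p (A1 & _ & _ & _ & A5). rewrite A1; trivial. }
  rewrite Hn in *. apply (G (Z.to_nat (N - n))); trivial; try lra.
  assert (n <= N)%Z; [|lia]. apply le_IZR. pose proof (F_le_Om _ Fx) as L. apply Rabs_le_inv in L. rewrite HN in L. nra.
Qed.

Lemma full_ladder : exists ps, Forall (fun p => entry_ok (fst (fst p)) 0 p) ps /\
  forall y, y <> NaN -> gsum (fin 0) ps y = y.
Proof.
  assert (Z0 : forall b, dsg b * 0 = 0) by (intros; ring).
  destruct (ladder_from true 0 F_0 ltac:(lra)) as (ps & P1 & P2).
  destruct (ladder_from false 0 F_0 ltac:(lra)) as (qs & Q1 & Q2). rewrite Z0 in P2, Q2.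
  assert (Beyond : forall b rs, Forall (entry_ok b 0) rs -> forall y, y <> NaN -> dle b y (fin 0) ->
     Forall (fun p => ~ dle (fst (fst p)) (snd (fst p)) y) rs).
  { intros b rs H y Ny L. eapply Forall_impl; [|apply H]. intros p (A1 & _ & _ & _ & A5) C.
    rewrite A1 in C. apply A5. rewrite Z0. eapply dle_trans; eauto. }
  exists (ps ++ qs). split.
  - apply Forall_app; split; [eapply Forall_impl; [|apply P1]|eapply Forall_impl; [|apply Q1]]; intros p Hp; destruct Hp as [A Hp];
      rewrite A; split; trivial.
  - intros y Ny. rewrite gsum_app. assert (N0 : fin 0 <> NaN) by discriminate.
    destruct (fle_total (fin 0) y N0 Ny) as [L|L].
    + rewrite (P2 y Ny L). apply gsum_false, (Beyond false qs); trivial.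
    + rewrite (gsum_false (fin 0) ps); [apply Q2; trivial|]. apply (Beyond true ps); trivial.
Qed.

End Ladder.

(** * Signals *)

Section Gadgets.
Context {E M : nat} {fp : FP E M}.

Local Notation Mz := (Z.of_nat M).
Local Notation pow_M1 := (pow2_S M).
Local Notation em := (emin E).
Local Notation eM := (emax E).
Local Notation F := (isF E M).
Local Notation w := (omega E M).
Local Notation Om := (Omega E M).
Local Notation wpos := (w_pos (E:=E) (M:=M)).
Local Notation inr := (in_range E M).
Local Notation fbar := (fbar E M).
Local Notation fin := (fin (E:=E) (M:=M)).
Local Notation wfp := (wf_pair (E:=E) (M:=M)).
Local Notation I2 := (pair_itv (E:=E) (M:=M)).
Local Notation rowI := (row_itv (E:=E) (M:=M)).
Local Notation rdn := (rdn (E:=E) (M:=M)).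
Local Notation Hr := (rdn_rspec (E:=E) (M:=M)).
Local Notation rdn_le := (rd_le _ (rdn_rspec (E:=E) (M:=M))).

Variable sigma : fbar -> fbar.
Variable d : nat.
Local Notation sr := (sr sigma).
Local Notation adm := (adm (E:=E) (M:=M) d).
Local Notation pre := (unit_pre sigma d).
Local Notation post := (unit_post sigma d).
Local Notation sig := (list (R * R) -> bool * bool).
Local Notation betw := (betw sigma).
Local Notation X := (X sigma d).
Local Notation vs := (vs d (E:=E) (M:=M)).
Hypothesis Hfin : forall x, F x -> sigma (fin x) = fin (sr x) /\ F (sr x).

Variables z ze c2 : R.
Hypothesis Hz : F z /\ eps M / 2 + 2 * eps M ^ 2 <= z <= 5 / 4 - 2 * eps M.
Hypothesis Hze : ze = z \/ ze = - z.
Hypothesis Fc2 : F c2.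
Hypothesis Hc2 : sr c2 = ze.
Local Notation good := (good E M z).
Local Notation run := (run rdn z).
Local Notation safe := (safe E M rdn z).
Local Notation zsg := (zsg z ze).
Local Notation cterm := (cterm z ze).
Local Notation Hzs := (zsg_mul rdn Hr z Hz ze Hze).

Variables (n a : Z) (e0 e1 : R).
Hypothesis He0 : e0 = IZR n * bp a.
Hypothesis He1 : e1 = e0 + bp a.
Hypothesis Fe0 : F e0.
Hypothesis Fe1 : F e1.
Hypothesis Hn : (2 ^ Mz <= Z.abs n <= 2 ^ (Mz + 1))%Z.
Hypothesis Hn1 : (2 ^ Mz <= Z.abs (n + 1) <= 2 ^ (Mz + 1))%Z.
Hypothesis Hadj : forall x, F x -> x <= e0 \/ e1 <= x.
Hypothesis Hlo : bp (em + 5) <= Rabs e0 < 4.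
Variable lam : R.
Local Notation al := (sr e0).
Local Notation be := (sr e1).
Hypothesis Hab : al <> be.
Hypothesis Hal : bp (em + 5) <= Rabs al <= bp (eM - 6) * Rabs e0.
Hypothesis Hbe : bp (em + 5) <= Rabs be <= bp (eM - 6) * Rabs e0.
Hypothesis Hlam : 0 <= lam <= bp (eM - 7) * Rmin (Rabs al) (bp (Mz + 3)).
Hypothesis Hlow : forall x, F x -> x <= e0 -> sg al be * (sr x - al) <= 0 /\ Rabs (sr x - al) <= lam * Rabs (x - e0).
Hypothesis Hhigh : forall x, F x -> e1 <= x -> 0 <= sg al be * (sr x - be) /\ Rabs (sr x - be) <= lam * Rabs (x - e1).
Hypothesis Hctype : exists g, forall k s A B, vs s -> X k s A B -> F A -> F B -> 32 * w <= Rabs (B - A) ->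
  X (k + g) s 0 ze /\ X (k + g) s ze 0.
Local Set Default Proof Using "All".

Local Notation with_eta L := (L rdn Hr z Hz n a e0 e1 He0 He1 Fe0 Fe1 Hn Hn1 Hadj Hlo al be lam
  (proj2 (Hfin e0 Fe0)) (proj2 (Hfin e1 Fe1)) Hab Hal Hbe Hlam).

Lemma Fze : F ze.
Proof. rewrite <- Hc2. apply Hfin; trivial. Qed.

Lemma const_ex k : exists psi, post k psi /\ forall B, adm B -> psi B = (ze, ze).
Proof.
  destruct (X_const sigma d Hfin k (fun _ => (true, true)) c2 Fc2) as (psi & H1 & H2).
  exists psi; split; trivial. intros B HB. rewrite H2, pr_same, Hc2; trivial.
Qed.

Definition cls (c : bool) (D p : R) : Prop := if c then phigh (E:=E) (M:=M) e1 D p else plow (E:=E) (M:=M) e0 D p.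
Definition qcls (c : bool) (D u : R) : Prop :=
  if c then high (E:=E) (M:=M) al be lam D u else low (E:=E) (M:=M) al be lam D u.

(* Before activation the unit codes the bit up to an error D: at most e0 if false, at least e1 if true. *)
Definition PC (k : nat) (s : sig) (D : R) : Prop := exists phi, pre k phi /\ forall B, adm B ->
  exists l u, phi B = I2 (l, u) /\ l <= u /\ cls (fst (s B)) D l /\ cls (snd (s B)) D u.

Lemma cls_valid s D l u : l <= u -> cls (fst s) D l -> cls (snd s) D u -> valid s.
Proof.
  pose proof (bp_pos a). unfold cls, valid, phigh, plow. intros L H1 H2 H3. rewrite H3 in H1. destruct (snd s); trivial. lra.
Qed.

(** If both sides of eta occur in the interval, the monotone jump of sigma puts the two extremes on
    opposite sides; otherwise only one class is present. The Lipschitz bound then applies on the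
    side where each extreme is attained. *)
Lemma class_post s D l u : 0 <= D -> l <= u -> cls (fst s) D l -> cls (snd s) D u ->
  exists l' u', sigma_sharp sigma (I2 (l, u)) = I2 (l', u') /\ wfp (l', u') /\
    (if Rlt_dec al be then qcls (fst s) D l' /\ qcls (snd s) D u' else qcls (snd s) D l' /\ qcls (fst s) D u').
Proof.
  intros HD L Cl Cu. pose proof (cls_valid s D l u L Cl Cu) as V. pose proof (bp_pos a) as PG.
  assert (W : wfp (l, u)).
  { unfold cls, phigh, plow in *. unfold wf_pair; simpl. destruct (fst s), (snd s); tauto. }
  destruct (sharp_ex sigma Hfin l u W) as (x1 & x2 & F1 & F2 & R1 & R2 & -> & Ext).
  destruct W as (Fl & Fu & _); simpl in Fl, Fu.
  exists (sr x1), (sr x2). split; trivial.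
  split; [split; [apply Hfin; trivial|split; [apply Hfin; trivial|simpl; apply Ext; trivial; lra]]|].
  assert (Lx : forall x, F x -> l <= x <= u -> x <= e0 -> fst s = false -> qcls false D (sr x)).
  { intros x Fx Hx Le Q. rewrite Q in Cl. destruct Cl as [_ Cl]. destruct (Hlow x Fx Le) as [A1 A2].
    split; [apply Hfin; trivial|]. split; trivial. eapply Rle_trans; [apply A2|]. apply Rmult_le_compat_l; [lra|].
    apply Rabs_le; lra. }
  assert (Hx : forall x, F x -> l <= x <= u -> e1 <= x -> snd s = true -> qcls true D (sr x)).
  { intros x Fx Hx Le Q. rewrite Q in Cu. destruct Cu as [_ Cu]. destruct (Hhigh x Fx Le) as [A1 A2].
    split; [apply Hfin; trivial|]. split; trivial. eapply Rle_trans; [apply A2|]. apply Rmult_le_compat_l; [lra|].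
    apply Rabs_le; lra. }
  unfold valid in V. pose proof (Ext l Fl ltac:(lra)) as El. pose proof (Ext u Fu ltac:(lra)) as Eu.
  assert (Sg : sg al be = if Rlt_dec al be then 1 else -1) by reflexivity.
  assert (T : fst s = true -> e1 <= l) by (intros Q; rewrite Q in Cl; destruct Cl; lra).
  assert (T' : fst s = false -> l <= e0) by (intros Q; rewrite Q in Cl; destruct Cl; lra).
  assert (U : snd s = true -> e1 <= u) by (intros Q; rewrite Q in Cu; destruct Cu; lra).
  assert (U' : snd s = false -> u <= e0) by (intros Q; rewrite Q in Cu; destruct Cu; lra).
  destruct (Rlt_dec al be) as [O|O]; rewrite Sg in Hlow, Hhigh.
  - split.
    + destruct (fst s) eqn:Q; [apply Hx; auto; specialize (T eq_refl); lra|].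
      destruct (Hadj x1 F1) as [C|C]; [apply Lx; auto|].
      exfalso. pose proof (Hhigh x1 F1 C). pose proof (Hlow l Fl (T' eq_refl)). lra.
    + destruct (snd s) eqn:Q.
      * destruct (Hadj x2 F2) as [C|C]; [|apply Hx; auto].
        exfalso. pose proof (Hlow x2 F2 C). pose proof (Hhigh u Fu (U eq_refl)). lra.
      * apply Lx; auto; [specialize (U' eq_refl); lra|]. destruct (fst s); trivial. specialize (V eq_refl); discriminate.
  - split.
    + destruct (snd s) eqn:Q.
      * destruct (Hadj x1 F1) as [C|C]; [|apply Hx; auto].
        exfalso. pose proof (Hlow x1 F1 C). pose proof (Hhigh u Fu (U eq_refl)). lra.
      * apply Lx; auto; [specialize (U' eq_refl); lra|]. destruct (fst s); trivial. specialize (V eq_refl); discriminate.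
    + destruct (fst s) eqn:Q; [apply Hx; auto; specialize (T eq_refl); lra|].
      destruct (Hadj x2 F2) as [C|C]; [apply Lx; auto|].
      exfalso. pose proof (Hhigh x2 F2 C). pose proof (Hlow l Fl (T' eq_refl)). lra.
Qed.

Lemma tlo_cterm v : tlo (cterm v) = z * v /\ thi (cterm v) = z * v.
Proof.
  destruct Hzs as [Q _]. unfold tlo, thi, cterm; simpl. rewrite Rmin_left, Rmax_left by lra.
  replace (ze * (zsg * v)) with (zsg * ze * v) by ring. rewrite Q; auto.
Qed.

Lemma wfin_cterms ws : Forall good ws -> Forall (wfin (E:=E) (M:=M)) (map cterm ws).
Proof.
  intros G. apply Forall_map. eapply Forall_impl; [|apply G]. intros v [Fv _]. split.
  - unfold wf_pair; simpl. pose proof Fze. repeat split; trivial; lra.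
  - apply (zsg_F rdn Hr z Hz ze Hze); trivial.
Qed.

Lemma tlo_cterms ws : map tlo (map cterm ws) = map (Rmult z) ws /\ map thi (map cterm ws) = map (Rmult z) ws.
Proof. rewrite !map_map. split; apply map_ext; intros; apply tlo_cterm. Qed.

Definition ckids (psi : list (R * R) -> R * R) (ws : list R) : list ((list (R * R) -> R * R) * R) :=
  map (fun v => (psi, zsg * v)) ws.

Lemma inst_ckids psi ws B : psi B = (ze, ze) -> inst (ckids psi ws) B = map cterm ws.
Proof. intros Q. unfold inst, ckids. rewrite map_map. apply map_ext. intros v. simpl. rewrite Q; trivial. Qed.

Lemma ckids_ok k psi ws : Forall good ws -> post k psi -> Forall (fun c => F (snd c) /\ post k (fst c)) (ckids psi ws).
Proof.
  intros G H. apply Forall_map. eapply Forall_impl; [|apply G]. intros v [Fv _]. simpl. split; trivial.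
  apply (zsg_F rdn Hr z Hz ze Hze); trivial.
Qed.

Lemma driver_row k psi kw ws1 ws2 : post k psi -> F kw -> Forall good ws1 -> Forall good ws2 -> safe 0 ws1 ->
  (forall u, F u -> inr (u * kw) /\ inr (run 0 ws1 + rdn (u * kw)) /\
     safe (rdn (run 0 ws1 + rdn (u * kw))) ws2 /\ inr (run (rdn (run 0 ws1 + rdn (u * kw))) ws2 + e0)) ->
  exists phi, pre (S k) phi /\ forall B, adm B ->
    phi B = I2 (rdn (run (rdn (run 0 ws1 + rdn ((if Rlt_dec 0 kw then fst (psi B) else snd (psi B)) * kw))) ws2 + e0),
                rdn (run (rdn (run 0 ws1 + rdn ((if Rlt_dec 0 kw then snd (psi B) else fst (psi B)) * kw))) ws2 + e0)).
Proof.
  intros Hp Fk G1 G2 S1 H. destruct (const_ex k) as (pc & Hpc & Qc).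
  set (cs := ckids pc ws1 ++ (psi, kw) :: ckids pc ws2).
  exists (fun B => rowI (inst cs B) e0).
  assert (Wp : forall B, adm B -> wfp (psi B)) by (intros B HB; destruct Hp as (phi & _ & Hp); apply Hp; trivial).
  assert (Q : forall B, adm B -> Forall (wfin (E:=E) (M:=M)) (inst cs B) /\
     exists u1 u2, F u1 /\ F u2 /\ u1 = (if Rlt_dec 0 kw then fst (psi B) else snd (psi B)) /\
       u2 = (if Rlt_dec 0 kw then snd (psi B) else fst (psi B)) /\
       map tlo (inst cs B) = map (Rmult z) ws1 ++ u1 * kw :: map (Rmult z) ws2 /\
       map thi (inst cs B) = map (Rmult z) ws1 ++ u2 * kw :: map (Rmult z) ws2).
  { intros B HB. specialize (Qc B HB). destruct (Wp B HB) as (Wl & Wu & L).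
    assert (I : inst cs B = map cterm ws1 ++ (psi B, kw) :: map cterm ws2).
    { unfold cs. rewrite <- (inst_ckids pc ws1 B Qc), <- (inst_ckids pc ws2 B Qc). unfold inst. rewrite map_app. reflexivity. }
    rewrite I. split.
    - apply Forall_app; split; [apply wfin_cterms; trivial|]. constructor; [split; simpl; auto|apply wfin_cterms; trivial].
    - exists (if Rlt_dec 0 kw then fst (psi B) else snd (psi B)), (if Rlt_dec 0 kw then snd (psi B) else fst (psi B)).
      rewrite !map_app, !map_cons. destruct (tlo_cterms ws1) as [-> ->], (tlo_cterms ws2) as [-> ->].
      unfold tlo, thi; simpl. destruct (Rlt_dec 0 kw) as [C|C].
      + rewrite Rmin_left, Rmax_right by nra. auto 7.
      + rewrite Rmin_right, Rmax_left by nra. auto 7. }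
  assert (Sf : forall u, F u -> ssafe E M rdn 0 (map (Rmult z) ws1 ++ u * kw :: map (Rmult z) ws2) /\
     inr (srun rdn 0 (map (Rmult z) ws1 ++ u * kw :: map (Rmult z) ws2) + e0) /\
     srun rdn 0 (map (Rmult z) ws1 ++ u * kw :: map (Rmult z) ws2) = run (rdn (run 0 ws1 + rdn (u * kw))) ws2).
  { intros u Fu. destruct (H u Fu) as (H1 & H2 & H3 & H4). rewrite srun_app, ssafe_app. simpl. rewrite !srun_run.
    repeat split; trivial; apply ssafe_safe; trivial. }
  split.
  - exists cs, e0. split; [|split; trivial].
    + apply Forall_app; split; [apply ckids_ok; trivial|]. constructor; [split; trivial|apply ckids_ok; trivial].
    + intros B HB. split; trivial. destruct (Q B HB) as (W & u1 & u2 & Fu1 & Fu2 & _ & _ & E1 & E2).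
      apply wfin_wft; trivial; [rewrite E1|rewrite E2]; eapply ssafe_inr; apply Sf; trivial.
  - intros B HB. destruct (Q B HB) as (W & u1 & u2 & Fu1 & Fu2 & <- & <- & E1 & E2).
    destruct (Sf u1 Fu1) as (S3 & I3 & R3), (Sf u2 Fu2) as (S4 & I4 & R4).
    apply rowI_fin; rewrite ?E1, ?E2; trivial; [rewrite R3|rewrite R4]; trivial.
Qed.

Lemma contract_step k s D : 0 <= D -> PC k s D ->
  PC (S k) s (step (M:=M) n a D) /\
  (small (M:=M) n a D -> exists phi, pre (S k) phi /\ forall B, adm B -> phi B = I2 (pr (s B) e0 e1)).
Proof.
  intros HD (phi & Hp & Hphi).
  set (P := fun B p => sigma_sharp sigma (phi B) = I2 p /\ wfp p /\
    (if Rlt_dec al be then qcls (fst (s B)) D (fst p) /\ qcls (snd (s B)) D (snd p)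
     else qcls (snd (s B)) D (fst p) /\ qcls (fst (s B)) D (snd p))).
  (* [class_post] yields endpoints box by box, so they are chosen to obtain a function of the
     box. *)
  set (psi := fun B => epsilon (inhabits (0, 0)) (P B)).
  assert (Hpsi : forall B, adm B -> P B (psi B) /\ valid (s B)).
  { intros B HB. destruct (Hphi B HB) as (l & u & Q & L & Cl & Cu). split; [|eapply cls_valid; eauto].
    apply epsilon_spec. destruct (class_post (s B) D l u HD L Cl Cu) as (l' & u' & H1 & H2 & H3).
    exists (l', u'). unfold P. rewrite Q. auto. }
  destruct (with_eta contract) as (kw & ws1 & ws2 & Fk & G1 & G2 & Sk & S1 & Hin & HL & HH & EL & EH).
  destruct (driver_row k psi kw ws1 ws2) as (phi' & Hp' & Q'); trivial.
  { exists phi; split; trivial. intros B HB. destruct (Hpsi B HB) as [(H1 & H2 & _) _]. auto. }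
  assert (Cls : forall B, adm B ->
     qcls (fst (s B)) D (if Rlt_dec 0 kw then fst (psi B) else snd (psi B)) /\
     qcls (snd (s B)) D (if Rlt_dec 0 kw then snd (psi B) else fst (psi B))).
  { intros B HB. destruct (Hpsi B HB) as [(_ & _ & H) _]. unfold sg in Sk.
    destruct (Rlt_dec al be), (Rlt_dec 0 kw); try tauto; exfalso; lra. }
  assert (Out : forall c u, qcls c D u -> cls c (step (M:=M) n a D) (rdn (run (rdn (run 0 ws1 + rdn (u * kw))) ws2 + e0))).
  { intros [] u Hu; [apply HH|apply HL]; trivial. }
  split.
  - exists phi'. split; trivial. intros B HB. destruct (Cls B HB) as [K1 K2]. rewrite (Q' B HB).
    do 2 eexists. split; [reflexivity|]. split; [|split; apply Out; trivial].
    destruct (Hpsi B HB) as [(_ & (_ & _ & L) & _) _].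
    apply rdn_le, Rplus_le_compat_r, run_mono; [apply rdn_le|]. apply rdn_le, Rplus_le_compat_l, rdn_le.
    destruct (Rlt_dec 0 kw); nra.
  - intros Sm. exists phi'. split; trivial. intros B HB. destruct (Cls B HB) as [K1 K2]. rewrite (Q' B HB).
    assert (Ex : forall c u, qcls c D u -> rdn (run (rdn (run 0 ws1 + rdn (u * kw))) ws2 + e0) = if c then e1 else e0).
    { intros [] u Hu; [apply (EH D)|apply (EL D)]; trivial. }
    rewrite (Ex _ _ K1), (Ex _ _ K2). unfold pr. pose proof (bp_pos a). destruct (Rle_dec e0 e1); [trivial|lra].
Qed.

Lemma betw_eta : betw e0 e1 /\ betw e1 e0.
Proof.
  pose proof (bp_pos a).
  split; intros x Fx Hx; destruct (Hadj x Fx); (replace x with e0 by lra) || (replace x with e1 by lra);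
    destruct (Rle_dec al be); lra.
Qed.

Lemma vs_pc k s D : PC k s D -> vs s.
Proof. intros (phi & _ & H) B HB. destruct (H B HB) as (l & u & _ & L & C1 & C2). eapply cls_valid; eauto. Qed.

(** A first-layer threshold only knows its side of eta, and 2 [Om] is an error bound that any two
    floats satisfy. The contraction is iterated until the error is small, and one more layer hits
    the exact pair. *)
Lemma settle s : PC 0 s (2 * Om) -> exists k, X k s al be.
Proof.
  intros H. destruct (with_eta small_ex) as (N & Sm & Nn).
  assert (P : PC N s (Nat.iter N (step (M:=M) n a) (2 * Om))).
  { clear Sm. induction N as [|N IH]; trivial. simpl. apply contract_step; trivial. }
  destruct (contract_step N s _ (Nn N) P) as [_ K]. destruct (K Sm) as (phi & Hp & Q).
  exists (S N). apply (post_X sigma d Hfin _ _ phi); trivial; [eapply vs_pc; eauto|apply betw_eta].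
Qed.

Lemma apart_eta : 32 * w <= Rabs (be - al).
Proof. apply (apart32 rdn Hr z Hz); try (apply Hfin; trivial); tauto. Qed.

(** Passes the bit on to the next layer with standard codes in either order. It serves both to align
    depths and to exchange codes for negation. *)
Lemma refresh k s A B : vs s -> X k s A B -> F A -> F B -> 32 * w <= Rabs (B - A) ->
  X (S k) s al be /\ X (S k) s be al.
Proof.
  intros V HX FA FB HD. pose proof (bp_pos a) as PG.
  assert (N : Rabs (e1 - e0) <= Om).
  { rewrite He1. replace (e0 + bp a - e0) with (bp a) by ring. rewrite Rabs_pos_eq by lra.
    destruct (with_eta G_le) as [_ L]. eapply Rle_trans; [|apply Om_ge]. apply bp_le. pose proof M_ge; pose proof emax_ge; lia. }
  assert (Xz : X k s ze ze) by (rewrite <- Hc2; apply (X_const sigma d Hfin); trivial).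
  split.
  - destruct (drives_pre sigma d Hfin k s ze A B e0 e1) as (phi & Hp & Q); trivial; try apply Fze.
    + apply (drives_pair rdn Hr z Hz ze Hze); trivial; [lra|left; trivial].
    + apply (post_X sigma d Hfin _ _ phi); trivial; apply betw_eta.
  - destruct (drives_pre sigma d Hfin k s ze A B e1 e0) as (phi & Hp & Q); trivial; try apply Fze.
    + apply (drives_pair rdn Hr z Hz ze Hze); trivial; [lra|left; rewrite Rabs_minus_sym; trivial].
    + apply (post_X sigma d Hfin _ _ phi); trivial; apply betw_eta.
Qed.

(** With codes 0 and ze, each true input contributes exactly w, and [or_row] evaluates the count.
    Increasing both bits only increases the terms, so the endpoints combine independently. *)
Lemma or_gate k s1 s2 : vs s1 -> vs s2 -> X k s1 0 ze -> X k s2 0 ze ->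
  X (S k) (fun B => (fst (s1 B) || fst (s2 B), snd (s1 B) || snd (s2 B))%bool) al be.
Proof.
  intros V1 V2 (p1 & Hp1 & Q1) (p2 & Hp2 & Q2). pose proof wpos as Pw.
  destruct (with_eta or_row) as (u & ws & Gu & Hu & Gws & Hws). destruct (const_ex k) as (pc & Hpc & Qc).
  destruct Hzs as [Hzs1 _]. pose proof (z_bounds rdn Hr z Hz) as Zb.
  set (cs := (p1, zsg * u) :: (p2, zsg * u) :: ckids pc ws).
  assert (zu : 0 <= z * u).
  { apply Rnot_lt_le; intros C. pose proof (rd_ub _ Hr (z * u) 0 F_0 ltac:(lra)). lra. }
  assert (Z0 : rdn 0 = 0) by apply (rd_0 _ Hr).
  set (b2j := fun b : bool => if b then 1%Z else 0%Z).
  assert (T : forall s, valid s -> tlo (pr s 0 ze, zsg * u) = (if fst s then z * u else 0) /\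
                              thi (pr s 0 ze, zsg * u) = (if snd s then z * u else 0)).
  { intros s V. destruct (tlo_pr (E:=E) (M:=M) s 0 ze (zsg * u) V) as [H _]. unfold psel in H; simpl in H.
    assert (Qz : ze * (zsg * u) = z * u).
    { transitivity (zsg * ze * u); [ring|rewrite Hzs1; trivial]. }
    rewrite Qz, Rmult_0_l in H. destruct (H zu) as [-> ->].
    split; [destruct (fst s)|destruct (snd s)]; rewrite ?Qz; ring. }
  assert (Sf : forall b1 b2 : bool, let ps := (if b1 then z * u else 0) :: (if b2 then z * u else 0) :: map (Rmult z) ws in
     ssafe E M rdn 0 ps /\ inr (srun rdn 0 ps + e0) /\ rdn (srun rdn 0 ps + e0) = if (b1 || b2)%bool then e1 else e0).
  { intros b1 b2. assert (Rb : forall b : bool, rdn (if b then z * u else 0) = IZR (b2j b) * w).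
    { intros []; simpl; [rewrite Hu|rewrite Z0]; ring. }
    assert (Ib : forall b : bool, inr (if b then z * u else 0)).
    { intros []; [apply Gu|apply inr_le, F_le_Om, F_0]. }
    assert (Fj : forall j, (0 <= j <= 2)%Z -> F (IZR j * w)) by (intros; apply F_w; pose proof (pow_M_8 (M:=M)); rewrite pow_M1; lia).
    assert (J : (0 <= b2j b1 + b2j b2 <= 2)%Z) by (destruct b1, b2; simpl; lia).
    assert (J1 : (0 <= b2j b1 <= 2)%Z) by (destruct b1; simpl; lia).
    simpl. rewrite !Rb, Rplus_0_l, (rd_id _ Hr _ (Fj _ J1)), <- Rmult_plus_distr_r, <- plus_IZR, (rd_id _ Hr _ (Fj _ J)), srun_run.
    destruct (Hws _ J) as (W1 & W2 & W3). repeat split; auto.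
    - apply inr_le, F_le_Om; auto.
    - apply inr_le, F_le_Om; auto.
    - apply ssafe_safe; trivial.
    - rewrite W3. destruct b1, b2; reflexivity. }
  assert (Q : forall B, adm B -> Forall (wfin (E:=E) (M:=M)) (inst cs B) /\
     map tlo (inst cs B) = (if fst (s1 B) then z * u else 0) :: (if fst (s2 B) then z * u else 0) :: map (Rmult z) ws /\
     map thi (inst cs B) = (if snd (s1 B) then z * u else 0) :: (if snd (s2 B) then z * u else 0) :: map (Rmult z) ws).
  { intros B HB. unfold cs. change (inst ((p1, zsg * u) :: (p2, zsg * u) :: ckids pc ws) B) with
      ((p1 B, zsg * u) :: (p2 B, zsg * u) :: inst (ckids pc ws) B).
    rewrite (inst_ckids pc ws B (Qc B HB)), (Q1 B HB), (Q2 B HB), !map_cons.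
    destruct (T _ (V1 B HB)) as [-> ->], (T _ (V2 B HB)) as [-> ->], (tlo_cterms ws) as [-> ->]. split; auto.
    assert (Wf : forall s, valid s -> wfin (E:=E) (M:=M) (pr s 0 ze, zsg * u)).
    { intros s V. split; simpl; [apply pr_wfp; trivial; [apply F_0|apply Fze]|apply (zsg_F rdn Hr z Hz ze Hze), Gu]. }
    constructor; [apply Wf, V1; trivial|]. constructor; [apply Wf, V2; trivial|]. apply wfin_cterms; trivial. }
  apply (post_X sigma d Hfin _ _ (fun B => rowI (inst cs B) e0)); trivial; [| |apply betw_eta|].
  - exists cs, e0. split; [|split; trivial].
    + constructor; [split; [apply (zsg_F rdn Hr z Hz ze Hze), Gu|trivial]|].
      constructor; [split; [apply (zsg_F rdn Hr z Hz ze Hze), Gu|trivial]|]. apply ckids_ok; trivial.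
    + intros B HB. split; trivial. destruct (Q B HB) as (W & E1 & E2).
      apply wfin_wft; trivial; [rewrite E1|rewrite E2]; eapply ssafe_inr; apply Sf.
  - intros B HB. specialize (V1 B HB). specialize (V2 B HB). unfold valid in *; simpl.
    destruct (fst (s1 B)), (fst (s2 B)); simpl; try discriminate; intros _; rewrite ?V1, ?V2 by trivial; auto using orb_true_r.
  - intros B HB. destruct (Q B HB) as (W & E1 & E2).
    destruct (Sf (fst (s1 B)) (fst (s2 B))) as (K1 & K2 & K3), (Sf (snd (s1 B)) (snd (s2 B))) as (K4 & K5 & K6).
    replace (pr _ e0 e1) with ((if (fst (s1 B) || fst (s2 B))%bool then e1 else e0), (if (snd (s1 B) || snd (s2 B))%bool then e1 else e0)).
    + apply rowI_fin; rewrite ?E1, ?E2; trivial.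
    + unfold pr; simpl. pose proof (bp_pos a). destruct (Rle_dec e0 e1); [trivial|lra].
Qed.

(** Availability at all large depths lets any finite family of bits feed one row, whose inputs must
    have equal depth. *)
Definition signal (s : sig) : Prop := vs s /\ exists K, forall k, (K <= k)%nat -> X k s al be.

Lemma signal_intro k s : vs s -> X k s al be -> signal s.
Proof.
  intros V H. split; trivial. exists k. intros k' L. induction L as [|k' L IH]; trivial.
  exact (proj1 (refresh k' s al be V IH (proj2 (Hfin e0 Fe0)) (proj2 (Hfin e1 Fe1)) apart_eta)).
Qed.

Lemma signal_ext s s' : signal s -> (forall B, adm B -> s B = s' B) -> signal s'.
Proof.
  intros [V [K H]] Q. split.
  - intros B HB. rewrite <- Q; auto.
  - exists K. intros k L. destruct (H k L) as (psi & H1 & H2). exists psi; split; trivial.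
    intros B HB. rewrite <- Q; auto.
Qed.

(** The bit is emitted with codes be, al and then read with al, be. *)
Lemma signal_flip s : signal s -> signal (fun B => flip (s B)).
Proof.
  intros [V [K H]]. apply (signal_intro (S K)).
  - intros B HB. apply valid_flip; auto.
  - apply (X_flip sigma d Hfin). exact (proj2 (refresh K s al be V (H K (le_n K)) (proj2 (Hfin e0 Fe0)) (proj2 (Hfin e1 Fe1)) apart_eta)).
Qed.

Lemma signal_ctype s : signal s -> exists K, forall k, (K <= k)%nat -> X k s 0 ze.
Proof.
  intros [V [K H]]. destruct Hctype as [g Hg]. exists (K + g)%nat. intros k L.
  replace k with (k - g + g)%nat by lia.
  exact (proj1 (Hg _ s al be V (H (k - g)%nat ltac:(lia)) (proj2 (Hfin e0 Fe0)) (proj2 (Hfin e1 Fe1)) apart_eta)).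
Qed.

Lemma signal_or s1 s2 : signal s1 -> signal s2 ->
  signal (fun B => (fst (s1 B) || fst (s2 B), snd (s1 B) || snd (s2 B))%bool).
Proof.
  intros H1 H2. destruct (signal_ctype s1 H1) as [K1 G1], (signal_ctype s2 H2) as [K2 G2].
  pose proof (proj1 H1) as V1. pose proof (proj1 H2) as V2.
  apply (signal_intro (S (K1 + K2))).
  - intros B HB. specialize (V1 B HB). specialize (V2 B HB). unfold valid in *; simpl.
    destruct (fst (s1 B)), (fst (s2 B)); simpl; try discriminate; intros _; rewrite ?V1, ?V2 by trivial; auto using orb_true_r.
  - apply or_gate; trivial; [apply G1|apply G2]; lia.
Qed.

Lemma signal_false : signal (fun _ => (false, false)).
Proof.
  apply (signal_intro 0); [intros B _ H; trivial|].
  apply (post_X sigma d Hfin _ _ _ e0 e1 (pre_const sigma d Hfin 0 e0 Fe0)); trivial.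
  - intros B _ H; trivial.
  - apply betw_eta.
  - intros B _. unfold pr; simpl. destruct (Rle_dec e0 e1); trivial.
Qed.

Definition gtb (p x : R) : bool := if Rlt_dec p x then true else false.

Lemma combine_zeros (B1 : list (R * R)) l l' :
  combine (B1 ++ l) (repeat 0 (length B1) ++ l') = map (fun p => (p, 0)) B1 ++ combine l l'.
Proof. induction B1; simpl; congruence. Qed.

(** The sign tau keeps the threshold in [0, 1), where [next_up] supplies the spacing; negative
    thresholds come from tau = -1. *)
Lemma atom_gt tau p i : tau = 1 \/ tau = -1 -> F p -> 0 <= p < 1 -> (i < d)%nat ->
  signal (fun B => let q := nth i B (0, 0) in
    if Rlt_dec 0 tau then (gtb p (fst q), gtb p (snd q)) else (gtb p (- snd q), gtb p (- fst q))).
Proof.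
  intros Ht Fp Hp Hi. pose proof emax_ge as E15. pose proof (bp_pos a) as PG. pose proof M_ge as M3.
  assert (O8 : 8 <= Om).
  { eapply Rle_trans; [|apply Om_ge]. replace 8 with (bp 3) by (unfold bp; simpl; ring). apply bp_le; lia. }
  destruct (next_up p Fp ltac:(lra)) as (k & c & Hk & Hc & Qp & Hkc & Fnx & Gap).
  rewrite Qp in Hp, Fnx, Gap.
  destruct (with_eta threshold_row k c Hk ltac:(lia) Hkc ltac:(lra)) as (wt & b & s & Fwt & Fb & Hs & Sw & Thr).
  rewrite <- Qp in Thr, Fnx, Gap, Hp.
  set (W := tau * wt).
  assert (Ftau : forall x, F x -> F (tau * x)).
  { intros x Fx. destruct Ht as [-> | ->]; [rewrite Rmult_1_l; trivial|]. replace (-1 * x) with (- x) by ring. apply F_opp; trivial. }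
  assert (Btau : forall x, Rabs (tau * x) = Rabs x).
  { intros x. destruct Ht as [-> | ->]; [rewrite Rmult_1_l; trivial|]. replace (-1 * x) with (- x) by ring. apply Rabs_Ropp. }
  set (lo := fun q : R * R => if Rlt_dec 0 W then fst q else snd q).
  set (hi := fun q : R * R => if Rlt_dec 0 W then snd q else fst q).
  (* For s = -1 the row computes the negated comparison, which is flipped back at the end. *)
  set (bit := fun x => if Rlt_dec 0 s then gtb p (tau * x) else negb (gtb p (tau * x))).
  set (Rv := fun x => rdn (rdn (x * W) + b)).
  assert (Prop1 : forall x, F x -> Rabs x <= 1 -> inr (x * W) /\ inr (rdn (x * W) + b) /\ cls (bit x) (2 * Om) (Rv x)).
  { intros x Fx Lx. destruct (Thr (tau * x) (Ftau x Fx) ltac:(rewrite Btau; trivial)) as (T1 & T2 & T3 & T4).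
    unfold Rv. replace (x * W) with (tau * x * wt) by (unfold W; ring). split; [|split]; trivial.
    set (y := rdn (rdn (tau * x * wt) + b)) in *. assert (Fy : F y) by apply (rs_F _ Hr).
    assert (By : Rabs y <= Om) by (apply F_le_Om; trivial). apply Rabs_le_inv in By.
    destruct Hlo as [_ L4]. apply Rabs_def2 in L4.
    assert (Cl : forall c : bool, (if c then e1 <= y else y <= e0) -> cls c (2 * Om) y).
    { intros []; unfold cls, phigh, plow; intros Hy; split; trivial; lra. }
    apply Cl. unfold bit, gtb. destruct (Rlt_dec p (tau * x)) as [C|C].
    - specialize (T4 (Gap _ (Ftau x Fx) C)). destruct (Rlt_dec 0 s); trivial.
    - specialize (T3 ltac:(lra)). destruct (Rlt_dec 0 s); trivial. }
  assert (Pc : PC 0 (fun B => let q := nth i B (0, 0) in (bit (lo q), bit (hi q))) (2 * Om)).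
  { exists (fun B => rowI [(nth i B (0, 0), W)] b).
    assert (Q : forall B, adm B -> let q := nth i B (0, 0) in
      F (lo q) /\ F (hi q) /\ Rabs (lo q) <= 1 /\ Rabs (hi q) <= 1 /\ wfp q /\ tlo (q, W) = lo q * W /\ thi (q, W) = hi q * W).
    { intros B [LB HB] q. rewrite Forall_forall in HB. destruct (HB q) as ((F1 & F2 & L) & L1 & L2).
      { apply nth_In. lia. }
      assert (Rabs (fst q) <= 1 /\ Rabs (snd q) <= 1) as [B1 B2] by (split; apply Rabs_le; lra).
      unfold lo, hi, tlo, thi; simpl.
      destruct (Rlt_dec 0 W); [rewrite Rmin_left, Rmax_right by nra|rewrite Rmin_right, Rmax_left by nra];
        repeat split; trivial. }
    assert (FW : F W) by (apply Ftau; trivial).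
    split.
    - exists (repeat 0 i ++ W :: repeat 0 (d - i - 1)), b. split; [|split; [|split; trivial]].
      + apply Forall_app. split; [|constructor; trivial]; apply Forall_forall; intros x Hx; apply repeat_spec in Hx; subst; apply F_0.
      + rewrite length_app; simpl. rewrite !repeat_length. lia.
      + intros B HB. destruct (Q B HB) as (F1 & F2 & L1 & L2 & Wq & T1 & T2). destruct HB as [LB HB].
        destruct (nth_split B (0, 0) (n:=i) ltac:(lia)) as (B1 & B2 & EB & LB1). remember (nth i B (0, 0)) as q eqn:Eq. clear Eq.
        assert (EC : combine B (repeat 0 i ++ W :: repeat 0 (d - i - 1)) = map (fun p => (p, 0)) B1 ++ [(q, W)] ++ map (fun p => (p, 0)) B2).
        { rewrite EB, <- LB1. rewrite combine_zeros. f_equal. simpl. f_equal.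
          assert (L : length B2 = (d - length B1 - 1)%nat) by (rewrite EB in LB; rewrite length_app in LB; simpl in LB; lia).
          rewrite <- L. rewrite <- (app_nil_r B2) at 1. rewrite <- (app_nil_r (repeat _ _)), combine_zeros. apply app_nil_r. }
        rewrite EC. rewrite EB in HB. apply Forall_app in HB. destruct HB as [HB1 HB2]. inversion HB2; subst.
        assert (W1 : Forall wfp B1) by (eapply Forall_impl; [|apply HB1]; simpl; tauto).
        assert (W2 : Forall wfp B2) by (eapply Forall_impl; [|eassumption]; simpl; tauto).
        assert (Wt : Forall (wft (E:=E) (M:=M)) [(q, W)]).
        { constructor; [|constructor]. split; [trivial|]. split; [trivial|]. rewrite T1, T2. split; apply Prop1; trivial. }
        split; [|symmetry; apply rowI_pad; trivial].
        apply Forall_app; split; [apply wft_zeros; trivial|]. apply Forall_app; split; [trivial|apply wft_zeros; trivial].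
    - intros B HB. destruct (Q B HB) as (F1 & F2 & L1 & L2 & Wq & T1 & T2). set (q := nth i B (0, 0)) in *.
      destruct (Prop1 _ F1 L1) as (J1 & J2 & J3), (Prop1 _ F2 L2) as (J4 & J5 & J6).
      exists (Rv (lo q)), (Rv (hi q)). simpl. split; [|split; [|split; trivial]].
      + assert (Id : forall x, rdn (0 + rdn x) = rdn x) by (intros; rewrite Rplus_0_l; apply (rd_id _ Hr), (rs_F _ Hr)).
        apply rowI_fin; simpl; rewrite ?T1, ?T2, ?Id; trivial.
        * constructor; [split; trivial|constructor].
        * rewrite Rplus_0_l. repeat split; trivial. apply inr_le, F_le_Om, (rs_F _ Hr).
        * rewrite Rplus_0_l. repeat split; trivial. apply inr_le, F_le_Om, (rs_F _ Hr).
      + apply rdn_le, Rplus_le_compat_r, rdn_le. rewrite <- T1, <- T2. apply tlo_le. }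
  destruct (settle _ Pc) as [k0 Hk0]. pose proof (signal_intro k0 _ (vs_pc _ _ _ Pc) Hk0) as Sg.
  assert (M1 : forall x, tau = 1 -> tau * x = x) by (intros x ->; ring).
  assert (M2 : forall x, tau = -1 -> tau * x = - x) by (intros x ->; ring).
  destruct (Rlt_dec 0 s) as [S0|S0].
  - refine (signal_ext _ _ Sg _). intros B _. cbv zeta. set (q := nth i B (0, 0)).
    unfold bit, lo, hi. destruct (Rlt_dec 0 tau) as [T0|T0].
    + destruct (Rlt_dec 0 W) as [W0|W0]; [|exfalso; unfold W in W0; nra]. rewrite !M1 by lra. trivial.
    + destruct (Rlt_dec 0 W) as [W0|W0]; [exfalso; unfold W in W0; nra|]. rewrite !M2 by lra. trivial.
  - refine (signal_ext _ _ (signal_flip _ Sg) _). intros B _. cbv zeta. set (q := nth i B (0, 0)).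
    unfold flip, bit, lo, hi; simpl. destruct (Rlt_dec 0 tau) as [T0|T0].
    + destruct (Rlt_dec 0 W) as [W0|W0]; [exfalso; unfold W in W0; destruct Hs; subst s; nra|].
      rewrite !M1, !negb_involutive by lra. trivial.
    + destruct (Rlt_dec 0 W) as [W0|W0]; [|exfalso; unfold W in W0; destruct Hs; subst s; nra].
      rewrite !M2, !negb_involutive by lra. trivial.
Qed.

(** P is the minimum of the bit over the box (it holds everywhere), Q the maximum (it holds
    somewhere). Negation exchanges the two, as in [psignal_not]. *)
Definition psignal (P Q : list (R * R) -> Prop) : Prop := signal (fun B => (asb (P B), asb (Q B))).

Lemma psignal_ext (P Q P' Q' : list (R * R) -> Prop) : psignal P Q ->
  (forall B, adm B -> (P B <-> P' B) /\ (Q B <-> Q' B)) -> psignal P' Q'.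
Proof.
  intros H K. apply (signal_ext _ _ H). intros B HB. destruct (K B HB). f_equal; apply asb_iff; trivial.
Qed.

Lemma psignal_not P Q : psignal P Q -> psignal (fun B => ~ Q B) (fun B => ~ P B).
Proof.
  intros H. apply (signal_ext _ _ (signal_flip _ H)). intros B _. unfold flip, asb; simpl.
  f_equal; repeat destruct excluded_middle_informative; tauto.
Qed.

Lemma psignal_or P Q P' Q' : psignal P Q -> psignal P' Q' -> psignal (fun B => P B \/ P' B) (fun B => Q B \/ Q' B).
Proof.
  intros H H'. apply (signal_ext _ _ (signal_or _ _ H H')). intros B _. unfold asb; simpl.
  f_equal; repeat destruct excluded_middle_informative; tauto.
Qed.

Lemma psignal_and P Q P' Q' : psignal P Q -> psignal P' Q' -> psignal (fun B => P B /\ P' B) (fun B => Q B /\ Q' B).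
Proof.
  intros H H'. eapply psignal_ext; [apply psignal_not, psignal_or; [apply psignal_not, H|apply psignal_not, H']|].
  intros B _. simpl. tauto.
Qed.

Lemma psignal_False : psignal (fun _ => False) (fun _ => False).
Proof. apply (signal_ext _ _ signal_false). intros. rewrite asb_false; tauto. Qed.

Lemma psignal_True : psignal (fun _ => True) (fun _ => True).
Proof. eapply psignal_ext; [apply psignal_not, psignal_False|]. intros; tauto. Qed.

Lemma psignal_const (K : Prop) P Q : (K -> psignal P Q) -> psignal (fun B => K /\ P B) (fun B => K /\ Q B).
Proof.
  intros H. destruct (classic K) as [HK|HK].
  - eapply psignal_ext; [apply (H HK)|]. intros; tauto.
  - eapply psignal_ext; [apply psignal_False|]. intros; tauto.
Qed.

Lemma psignal_exists {A : Type} (L : list A) (P Q : A -> list (R * R) -> Prop) : (forall c, In c L -> psignal (P c) (Q c)) ->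
  psignal (fun B => exists c, In c L /\ P c B) (fun B => exists c, In c L /\ Q c B).
Proof.
  induction L as [|c L IH]; intros H.
  - eapply psignal_ext; [apply psignal_False|]. intros B _. simpl.
    split; split; [intros []|intros (x & [] & _)|intros []|intros (x & [] & _)].
  - eapply psignal_ext; [apply psignal_or; [apply (H c); simpl; auto|apply IH; intros; apply H; simpl; auto]|].
    intros B _. simpl. split; split.
    + intros [K|(x & K1 & K2)]; eauto.
    + intros (x & [->|K1] & K2); eauto.
    + intros [K|(x & K1 & K2)]; eauto.
    + intros (x & [->|K1] & K2); eauto.
Qed.

Lemma psignal_forall (m : nat) (P Q : nat -> list (R * R) -> Prop) : (forall i, (i < m)%nat -> psignal (P i) (Q i)) ->
  psignal (fun B => forall i, (i < m)%nat -> P i B) (fun B => forall i, (i < m)%nat -> Q i B).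
Proof.
  induction m as [|m IH]; intros H.
  - eapply psignal_ext; [apply psignal_True|]. intros B _. split; split; trivial; intros; lia.
  - eapply psignal_ext; [apply psignal_and; [apply (H m); lia|apply IH; intros; apply H; lia]|].
    intros B _. split; split.
    + intros [K1 K2] i Hi. destruct (Nat.eq_dec i m) as [->|D]; trivial. apply K2; lia.
    + intros K; split; intros; apply K; lia.
    + intros [K1 K2] i Hi. destruct (Nat.eq_dec i m) as [->|D]; trivial. apply K2; lia.
    + intros K; split; intros; apply K; lia.
Qed.

Lemma adm_nth B i : adm B -> (i < d)%nat -> wfp (nth i B (0, 0)) /\ -1 <= fst (nth i B (0, 0)) /\ snd (nth i B (0, 0)) <= 1.
Proof.
  intros [LB HB] Hi. rewrite Forall_forall in HB. apply HB, nth_In. lia.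
Qed.

(** For c <= 0 the condition c <= x is the negation of -c < -x, except that c = -1 always holds on
    the unit box. For c > 0 it means that x exceeds the largest float below c. *)
Lemma atom_ge tau c i : tau = 1 \/ tau = -1 -> F c -> -1 <= c <= 1 -> (i < d)%nat ->
  psignal (fun B => let q := nth i B (0, 0) in if Rlt_dec 0 tau then c <= fst q else c <= - snd q)
          (fun B => let q := nth i B (0, 0) in if Rlt_dec 0 tau then c <= snd q else c <= - fst q).
Proof.
  intros Ht Fc Hc Hi. pose proof wpos as Pw.
  assert (gtP : forall p x, gtb p x = asb (p < x)).
  { intros p x. unfold gtb, asb. destruct (Rlt_dec p x), (excluded_middle_informative (p < x)); tauto. }
  destruct (Rle_dec c 0) as [C0|C0].
  - destruct (Req_dec c (-1)) as [C1|C1].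
    + eapply psignal_ext; [apply psignal_True|]. intros B HB. destruct (adm_nth B i HB Hi) as ((_ & _ & L) & L1 & L2).
      cbv zeta. destruct (Rlt_dec 0 tau); split; split; intros; trivial; lra.
    + assert (H : signal (fun B => let q := nth i B (0, 0) in
        if Rlt_dec 0 (- tau) then (gtb (- c) (fst q), gtb (- c) (snd q)) else (gtb (- c) (- snd q), gtb (- c) (- fst q)))).
      { apply atom_gt; trivial; [lra|apply F_opp; trivial|lra]. }
      apply (signal_ext _ _ (signal_flip _ H)). intros B _. cbv zeta. set (q := nth i B (0, 0)). unfold flip.
      destruct (Rlt_dec 0 tau), (Rlt_dec 0 (- tau)); try lra; simpl; rewrite !gtP; unfold asb;
        f_equal; repeat destruct excluded_middle_informative; trivial; lra.
  - destruct (F_mult c Fc) as [j Hj].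
    destruct (Zmax_ex (fun m => F (IZR m * w) /\ IZR m * w < c) 0 j) as (m & (Fm & Lm) & Mx).
    { rewrite Rmult_0_l. split; [apply F_0|lra]. }
    { intros m [_ L]. rewrite Hj in L. apply Rmult_lt_reg_r in L; trivial. apply lt_IZR in L. lia. }
    assert (M0 : 0 <= IZR m * w).
    { assert (0 <= m)%Z by (apply Mx; rewrite Rmult_0_l; split; [apply F_0|lra]). apply IZR_le in H. nra. }
    pose proof (atom_gt tau (IZR m * w) i Ht Fm ltac:(lra) Hi) as H.
    apply (signal_ext _ _ H). intros B HB. destruct (adm_nth B i HB Hi) as ((F1 & F2 & _) & _). cbv zeta. set (q := nth i B (0, 0)) in *.
    assert (Eq : forall x, F x -> gtb (IZR m * w) x = asb (c <= x)).
    { intros x Fx. rewrite gtP. apply asb_iff. split; intros L; [|lra].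
      apply Rnot_lt_le; intros C. destruct (F_mult x Fx) as [i' Hi']. rewrite Hi' in *.
      assert (i' <= m)%Z by (apply Mx; auto). apply IZR_le in H0. nra. }
    destruct (Rlt_dec 0 tau); rewrite !Eq; trivial; apply F_opp; trivial.
Qed.

Lemma Forall2_nth_iff {A B : Type} (P : A -> B -> Prop) da db l l' : length l = length l' ->
  (Forall2 P l l' <-> forall i, (i < length l)%nat -> P (nth i l da) (nth i l' db)).
Proof.
  revert l'; induction l as [|x l IH]; intros [|y l'] L; try discriminate; simpl.
  - split; [intros; lia|constructor].
  - injection L as L. split.
    + intros H i Hi. inversion H; subst. destruct i; trivial. apply IH; trivial. lia.
    + intros H. constructor; [apply (H 0%nat); lia|]. apply IH; trivial. intros i Hi. apply (H (S i)). lia.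
Qed.

(** The bit tells whether a point lies in C; its minimum over B says that B is contained in C, its
    maximum that they meet. Both split into conditions on coordinates, where conjunction is
    exact. *)
Lemma box_signal C : adm C ->
  psignal (Forall2 (fun c q => fst c <= fst q /\ snd q <= snd c) C) (Forall2 (fun c q => fst c <= snd q /\ fst q <= snd c) C).
Proof.
  intros HC.
  assert (H : psignal (fun B => forall i, (i < d)%nat -> fst (nth i C (0, 0)) <= fst (nth i B (0, 0)) /\ snd (nth i B (0, 0)) <= snd (nth i C (0, 0)))
                      (fun B => forall i, (i < d)%nat -> fst (nth i C (0, 0)) <= snd (nth i B (0, 0)) /\ fst (nth i B (0, 0)) <= snd (nth i C (0, 0)))).
  { apply psignal_forall. intros i Hi. destruct (adm_nth C i HC Hi) as ((F1 & F2 & L) & L1 & L2). apply psignal_and.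
    - pose proof (atom_ge 1 _ i ltac:(auto) F1 ltac:(lra) Hi) as H. cbv zeta in H. destruct (Rlt_dec 0 1); [exact H|lra].
    - pose proof (atom_ge (-1) _ i ltac:(auto) (F_opp _ F2) ltac:(lra) Hi) as H. cbv zeta in H. destruct (Rlt_dec 0 (-1)); [lra|].
      eapply psignal_ext; [exact H|]. intros B _. split; split; intros; lra. }
  eapply psignal_ext; [exact H|]. intros B HB. destruct HC as [LC _], HB as [LB _].
  rewrite !(Forall2_nth_iff _ (0, 0) (0, 0) C B) by congruence. rewrite LC. tauto.
Qed.

Definition inB (B : list (R * R)) (x : list R) : Prop := Forall2 (fun q t => F t /\ fst q <= t <= snd q) B x.

Lemma grid_ex : exists L : list R, forall x, F x -> -1 <= x <= 1 -> In x L.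
Proof.
  pose proof wpos as Pw. destruct (floor_mult 1 w Pw) as (j & J1 & J2).
  exists (map (fun i : nat => IZR (Z.of_nat i - j - 1) * w) (seq 0 (Z.to_nat (2 * j + 3)))).
  intros x Fx Hx. destruct (F_mult x Fx) as [i Hi]. apply in_map_iff. exists (Z.to_nat (i + j + 1)).
  assert (i < j + 1)%Z by (apply lt_IZR; rewrite plus_IZR; nra).
  assert (- (j + 1) < i)%Z by (apply lt_IZR; rewrite opp_IZR, plus_IZR; nra).
  split; [rewrite Hi; do 2 f_equal; lia|]. apply in_seq. lia.
Qed.

(** [-1, 1] contains finitely many floats, so there are finitely many boxes, and disjunctions over
    boxes are finite. *)
Lemma adm_list : exists L, forall B, adm B -> In B L.
Proof.
  destruct grid_ex as [G HG].
  assert (K : forall m, exists L, forall B : list (R * R), length B = m ->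
     Forall (fun p => wfp p /\ -1 <= fst p /\ snd p <= 1) B -> In B L).
  { induction m as [|m [L HL]].
    - exists [[]]. intros [|p B] LB; [left; trivial|discriminate].
    - exists (flat_map (fun p => map (fun B => p :: B) L) (list_prod G G)).
      intros [|p B] LB HB; [discriminate|]. inversion HB as [|? ? ((F1 & F2 & Lp) & L1 & L2) HB']; subst.
      apply in_flat_map. exists p. split.
      + destruct p as [l u]; simpl in *. apply in_prod; apply HG; trivial; lra.
      + apply in_map, HL; trivial. simpl in LB. lia. }
  destruct (K d) as [L HL]. exists L. intros B [LB HB]. auto.
Qed.

Lemma inB_point x : Forall (fun t => F t /\ -1 <= t <= 1) x -> length x = d ->
  adm (map (fun t => (t, t)) x) /\ forall y, inB (map (fun t => (t, t)) x) y -> y = x.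
Proof.
  intros Fx Lx. split.
  - split; [rewrite length_map; trivial|]. apply Forall_map. eapply Forall_impl; [|apply Fx].
    intros t [Ft Ht]. unfold wf_pair; simpl. repeat split; trivial; lra.
  - clear. induction x as [|t x IH]; intros y H; inversion H; subst; trivial. f_equal; [simpl in *; lra|apply IH; trivial].
Qed.

Lemma inB_adm B x : adm B -> inB B x -> Forall (fun t => F t /\ -1 <= t <= 1) x /\ length x = d.
Proof.
  intros [LB HB] H. split; [|rewrite <- LB; symmetry; eapply Forall2_length; eauto].
  clear LB. induction H as [|q t B x [Ft Ht] H IH]; constructor; inversion HB as [|? ? (W & L1 & L2) HB']; subst; auto.
  split; trivial; lra.
Qed.

(* x lies in U iff some subbox C of U contains x; a box B lies in U iff such a C contains B,
   and meets U iff such a C meets B. *)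
Lemma set_signal (U : list R -> Prop) : psignal (fun B => forall x, inB B x -> U x) (fun B => exists x, inB B x /\ U x).
Proof.
  destruct adm_list as [L HL].
  pose proof (psignal_exists L
    (fun C B => (adm C /\ forall x, inB C x -> U x) /\ Forall2 (fun c q => fst c <= fst q /\ snd q <= snd c) C B)
    (fun C B => (adm C /\ forall x, inB C x -> U x) /\ Forall2 (fun c q => fst c <= snd q /\ fst q <= snd c) C B)) as H.
  eapply psignal_ext; [apply H; intros C _; apply psignal_const; intros [HC _]; apply box_signal; trivial|].
  clear H. intros B HB. split; split.
  - intros (C & _ & (_ & HU) & HCB) x Hx. apply HU. clear - HCB Hx. revert x Hx.
    induction HCB as [|c q C B [A1 A2] HCB IH]; intros x Hx; inversion Hx; subst; constructor; [|apply IH; trivial].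
    destruct H1. split; trivial; lra.
  - intros HU. exists B. split; [auto|]. split; [auto|]. clear. induction B; constructor; trivial. lra.
  - intros (C & _ & (HC & HU) & HCB).
    assert (K : exists x, inB C x /\ inB B x).
    { destruct HC as [_ HC], HB as [_ HB]. clear - HCB HC HB. induction HCB as [|c q C B [A1 A2] HCB IH]; [exists []; split; constructor|].
      inversion HC as [|? ? ((F1 & F2 & L1) & _) HC']; inversion HB as [|? ? ((F3 & F4 & L2) & _) HB']; subst.
      destruct (IH HB' HC') as (x & X1 & X2).
      destruct (Rle_dec (fst c) (fst q)); [exists (fst q :: x)|exists (fst c :: x)];
        split; constructor; trivial; split; trivial; lra. }
    destruct K as (x & X1 & X2). exists x; auto.
  - intros (x & Hx & HU). destruct (inB_adm B x HB Hx) as [Fx Lx]. destruct (inB_point x Fx Lx) as [HC Only].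
    exists (map (fun t => (t, t)) x). split; [auto|]. split.
    + split; trivial. intros y Hy. rewrite (Only y Hy); trivial.
    + clear - Hx. induction Hx as [|q t B x [_ Ht] Hx IH]; constructor; trivial. simpl; lra.
Qed.

Lemma finite_min (b : bool) (S : fbar -> Prop) L : (forall v, S v -> In v L) -> (exists v, S v) -> (forall v, S v -> v <> NaN) ->
  exists m, S m /\ forall v, S v -> dle b m v.
Proof using fp.
  revert S; induction L as [|x L IH]; intros S HL [v Sv] HN; [destruct (HL v Sv)|].
  assert (Rf : forall u : fbar, u <> NaN -> dle b u u) by (destruct b; apply fle_refl).
  destruct (classic (exists v, S v /\ v <> x)) as [Ex|Ex].
  - destruct (IH (fun v => S v /\ v <> x)) as (m & [Sm _] & Hm); trivial.
    { intros u [Su Nu]. destruct (HL u Su); [congruence|trivial]. }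
    { intros u [Su _]; auto. }
    destruct (classic (S x)) as [Sx|Sx].
    + destruct (dle_total b m x (HN m Sm) (HN x Sx)) as [C|C].
      * exists m. split; trivial. intros u Su. destruct (classic (u = x)) as [->|D]; trivial. apply Hm; auto.
      * exists x. split; trivial. intros u Su. destruct (classic (u = x)) as [->|D]; [apply Rf; auto|].
        apply (dle_trans b x m u C), Hm; auto.
    + exists m. split; trivial. intros u Su. apply Hm. split; trivial. intros ->; auto.
  - assert (Only : forall u, S u -> u = x).
    { intros u Su. destruct (classic (u = x)) as [D|D]; trivial. elim Ex; eauto. }
    rewrite (Only v Sv) in Sv. exists x. split; trivial. intros u Su. rewrite (Only u Su). apply Rf; auto.
Qed.

Variable f : list R -> R.
Definition image (B : list (R * R)) (v : fbar) : Prop := exists x, inB B x /\ v = rnd E M (f x).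

Lemma image_bounds B : adm B -> exists m m', image B m /\ image B m' /\ forall v, image B v -> fle m v /\ fle v m'.
Proof.
  intros HB. destruct adm_list as [L HL].
  assert (Fin : forall v, image B v -> In v (map (fun C => rnd E M (f (map fst C))) L)).
  { intros v (x & Hx & ->). apply in_map_iff. exists (map (fun t => (t, t)) x). split.
    - rewrite map_map. simpl. rewrite map_id. trivial.
    - apply HL. destruct (inB_adm B x HB Hx). apply inB_point; trivial. }
  assert (Ne : exists v, image B v).
  { exists (rnd E M (f (map fst B))), (map fst B). split; trivial. destruct HB as [_ HB]. clear - HB.
    induction HB as [|q B ((F1 & F2 & L) & _) HB IH]; constructor; trivial. split; trivial; lra. }
  assert (NN : forall v, image B v -> v <> NaN).
  { intros v (x & _ & ->). apply rnd_not_NaN. }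
  destruct (finite_min true _ _ Fin Ne NN) as (m & Sm & Hm), (finite_min false _ _ Fin Ne NN) as (m' & Sm' & Hm').
  exists m, m'. repeat split; trivial; [apply Hm|apply Hm']; trivial.
Qed.

(** The sum for a single value y returns y. Over a box, every term has its lower endpoint at the
    minimum of f^ and its upper endpoint at the maximum, so the two endpoint sums return those two
    values. *)
Lemma output_unit : exists k phi, pre k phi /\ forall B, adm B -> phi B = Itv (setmin (image B)) (setmax (image B)).
Proof.
  destruct (full_ladder z Hz) as (ps & Ok & Lad).
  set (sp := fun (p : (bool * fbar) * R) (B : list (R * R)) =>
    (asb (forall x, inB B x -> dle (fst (fst p)) (snd (fst p)) (rnd E M (f x))),
     asb (exists x, inB B x /\ dle (fst (fst p)) (snd (fst p)) (rnd E M (f x))))).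
  assert (Sg : forall p, signal (sp p)) by (intros p; apply set_signal).
  assert (Lv : exists K, Forall (fun p => X K (sp p) 0 ze) ps).
  { assert (K0 : exists K, Forall (fun p => forall k, (K <= k)%nat -> X k (sp p) 0 ze) ps).
    { clear - Sg Hctype Hc2 Hfin Hab Hal Hbe Hlo Hlam Hlow Hhigh Hadj Hn Hn1 He0 He1 Fe0 Fe1 Hz Hze Fc2.
      induction ps as [|p ps [K IH]]; [exists 0%nat; constructor|].
      destruct (signal_ctype _ (Sg p)) as [K' H']. exists (K + K')%nat. constructor.
      - intros k L. apply H'; lia.
      - eapply Forall_impl; [|apply IH]. intros q Hq k L. apply Hq; lia. }
    destruct K0 as [K HK]. exists K. eapply Forall_impl; [|apply HK]. intros p Hp. apply Hp; trivial. }
  destruct Lv as [K XK].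
  assert (C : exists cs, Forall2 (fun p c => entry_ok z (fst (fst p)) 0 p /\ snd c = zsg * snd p /\ post K (fst c) /\
     forall B, adm B -> fst c B = pr (sp p B) 0 ze) ps cs).
  { apply list_choice. rewrite Forall_forall in *. intros p Hp. destruct (XK p Hp) as (psi & H1 & H2).
    exists (psi, zsg * snd p). simpl. auto. }
  destruct C as [cs C]. destruct Hzs as [Hzs1 _].
  assert (Val : forall B, adm B -> forall m m', image B m -> image B m' -> (forall v, image B v -> fle m v /\ fle v m') ->
    Forall (wft (E:=E) (M:=M)) (inst cs B) /\ map tlo (inst cs B) = map (fun p => contrib z p m) ps /\
    map thi (inst cs B) = map (fun p => contrib z p m') ps).
  { intros B HB m m' Im Im' Bd.
    assert (Ibt : forall p (y : fbar), good (snd p) -> inr (contrib z p y)).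
    { intros p y [_ Ip]. unfold contrib. destruct (asb _); trivial. apply inr_le, F_le_Om, F_0. }
    assert (T : forall p c, entry_ok z (fst (fst p)) 0 p -> snd c = zsg * snd p -> fst c B = pr (sp p B) 0 ze ->
      wfin (E:=E) (M:=M) (fst c B, snd c) /\ tlo (fst c B, snd c) = contrib z p m /\ thi (fst c B, snd c) = contrib z p m').
    { intros [[b th] v] [psi u] (_ & Gv & Sv & _) Eu Ep. simpl in *. rewrite Ep, Eu. subst u.
      pose proof (proj1 (Sg ((b, th), v)) B HB) as V. set (s := sp ((b, th), v) B) in *.
      assert (Es : s = (asb (forall x, inB B x -> dle b th (rnd E M (f x))), asb (exists x, inB B x /\ dle b th (rnd E M (f x))))) by reflexivity.
      clearbody s.
      split; [split; simpl; [apply pr_wfp; trivial; [apply F_0|apply Fze]|apply (zsg_F rdn Hr z Hz ze Hze), Gv]|].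
      destruct (tlo_pr (E:=E) (M:=M) s 0 ze (zsg * v) V) as [T1 T2]. unfold psel in T1, T2; simpl in T1, T2.
      assert (Qz : ze * (zsg * v) = z * v).
      { transitivity (zsg * ze * v); [ring|rewrite Hzs1; trivial]. }
      assert (Sel : forall b' : bool, (if b' then ze else 0) * (zsg * v) = if b' then z * v else 0).
      { intros []; [trivial|ring]. }
      rewrite Qz, Rmult_0_l, !Sel in T1, T2. unfold contrib; simpl.
      assert (All : forall v0, image B v0 -> exists x, inB B x /\ v0 = rnd E M (f x)) by auto.
      destruct Im as (xm & Xm & Em), Im' as (xm' & Xm' & Em').
      (* Increments on the positive side grow with their bit, so the lower endpoint uses its
         minimum. On the negative side they are negative and the bit tests f^ <= th, so the lower
         endpoint uses its maximum; again this is the test at m. *)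
      destruct b; simpl in Sv.
      - destruct T1 as [-> ->]; [lra|]. rewrite Es; simpl.
        rewrite (asb_iff (forall x, inB B x -> fle th (rnd E M (f x))) (fle th m)).
        2: { split; [intros H; rewrite Em; auto|]. intros H x Hx. eapply fle_trans; [apply H|]. apply Bd. exists x; auto. }
        rewrite (asb_iff (exists x, inB B x /\ fle th (rnd E M (f x))) (fle th m')); auto.
        split; [|intros H; exists xm'; rewrite <- Em'; auto]. intros (x & Hx & H). eapply fle_trans; [apply H|]. apply Bd. exists x; auto.
      - destruct T2 as [-> ->]; [lra|]. rewrite Es; simpl.
        rewrite (asb_iff (forall x, inB B x -> fle (rnd E M (f x)) th) (fle m' th)).
        2: { split; [intros H; rewrite Em'; auto|]. intros H x Hx. eapply fle_trans; [|apply H]. apply Bd. exists x; auto. }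
        rewrite (asb_iff (exists x, inB B x /\ fle (rnd E M (f x)) th) (fle m th)); auto.
        split; [|intros H; exists xm; rewrite <- Em; auto]. intros (x & Hx & H). eapply fle_trans; [|apply H]. apply Bd. exists x; auto. }
    clear - C T Ibt HB fp. induction C as [|p c ps cs (C1 & C2 & C3 & C4) C (IH1 & IH2 & IH3)]; simpl; auto.
    destruct (T p c C1 C2 (C4 B HB)) as (W & T1 & T2). rewrite T1, T2, IH2, IH3. split; auto.
    constructor; trivial. destruct W as [W1 W2]. split; [trivial|]. split; [trivial|]. simpl in *. rewrite T1, T2.
    split; apply Ibt, C1. }
  exists (S K), (fun B => rowI (inst cs B) 0). split.
  - exists cs, 0. split; [|split; [apply F_0|]].
    + clear - C fp Hz Hze. induction C as [|p c ps cs (C1 & C2 & C3 & C4) C IH]; constructor; trivial. split; trivial.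
      rewrite C2. apply (zsg_F rdn Hr z Hz ze Hze), C1.
    + intros B HB. split; trivial. destruct (image_bounds B HB) as (m & m' & H1 & H2 & H3). apply (Val B HB m m'); trivial.
  - intros B HB. destruct (image_bounds B HB) as (m & m' & H1 & H2 & H3).
    destruct (Val B HB m m' H1 H2 H3) as (W & E1 & E2).
    rewrite rowI_eq by (trivial; apply F_0). rewrite !fadd_0, E1, E2.
    change (Itv (gsum z (fin 0) ps m) (gsum z (fin 0) ps m') = Itv (setmin (image B)) (setmax (image B))).
    rewrite !Lad by (eapply fle_not_NaN; apply H3; eassumption). f_equal; symmetry.
    + apply setmin_eq; trivial. intros v Hv; apply H3; trivial.
    + apply setmax_eq; trivial. intros v Hv; apply H3; trivial.
Qed.

Lemma net_exists : exists net, wf_net d 1 net /\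
  forall B, adm B -> net_sharp sigma net (map I2 B) = [Itv (setmin (image B)) (setmax (image B))].
Proof.
  destruct output_unit as (k & phi & Hp & Q).
  destruct (realize sigma d k [phi]) as (net & N1 & _ & N3); [constructor; trivial|].
  exists net. split; trivial. intros B HB. rewrite N3 by trivial. simpl. rewrite Q; trivial.
Qed.

End Gadgets.

(** * Switchable increments from Condition C1 *)

Section CType.
Context {E M : nat} {fp : FP E M}.

Local Notation Mz := (Z.of_nat M).
Local Notation em := (emin E).
Local Notation F := (isF E M).
Local Notation w := (omega E M).
Local Notation Om := (Omega E M).
Local Notation fbar := (fbar E M).
Local Notation fin := (fin (E:=E) (M:=M)).
Local Notation rdn := (rdn (E:=E) (M:=M)).
Local Notation Hr := (rdn_rspec (E:=E) (M:=M)).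

Variable sigma : fbar -> fbar.
Variable d : nat.
Local Notation sr := (sr sigma).
Local Notation betw := (betw sigma).
Local Notation X := (X sigma d).
Local Notation vs := (vs d (E:=E) (M:=M)).
Hypothesis Hfin : forall x, F x -> sigma (fin x) = fin (sr x) /\ F (sr x).
Local Set Default Proof Using "fp Hfin".

Definition amplitude_ok (x : R) : Prop := eps M / 2 + 2 * eps M ^ 2 <= Rabs x <= 5 / 4 - 2 * eps M.

(** A bit with codes 0 and ze makes a term of weight v contribute either nothing or ze v. Any pair
    of well separated codes can be converted to these within g layers. *)
Definition ctype (ze : R) : Prop := exists g, forall k s A B, vs s -> X k s A B -> F A -> F B -> 32 * w <= Rabs (B - A) ->
  X (k + g) s 0 ze /\ X (k + g) s ze 0.

Variable c1 : R.
Hypothesis Fc1 : F c1.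
Hypothesis Sc1 : sr c1 = 0.
Local Set Default Proof Using "fp Hfin Fc1 Sc1".

Lemma betw_sym P Q : betw P Q -> betw Q P.
Proof using fp. intros H x Fx Hx. destruct (H x Fx ltac:(tauto)); auto. Qed.

Lemma amplitude_pos x : amplitude_ok x -> 0 < Rabs x.
Proof using fp.
  intros [H _]. pose proof (bp_pos (- Mz - 1)) as P. rewrite <- eps_bp in P. assert (0 <= eps M ^ 2) by apply pow2_ge_0. lra.
Qed.

Lemma amplitude_z c : F c -> amplitude_ok (sr c) ->
  (F (Rabs (sr c)) /\ eps M / 2 + 2 * eps M ^ 2 <= Rabs (sr c) <= 5 / 4 - 2 * eps M) /\
  (sr c = Rabs (sr c) \/ sr c = - Rabs (sr c)).
Proof.
  intros Fc H. pose proof (proj2 (Hfin c Fc)) as Fs. split; [split; trivial|].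
  - unfold Rabs. destruct (Rcase_abs (sr c)); [apply F_opp|]; trivial.
  - unfold Rabs. destruct (Rcase_abs (sr c)); lra.
Qed.

Lemma X_zeta k s c : F c -> X k s (sr c) (sr c).
Proof. apply (X_const sigma d Hfin). Qed.

Lemma pair_unit c k s A B P Q : F c -> amplitude_ok (sr c) -> vs s -> X k s A B -> F A -> F B -> 32 * w <= Rabs (B - A) ->
  F P -> F Q -> P <> Q -> near_pair (E:=E) (M:=M) P Q -> betw P Q -> X (S k) s (sr P) (sr Q).
Proof.
  intros Fc HA V HX FA FB HD FP FQ N NP HB. destruct (amplitude_z c Fc HA) as [Hz Hze].
  destruct (drives_pre sigma d Hfin k s (sr c) A B P Q) as (phi & H1 & H2); trivial.
  - apply (drives_pair rdn Hr (Rabs (sr c)) Hz (sr c) Hze); trivial.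
  - apply Hfin; trivial.
  - apply X_zeta; trivial.
  - apply (post_X sigma d Hfin _ _ phi); trivial.
Qed.

Lemma near_pair_sym P Q : near_pair (E:=E) (M:=M) P Q -> near_pair (E:=E) (M:=M) Q P.
Proof using fp. unfold near_pair. rewrite Rabs_minus_sym. tauto. Qed.

(** One row produces the pair c1, c before activation, and sigma maps it to 0 and sigma(c), exactly
    on intervals by [betw]. *)
Lemma ctype_near c : F c -> amplitude_ok (sr c) -> betw c1 c -> near_pair (E:=E) (M:=M) c1 c -> ctype (sr c).
Proof.
  intros Fc HA HB NP. exists 1%nat. intros k s A B V HX FA FB HD.
  assert (N : c1 <> c).
  { intros <-. pose proof (amplitude_pos _ HA) as P. rewrite Sc1, Rabs_R0 in P. lra. }
  rewrite Nat.add_1_r, <- Sc1. split; apply (pair_unit c k s A B); trivial; auto using betw_sym, near_pair_sym.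
Qed.

Lemma far_pair P Q : Rabs P <= 5 -> 40 <= Rabs Q -> near_pair (E:=E) (M:=M) P Q.
Proof using fp.
  intros HP HQ. right; left. split; [|lra]. pose proof (emin_emax (E:=E)); pose proof emax_ge.
  assert (bp (em + 3) <= bp 0) by (apply bp_le; lia). rewrite bp_0 in H1. lra.
Qed.

(* eps/2 + 2 eps^2 is two units in the last place above eps/2. *)
Lemma below_half_eps x y : F x -> F y -> 0 < x < y -> y < eps M / 2 + 2 * eps M ^ 2 -> x <= eps M / 2.
Proof using fp.
  intros Fx Fy L Ly. apply Rnot_lt_le; intros C.
  pose proof (emin_emax (E:=E)) as EE; pose proof emax_ge as E15.
  assert (Q1 : eps M / 2 = bp (- Mz - 2)).
  { rewrite eps_bp. replace (- Mz - 1)%Z with (- Mz - 2 + 1)%Z by lia. rewrite bp_S. field. }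
  assert (Q2 : eps M ^ 2 = bp (- 2 * Mz - 2)).
  { replace (eps M ^ 2) with (eps M * eps M) by ring. rewrite eps_bp, <- bp_add. f_equal; lia. }
  rewrite Q1 in *. rewrite Q2 in *. set (c := (- 2 * Mz - 2)%Z) in *. pose proof (bp_pos c) as Pc.
  assert (K : forall t, F t -> bp (- Mz - 2) < t -> exists i, t = IZR i * bp c).
  { intros t Ft Lt. pose proof (bp_pos (- Mz - 2)). destruct (Fpos_rep t Ft ltac:(lra)) as (m & a & Hm & Ha & Qt & _).
    assert (- Mz - 2 < Mz + 1 + a)%Z.
    { apply bp_lt_inv. eapply Rlt_trans; [apply Lt|]. rewrite Qt, <- (bp_mul_IZR (Mz + 1) a) by lia.
      apply Rmult_lt_compat_r; [apply bp_pos|apply IZR_lt; lia]. }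
    exists (m * 2 ^ (a - c))%Z. rewrite Qt. apply F_rescale. unfold c; lia. }
  destruct (K x Fx C) as [i ->], (K y Fy ltac:(lra)) as [j ->].
  assert (Qe : bp (- Mz - 2) = IZR (2 ^ Mz) * bp c) by (rewrite bp_mul_IZR by lia; f_equal; unfold c; lia).
  rewrite Qe in *.
  assert (2 ^ Mz < i)%Z by (apply lt_IZR; nra). assert (i < j)%Z by (apply lt_IZR; nra).
  assert (IZR (2 ^ Mz) + 2 <= IZR j) by (rewrite <- plus_IZR; apply IZR_le; lia). nra.
Qed.

(** e' and e'' are eta and its successor in some order, between c1 and c2 and near 0, so each forms
    an easy pair with c1 and c2. If sigma(e') is large enough, it replaces sigma(c2) as the
    constant. Otherwise sigma(e''), nonzero and smaller in modulus than sigma(e'), is at most eps/2,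
    hence negligible next to huge values; the pair sigma(c2), sigma(e'') then drives the row that
    produces c1, c2, at the price of one more layer. *)
Lemma ctype_far c2 e' e'' s0 : F c2 -> F e' -> F e'' -> amplitude_ok (sr c2) -> betw c1 c2 ->
  Rabs e' <= 5 -> Rabs e'' <= 5 -> 40 <= Rabs c1 -> 40 <= Rabs c2 -> Om < Rabs (c2 - c1) ->
  betw c1 e' -> betw e'' c2 -> bp (em + 5) <= Rabs (sr e'') -> s0 = 1 \/ s0 = -1 ->
  0 < s0 * sr e'' < s0 * sr e' -> s0 * sr e' <= s0 * sr c2 ->
  exists c, F c /\ amplitude_ok (sr c) /\ ctype (sr c).
Proof.
  intros Fc2 Fe' Fe'' HA HB B1 B2 L1 L2 HO HB1 HB2 Hal Hs H1 H2.
  assert (Ab : forall x, 0 < s0 * x -> Rabs x = s0 * x).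
  { intros x Hx. destruct Hs as [-> | ->]; [rewrite Rabs_pos_eq|rewrite Rabs_left]; lra. }
  assert (Fs : forall x, F x -> F (s0 * x)).
  { intros x Fx. destruct Hs as [-> | ->]; [rewrite Rmult_1_l; trivial|]. replace (-1 * x) with (- x) by ring. apply F_opp; trivial. }
  assert (A2 : Rabs (sr e'') = s0 * sr e'') by (apply Ab; lra).
  assert (A1 : Rabs (sr e') = s0 * sr e') by (apply Ab; lra).
  assert (A3 : Rabs (sr c2) = s0 * sr c2) by (apply Ab; lra).
  destruct (Rle_dec (eps M / 2 + 2 * eps M ^ 2) (Rabs (sr e'))) as [C|C].
  - exists e'. split; trivial.
    assert (HA' : amplitude_ok (sr e')) by (split; trivial; destruct HA; lra).
    split; trivial. apply ctype_near; trivial. apply near_pair_sym, far_pair; trivial.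
  - exists c2. split; trivial. split; trivial. exists 2%nat. intros k s A B V HX FA FB HD.
    destruct (amplitude_z c2 Fc2 HA) as [Hz Hze].
    assert (Fa'' : F (sr e'')) by (apply Hfin; trivial).
    assert (Fc : F (sr c2)) by (apply Hfin; trivial).
    assert (Hal2 : Rabs (sr e'') <= eps M / 2).
    { rewrite A2. apply below_half_eps with (s0 * sr e'); try lra; apply Fs; apply Hfin; trivial. }
    assert (HD2 : 32 * w <= Rabs (sr e'' - sr c2)).
    { rewrite Rabs_minus_sym. destruct HA as [HA _]. assert (0 <= eps M ^ 2) by apply pow2_ge_0.
      apply (apart32 rdn Hr (Rabs (sr c2)) Hz); trivial; try lra. intros Q. rewrite Q in *. lra. }
    assert (N : e'' <> c2) by (intros Q; rewrite Q in *; lra).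
    assert (V1 : X (S k) s (sr e'') (sr c2)).
    { apply (pair_unit c2 k s A B); trivial. apply far_pair; trivial. }
    assert (V2 : X (S k) s (sr c2) (sr e'')).
    { apply (pair_unit c2 k s A B); trivial; auto using betw_sym. apply near_pair_sym, far_pair; trivial. }
    assert (Sg : 0 < sr e'' / sr c2).
    { replace (sr e'' / sr c2) with ((s0 * sr e'') / (s0 * sr c2)).
      - apply Rdiv_lt_0_compat; lra.
      - field. destruct Hs as [-> | ->]; split; lra. }
    assert (K : forall P Q, F P -> F Q -> Om < Rabs (Q - P) -> betw P Q -> X (k + 2) s (sr P) (sr Q)).
    { intros P Q FP FQ HPQ HBPQ. replace (k + 2)%nat with (S (S k)) by lia.
      assert (exists phi, unit_pre sigma d (S (S k)) phi /\ forall b, adm (E:=E) (M:=M) d b -> phi b = pair_itv (pr (s b) P Q)) as (phi & P1 & P2).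
      { destruct (drives_split_any rdn Hr (Rabs (sr c2)) Hz (sr c2) Hze (sr e'') P Q) as [D|D]; trivial.
        - apply (drives_pre sigma d Hfin (S k) s (sr c2) (sr c2) (sr e'')); trivial. apply X_zeta; trivial.
        - apply (drives_pre sigma d Hfin (S k) s (sr c2) (sr e'') (sr c2)); trivial. apply X_zeta; trivial. }
      apply (post_X sigma d Hfin _ _ phi); trivial. }
    rewrite <- Sc1. split; apply K; auto using betw_sym. rewrite Rabs_minus_sym; trivial.
Qed.

End CType.

(** * The theorem *)

Section Discharge.
Context {E M : nat} {fp : FP E M}.
Local Set Default Proof Using "fp".

Local Notation Mz := (Z.of_nat M).
Local Notation pow_M1 := (pow2_S M).
Local Notation em := (emin E).
Local Notation F := (isF E M).
Local Notation Om := (Omega E M).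
Local Notation fbar := (fbar E M).
Local Notation fin := (fin (E:=E) (M:=M)).
Local Notation wfp := (wf_pair (E:=E) (M:=M)).
Local Notation I2 := (pair_itv (E:=E) (M:=M)).

(** eta and its successor are written with one exponent, also across the end of a binade; the closed
    bounds on n and n + 1 allow this. *)
Lemma eta_rep e : F e -> bp (em + 5) <= Rabs e -> Rabs e < 4 -> exists n a, e = IZR n * bp a /\ F (e + bp a) /\
  (2 ^ Mz <= Z.abs n <= 2 ^ (Mz + 1))%Z /\ (2 ^ Mz <= Z.abs (n + 1) <= 2 ^ (Mz + 1))%Z /\
  bp a <= 1 /\ forall x, F x -> x <= e \/ e + bp a <= x.
Proof.
  intros Fe L5 L4. pose proof (pow_M_8 (M:=M)) as P8. pose proof pow_M1 as PM1. pose proof M_ge as M3.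
  pose proof emax_ge as E15. pose proof (emin_emax (E:=E)) as EE. pose proof (bp_pos (em + 5)) as P5.
  assert (O8 : 8 <= Om).
  { eapply Rle_trans; [|apply Om_ge]. replace 8 with (bp 3) by (unfold bp; simpl; ring). apply bp_le; lia. }
  assert (K : forall y, F y -> bp (em + 5) <= y < 4 -> exists m a, (2 ^ Mz <= m < 2 ^ (Mz + 1))%Z /\
     (em - Mz + 5 <= a <= - Mz + 1)%Z /\ y = IZR m * bp a).
  { intros y Fy Hy. destruct (Fpos_rep y Fy ltac:(lra)) as (m & a & Hm & Ha & Q & Hc). exists m, a.
    assert (em + 5 < Mz + 1 + a)%Z.
    { apply bp_lt_inv. eapply Rle_lt_trans; [apply Hy|]. rewrite Q, <- (bp_mul_IZR (Mz + 1) a) by lia.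
      apply Rmult_lt_compat_r; [apply bp_pos|apply IZR_lt; lia]. }
    destruct Hc as [Hc|Hc]; [lia|].
    assert (Mz + a < 2)%Z.
    { apply bp_lt_inv. rewrite <- (bp_mul_IZR Mz a) by lia. apply Rle_lt_trans with y.
      - rewrite Q. apply Rmult_le_compat_r; [left; apply bp_pos|apply IZR_le; lia].
      - replace (bp 2) with 4 by (unfold bp; simpl; ring). lra. }
    repeat split; trivial; lia. }
  assert (B1 : forall a, (a <= - Mz + 1)%Z -> bp a <= 1).
  { intros a Ha. rewrite <- bp_0. apply bp_le; lia. }
  assert (Sm : forall i a, (Z.abs i <= 2 ^ (Mz + 1))%Z -> (em - Mz + 4 <= a <= - Mz + 1)%Z -> F (IZR i * bp a)).
  { intros i a Hi Ha. apply F_small; trivial. lia. }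
  destruct (Rle_dec 0 e) as [C|C].
  - rewrite Rabs_pos_eq in * by trivial. destruct (K e Fe ltac:(lra)) as (m & a & Hm & Ha & Q). exists m, a.
    pose proof (bp_pos a). split; trivial. split; [|split; [lia|split; [lia|split; [apply B1; lia|]]]].
    + replace (e + bp a) with (IZR (m + 1) * bp a) by (rewrite Q, plus_IZR; ring). apply Sm; lia.
    + intros x Fx. destruct (Rle_dec x e) as [D|D]; auto. right. rewrite Q. apply gap_up; trivial; try lia. rewrite <- Q; lra.
  - rewrite Rabs_left1 in * by lra. destruct (K (- e) (F_opp _ Fe) ltac:(lra)) as (m & a & Hm & Ha & Q).
    (* Above minus a power of two the spacing is halved, so 2^M is rewritten as 2^(M+1) with the
       next smaller exponent. *)
    assert (K2 : exists m a, (2 ^ Mz < m <= 2 ^ (Mz + 1))%Z /\ (em - Mz + 4 <= a <= - Mz + 1)%Z /\ - e = IZR m * bp a).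
    { destruct (Z.eq_dec m (2 ^ Mz)) as [D|D]; [|exists m, a; split; [lia|split; [lia|trivial]]].
      exists (2 ^ (Mz + 1))%Z, (a - 1)%Z. split; [lia|split; [lia|]]. rewrite Q, D, !bp_mul_IZR by lia. f_equal; lia. }
    clear m a Hm Ha Q. destruct K2 as (m & a & Hm & Ha & Q). exists (- m)%Z, a. pose proof (bp_pos a).
    split; [rewrite opp_IZR; lra|]. split; [|split; [lia|split; [lia|split; [apply B1; lia|]]]].
    + replace (e + bp a) with (IZR (- (m - 1)) * bp a) by (rewrite opp_IZR, minus_IZR; lra). apply Sm; lia.
    + intros x Fx. destruct (Rle_dec x e) as [D|D]; auto. right.
      assert (- x <= IZR m * bp a - bp a); [|lra]. apply gap_dn; try lia; [apply F_opp; trivial|lra].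
Qed.

Lemma flt_fin x y : F x -> F y -> flt (fin x) (fin y) <-> x < y.
Proof.
  intros Fx Fy. unfold flt. rewrite fle_fin by trivial. split.
  - intros [L N]. destruct (Rle_lt_or_eq_dec _ _ L) as [C|C]; trivial. subst. elim N; trivial.
  - intros L. split; [lra|]. intros Q. injection Q as Q. apply (f_equal fval) in Q. rewrite !fval_toF in Q by trivial. lra.
Qed.

Lemma fsucc_fin e e1 : F e -> F e1 -> e < e1 -> (forall x, F x -> x <= e \/ e1 <= x) -> fsucc (toF (E:=E) (M:=M) e) = fin e1.
Proof.
  intros Fe Fe1 L Adj. unfold fsucc. fold (fin e).
  set (P := fun y : fbar => y <> NaN /\ flt (fin e) y /\ forall t, t <> NaN -> flt (fin e) t -> fle y t).
  assert (H1 : P (fin e1)).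
  { split; [discriminate|]. split; [apply flt_fin; trivial|]. intros t Nt Lt.
    destruct t as [x| | |]; [|reflexivity|destruct Lt as [Lt _]; discriminate|congruence].
    rewrite Fin_fin in *. pose proof (fval_F x) as Fx. apply flt_fin in Lt; trivial. apply fle_fin; trivial.
    destruct (Adj _ Fx); lra. }
  destruct (epsilon_spec (inhabits NaN) P (ex_intro _ _ H1)) as (N2 & L2 & M2). destruct H1 as (N1 & L1 & M1).
  apply fle_antisym; auto.
Qed.

(** It suffices to test the unit-cube hypothesis at the two extreme corners, which makes all
    endpoints finite. The corner chosen for [Top] is NaN, which the hypothesis excludes. *)
Lemma box_pairs d (B : list (itv E M)) : length B = d -> Forall (@valid_itv E M) B -> box_in_unit B ->
  exists B', adm (E:=E) (M:=M) d B' /\ B = map I2 B'.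
Proof.
  intros LB VB HB.
  set (lo := fun I : itv E M => match I with Itv a _ => a | Top _ _ => NaN end).
  set (hi := fun I : itv E M => match I with Itv _ b => b | Top _ _ => NaN end).
  assert (IL : in_box B (map lo B)).
  { clear LB HB. induction VB as [|I B V VB IH]; constructor; trivial. destruct I as [x y|]; simpl; trivial.
    destruct V as (N1 & N2 & L). repeat split; trivial. apply fle_refl; trivial. }
  assert (IH : in_box B (map hi B)).
  { clear LB HB IL. induction VB as [|I B V VB IH]; constructor; trivial. destruct I as [x y|]; simpl; trivial.
    destruct V as (N1 & N2 & L). repeat split; trivial. apply fle_refl; trivial. }
  apply HB in IL, IH. rewrite Forall_map in IL, IH.
  assert (C : Forall (fun I => exists p, I = I2 p /\ wfp p /\ -1 <= fst p /\ snd p <= 1) B).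
  { rewrite Forall_forall in *. intros I HI. destruct (IL I HI) as (x & Qx & Hx), (IH I HI) as (y & Qy & Hy).
    specialize (VB I HI). destruct I as [u v|]; simpl in *; [|discriminate]. subst u v. destruct VB as (_ & _ & L).
    exists (fval x, fval y). unfold pair_itv; simpl. rewrite <- !Fin_fin. split; trivial.
    rewrite !Fin_fin, fle_fin in L by apply fval_F. pose proof (fval_F x). pose proof (fval_F y).
    unfold wf_pair; simpl. repeat split; trivial; lra. }
  apply list_choice in C. destruct C as [B' C]. exists B'. split.
  - split; [rewrite <- (Forall2_length C); trivial|]. clear - C. induction C; constructor; tauto.
  - clear - C. induction C as [|I p B B' [H _] C IH]; simpl; congruence.
Qed.

Lemma image_fhat f d (B : list (R * R)) v : adm (E:=E) (M:=M) d B -> fhat_image f (map I2 B) v <-> image (E:=E) (M:=M) f B v.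
Proof.
  intros [_ HB]. unfold fhat_image, image. split.
  - intros (xs & Hx & ->). exists (map fval xs). split; trivial. clear - HB Hx fp. revert xs Hx.
    induction HB as [|p B ((F1 & F2 & _) & _) HB IH]; intros xs Hx; destruct xs as [|x xs]; inversion Hx; subst; constructor.
    + destruct p as [l u]. apply gamma_I2 in H2; trivial. destruct H2 as (t & Qt & Ft & Ht). rewrite Fin_fin in Qt.
      injection Qt as Qt. apply (f_equal fval) in Qt. rewrite !fval_toF in Qt by (trivial; apply fval_F). rewrite Qt. auto.
    + apply IH; trivial.
  - intros (x & Hx & ->). exists (map (toF (E:=E) (M:=M)) x). split.
    + clear - HB Hx fp. revert x Hx. induction HB as [|p B ((F1 & F2 & _) & _) HB IH]; intros x Hx; inversion Hx; subst; constructor.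
      * destruct p as [l u]. apply gamma_I2; trivial. exists y. tauto.
      * apply IH; trivial.
    + rewrite map_map. do 2 f_equal. clear - Hx fp. induction Hx as [|p t B x [Ft _] Hx IH]; simpl; trivial.
      rewrite fval_toF, <- IH; trivial.
Qed.

End Discharge.

Theorem theorem1 (E M : nat) (hE : (5 <= E)%nat) (hM : (3 <= M)%nat)
  (hEM : (M <= 2 ^ (E - 1))%nat)
  (sigma : fbar E M -> fbar E M) (hsigma : condition1 sigma)
  (d : nat) (f : list R -> R) :
  exists net : list (layer E M),
    wf_net d 1 net /\
    forall B : list (itv E M),
      length B = d -> Forall (@valid_itv E M) B -> box_in_unit B ->
      exists I : itv E M,
        net_sharp sigma net B = [I] /\
        forall v : fbar E M,
          gamma I v <->
          gamma (Itv (setmin (fhat_image f B)) (setmax (fhat_image f B))) v.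
Proof.
  assert (fp : FP E M) by (constructor; trivial).
  destruct hsigma as ((c1 & c2 & (s1 & Q1 & Z1) & (s2 & Q2 & A2) & _ & Bt) & eta & (Heta & (se & Qe & Ae) & (sp & Qp & Ap) & Or) & lam & Lam0 & (se' & Qe' & Lam) & Lip).
  pose proof (emin_emax (E:=E)) as EE. pose proof emax_ge as E15. pose proof M_ge as M3.
  set (e0 := fval eta) in *. assert (Fe0 : isF E M e0) by apply fval_F.
  assert (Eps : 0 < eps M) by (rewrite eps_bp; apply bp_pos).
  fold (bp (emin E + 5)) in *. fold (bp (emax E - 6)) in *. fold (bp (emax E - 7)) in *. fold (bp (Z.of_nat M + 3)) in *.
  destruct (eta_rep e0 Fe0 ltac:(lra) ltac:(lra)) as (n & a & He0 & Fe1 & Hn & Hn1 & Ha1 & Adj).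
  set (e1 := e0 + bp a) in *. pose proof (bp_pos a) as Pa.
  assert (Eeta : eta = toF e0) by (unfold e0; rewrite toF_fval; trivial).
  assert (Su : fsucc eta = fin e1) by (rewrite Eeta; apply fsucc_fin; trivial; unfold e1; lra).
  rewrite Su in *.
  assert (Qeq : Fin eta = fin e0) by (rewrite Eeta; reflexivity).
  assert (Pair : forall x y, isF E M x -> isF E M y -> x <= e0 -> e1 <= y ->
    exists sx sy, sigma (fin x) = Fin sx /\ sigma (fin y) = Fin sy /\
      Rabs (fval sx - fval se) <= lam * Rabs (x - e0) /\ Rabs (fval sy - fval sp) <= lam * Rabs (y - e1)).
  { intros x y Fx Fy Lx Ly. destruct (Lip (toF x) (toF y)) as (sx & t & sy & p & ep & H1 & H2 & H3 & H4 & H5 & H6 & H7).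
    - rewrite fval_toF; trivial.
    - apply fle_fin; trivial.
    - exists sx, sy. rewrite Qe in H2. injection H2 as <-. rewrite Qp in H4. injection H4 as <-.
      injection H3 as H3. rewrite <- H3, !fval_toF in * by trivial. auto. }
  (* C3 asserts finite values at all floats on either side of eta, and every float lies on one of
     the two sides. *)
  assert (Hfin : forall x, isF E M x -> sigma (fin x) = fin (sr sigma x) /\ isF E M (sr sigma x)).
  { intros x Fx. assert (K : exists s, sigma (fin x) = Fin s).
    { destruct (Adj x Fx) as [L|L].
      - destruct (Pair x e1 Fx Fe1 L ltac:(lra)) as (sx & _ & H & _); eauto.
      - destruct (Pair e0 x Fe0 Fx ltac:(lra) L) as (_ & sx & _ & H & _); eauto. }
    destruct K as [s Hs]. unfold sr. rewrite Hs. split; [apply Fin_fin|apply fval_F]. }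
  assert (Sr : forall (x : float E M) s, sigma (Fin x) = Fin s -> sr sigma (fval x) = fval s).
  { intros x s H. unfold sr. rewrite <- Fin_fin, H; trivial. }
  assert (Sal : sr sigma e0 = fval se) by (apply (Sr eta); trivial).
  assert (Sbe : sr sigma e1 = fval sp) by (unfold sr; rewrite Qp; trivial).
  assert (Se' : se' = se) by congruence. subst se'.
  rewrite <- Sal, <- Sbe in Pair. rewrite <- Sal in Lam, Ae. rewrite <- Sbe in Ap.
  assert (LipR : forall x y, isF E M x -> isF E M y -> x <= e0 -> e1 <= y ->
     Rabs (sr sigma x - sr sigma e0) <= lam * Rabs (x - e0) /\ Rabs (sr sigma y - sr sigma e1) <= lam * Rabs (y - e1)).
  { intros x y Fx Fy Lx Ly. destruct (Pair x y Fx Fy Lx Ly) as (sx & sy & H1 & H2 & H3). unfold sr at 1 3. rewrite H1, H2; trivial. }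
  set (al := sr sigma e0) in *. set (be := sr sigma e1) in *.
  assert (OrR : forall x y, isF E M x -> isF E M y -> x <= e0 -> e1 <= y ->
     (sr sigma x <= al /\ al < be /\ be <= sr sigma y) \/ (al <= sr sigma x /\ be < al /\ sr sigma y <= be)).
  { intros x y Fx Fy Lx Ly. destruct (Or (toF x) (toF y)) as [(H1 & H2 & H3)|(H1 & H2 & H3)].
    - rewrite fval_toF; trivial.
    - apply fle_fin; trivial.
    - left. fold (fin x) (fin y) in *. rewrite Qeq, (proj1 (Hfin e0 Fe0)) in H1, H2. rewrite (proj1 (Hfin e1 Fe1)) in H2, H3.
      rewrite (proj1 (Hfin x Fx)) in H1. rewrite (proj1 (Hfin y Fy)) in H3.
      apply fle_fin in H1; try (apply Hfin; trivial). apply flt_fin in H2; try (apply Hfin; trivial).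
      apply fle_fin in H3; try (apply Hfin; trivial). auto.
    - right. fold (fin x) (fin y) in *. rewrite Qeq, (proj1 (Hfin e0 Fe0)) in H1, H2. rewrite (proj1 (Hfin e1 Fe1)) in H2, H3.
      rewrite (proj1 (Hfin x Fx)) in H1. rewrite (proj1 (Hfin y Fy)) in H3.
      apply fle_fin in H1; try (apply Hfin; trivial). apply flt_fin in H2; try (apply Hfin; trivial).
      apply fle_fin in H3; try (apply Hfin; trivial). auto. }
  assert (Hab : al <> be) by (destruct (OrR e0 e1 Fe0 Fe1 ltac:(lra) ltac:(lra)); lra).
  assert (Hlow : forall x, isF E M x -> x <= e0 -> sg al be * (sr sigma x - al) <= 0 /\ Rabs (sr sigma x - al) <= lam * Rabs (x - e0)).
  { intros x Fx Lx. split; [|apply (LipR x e1); trivial; lra]. unfold sg.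
    destruct (OrR x e1 Fx Fe1 Lx ltac:(lra)); destruct (Rlt_dec al be); lra. }
  assert (Hhigh : forall x, isF E M x -> e1 <= x -> 0 <= sg al be * (sr sigma x - be) /\ Rabs (sr sigma x - be) <= lam * Rabs (x - e1)).
  { intros x Fx Lx. split; [|apply (LipR e0 x); trivial; lra]. unfold sg.
    destruct (OrR e0 x Fe0 Fx ltac:(lra) Lx); destruct (Rlt_dec al be); lra. }
  pose proof (fval_F c1) as Fc1. pose proof (fval_F c2) as Fc2.
  pose proof (Sr c1 s1 Q1) as Sc1. rewrite Z1 in Sc1. pose proof (Sr c2 s2 Q2) as Sc2. rewrite <- Sc2 in A2.
  rewrite Q1, Q2, !Fin_fin, Z1, <- Sc2 in Bt.
  set (r1 := fval c1) in *. set (r2 := fval c2) in *.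
  assert (HB : betw sigma r1 r2).
  { intros x Fx Hx. specialize (Bt (fin x)). unfold fbetween in Bt. rewrite (proj1 (Hfin x Fx)) in Bt.
    pose proof (proj2 (Hfin x Fx)). pose proof (proj2 (Hfin r2 Fc2)). pose proof (F_0 (E:=E) (M:=M)).
    rewrite !fle_fin in Bt by trivial. rewrite Sc1. auto. }
  (* If c1, c2 is not a near pair, the difference overflows while neither modulus is at most an
     eighth of the other. Both are then huge and of opposite signs, with eta and its successor in
     between. *)
  assert (CT : exists c, isF E M c /\ amplitude_ok (M:=M) (sr sigma c) /\ ctype sigma d (sr sigma c)).
  { destruct (classic (near_pair (E:=E) (M:=M) r1 r2)) as [NP|NP]; [exists r2; repeat split; trivial; try apply A2; apply (ctype_near sigma d Hfin r1); trivial|].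
    unfold near_pair in NP. pose proof (Om_ge (E:=E) (M:=M)) as OG.
    assert (O15 : 32768 <= bp (emax E)).
    { replace 32768 with (bp 15) by (unfold bp; simpl; ring). apply bp_le; lia. }
    assert (B3 : bp (emin E + 3) <= 1) by (rewrite <- bp_0; apply bp_le; lia).
    pose proof (F_le_Om r1 Fc1) as O1. pose proof (F_le_Om r2 Fc2) as O2.
    assert (HO : Omega E M < Rabs (r2 - r1)) by (apply Rnot_le_lt; tauto).
    assert (Big : 40 <= Rabs r1 /\ 40 <= Rabs r2).
    { assert (Rabs (r2 - r1) <= Rabs r2 + Rabs r1) by (unfold Rminus; rewrite <- (Rabs_Ropp r1); apply Rabs_triang).
      destruct (Rle_dec (Rabs r1) (Rabs r2 / 8)), (Rle_dec (Rabs r2) (Rabs r1 / 8)); try lra;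
        exfalso; apply NP; right; (left; split; lra) || (right; split; lra). }
    destruct Big as [Big1 Big2].
    assert (He : -5 <= e0 /\ e1 <= 5).
    { destruct Heta as [_ H4]. apply Rabs_le_inv in H4. unfold e1. lra. }
    assert (E0 : Rabs e0 <= 5) by (apply Rabs_le; unfold e1 in *; lra).
    assert (E1 : Rabs e1 <= 5) by (apply Rabs_le; unfold e1 in *; lra).
    assert (Ordered : e0 < e1) by (unfold e1; lra).
    pose proof (bp_pos (emin E + 5)) as P5.
    assert (Nz : al <> 0 /\ be <> 0).
    { split; intros Q; rewrite Q, Rabs_R0 in *; lra. }
    assert (Eq : forall x, isF E M x -> e0 <= x <= e1 -> x = e0 \/ x = e1).
    { intros x Fx Hx. destruct (Adj x Fx); [left|right]; lra. }
    destruct (Rle_dec r1 0) as [S1|S1].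
    - rewrite Rabs_left1 in Big1 by lra.
      assert (S2 : 40 <= r2).
      { destruct (Rle_dec 0 r2) as [C|C]; [rewrite Rabs_pos_eq in Big2; lra|].
        rewrite (Rabs_left1 r1), (Rabs_left1 r2) in * by lra. exfalso.
        destruct (Rle_dec 0 (r2 - r1)); [rewrite Rabs_pos_eq in HO by lra|rewrite Rabs_left1 in HO by lra]; lra. }
      (* sigma(c1) = 0 is at one end of the order given by C2, so the moduli of sigma grow from eta
         (nonzero) to its successor and on to c2. *)
      destruct (OrR r1 r2 Fc1 Fc2 ltac:(lra) ltac:(lra)) as [(Q3 & Q4 & Q5)|(Q3 & Q4 & Q5)]; rewrite Sc1 in Q3.
      + apply (ctype_far sigma d Hfin r1 Fc1 Sc1 r2 e1 e0 1); trivial; try lra; try (fold al be; lra).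
        * rewrite Rabs_left1; lra.
        * intros x Fx Hx. rewrite Sc1. fold be. destruct (Adj x Fx) as [L|L]; [|replace x with e1 by lra; fold be; lra].
          destruct (OrR x r2 Fx Fc2 L ltac:(lra)) as [K|K]; [|lra]. destruct (HB x Fx ltac:(lra)) as [K'|K']; lra.
        * intros x Fx Hx. fold al. destruct (Adj x Fx) as [L|L]; [replace x with e0 by lra; fold al; lra|].
          destruct (OrR r1 x Fc1 Fx ltac:(lra) L) as [K|K]; [|lra]. destruct (HB x Fx ltac:(lra)) as [K'|K']; lra.
      + apply (ctype_far sigma d Hfin r1 Fc1 Sc1 r2 e1 e0 (-1)); trivial; try lra; try (fold al be; lra).
        * rewrite Rabs_left1; lra.
        * intros x Fx Hx. rewrite Sc1. fold be. destruct (Adj x Fx) as [L|L]; [|replace x with e1 by lra; fold be; lra].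
          destruct (OrR x r2 Fx Fc2 L ltac:(lra)) as [K|K]; [lra|]. destruct (HB x Fx ltac:(lra)) as [K'|K']; lra.
        * intros x Fx Hx. fold al. destruct (Adj x Fx) as [L|L]; [replace x with e0 by lra; fold al; lra|].
          destruct (OrR r1 x Fc1 Fx ltac:(lra) L) as [K|K]; [lra|]. destruct (HB x Fx ltac:(lra)) as [K'|K']; lra.
    - rewrite Rabs_pos_eq in Big1 by lra.
      assert (S2 : r2 <= -40).
      { destruct (Rle_dec r2 0) as [C|C]; [rewrite Rabs_left1 in Big2; lra|].
        rewrite (Rabs_pos_eq r1), (Rabs_pos_eq r2) in * by lra. exfalso.
        destruct (Rle_dec 0 (r2 - r1)); [rewrite Rabs_pos_eq in HO by lra|rewrite Rabs_left1 in HO by lra]; lra. }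
      destruct (OrR r2 r1 Fc2 Fc1 ltac:(lra) ltac:(lra)) as [(Q3 & Q4 & Q5)|(Q3 & Q4 & Q5)]; rewrite Sc1 in Q5.
      + apply (ctype_far sigma d Hfin r1 Fc1 Sc1 r2 e0 e1 (-1)); trivial; try lra; try (fold al be; lra).
        * rewrite Rabs_pos_eq; lra.
        * intros x Fx Hx. rewrite Sc1. fold al. destruct (Adj x Fx) as [L|L]; [replace x with e0 by lra; fold al; lra|].
          destruct (OrR r2 x Fc2 Fx ltac:(lra) L) as [K|K]; [|lra]. destruct (HB x Fx ltac:(lra)) as [K'|K']; lra.
        * intros x Fx Hx. fold be. destruct (Adj x Fx) as [L|L]; [|replace x with e1 by lra; fold be; lra].
          destruct (OrR x r1 Fx Fc1 L ltac:(lra)) as [K|K]; [|lra]. destruct (HB x Fx ltac:(lra)) as [K'|K']; lra.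
      + apply (ctype_far sigma d Hfin r1 Fc1 Sc1 r2 e0 e1 1); trivial; try lra; try (fold al be; lra).
        * rewrite Rabs_pos_eq; lra.
        * intros x Fx Hx. rewrite Sc1. fold al. destruct (Adj x Fx) as [L|L]; [replace x with e0 by lra; fold al; lra|].
          destruct (OrR r2 x Fc2 Fx ltac:(lra) L) as [K|K]; [lra|]. destruct (HB x Fx ltac:(lra)) as [K'|K']; lra.
        * intros x Fx Hx. fold be. destruct (Adj x Fx) as [L|L]; [|replace x with e1 by lra; fold be; lra].
          destruct (OrR x r1 Fx Fc1 L ltac:(lra)) as [K|K]; [lra|]. destruct (HB x Fx ltac:(lra)) as [K'|K']; lra. }
  destruct CT as (c & Fc & Ac & CT). destruct (amplitude_z sigma Hfin r1 Fc1 Sc1 c Fc Ac) as [Hz Hze].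
  destruct (net_exists sigma d Hfin (Rabs (sr sigma c)) (sr sigma c) c Hz Hze Fc eq_refl n a e0 e1 He0 eq_refl Fe0 Fe1 Hn Hn1
    Adj ltac:(lra) lam Hab Ae Ap (conj Lam0 Lam) Hlow Hhigh CT f) as (net & N1 & N2).
  exists net. split; trivial. intros B LB VB UB. destruct (box_pairs d B LB VB UB) as (B' & HB' & ->).
  exists (Itv (setmin (image (E:=E) (M:=M) f B')) (setmax (image (E:=E) (M:=M) f B'))). split; [apply N2; trivial|].
  replace (fhat_image f (map (pair_itv (E:=E) (M:=M)) B')) with (image (E:=E) (M:=M) f B'); [tauto|].
  apply functional_extensionality. intros v. apply propositional_extensionality. symmetry. apply (image_fhat f d); trivial.
Qed.
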